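(* Assume the extensionality schemes and the identity extension schema. Let $\alpha\vdash\sigma(\alpha)$ be an inductively constructed type in which $\alpha$ occurs only positively, with initial algebra $\mathit{in}:\sigma(\mu\alpha.\sigma(\alpha))\multimap\mu\alpha.\sigma(\alpha)$ and final coalgebra $\mathit{out}:\nu\alpha.\sigma(\alpha)\multimap\sigma(\nu\alpha.\sigma(\alpha))$ as defined below. Then there are PILL$_Y$ terms $\mathit{in}^{-1}:\mu\alpha.\sigma(\alpha)\multimap\sigma(\mu\alpha.\sigma(\alpha))$ and $\mathit{out}^{-1}:\sigma(\nu\alpha.\sigma(\alpha))\multimap\nu\alpha.\sigma(\alpha)$ which are internally inverse to $\mathit{in}$ and $\mathit{out}$ respectively, and (up to internal equality) $(\mu\alpha.\sigma(\alpha),\mathit{in}^{-1})$ is a final coalgebra and $(\nu\alpha.\sigma(\alpha),\mathit{out}^{-1})$ is an initial algebra for the endofunctor of ${\rm LinType}_\Xi$ induced by $\sigma$.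
   Context: PILL$_Y$ is the polymorphic intuitionistic/linear lambda calculus with fixed points. Types in a context $\Xi$ of type variables are given by $\sigma ::= \alpha \mid I \mid \sigma\otimes\sigma \mid \sigma\multimap\sigma \mid\ !\sigma \mid \Pi\alpha.\sigma$. Terms are typed in judgements $\Xi\mid\Gamma;\Delta\vdash t:\tau$ with an intuitionistic variable context $\Gamma$ and a linear variable context $\Delta$; the constructs are variables, $\star:I$, linear abstraction $\lambda^\circ x{:}\sigma.t$ and application $t\,u$, $t\otimes s$, $!t$ (allowed only when the linear context is empty), type abstraction $\Lambda\alpha.t$ and type application $t\,\sigma$, the eliminations $\mathrm{let}\ x\otimes y = s\ \mathrm{in}\ t$, $\mathrm{let}\ !x = s\ \mathrm{in}\ t$, $\mathrm{let}\ \star = s\ \mathrm{in}\ t$, and a constant $Y:\Pi\alpha.(\alpha\to\alpha)\to\alpha$. Here $\sigma\to\tau$ abbreviates $!\sigma\multimap\tau$ and $\lambda x{:}\sigma.t$ abbreviates $\lambda^\circ y{:}!\sigma.\ \mathrm{let}\ !x=y\ \mathrm{in}\ t$. External equality of terms is generated by the $\beta$- and $\eta$-rules of all constructs, commuting conversions of the let-constructs with linear contexts, congruence, and $f\,(!(Y\,\sigma\,(!f))) = Y\,\sigma\,(!f)$. $g\circ f=\lambda^\circ x.g(f\,x)$. LAPL is an intuitionistic higher-order predicate logic over PILL$_Y$ with contexts $\Xi\mid\Gamma\mid\Theta$, where $\Theta$ declares relation variables and admissible relation variables $R:\mathrm{AdmRel}(\sigma,\tau)$; propositions include internal equality $t=_\sigma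 u$ (externally equal terms are internally equal), $\rho(t,u)$ for definable relations, connectives and quantifiers over types, terms, relations and admissible relations. Admissible relations are a designated class of definable relations containing equality relations and graphs of linear terms. Each type has a relational interpretation $\sigma[\vec\rho]$ at admissible relations with $\alpha_i[\vec\rho]\equiv\rho_i$, $(\sigma\multimap\sigma')[\vec\rho](f,g)\Leftrightarrow\forall x,y.\sigma[\vec\rho](x,y)\supset\sigma'[\vec\rho](f\,x,g\,y)$, $(\Pi\beta.\sigma)[\vec\rho](t,u)\Leftrightarrow\forall\beta,\beta'.\forall R:\mathrm{AdmRel}(\beta,\beta').\sigma[\vec\rho,R](t\beta,u\beta')$ (and clauses for $\otimes,!,I$). The extensionality schemes are $(\forall x.\ t\,x=u\,x)\supset t=_{\sigma\multimap\tau}u$ and $(\forall\alpha.\ t\,\alpha=u\,\alpha)\supset t=_{\Pi\alpha.\tau}u$; the identity extension schema is $\forall\vec\alpha.\ \sigma[eq_{\vec\alpha}]\equiv eq_{\sigma(\vec\alpha)}$ for every type, $eq$ denoting internal equality. ${\rm LinType}_\Xi$ is the category with objects types in context $\Xi$ and morphisms terms $\Xi\mid-;-\vdash f:\sigma\multimap\tau$ modulo internal equality provable in LAPL plus extensionality and identity extension. A type is inductively constructed if it is built from type variables and closed types using $\multimap,\otimes,I,!,\Pi$; polarity of occurrences is as usual ($\multimap$ reverses polarity in its argument). For such $\sigma(\alpha)$ with $\alpha$ only positive, $\sigma(f):\sigma(\tau)\multimap\sigma(\tau')$ for $f:\tau\multimap\tau'$ is the functorial action defined by structural induction ($\alpha(f)=f$,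 closed types act by identity, pre/post-composition for $\multimap$, componentwise for $\otimes$, $\lambda^\circ x.\mathrm{let}\ !y=x\ \mathrm{in}\ !(\sigma_1(f)y)$ for $!$, pointwise for $\Pi$). Definitions: $\mu\alpha.\sigma(\alpha)=\Pi\alpha.(\sigma(\alpha)\multimap\alpha)\to\alpha$, $\mathit{fold}=\Lambda\alpha.\lambda f.\lambda^\circ u.\ u\,\alpha\,(!f)$, $\mathit{in}\,z=\Lambda\alpha.\lambda f{:}\sigma(\alpha)\multimap\alpha.\ f(\sigma(\mathit{fold}\,\alpha\,(!f))\,z)$; $\nu\alpha.\sigma(\alpha)=\Pi\beta.(\Pi\alpha.(!(\alpha\multimap\sigma(\alpha))\otimes\alpha\multimap\beta))\multimap\beta$, $\mathit{pack}=\Lambda\alpha.\lambda^\circ x.\Lambda\beta.\lambda^\circ g.\ g\,\alpha\,x$, $\mathit{unfold}=\Lambda\alpha.\lambda^\circ f{:}!(\alpha\multimap\sigma(\alpha)).\lambda^\circ x{:}\alpha.\ \mathit{pack}\,\alpha\,(f\otimes x)$, $\mathit{out}=\lambda^\circ x.\ x\,\sigma(\nu\alpha.\sigma(\alpha))\,r$ with $r=\Lambda\alpha.\lambda^\circ y.\ \mathrm{let}\ w\otimes z=y\ \mathrm{in}\ \sigma(\mathit{unfold}\,\alpha\,w)(\mathrm{let}\ !f=w\ \mathrm{in}\ f\,z)$. Algebras, coalgebras, initiality and finality are understood in ${\rm LinType}_\Xi$ (maps of (co)algebras commuting up to internal equality, uniqueness up to internal equality).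
   Formalization: In the definition of out, r as written uses the linear variable w twice and so is not a typable term; it is read as r = Λα.λ°y. let w⊗z = y in let !f = w in σ(unfold α (!f))(f z). *)

(* Defs.v *)
From mathcomp Require Import all_boot.

Set Implicit Arguments.
Unset Strict Implicit.
Unset Printing Implicit Defensive.

(* Syntax is raw de Bruijn syntax.  Type variables, term variables and relation
   variables are three independent index spaces; index 0 is always the
   innermost binder. *)

Definition scons {T : Type} (a : T) (s : nat -> T) (i : nat) : T :=
  if i is j.+1 then s j else a.

Definition upr (r : nat -> nat) : nat -> nat := scons 0 (fun i => (r i).+1).

Inductive ty : Type :=
| TVar (i : nat)
| TOne
| TTens (a b : ty)
| TLol (a b : ty)
| TBang (a : ty)
| TPi (a : ty).

Fixpoint wf_ty (n : nat) (a : ty) : bool :=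
  match a with
  | TVar i => i < n
  | TOne => true
  | TTens a b | TLol a b => wf_ty n a && wf_ty n b
  | TBang a => wf_ty n a
  | TPi a => wf_ty n.+1 a
  end.

Definition closed_ty (a : ty) : bool := wf_ty 0 a.

Fixpoint tren (r : nat -> nat) (a : ty) : ty :=
  match a with
  | TVar i => TVar (r i)
  | TOne => TOne
  | TTens a b => TTens (tren r a) (tren r b)
  | TLol a b => TLol (tren r a) (tren r b)
  | TBang a => TBang (tren r a)
  | TPi a => TPi (tren (upr r) a)
  end.

Definition upt (s : nat -> ty) : nat -> ty :=
  scons (TVar 0) (fun i => tren S (s i)).

Fixpoint tsub (s : nat -> ty) (a : ty) : ty :=
  match a with
  | TVar i => s i
  | TOne => TOne
  | TTens a b => TTens (tsub s a) (tsub s b)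
  | TLol a b => TLol (tsub s a) (tsub s b)
  | TBang a => TBang (tsub s a)
  | TPi a => TPi (tsub (upt s) a)
  end.

(* [tapp s a] is s(a), for a type s(alpha) whose parameter alpha is index 0. *)
Definition tapp (s a : ty) : ty := tsub (scons a TVar) s.

(* [tapps s l] is s(l_0, ..., l_{k-1}), for k the size of l and s a type in the
   context of k type variables (the default value of [nth] is then unused). *)
Definition tapps (s : ty) (l : seq ty) : ty := tsub (nth TOne l) s.

(* Intuitionistic and linear variables share one index space; the typing
   context records which is which. *)
Inductive tm : Type :=
| Var (i : nat)
| Star
| YC
| Lam (a : ty) (t : tm)
| App (t u : tm)
| Tens (t u : tm)
| Bang (t : tm)
| TLam (t : tm)
| TApp (t : tm) (a : ty)
| LetT (s t : tm)             (* let x (x) y = s in t: in t, x is 1 and y is 0 *)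
| LetB (s t : tm)             (* let !x = s in t: in t, x is 0 *)
| LetS (s t : tm).

Fixpoint eren (rt re : nat -> nat) (t : tm) : tm :=
  match t with
  | Var i => Var (re i)
  | Star => Star
  | YC => YC
  | Lam a t => Lam (tren rt a) (eren rt (upr re) t)
  | App t u => App (eren rt re t) (eren rt re u)
  | Tens t u => Tens (eren rt re t) (eren rt re u)
  | Bang t => Bang (eren rt re t)
  | TLam t => TLam (eren (upr rt) re t)
  | TApp t a => TApp (eren rt re t) (tren rt a)
  | LetT s t => LetT (eren rt re s) (eren rt (upr (upr re)) t)
  | LetB s t => LetB (eren rt re s) (eren rt (upr re) t)
  | LetS s t => LetS (eren rt re s) (eren rt re t)
  end.

(* weakening of a term by k type variables and m term variables *)
Definition eshift (k m : nat) (t : tm) : tm := eren (addn k) (addn m) t.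

Definition upe (s : nat -> tm) : nat -> tm :=
  scons (Var 0) (fun i => eshift 0 1 (s i)).

Fixpoint esub (st : nat -> ty) (se : nat -> tm) (t : tm) : tm :=
  match t with
  | Var i => se i
  | Star => Star
  | YC => YC
  | Lam a t => Lam (tsub st a) (esub st (upe se) t)
  | App t u => App (esub st se t) (esub st se u)
  | Tens t u => Tens (esub st se t) (esub st se u)
  | Bang t => Bang (esub st se t)
  | TLam t => TLam (esub (upt st) (fun i => eshift 1 0 (se i)) t)
  | TApp t a => TApp (esub st se t) (tsub st a)
  | LetT s t => LetT (esub st se s) (esub st (upe (upe se)) t)
  | LetB s t => LetB (esub st se s) (esub st (upe se) t)
  | LetS s t => LetS (esub st se s) (esub st se t)
  end.

(* A dual context Gamma; Delta is a single list of declarations: [Many] marks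
   the variables of Gamma and [One] those of Delta.  [Zero] marks a linear
   variable that is bound outside but not in the linear context at hand (it went
   to another premise of a multiplicative rule), so that splitting Delta does
   not renumber variables.  The declared types are assumed well formed. *)
Inductive usage : Type := Zero | One | Many.

Definition tctx := seq (usage * ty).

Definition lin_free (C : tctx) : bool :=
  all (fun d => if d.1 is One then false else true) C.

Definition tctx_shift (C : tctx) : tctx := [seq (d.1, tren S d.2) | d <- C].

Inductive usplit : usage -> usage -> usage -> Prop :=
| us_many : usplit Many Many Many
| us_left : usplit One One Zero
| us_right : usplit One Zero One
| us_zero : usplit Zero Zero Zero.

Inductive csplit : tctx -> tctx -> tctx -> Prop :=
| cs_nil : csplit [::] [::] [::]
| cs_cons u u1 u2 a C C1 C2 :
    usplit u u1 u2 -> csplit C C1 C2 ->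
    csplit ((u, a) :: C) ((u1, a) :: C1) ((u2, a) :: C2).

Definition TArr (a b : ty) : ty := TLol (TBang a) b.

Definition Y_ty : ty :=
  TPi (TArr (TArr (TVar 0) (TVar 0)) (TVar 0)).

Inductive has_type : nat -> tctx -> tm -> ty -> Prop :=
| ht_var n C i u a :
    onth C i = Some (u, a) -> u <> Zero ->
    lin_free (take i C ++ drop i.+1 C) ->
    has_type n C (Var i) a
| ht_star n C : lin_free C -> has_type n C Star TOne
| ht_Y n C : lin_free C -> has_type n C YC Y_ty
| ht_lam n C a b t :
    wf_ty n a -> has_type n ((One, a) :: C) t b ->
    has_type n C (Lam a t) (TLol a b)
| ht_app n C C1 C2 a b t u :
    csplit C C1 C2 -> has_type n C1 t (TLol a b) -> has_type n C2 u a ->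
    has_type n C (App t u) b
| ht_tens n C C1 C2 a b t u :
    csplit C C1 C2 -> has_type n C1 t a -> has_type n C2 u b ->
    has_type n C (Tens t u) (TTens a b)
| ht_bang n C a t :
    lin_free C -> has_type n C t a -> has_type n C (Bang t) (TBang a)
| ht_tlam n C a t :
    has_type n.+1 (tctx_shift C) t a -> has_type n C (TLam t) (TPi a)
| ht_tapp n C a b t :
    has_type n C t (TPi a) -> wf_ty n b ->
    has_type n C (TApp t b) (tapp a b)
| ht_lett n C C1 C2 a b c s t :
    csplit C C1 C2 -> has_type n C1 s (TTens a b) ->
    has_type n [:: (One, b), (One, a) & C2] t c ->
    has_type n C (LetT s t) c
| ht_letb n C C1 C2 a c s t :
    csplit C C1 C2 -> has_type n C1 s (TBang a) ->
    has_type n ((Many, a) :: C2) t c ->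
    has_type n C (LetB s t) c
| ht_lets n C C1 C2 c s t :
    csplit C C1 C2 -> has_type n C1 s TOne -> has_type n C2 t c ->
    has_type n C (LetS s t) c.

(* Linear contexts: one hole, not below a [Bang]. *)
Inductive lctx : Type :=
| KHole
| KLam (a : ty) (K : lctx)
| KAppL (K : lctx) (t : tm)
| KAppR (t : tm) (K : lctx)
| KTensL (K : lctx) (t : tm)
| KTensR (t : tm) (K : lctx)
| KTLam (K : lctx)
| KTApp (K : lctx) (a : ty)
| KLetTL (K : lctx) (t : tm)
| KLetTR (s : tm) (K : lctx)
| KLetBL (K : lctx) (t : tm)
| KLetBR (s : tm) (K : lctx)
| KLetSL (K : lctx) (t : tm)
| KLetSR (s : tm) (K : lctx).

Fixpoint plug (K : lctx) (u : tm) : tm :=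
  match K with
  | KHole => u
  | KLam a K => Lam a (plug K u)
  | KAppL K t => App (plug K u) t
  | KAppR t K => App t (plug K u)
  | KTensL K t => Tens (plug K u) t
  | KTensR t K => Tens t (plug K u)
  | KTLam K => TLam (plug K u)
  | KTApp K a => TApp (plug K u) a
  | KLetTL K t => LetT (plug K u) t
  | KLetTR s K => LetT s (plug K u)
  | KLetBL K t => LetB (plug K u) t
  | KLetBR s K => LetB s (plug K u)
  | KLetSL K t => LetS (plug K u) t
  | KLetSR s K => LetS s (plug K u)
  end.

(* numbers of type variables and of term variables bound at the hole *)
Fixpoint tdepth (K : lctx) : nat :=
  match K with
  | KHole => 0
  | KTLam K => (tdepth K).+1
  | KLam _ K | KAppL K _ | KAppR _ K | KTensL K _ | KTensR _ K | KTApp K _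
  | KLetTL K _ | KLetTR _ K | KLetBL K _ | KLetBR _ K
  | KLetSL K _ | KLetSR _ K => tdepth K
  end.

Fixpoint edepth (K : lctx) : nat :=
  match K with
  | KHole => 0
  | KLam _ K | KLetBR _ K => (edepth K).+1
  | KLetTR _ K => (edepth K).+2
  | KAppL K _ | KAppR _ K | KTensL K _ | KTensR _ K | KTLam K | KTApp K _
  | KLetTL K _ | KLetBL K _ | KLetSL K _ | KLetSR _ K => edepth K
  end.

Fixpoint kren (rt re : nat -> nat) (K : lctx) : lctx :=
  match K with
  | KHole => KHole
  | KLam a K => KLam (tren rt a) (kren rt (upr re) K)
  | KAppL K t => KAppL (kren rt re K) (eren rt re t)
  | KAppR t K => KAppR (eren rt re t) (kren rt re K)
  | KTensL K t => KTensL (kren rt re K) (eren rt re t)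
  | KTensR t K => KTensR (eren rt re t) (kren rt re K)
  | KTLam K => KTLam (kren (upr rt) re K)
  | KTApp K a => KTApp (kren rt re K) (tren rt a)
  | KLetTL K t => KLetTL (kren rt re K) (eren rt (upr (upr re)) t)
  | KLetTR s K => KLetTR (eren rt re s) (kren rt (upr (upr re)) K)
  | KLetBL K t => KLetBL (kren rt re K) (eren rt (upr re) t)
  | KLetBR s K => KLetBR (eren rt re s) (kren rt (upr re) K)
  | KLetSL K t => KLetSL (kren rt re K) (eren rt re t)
  | KLetSR s K => KLetSR (eren rt re s) (kren rt re K)
  end.

(* Moves a block of m pattern variables from outside the d variables bound by a
   linear context to inside them. *)
Definition swap (d m i : nat) : nat :=
  if i < d then i + m else if i < d + m then i - d else i.

Inductive eeq : nat -> tctx -> tm -> tm -> ty -> Prop :=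
| eeq_refl n C t a : has_type n C t a -> eeq n C t t a
| eeq_sym n C t u a : eeq n C t u a -> eeq n C u t a
| eeq_trans n C t u v a : eeq n C t u a -> eeq n C u v a -> eeq n C t v a
| eeq_lam n C a b t t' :
    wf_ty n a -> eeq n ((One, a) :: C) t t' b ->
    eeq n C (Lam a t) (Lam a t') (TLol a b)
| eeq_app n C C1 C2 a b t t' u u' :
    csplit C C1 C2 -> eeq n C1 t t' (TLol a b) -> eeq n C2 u u' a ->
    eeq n C (App t u) (App t' u') b
| eeq_tens n C C1 C2 a b t t' u u' :
    csplit C C1 C2 -> eeq n C1 t t' a -> eeq n C2 u u' b ->
    eeq n C (Tens t u) (Tens t' u') (TTens a b)
| eeq_bang n C a t t' :
    lin_free C -> eeq n C t t' a -> eeq n C (Bang t) (Bang t') (TBang a)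
| eeq_tlam n C a t t' :
    eeq n.+1 (tctx_shift C) t t' a -> eeq n C (TLam t) (TLam t') (TPi a)
| eeq_tapp n C a b t t' :
    eeq n C t t' (TPi a) -> wf_ty n b ->
    eeq n C (TApp t b) (TApp t' b) (tapp a b)
| eeq_lett n C C1 C2 a b c s s' t t' :
    csplit C C1 C2 -> eeq n C1 s s' (TTens a b) ->
    eeq n [:: (One, b), (One, a) & C2] t t' c ->
    eeq n C (LetT s t) (LetT s' t') c
| eeq_letb n C C1 C2 a c s s' t t' :
    csplit C C1 C2 -> eeq n C1 s s' (TBang a) ->
    eeq n ((Many, a) :: C2) t t' c ->
    eeq n C (LetB s t) (LetB s' t') c
| eeq_lets n C C1 C2 c s s' t t' :
    csplit C C1 C2 -> eeq n C1 s s' TOne -> eeq n C2 t t' c ->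
    eeq n C (LetS s t) (LetS s' t') c
| eeq_beta n C a t u c :
    has_type n C (App (Lam a t) u) c ->
    eeq n C (App (Lam a t) u) (esub TVar (scons u Var) t) c
| eeq_eta n C a b t :
    has_type n C t (TLol a b) ->
    eeq n C t (Lam a (App (eshift 0 1 t) (Var 0))) (TLol a b)
| eeq_tbeta n C t a c :
    has_type n C (TApp (TLam t) a) c ->
    eeq n C (TApp (TLam t) a) (esub (scons a TVar) Var t) c
| eeq_teta n C a t :
    has_type n C t (TPi a) ->
    eeq n C t (TLam (TApp (eshift 1 0 t) (TVar 0))) (TPi a)
| eeq_betaT n C t u v c :
    has_type n C (LetT (Tens u v) t) c ->
    eeq n C (LetT (Tens u v) t) (esub TVar (scons v (scons u Var)) t) c
| eeq_etaT n C a b t :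
    has_type n C t (TTens a b) ->
    eeq n C t (LetT t (Tens (Var 1) (Var 0))) (TTens a b)
| eeq_betaB n C t u c :
    has_type n C (LetB (Bang u) t) c ->
    eeq n C (LetB (Bang u) t) (esub TVar (scons u Var) t) c
| eeq_etaB n C a t :
    has_type n C t (TBang a) ->
    eeq n C t (LetB t (Bang (Var 0))) (TBang a)
| eeq_betaS n C t c :
    has_type n C (LetS Star t) c -> eeq n C (LetS Star t) t c
| eeq_etaS n C t :
    has_type n C t TOne -> eeq n C t (LetS t Star) TOne
| eeq_commT n C K s u c :
    has_type n C (LetT s (plug (kren id (addn 2) K) u)) c ->
    eeq n C (LetT s (plug (kren id (addn 2) K) u))
            (plug K (LetT (eshift (tdepth K) (edepth K) s)
                          (eren id (swap (edepth K) 2) u))) c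
| eeq_commB n C K s u c :
    has_type n C (LetB s (plug (kren id (addn 1) K) u)) c ->
    eeq n C (LetB s (plug (kren id (addn 1) K) u))
            (plug K (LetB (eshift (tdepth K) (edepth K) s)
                          (eren id (swap (edepth K) 1) u))) c
| eeq_commS n C K s u c :
    has_type n C (LetS s (plug K u)) c ->
    eeq n C (LetS s (plug K u))
            (plug K (LetS (eshift (tdepth K) (edepth K) s) u)) c
| eeq_Y n C a f :
    lin_free C -> wf_ty n a -> has_type n C f (TArr a a) ->
    eeq n C (App f (Bang (App (TApp YC a) (Bang f))))
            (App (TApp YC a) (Bang f)) a.

(* [BRel true a b] binds a variable of AdmRel(a, b), [BRel false a b] one of
   Rel(a, b). *)
Inductive bndr : Type :=
| BTy
| BTm (a : ty)
| BRel (adm : bool) (a b : ty).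

(* [RComp a b phi] is (x : a, y : b). phi, with x as index 1 and y as index 0.
   [RTy s rs] is the relational interpretation s[rs]; all type variables of s
   are bound, the i-th one being interpreted by the i-th element of rs. *)
Inductive prop : Type :=
| PEq (a : ty) (t u : tm)
| PRel (r : drel) (t u : tm)
| PTop
| PBot
| PAnd (p q : prop)
| POr (p q : prop)
| PImp (p q : prop)
| PAll (b : bndr) (p : prop)
| PEx (b : bndr) (p : prop)
with drel : Type :=
| RVar (i : nat)
| RComp (a b : ty) (p : prop)
| RTy (s : ty) (rs : seq drel).

Definition PIff (p q : prop) : prop := PAnd (PImp p q) (PImp q p).

Definition bmap (f : ty -> ty) (b : bndr) : bndr :=
  match b with
  | BTy => BTy
  | BTm a => BTm (f a)
  | BRel k a b => BRel k (f a) (f b)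
  end.

Record renaming := Ren { rn_ty : nat -> nat; rn_tm : nat -> nat; rn_rel : nat -> nat }.

Definition liftr (b : bndr) (r : renaming) : renaming :=
  match b with
  | BTy => Ren (upr (rn_ty r)) (rn_tm r) (rn_rel r)
  | BTm _ => Ren (rn_ty r) (upr (rn_tm r)) (rn_rel r)
  | BRel _ _ _ => Ren (rn_ty r) (rn_tm r) (upr (rn_rel r))
  end.

Definition liftr2 (r : renaming) : renaming :=
  Ren (rn_ty r) (upr (upr (rn_tm r))) (rn_rel r).

Fixpoint pren (r : renaming) (p : prop) : prop :=
  match p with
  | PEq a t u => PEq (tren (rn_ty r) a) (eren (rn_ty r) (rn_tm r) t)
                     (eren (rn_ty r) (rn_tm r) u)
  | PRel s t u => PRel (rren r s) (eren (rn_ty r) (rn_tm r) t)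
                       (eren (rn_ty r) (rn_tm r) u)
  | PTop => PTop
  | PBot => PBot
  | PAnd p q => PAnd (pren r p) (pren r q)
  | POr p q => POr (pren r p) (pren r q)
  | PImp p q => PImp (pren r p) (pren r q)
  | PAll b p => PAll (bmap (tren (rn_ty r)) b) (pren (liftr b r) p)
  | PEx b p => PEx (bmap (tren (rn_ty r)) b) (pren (liftr b r) p)
  end
with rren (r : renaming) (s : drel) : drel :=
  match s with
  | RVar i => RVar (rn_rel r i)
  | RComp a b p =>
      RComp (tren (rn_ty r) a) (tren (rn_ty r) b) (pren (liftr2 r) p)
  | RTy a rs => RTy a (map (rren r) rs)
  end.

(* weakening by k type, m term and l relation variables *)
Definition wk (k m l : nat) : renaming := Ren (addn k) (addn m) (addn l).

Definition wkb (b : bndr) : renaming :=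
  match b with
  | BTy => wk 1 0 0
  | BTm _ => wk 0 1 0
  | BRel _ _ _ => wk 0 0 1
  end.

Record subst := Sub { sb_ty : nat -> ty; sb_tm : nat -> tm; sb_rel : nat -> drel }.

Definition lifts (b : bndr) (s : subst) : subst :=
  match b with
  | BTy => Sub (upt (sb_ty s)) (fun i => eshift 1 0 (sb_tm s i))
               (fun i => rren (wk 1 0 0) (sb_rel s i))
  | BTm _ => Sub (sb_ty s) (upe (sb_tm s))
                 (fun i => rren (wk 0 1 0) (sb_rel s i))
  | BRel _ _ _ => Sub (sb_ty s) (sb_tm s)
                      (scons (RVar 0) (fun i => rren (wk 0 0 1) (sb_rel s i)))
  end.

Definition lifts2 (s : subst) : subst :=
  Sub (sb_ty s) (upe (upe (sb_tm s))) (fun i => rren (wk 0 2 0) (sb_rel s i)).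

Fixpoint psub (s : subst) (p : prop) : prop :=
  match p with
  | PEq a t u => PEq (tsub (sb_ty s) a) (esub (sb_ty s) (sb_tm s) t)
                     (esub (sb_ty s) (sb_tm s) u)
  | PRel r t u => PRel (rsub s r) (esub (sb_ty s) (sb_tm s) t)
                       (esub (sb_ty s) (sb_tm s) u)
  | PTop => PTop
  | PBot => PBot
  | PAnd p q => PAnd (psub s p) (psub s q)
  | POr p q => POr (psub s p) (psub s q)
  | PImp p q => PImp (psub s p) (psub s q)
  | PAll b p => PAll (bmap (tsub (sb_ty s)) b) (psub (lifts b s) p)
  | PEx b p => PEx (bmap (tsub (sb_ty s)) b) (psub (lifts b s) p)
  end
with rsub (s : subst) (r : drel) : drel :=
  match r with
  | RVar i => sb_rel s i
  | RComp a b p => RComp (tsub (sb_ty s) a) (tsub (sb_ty s) b) (psub (lifts2 s) p)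
  | RTy a rs => RTy a (map (rsub s) rs)
  end.

Inductive inst : Type :=
| ITy (a : ty)
| ITm (t : tm)
| IRel (r : drel).

Definition sub1 (i : inst) : subst :=
  match i with
  | ITy a => Sub (scons a TVar) Var RVar
  | ITm t => Sub TVar (scons t Var) RVar
  | IRel r => Sub TVar Var (scons r RVar)
  end.

(* substitution of t for index 1 and u for index 0 *)
Definition sub2 (t u : tm) : subst := Sub TVar (scons u (scons t Var)) RVar.

Definition rel_eq (a : ty) : drel := RComp a a (PEq a (Var 1) (Var 0)).

(* For r : Rel(a, a') and q : Rel(b, b'):
   (f, g). forall x x', r(x, x') => q(f x, g x') *)
Definition rel_lol (a a' b b' : ty) (r q : drel) : drel :=
  RComp (TLol a b) (TLol a' b')
    (PAll (BTm a) (PAll (BTm a')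
      (PImp (PRel (rren (wk 0 4 0) r) (Var 1) (Var 0))
            (PRel (rren (wk 0 4 0) q) (App (Var 3) (Var 1)) (App (Var 2) (Var 0)))))).

(* The relations for (x), I and ! are the least admissible relations closed under
   the introduction forms, expressed by quantification over AdmRel. *)

(* (x, y). forall alpha beta (R : AdmRel(alpha, beta))
             (f : a -o b -o alpha) (g : a' -o b' -o beta),
     (r -o q -o R)(f, g) =>
     R(let u (x) v = x in f u v, let u (x) v = y in g u v) *)
Definition rel_tens (a a' b b' : ty) (r q : drel) : drel :=
  let s := tren (addn 2) in
  RComp (TTens a b) (TTens a' b')
    (PAll BTy (PAll BTy (PAll (BRel true (TVar 1) (TVar 0))
      (PAll (BTm (TLol (s a) (TLol (s b) (TVar 1))))
      (PAll (BTm (TLol (s a') (TLol (s b') (TVar 0))))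
        (PImp
          (PRel (rel_lol (s a) (s a') (TLol (s b) (TVar 1)) (TLol (s b') (TVar 0))
                   (rren (wk 2 4 1) r)
                   (rel_lol (s b) (s b') (TVar 1) (TVar 0)
                      (rren (wk 2 4 1) q) (RVar 0)))
             (Var 1) (Var 0))
          (PRel (RVar 0)
             (LetT (Var 3) (App (App (Var 3) (Var 1)) (Var 0)))
             (LetT (Var 2) (App (App (Var 2) (Var 1)) (Var 0)))))))))).

(* (x, y). forall alpha beta (R : AdmRel(alpha, beta)) (z : alpha) (w : beta),
     R(z, w) => R(let * = x in z, let * = y in w) *)
Definition rel_one : drel :=
  RComp TOne TOne
    (PAll BTy (PAll BTy (PAll (BRel true (TVar 1) (TVar 0))
      (PAll (BTm (TVar 1)) (PAll (BTm (TVar 0))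
        (PImp (PRel (RVar 0) (Var 1) (Var 0))
              (PRel (RVar 0) (LetS (Var 3) (Var 1)) (LetS (Var 2) (Var 0))))))))).

(* (x, y). forall alpha beta (R : AdmRel(alpha, beta))
             (f : !a -o alpha) (g : !a' -o beta),
     (forall u u', r(u, u') => R(f !u, g !u')) => R(f x, g y) *)
Definition rel_bang (a a' : ty) (r : drel) : drel :=
  let s := tren (addn 2) in
  RComp (TBang a) (TBang a')
    (PAll BTy (PAll BTy (PAll (BRel true (TVar 1) (TVar 0))
      (PAll (BTm (TLol (TBang (s a)) (TVar 1)))
      (PAll (BTm (TLol (TBang (s a')) (TVar 0)))
        (PImp
          (PAll (BTm (s a)) (PAll (BTm (s a'))
            (PImp (PRel (rren (wk 2 6 1) r) (Var 1) (Var 0))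
                  (PRel (RVar 0) (App (Var 3) (Bang (Var 1)))
                                 (App (Var 2) (Bang (Var 0)))))))
          (PRel (RVar 0) (App (Var 1) (Var 3)) (App (Var 0) (Var 2))))))))).

(* The relation that defines s[rs], for rs_i : AdmRel(l_i, l'_i). *)
Definition ty_clause (s : ty) (rs : seq drel) (l l' : seq ty) : drel :=
  match s with
  | TVar i => nth (RVar 0) rs i
  | TOne => rel_one
  | TTens a b => rel_tens (tapps a l) (tapps a l') (tapps b l) (tapps b l')
                          (RTy a rs) (RTy b rs)
  | TLol a b => rel_lol (tapps a l) (tapps a l') (tapps b l) (tapps b l')
                        (RTy a rs) (RTy b rs)
  | TBang a => rel_bang (tapps a l) (tapps a l') (RTy a rs)
  | TPi a =>
      RComp (tapps s l) (tapps s l')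
        (PAll BTy (PAll BTy (PAll (BRel true (TVar 1) (TVar 0))
          (PRel (RTy a (RVar 0 :: map (rren (wk 2 2 1)) rs))
                (TApp (Var 1) (TVar 1)) (TApp (Var 0) (TVar 0))))))
  end.

(* Contexts Xi | Gamma | Theta; Xi is a number of type variables, and in Theta
   the boolean tells admissible relation variables. *)
Record ctx := Ctx { cty : nat; ctm : seq ty; crel : seq (bool * ty * ty) }.

Definition ext (c : ctx) (b : bndr) : ctx :=
  match b with
  | BTy => Ctx (cty c).+1 (map (tren S) (ctm c))
               [seq (d.1.1, tren S d.1.2, tren S d.2) | d <- crel c]
  | BTm a => Ctx (cty c) (a :: ctm c) (crel c)
  | BRel k a b => Ctx (cty c) (ctm c) ((k, a, b) :: crel c)
  end.

Definition wf_bndr (c : ctx) (b : bndr) : bool :=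
  match b with
  | BTy => true
  | BTm a => wf_ty (cty c) a
  | BRel _ a b => wf_ty (cty c) a && wf_ty (cty c) b
  end.

(* Terms in formulas have no free linear variables. *)
Definition intu (c : ctx) : tctx := [seq (Many, a) | a <- ctm c].

Definition tm_in (c : ctx) (t : tm) (a : ty) : Prop := has_type (cty c) (intu c) t a.

Section Logic.

(* The logic is parameterized by additional axiom schemes. *)
Variable Ax : ctx -> prop -> Prop.

Inductive wf_prop : ctx -> prop -> Prop :=
| wf_eq c a t u : tm_in c t a -> tm_in c u a -> wf_prop c (PEq a t u)
| wf_rel_app c r a b t u :
    wf_rel c r a b -> tm_in c t a -> tm_in c u b -> wf_prop c (PRel r t u)
| wf_top c : wf_prop c PTop
| wf_bot c : wf_prop c PBot
| wf_and c p q : wf_prop c p -> wf_prop c q -> wf_prop c (PAnd p q)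
| wf_or c p q : wf_prop c p -> wf_prop c q -> wf_prop c (POr p q)
| wf_imp c p q : wf_prop c p -> wf_prop c q -> wf_prop c (PImp p q)
| wf_all c b p : wf_bndr c b -> wf_prop (ext c b) p -> wf_prop c (PAll b p)
| wf_ex c b p : wf_bndr c b -> wf_prop (ext c b) p -> wf_prop c (PEx b p)

with wf_rel : ctx -> drel -> ty -> ty -> Prop :=
| wr_var c i k a b : onth (crel c) i = Some (k, a, b) -> wf_rel c (RVar i) a b
| wr_comp c a b p :
    wf_ty (cty c) a -> wf_ty (cty c) b ->
    wf_prop (ext (ext c (BTm a)) (BTm b)) p -> wf_rel c (RComp a b p) a b
| wr_ty c s rs l l' :
    wf_ty (size rs) s -> adms c rs l l' ->
    wf_rel c (RTy s rs) (tapps s l) (tapps s l')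

(* [adm c r a b]: r is an admissible relation between a and b *)
with adm : ctx -> drel -> ty -> ty -> Prop :=
| adm_var c i a b : onth (crel c) i = Some (true, a, b) -> adm c (RVar i) a b
| adm_eq c a : wf_ty (cty c) a -> adm c (rel_eq a) a a
| adm_ty c s rs l l' :
    wf_ty (size rs) s -> adms c rs l l' ->
    adm c (RTy s rs) (tapps s l) (tapps s l')
| adm_reindex c r a a' b b' t u :
    adm c r a b -> wf_ty (cty c) a' -> wf_ty (cty c) b' ->
    tm_in c t (TLol a' a) -> tm_in c u (TLol b' b) ->
    adm c (RComp a' b' (PRel (rren (wk 0 2 0) r) (App (eshift 0 2 t) (Var 1))
                             (App (eshift 0 2 u) (Var 0)))) a' b'
| adm_op c r a b :
    adm c r a b ->
    adm c (RComp b a (PRel (rren (wk 0 2 0) r) (Var 0) (Var 1))) b a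
| adm_top c a b :
    wf_ty (cty c) a -> wf_ty (cty c) b -> adm c (RComp a b PTop) a b
| adm_and c r q a b :
    adm c r a b -> adm c q a b ->
    adm c (RComp a b (PAnd (PRel (rren (wk 0 2 0) r) (Var 1) (Var 0))
                           (PRel (rren (wk 0 2 0) q) (Var 1) (Var 0)))) a b
| adm_imp c p r a b :
    wf_prop c p -> adm c r a b ->
    adm c (RComp a b (PImp (pren (wk 0 2 0) p)
                           (PRel (rren (wk 0 2 0) r) (Var 1) (Var 0)))) a b
(* (x, y). forall b, r(x, y), where b is a type, term or relation variable on
   which a1 and a2 do not depend *)
| adm_all c b r a1 a2 :
    wf_bndr c b -> wf_ty (cty c) a1 -> wf_ty (cty c) a2 ->
    adm (ext c b) r (tren (rn_ty (wkb b)) a1) (tren (rn_ty (wkb b)) a2) ->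
    adm c (RComp a1 a2
             (PAll b (PRel (rren (liftr b (wk 0 2 0)) r)
                           (Var (rn_tm (wkb b) 1)) (Var (rn_tm (wkb b) 0))))) a1 a2
| adm_equiv c r q a b :
    adm c r a b -> wf_rel c q a b ->
    prv c [::] (PAll (BTm a) (PAll (BTm b)
                  (PIff (PRel (rren (wk 0 2 0) r) (Var 1) (Var 0))
                        (PRel (rren (wk 0 2 0) q) (Var 1) (Var 0))))) ->
    adm c q a b

with adms : ctx -> seq drel -> seq ty -> seq ty -> Prop :=
| adms_nil c : adms c [::] [::] [::]
| adms_cons c r rs a l a' l' :
    wf_ty (cty c) a -> wf_ty (cty c) a' -> adm c r a a' -> adms c rs l l' ->
    adms c (r :: rs) (a :: l) (a' :: l')

with inst_ok : ctx -> bndr -> inst -> Prop :=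
| io_ty c a : wf_ty (cty c) a -> inst_ok c BTy (ITy a)
| io_tm c t a : tm_in c t a -> inst_ok c (BTm a) (ITm t)
| io_rel c r a b : wf_rel c r a b -> inst_ok c (BRel false a b) (IRel r)
| io_adm c r a b : adm c r a b -> inst_ok c (BRel true a b) (IRel r)

(* [prv c H p] is  Xi | Gamma | Theta | H |- p,  for well-formed c and H *)
with prv : ctx -> seq prop -> prop -> Prop :=
| prv_ax c H p : Ax c p -> prv c H p
| prv_hyp c H i p : onth H i = Some p -> prv c H p
| prv_topI c H : prv c H PTop
| prv_botE c H p : wf_prop c p -> prv c H PBot -> prv c H p
| prv_andI c H p q : prv c H p -> prv c H q -> prv c H (PAnd p q)
| prv_andE1 c H p q : prv c H (PAnd p q) -> prv c H p
| prv_andE2 c H p q : prv c H (PAnd p q) -> prv c H q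
| prv_orI1 c H p q : wf_prop c q -> prv c H p -> prv c H (POr p q)
| prv_orI2 c H p q : wf_prop c p -> prv c H q -> prv c H (POr p q)
| prv_orE c H p q s :
    prv c H (POr p q) -> prv c (p :: H) s -> prv c (q :: H) s -> prv c H s
| prv_impI c H p q : wf_prop c p -> prv c (p :: H) q -> prv c H (PImp p q)
| prv_impE c H p q : prv c H (PImp p q) -> prv c H p -> prv c H q
| prv_allI c H b p :
    wf_bndr c b -> prv (ext c b) (map (pren (wkb b)) H) p -> prv c H (PAll b p)
| prv_allE c H b p i :
    prv c H (PAll b p) -> inst_ok c b i -> prv c H (psub (sub1 i) p)
| prv_exI c H b p i :
    wf_bndr c b -> wf_prop (ext c b) p -> inst_ok c b i ->
    prv c H (psub (sub1 i) p) -> prv c H (PEx b p)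
| prv_exE c H b p q :
    wf_prop c q -> prv c H (PEx b p) ->
    prv (ext c b) (p :: map (pren (wkb b)) H) (pren (wkb b) q) -> prv c H q
| prv_eqI c H t u a : eeq (cty c) (intu c) t u a -> prv c H (PEq a t u)
| prv_eqE c H a t u p :
    wf_prop (ext c (BTm a)) p ->
    prv c H (PEq a t u) -> prv c H (psub (sub1 (ITm t)) p) ->
    prv c H (psub (sub1 (ITm u)) p)
| prv_compI c H a b p t u :
    wf_rel c (RComp a b p) a b -> tm_in c t a -> tm_in c u b ->
    prv c H (psub (sub2 t u) p) -> prv c H (PRel (RComp a b p) t u)
| prv_compE c H a b p t u :
    prv c H (PRel (RComp a b p) t u) -> prv c H (psub (sub2 t u) p)
| prv_ty c H s rs l l' t u :
    wf_ty (size rs) s -> adms c rs l l' ->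
    tm_in c t (tapps s l) -> tm_in c u (tapps s l') ->
    prv c H (PIff (PRel (RTy s rs) t u) (PRel (ty_clause s rs l l') t u)).

End Logic.

Inductive ext_schemes : ctx -> prop -> Prop :=
| ext_lol c a b t u :
    tm_in c t (TLol a b) -> tm_in c u (TLol a b) ->
    ext_schemes c
      (PImp (PAll (BTm a) (PEq b (App (eshift 0 1 t) (Var 0)) (App (eshift 0 1 u) (Var 0))))
            (PEq (TLol a b) t u))
| ext_pi c a t u :
    tm_in c t (TPi a) -> tm_in c u (TPi a) ->
    ext_schemes c
      (PImp (PAll BTy (PEq a (TApp (eshift 1 0 t) (TVar 0)) (TApp (eshift 1 0 u) (TVar 0))))
            (PEq (TPi a) t u)).

(* forall alpha_0 ... alpha_{n-1}, s[eq_{alpha_0}, ..., eq_{alpha_{n-1}}] = eq_s;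
   below the n quantifiers, the index of alpha_i is the index it has in s *)
Definition identity_extension (n : nat) (s : ty) : prop :=
  iter n (PAll BTy)
    (PAll (BTm s) (PAll (BTm s)
      (PIff (PRel (RTy s [seq rel_eq (TVar i) | i <- iota 0 n]) (Var 1) (Var 0))
            (PRel (rel_eq s) (Var 1) (Var 0))))).

Inductive parametric_schemes : ctx -> prop -> Prop :=
| ps_ext c p : ext_schemes c p -> parametric_schemes c p
| ps_ies c n s : wf_ty n s -> parametric_schemes c (identity_extension n s).

(* Morphisms of LinType_Xi, for Xi of n type variables, and their equality. *)
Definition hom (n : nat) (f : tm) (a b : ty) : Prop := has_type n [::] f (TLol a b).

Definition hom_eq (n : nat) (f g : tm) (a b : ty) : Prop :=
  prv parametric_schemes (Ctx n [::] [::]) [::] (PEq (TLol a b) f g).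

Definition idtm (a : ty) : tm := Lam a (Var 0).

(* g o f, for f with domain a *)
Definition tcomp (a : ty) (g f : tm) : tm :=
  Lam a (App (eshift 0 1 g) (App (eshift 0 1 f) (Var 0))).

(* The grammar of types here has no type constants, so that every type satisfies
   this predicate. *)
Inductive ind_constructed : ty -> Prop :=
| ic_var i : ind_constructed (TVar i)
| ic_closed a : closed_ty a -> ind_constructed a
| ic_one : ind_constructed TOne
| ic_tens a b : ind_constructed a -> ind_constructed b -> ind_constructed (TTens a b)
| ic_lol a b : ind_constructed a -> ind_constructed b -> ind_constructed (TLol a b)
| ic_bang a : ind_constructed a -> ind_constructed (TBang a)
| ic_pi a : ind_constructed a -> ind_constructed (TPi a).

(* [occurs_only true k s]: index k occurs only positively in s;
   [occurs_only false k s]: only negatively *)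
Fixpoint occurs_only (pos : bool) (k : nat) (s : ty) : bool :=
  match s with
  | TVar i => (i == k) ==> pos
  | TOne => true
  | TTens a b => occurs_only pos k a && occurs_only pos k b
  | TLol a b => occurs_only (~~ pos) k a && occurs_only pos k b
  | TBang a => occurs_only pos k a
  | TPi a => occurs_only pos k.+1 a
  end.

(* The environments d and e agree except at index k.  For f : d k -o e k,
   [act k d e f s] is a term s(d) -o s(e) if k occurs only positively in s, and
   [act k e d f s] is one if k occurs only negatively in s. *)
Fixpoint act (k : nat) (d e : nat -> ty) (f : tm) (s : ty) : tm :=
  if closed_ty s then idtm s else
  match s with
  | TVar i => if i == k then f else idtm (d i)
  | TOne => idtm TOne
  | TTens a b =>
      Lam (tsub d s)
        (LetT (Var 0) (Tens (App (eshift 0 3 (act k d e f a)) (Var 1))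
                            (App (eshift 0 3 (act k d e f b)) (Var 0))))
  | TLol a b =>
      Lam (tsub d s)
        (tcomp (tsub e a) (eshift 0 1 (act k d e f b))
           (tcomp (tsub e a) (Var 0) (eshift 0 1 (act k e d f a))))
  | TBang a =>
      Lam (tsub d s)
        (LetB (Var 0) (Bang (App (eshift 0 2 (act k d e f a)) (Var 0))))
  | TPi a =>
      Lam (tsub d s)
        (TLam (App (eshift 0 1 (act k.+1 (upt d) (upt e) (eshift 1 0 f) a))
                   (TApp (Var 0) (TVar 0))))
  end.

(* s(f) : s(a) -o s(b), for f : a -o b *)
Definition fmap (s a b : ty) (f : tm) : tm :=
  act 0 (scons a TVar) (scons b TVar) f s.

(* intuitionistic abstraction: Lam y : !a. let !x = y in t *)
Definition ILam (a : ty) (t : tm) : tm :=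
  Lam (TBang a) (LetB (Var 0) (eren id (upr S) t)).

Section FixedPointTypes.

(* a type in the context of the single type variable of index 0; wherever [s]
   itself is used below, index 0 is the variable it is applied to *)
Variable s : ty.

Definition mu : ty := TPi (TArr (TLol s (TVar 0)) (TVar 0)).

Definition fold_tm : tm :=
  TLam (ILam (TLol s (TVar 0))
    (Lam mu (App (TApp (Var 0) (TVar 0)) (Bang (Var 1))))).

Definition in_tm : tm :=
  Lam (tapp s mu)
    (TLam (ILam (TLol s (TVar 0))
      (App (Var 0)
        (App (fmap s mu (TVar 0) (App (TApp fold_tm (TVar 0)) (Bang (Var 0))))
             (Var 1))))).

(* !(alpha -o s(alpha)) (x) alpha *)
Definition coalg_ty : ty := TTens (TBang (TLol (TVar 0) s)) (TVar 0).

Definition nu : ty :=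
  TPi (TLol (TPi (TLol coalg_ty (TVar 1))) (TVar 0)).

Definition pack_tm : tm :=
  TLam (Lam coalg_ty
    (TLam (Lam (TPi (TLol coalg_ty (TVar 1)))
      (App (TApp (Var 0) (TVar 1)) (Var 1))))).

Definition unfold_tm : tm :=
  TLam (Lam (TBang (TLol (TVar 0) s)) (Lam (TVar 0)
    (App (TApp pack_tm (TVar 0)) (Tens (Var 1) (Var 0))))).

(* let w (x) z = y in let !f = w in s(unfold alpha (!f)) (f z): the linear
   variable w is needed twice, hence opened before both uses *)
Definition out_body : tm :=
  TLam (Lam coalg_ty
    (LetT (Var 0) (LetB (Var 1)
      (App (fmap s (TVar 0) nu (App (TApp unfold_tm (TVar 0)) (Bang (Var 0))))
           (App (Var 0) (Var 1)))))).

Definition out_tm : tm :=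
  Lam nu (App (TApp (Var 0) (tapp s nu)) out_body).

Definition alg_map (n : nat) (a : ty) (f : tm) (b : ty) (g h : tm) : Prop :=
  hom n h a b /\
  hom_eq n (tcomp (tapp s a) h f) (tcomp (tapp s a) g (fmap s a b h)) (tapp s a) b.

Definition initial_algebra (n : nat) (a : ty) (f : tm) : Prop :=
  [/\ wf_ty n a, hom n f (tapp s a) a &
      forall (b : ty) (g : tm), wf_ty n b -> hom n g (tapp s b) b ->
      exists h : tm, alg_map n a f b g h /\
        forall h' : tm, alg_map n a f b g h' -> hom_eq n h' h a b].

Definition coalg_map (n : nat) (a : ty) (f : tm) (b : ty) (g h : tm) : Prop :=
  hom n h a b /\
  hom_eq n (tcomp a g h) (tcomp a (fmap s a b h) f) a (tapp s b).

Definition final_coalgebra (n : nat) (b : ty) (g : tm) : Prop :=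
  [/\ wf_ty n b, hom n g b (tapp s b) &
      forall (a : ty) (f : tm), wf_ty n a -> hom n f a (tapp s a) ->
      exists h : tm, coalg_map n a f b g h /\
        forall h' : tm, coalg_map n a f b g h' -> hom_eq n h' h a b].

End FixedPointTypes.

Definition inverse_in (n : nat) (f g : tm) (a b : ty) : Prop :=
  hom_eq n (tcomp a g f) (idtm a) a a /\ hom_eq n (tcomp b f g) (idtm b) b b.

(* Main.v *)
(** Parametricity makes the functorial action of [s] preserve composition and
    gives naturality of the elements of [mu s] and [nu s], whence the only algebra
    endomorphism of [in] and the only coalgebra endomorphism of [out] are the
    identities; Lambek's argument then yields [in_inv] and [out_inv].  For a
    coalgebra [f] on [a] and an algebra [g] on [b] let [hylo a b f g] be the fixed
    point [Y (h |-> g o s(h) o f)].  Parametricity of [Y] at graphs of linear terms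
    says that composition with a linear map commutes with fixed points, so hylo
    is natural in both arguments.  If [g] is the inverse of a coalgebra [g'], then
    [hylo a b f g] is a coalgebra map from [f] to [g'].  It is the only one when
    [b = mu s], because any other one, [h], satisfies
    [hylo a mu f in = hylo mu mu in_inv in o h], and [hylo mu mu in_inv in] is an
    algebra endomorphism of [in], hence the identity.  The argument for [nu s] is
    dual. *)
From Stdlib Require Import FunctionalExtensionality.
From mathcomp Require Import all_boot zify.
Require Import Defs.

Set Implicit Arguments.
Unset Strict Implicit.
Unset Printing Implicit Defensive.

(** Preservation of composition is not an induction on [s]. It rests on two facts about the relation
    s[graph h]: it contains every pair (x, s(h) x), and on related x, y it forces s(p) x = s(q) y
    whenever p = q o h. Each is parametricity of the functorial action with one end fixed and the
    other end abstracted. Preservation of identities, in contrast, is an induction on the type.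

    Fixed points can be compared because precomposition and postcomposition with a fixed morphism
    are themselves linear terms between types of morphisms, so their graphs are admissible and [Y]
    may be instantiated at them.

    Although the result concerns closed terms, equations are needed below type and term
    abstractions; hence almost every lemma is stated in an arbitrary context under arbitrary
    hypotheses. Terms in formulas have no free linear variables, so internal equality cannot rewrite
    below a linear pattern: this is done by external equality or by the induction principles for [!]
    and tensor, which are themselves consequences of identity extension. *)

Local Ltac fext := apply: functional_extensionality.

(** * Renamings and substitutions *)

Lemma upr_id : upr id = id.
Proof. by fext => -[]. Qed.

Lemma upt_TVar : upt TVar = TVar.
Proof. by fext => -[]. Qed.

Lemma upe_Var : upe Var = Var.
Proof. by fext => -[]. Qed.

Lemma upr_comp f g : upr f \o upr g = upr (f \o g).
Proof. by fext => -[]. Qed.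

Lemma tren_tren f g a : tren f (tren g a) = tren (f \o g) a.
Proof.
elim: a f g => //= [a IHa b IHb|a IHa b IHb|a IHa|a IHa] f g.
- by rewrite IHa IHb.
- by rewrite IHa IHb.
- by rewrite IHa.
- by rewrite IHa upr_comp.
Qed.

Lemma upt_upr s r : upt s \o upr r = upt (s \o r).
Proof. by fext => -[]. Qed.

Lemma tsub_tren s r a : tsub s (tren r a) = tsub (s \o r) a.
Proof.
elim: a s r => //= [a IHa b IHb|a IHa b IHb|a IHa|a IHa] s r.
- by rewrite IHa IHb.
- by rewrite IHa IHb.
- by rewrite IHa.
- by rewrite IHa upt_upr.
Qed.

Lemma upr_upt r s : tren (upr r) \o upt s = upt (tren r \o s).
Proof. by fext => -[|i] //=; rewrite !tren_tren. Qed.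

Lemma tren_tsub r s a : tren r (tsub s a) = tsub (tren r \o s) a.
Proof.
elim: a r s => //= [a IHa b IHb|a IHa b IHb|a IHa|a IHa] r s.
- by rewrite IHa IHb.
- by rewrite IHa IHb.
- by rewrite IHa.
- by rewrite IHa upr_upt.
Qed.

Lemma upt_comp s2 s1 : tsub (upt s2) \o upt s1 = upt (tsub s2 \o s1).
Proof. by fext => -[|i] //=; rewrite tsub_tren tren_tsub. Qed.

Lemma tsub_tsub s2 s1 a : tsub s2 (tsub s1 a) = tsub (tsub s2 \o s1) a.
Proof.
elim: a s1 s2 => //= [a IHa b IHb|a IHa b IHb|a IHa|a IHa] s1 s2.
- by rewrite IHa IHb.
- by rewrite IHa IHb.
- by rewrite IHa.
- by rewrite IHa upt_comp.
Qed.

Lemma tsub_id a : tsub TVar a = a.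
Proof. by elim: a => //= [a -> b ->|a -> b ->|a ->|a IHa] //; rewrite upt_TVar IHa. Qed.

Lemma upt_var r : upt (TVar \o r) = TVar \o upr r.
Proof. by fext => -[]. Qed.

Lemma tren_as_tsub r a : tren r a = tsub (TVar \o r) a.
Proof.
elim: a r => //= [a IHa b IHb|a IHa b IHb|a IHa|a IHa] r.
- by rewrite IHa IHb.
- by rewrite IHa IHb.
- by rewrite IHa.
- by rewrite IHa upt_var.
Qed.

Lemma tren_id a : tren id a = a.
Proof. by rewrite tren_as_tsub; apply: tsub_id. Qed.

Lemma eren_eren rt' re' rt re t :
  eren rt' re' (eren rt re t) = eren (rt' \o rt) (re' \o re) t.
Proof.
elim: t rt re rt' re' => //= [a t IH|t IHt u IHu|t IHt u IHu|t IH|t IH|t IH a|s IHs t IHt|s IHs t IHt|s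
  IHs t IHt] rt re rt' re';
  rewrite ?IH ?IHs ?IHt ?IHu ?tren_tren ?upr_comp //.
Qed.

Lemma upe_upr s r : upe s \o upr r = upe (s \o r).
Proof. by fext => -[]. Qed.

Lemma esub_eren st se rt re t :
  esub st se (eren rt re t) = esub (st \o rt) (se \o re) t.
Proof.
elim: t st se rt re => //= [a t IH|t IHt u IHu|t IHt u IHu|t IH|t IH|t IH a|s IHs t IHt|s IHs t IHt|s
  IHs t IHt] st se rt re;
  rewrite ?IH ?IHs ?IHt ?IHu ?tsub_tren ?upe_upr ?upt_upr //.
Qed.

Lemma upr_upe rt re s : eren rt (upr re) \o upe s = upe (eren rt re \o s).
Proof. by fext => -[|i] //=; rewrite /eshift !eren_eren. Qed.

Lemma eren_eshift1 rt re t : eren (upr rt) re (eshift 1 0 t) = eshift 1 0 (eren rt re t).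
Proof. by rewrite /eshift !eren_eren. Qed.

Lemma eren_esub rt re st se t :
  eren rt re (esub st se t) = esub (tren rt \o st) (eren rt re \o se) t.
Proof.
elim: t st se rt re => //= [a t IH|t IHt u IHu|t IHt u IHu|t IH|t IH|t IH a|s IHs t IHt|s IHs t IHt|s
  IHs t IHt] st se rt re;
  rewrite ?IH ?IHs ?IHt ?IHu ?tren_tsub ?upr_upe ?upr_upt //.
congr (TLam (esub _ _ _)); fext => i /=; exact: eren_eshift1.
Qed.

Lemma upe_comp st se' se : esub st (upe se') \o upe se = upe (esub st se' \o se).
Proof. by fext => -[|i] //=; rewrite /eshift esub_eren eren_esub; congr esub; fext => j /=; rewrite
  tren_id. Qed.

Lemma esub_esub st' se' st se t :
  esub st' se' (esub st se t) = esub (tsub st' \o st) (esub st' se' \o se) t.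
Proof.
elim: t st se st' se' => //= [a t IH|t IHt u IHu|t IHt u IHu|t IH|t IH|t IH a|s IHs t IHt|s IHs t IHt|s
  IHs t IHt] st se st' se';
  rewrite ?IH ?IHs ?IHt ?IHu ?tsub_tsub ?upe_comp ?upt_comp //.
congr (TLam (esub _ _ _)); fext => i /=.
by rewrite /eshift esub_eren eren_esub.
Qed.

Lemma esub_id t : esub TVar Var t = t.
Proof.
elim: t => //= [a t IH|t IHt u IHu|t IHt u IHu|t IH|t IH|t IH a|s IHs t IHt|s IHs t IHt|s IHs t IHt];
  rewrite ?tsub_id ?upe_Var ?upt_TVar ?IH ?IHs ?IHt ?IHu //.
Qed.

Lemma upe_var r : upe (Var \o r) = Var \o upr r.
Proof. by fext => -[]. Qed.

Lemma eren_as_esub rt re t : eren rt re t = esub (TVar \o rt) (Var \o re) t.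
Proof. by rewrite -[in LHS](esub_id t) eren_esub. Qed.

Lemma eren_id t : eren id id t = t.
Proof. by rewrite eren_as_esub; apply: esub_id. Qed.

Section PropInd.
Variables (P : prop -> Prop) (Q : drel -> Prop).
Hypotheses
  (HEq : forall a t u, P (PEq a t u))
  (HRel : forall r t u, Q r -> P (PRel r t u))
  (HTop : P PTop) (HBot : P PBot)
  (HAnd : forall p q, P p -> P q -> P (PAnd p q))
  (HOr : forall p q, P p -> P q -> P (POr p q))
  (HImp : forall p q, P p -> P q -> P (PImp p q))
  (HAll : forall b p, P p -> P (PAll b p))
  (HEx : forall b p, P p -> P (PEx b p))
  (HVar : forall i, Q (RVar i))
  (HComp : forall a b p, P p -> Q (RComp a b p))
  (HTy : forall s rs, foldr (fun r => and (Q r)) True rs -> Q (RTy s rs)).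

(** The generated mutual induction principle gives no hypothesis for the list of relations inside
    [RTy]; the inner [fix] supplies one for each element. *)
Fixpoint prop_ind2 p : P p :=
  match p with
  | PEq a t u => HEq a t u
  | PRel r t u => HRel t u (drel_ind2 r)
  | PTop => HTop
  | PBot => HBot
  | PAnd p q => HAnd (prop_ind2 p) (prop_ind2 q)
  | POr p q => HOr (prop_ind2 p) (prop_ind2 q)
  | PImp p q => HImp (prop_ind2 p) (prop_ind2 q)
  | PAll b p => HAll b (prop_ind2 p)
  | PEx b p => HEx b (prop_ind2 p)
  end
with drel_ind2 r : Q r :=
  match r with
  | RVar i => HVar i
  | RComp a b p => HComp a b (prop_ind2 p)
  | RTy s rs => HTy s
      ((fix go rs : foldr (fun r => and (Q r)) True rs :=
          match rs with
          | [::] => I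
          | r :: rs => conj (drel_ind2 r) (go rs)
          end) rs)
  end.

Lemma prop_drel_ind : (forall p, P p) /\ (forall r, Q r).
Proof. by split; [exact: prop_ind2 | exact: drel_ind2]. Qed.
End PropInd.

Definition rcomp (r' r : renaming) : renaming :=
  Ren (rn_ty r' \o rn_ty r) (rn_tm r' \o rn_tm r) (rn_rel r' \o rn_rel r).

Definition sren (s : subst) (r : renaming) : subst :=
  Sub (sb_ty s \o rn_ty r) (sb_tm s \o rn_tm r) (sb_rel s \o rn_rel r).

Definition rsubst (r : renaming) (s : subst) : subst :=
  Sub (tren (rn_ty r) \o sb_ty s) (eren (rn_ty r) (rn_tm r) \o sb_tm s)
      (rren r \o sb_rel s).

Definition scomp (s' s : subst) : subst :=
  Sub (tsub (sb_ty s') \o sb_ty s) (esub (sb_ty s') (sb_tm s') \o sb_tm s)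
      (rsub s' \o sb_rel s).

Definition sid : subst := Sub TVar Var RVar.

Lemma bmap_bmap f g b : bmap f (bmap g b) = bmap (f \o g) b.
Proof. by case: b. Qed.

Lemma eq_bmap f g b : f =1 g -> bmap f b = bmap g b.
Proof. by case: b => //= [a|k a b] fg; rewrite !fg. Qed.

Lemma liftr_bmap f b r : liftr (bmap f b) r = liftr b r.
Proof. by case: b. Qed.

Lemma lifts_bmap f b s : lifts (bmap f b) s = lifts b s.
Proof. by case: b. Qed.

Lemma liftr_comp b r' r : rcomp (liftr b r') (liftr b r) = liftr b (rcomp r' r).
Proof. by case: b => [|a|k a b]; rewrite /rcomp /= upr_comp. Qed.

Lemma liftr2_comp r' r : rcomp (liftr2 r') (liftr2 r) = liftr2 (rcomp r' r).
Proof. by rewrite /rcomp /= !upr_comp. Qed.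

Local Ltac pind := apply: prop_drel_ind => //= [a t u|s t u IH|p q IHp IHq|p q IHp IHq|p q IHp IHq|b p
  IH|b p IH|a b p IH|s rs IH].

(** The four composition laws (renaming after renaming, substitution after renaming, renaming after
    substitution, substitution after substitution) come in this order because lifting each one below
    a binder uses the previous ones. *)
Lemma pren_rren :
  (forall p r' r, pren r' (pren r p) = pren (rcomp r' r) p) /\
  (forall s r' r, rren r' (rren r s) = rren (rcomp r' r) s).
Proof.
pind => r' r; rewrite ?eren_eren ?tren_tren ?IH ?IHp ?IHq ?liftr_bmap ?bmap_bmap
   ?liftr_comp ?liftr2_comp //.
- by congr PAll; apply: eq_bmap => a; rewrite /= tren_tren.
- by congr PEx; apply: eq_bmap => a; rewrite /= tren_tren.
- rewrite -map_comp; congr RTy.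
  by elim: rs IH => //= s' rs IH [-> /IH ->].
Qed.

Definition rren_rren := pren_rren.2.

Lemma lifts_liftr b s r : sren (lifts b s) (liftr b r) = lifts b (sren s r).
Proof.
case: b => [|a|k a b]; rewrite /sren /=; congr Sub; try (by fext => -[]).
Qed.

Lemma lifts2_liftr2 s r : sren (lifts2 s) (liftr2 r) = lifts2 (sren s r).
Proof. by rewrite /sren /lifts2 /=; congr Sub; rewrite !upe_upr. Qed.

Lemma psub_rsub_ren :
  (forall p s r, psub s (pren r p) = psub (sren s r) p) /\
  (forall q s r, rsub s (rren r q) = rsub (sren s r) q).
Proof.
pind => s' r; rewrite ?esub_eren ?tsub_tren ?IH ?IHp ?IHq ?lifts_bmap ?bmap_bmap
   ?lifts_liftr ?lifts2_liftr2 //.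
- by congr PAll; apply: eq_bmap => a; rewrite /= tsub_tren.
- by congr PEx; apply: eq_bmap => a; rewrite /= tsub_tren.
- rewrite -map_comp; congr RTy.
  by elim: rs IH => //= q rs IH [-> /IH ->].
Qed.

Definition rsub_rren := psub_rsub_ren.2.

Lemma liftr_lifts b r s : rsubst (liftr b r) (lifts b s) = lifts b (rsubst r s).
Proof.
case: b => [|a|k a b]; rewrite /rsubst /=; congr Sub; rewrite ?upr_upt ?upr_upe //;
  fext => -[|i] //=; rewrite ?eren_eshift1 // !rren_rren //.
Qed.

Lemma liftr2_lifts2 r s : rsubst (liftr2 r) (lifts2 s) = lifts2 (rsubst r s).
Proof.
rewrite /rsubst /lifts2 /=; congr Sub; rewrite ?upr_upe //.
by fext => i /=; rewrite !rren_rren.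
Qed.

Lemma pren_rren_sub :
  (forall p r s, pren r (psub s p) = psub (rsubst r s) p) /\
  (forall q r s, rren r (rsub s q) = rsub (rsubst r s) q).
Proof.
pind => r s'; rewrite ?eren_esub ?tren_tsub ?IH ?IHp ?IHq ?lifts_bmap ?liftr_bmap ?bmap_bmap
   ?liftr_lifts ?liftr2_lifts2 //.
- by congr PAll; apply: eq_bmap => a; rewrite /= tren_tsub.
- by congr PEx; apply: eq_bmap => a; rewrite /= tren_tsub.
- rewrite -map_comp; congr RTy.
  by elim: rs IH => //= q rs IH [-> /IH ->].
Qed.

Definition rren_rsub := pren_rren_sub.2.

Lemma tren0 : tren (addn 0) = id.
Proof. by fext => a; apply: tren_id. Qed.

Lemma lifts_comp b s' s : scomp (lifts b s') (lifts b s) = lifts b (scomp s' s).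
Proof.
case: b => [|a|k a b]; rewrite /scomp /=; congr Sub; rewrite ?upt_comp ?upe_comp //;
 fext => -[|i] //=; rewrite /eshift ?esub_eren ?eren_esub ?rsub_rren ?rren_rsub //;
 rewrite /sren /rsubst /=; congr rsub; congr Sub; rewrite ?tren0 //;
 by fext => j /=; rewrite /eshift // eren_id.
Qed.

(** Lifting below a term binder ignores the type of the binder, so [TOne] is an arbitrary choice. *)
Lemma lifts2E s : lifts2 s = lifts (BTm TOne) (lifts (BTm TOne) s).
Proof. by rewrite /lifts2 /=; congr Sub; fext => i; rewrite rren_rren. Qed.

Lemma lifts2_comp s' s : scomp (lifts2 s') (lifts2 s) = lifts2 (scomp s' s).
Proof. by rewrite !lifts2E !lifts_comp. Qed.

Lemma psub_rsub_comp :
  (forall p s' s, psub s' (psub s p) = psub (scomp s' s) p) /\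
  (forall q s' s, rsub s' (rsub s q) = rsub (scomp s' s) q).
Proof.
pind => s' s''; rewrite ?esub_esub ?tsub_tsub ?IH ?IHp ?IHq ?lifts_bmap ?bmap_bmap
   ?lifts_comp ?lifts2_comp //.
- by congr PAll; apply: eq_bmap => a; rewrite /= tsub_tsub.
- by congr PEx; apply: eq_bmap => a; rewrite /= tsub_tsub.
- rewrite -map_comp; congr RTy.
  by elim: rs IH => //= q rs IH [-> /IH ->].
Qed.

Definition psub_psub := psub_rsub_comp.1.
Definition rsub_rsub := psub_rsub_comp.2.

Lemma lifts_sid b : lifts b sid = sid.
Proof.
by case: b => [|a|k a b]; rewrite /sid /= ?upt_TVar ?upe_Var; congr Sub; fext => -[].
Qed.

Lemma lifts2_sid : lifts2 sid = sid.
Proof. by rewrite lifts2E !lifts_sid. Qed.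

Lemma psub_rsub_id : (forall p, psub sid p = p) /\ (forall q, rsub sid q = q).
Proof.
have bm b : bmap (tsub TVar) b = b by case: b => //= *; rewrite !tsub_id.
pind; rewrite ?esub_id ?tsub_id ?bm ?lifts_sid ?lifts2_sid ?IH ?IHp ?IHq //.
by congr RTy; elim: rs IH => //= q rs IH [-> /IH ->].
Qed.

Definition psub_id := psub_rsub_id.1.
Definition rsub_id := psub_rsub_id.2.

Definition ren_subst (r : renaming) : subst :=
  Sub (TVar \o rn_ty r) (Var \o rn_tm r) (RVar \o rn_rel r).

Lemma rren_as_rsub r q : rren r q = rsub (ren_subst r) q.
Proof. by rewrite -[in LHS](rsub_id q) rren_rsub. Qed.

(** * Typing *)

(* Occurrences below a [Bang] count twice, so that [lcount i t = 1] says that i is used linearly. *)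
Fixpoint lcount (i : nat) (t : tm) : nat :=
  match t with
  | Var j => i == j
  | Star | YC => 0
  | Lam _ t => lcount i.+1 t
  | App t u | Tens t u | LetS t u => lcount i t + lcount i u
  | Bang t => (lcount i t).*2
  | TLam t | TApp t _ => lcount i t
  | LetT s t => lcount i s + lcount i.+2 t
  | LetB s t => lcount i s + lcount i.+1 t
  end.

Fixpoint lwf (t : tm) : bool :=
  match t with
  | Var _ | Star | YC => true
  | Lam _ t => (lcount 0 t == 1) && lwf t
  | App t u | Tens t u | LetS t u | LetB t u => lwf t && lwf u
  | Bang t | TLam t | TApp t _ => lwf t
  | LetT s t => [&& lwf s, lcount 0 t == 1, lcount 1 t == 1 & lwf t]
  end.

(* [has_type] is [sty], which ignores linearity, together with the syntactic linearity
   check [lwf]; unlike [csplit], both are easily transported along substitutions. *)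
Inductive sty : nat -> seq ty -> tm -> ty -> Prop :=
| sty_var n G i a : onth G i = Some a -> sty n G (Var i) a
| sty_star n G : sty n G Star TOne
| sty_Y n G : sty n G YC Y_ty
| sty_lam n G a b t : wf_ty n a -> sty n (a :: G) t b -> sty n G (Lam a t) (TLol a b)
| sty_app n G a b t u : sty n G t (TLol a b) -> sty n G u a -> sty n G (App t u) b
| sty_tens n G a b t u : sty n G t a -> sty n G u b -> sty n G (Tens t u) (TTens a b)
| sty_bang n G a t : sty n G t a -> sty n G (Bang t) (TBang a)
| sty_tlam n G a t : sty n.+1 (map (tren S) G) t a -> sty n G (TLam t) (TPi a)
| sty_tapp n G a b t : sty n G t (TPi a) -> wf_ty n b -> sty n G (TApp t b) (tapp a b)
| sty_lett n G a b c s t :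
    sty n G s (TTens a b) -> sty n [:: b, a & G] t c -> sty n G (LetT s t) c
| sty_letb n G a c s t :
    sty n G s (TBang a) -> sty n (a :: G) t c -> sty n G (LetB s t) c
| sty_lets n G c s t : sty n G s TOne -> sty n G t c -> sty n G (LetS s t) c.

Definition uok (u : usage) (m : nat) : bool :=
  match u with Zero => m == 0 | One => m == 1 | Many => true end.

(** [k i] stands for the number of occurrences of variable [i]. With counts given as functions,
    splitting a context becomes pointwise addition. *)
Fixpoint cok (C : tctx) (k : nat -> nat) : bool :=
  if C is d :: C then uok d.1 (k 0) && cok C (k \o S) else true.

Lemma eq_cok C k k' : k =1 k' -> cok C k = cok C k'.
Proof.
elim: C k k' => //= d C IH k k' kk'; rewrite kk'; congr andb.
by apply: IH => i; apply: kk'.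
Qed.

Lemma csplit_types C C1 C2 : csplit C C1 C2 -> unzip2 C1 = unzip2 C /\ unzip2 C2 = unzip2 C.
Proof. by elim=> //= u u1 u2 a C0 C01 C02 _ _ [-> ->]. Qed.

Lemma cok_csplit C C1 C2 k1 k2 : csplit C C1 C2 ->
  cok C1 k1 -> cok C2 k2 -> cok C (fun i => k1 i + k2 i).
Proof.
move=> H; elim: H k1 k2 => //= u u1 u2 a {}C {}C1 {}C2 H _ IH k1 k2 /andP[h1 h2] /andP[h3 h4].
rewrite IH // andbT.
by case: H h1 h3 => //= /eqP-> /eqP->.
Qed.

Lemma lin_free_cok0 C : lin_free C -> cok C (fun=> 0).
Proof. by elim: C => //= -[[] a] C IH //= /IH. Qed.

Lemma lin_free_cok2 C k : lin_free C -> cok C k -> cok C (fun i => (k i).*2).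
Proof.
elim: C k => //= -[[] a] C IH k //= lC; last exact: IH.
by case/andP=> /eqP-> H; apply: IH.
Qed.

(** A doubled count is never 1, so no variable can be declared [One]. This is how the doubling in
    [lcount] expresses the side condition on [Bang]. *)
Lemma cok2_lin_free C k : cok C (fun i => (k i).*2) -> lin_free C /\ cok C k.
Proof.
elim: C k => //= -[u a] C IH k /= /andP[h /IH[h1 h2]].
by case: u h => /= /eqP; rewrite ?h2 ?andbT //= => h; split => //; apply/eqP; lia.
Qed.

Lemma cok_var C i u a : onth C i = Some (u, a) -> u <> Zero ->
  lin_free (take i C ++ drop i.+1 C) -> cok C (fun j => (j == i) : nat).
Proof.
elim: C i => [|[v b] C IH] [|i] //=.
  rewrite drop0 => -[<- _] Hv lC; apply/andP; split; first by case: v Hv.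
  exact: (lin_free_cok0 lC).
move=> H Hu /andP[hv lC].
rewrite (eq_cok C (k' := fun j => (j == i) : nat)) // IH // andbT.
by case: v hv.
Qed.

Lemma cok0_lin_free C : cok C (fun=> 0) -> lin_free C.
Proof. by elim: C => //= -[[] a] C IH //= /IH. Qed.

Lemma cok_var_inv C i a : onth (unzip2 C) i = Some a -> cok C (fun j => (j == i) : nat) ->
  exists u, [/\ onth C i = Some (u, a), u <> Zero & lin_free (take i C ++ drop i.+1 C)].
Proof.
elim: C i => [|[v b] C IH] [|i] //=.
  move=> [->] /andP[h hC]; exists v; rewrite drop0; split => //; first by case: v h.
  exact: cok0_lin_free hC.
move=> H /andP[h]; rewrite (eq_cok C (k' := fun j => (j == i) : nat)) // => hC.
have [u [h1 h2 h3]] := IH _ H hC; exists u; split => //; rewrite h3 andbT.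
by case: v h.
Qed.

(** If a linear variable has total count 1, the summand equal to 1 says to which premise it goes;
    the existential splitting of the multiplicative rules is thereby recovered from the counts. *)
Lemma cok_split C k1 k2 : cok C (fun i => k1 i + k2 i) ->
  exists C1 C2, [/\ csplit C C1 C2, cok C1 k1 & cok C2 k2].
Proof.
elim: C k1 k2 => [|[u a] C IH] k1 k2 /=; first by exists [::], [::]; split => //; constructor.
case/andP=> h /IH[C1 [C2 [h1 h2 h3]]].
have [u1 [u2 [h4 h5 h6]]] : exists u1 u2, [/\ usplit u u1 u2, uok u1 (k1 0) & uok u2 (k2 0)].
  case: u h => /= h.
  - by exists Zero, Zero; split; [constructor|..] => /=; apply/eqP; move/eqP: h; lia.
  - have [h'|h'] : (k1 0 = 1 /\ k2 0 = 0) \/ (k1 0 = 0 /\ k2 0 = 1) by move/eqP: h; lia.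
    + by exists One, Zero; split; [exact: us_left| |]; case: h' => /= h1' h2'; rewrite ?h1' ?h2'.
    + by exists Zero, One; split; [exact: us_right| |]; case: h' => /= h1' h2'; rewrite ?h1' ?h2'.
  - by exists Many, Many; split => //; constructor.
exists ((u1, a) :: C1), ((u2, a) :: C2).
by split; [constructor| rewrite /= h5|rewrite /= h6].
Qed.

Lemma cok_shift C k : cok (tctx_shift C) k = cok C k.
Proof. by elim: C k => //= d C IH k; rewrite IH. Qed.

Lemma unzip2_shift C : unzip2 (tctx_shift C) = map (tren S) (unzip2 C).
Proof. by elim: C => //= d C ->. Qed.

Lemma has_typeE n C t a :
  has_type n C t a <-> [/\ sty n (unzip2 C) t a, lwf t & cok C (lcount^~ t)].
Proof.
split.
  elim=> {n C t a} /=.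
  - move=> n C a i u H Hu lC; split => //; last exact: cok_var H Hu lC.
    by constructor; rewrite onth_map H.
  - by move=> n C lC; split; [by constructor | by [] | exact: lin_free_cok0].
  - by move=> n C lC; split; [by constructor | by [] | exact: lin_free_cok0].
  - move=> n C a b t wa _ [h1 h2 /andP[h3 h4]]; rewrite h2 h3; split => //.
    by constructor.
  - move=> n C C1 C2 a b t u H _ [h1 h2 h3] _ [h4 h5 h6]; rewrite h2 h5.
    case: (csplit_types H) h1 h4 => -> -> h1 h4; split => //; first exact: sty_app h1 h4.
    exact: cok_csplit H h3 h6.
  - move=> n C C1 C2 a b t u H _ [h1 h2 h3] _ [h4 h5 h6]; rewrite h2 h5.
    case: (csplit_types H) h1 h4 => -> -> h1 h4; split => //; first exact: sty_tens h1 h4.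
    exact: cok_csplit H h3 h6.
  - move=> n C a t lC _ [h1 h2 h3]; split => //; first by constructor.
    exact: lin_free_cok2.
  - move=> n C a t _ [h1 h2 h3]; split => //; first by constructor; rewrite -unzip2_shift.
    by rewrite cok_shift in h3.
  - by move=> n C a b t _ [h1 h2 h3] wb; split => //; constructor.
  - move=> n C C1 C2 a b c s t H _ [h1 h2 h3] _ [h4 h5 /and3P[/= h6 h7 h8]]; rewrite h2 h5 h6 h7.
    case: (csplit_types H) h1 h4 => + /= -> => -> h1 h4; split => //; first exact: sty_lett h1 h4.
    exact: cok_csplit H h3 h8.
  - move=> n C C1 C2 a c s t H _ [h1 h2 h3] _ [h4 h5 /= h6]; rewrite h2 h5.
    case: (csplit_types H) h1 h4 => + /= -> => -> h1 h4; split => //; first exact: sty_letb h1 h4.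
    exact: cok_csplit H h3 h6.
  - move=> n C C1 C2 c s t H _ [h1 h2 h3] _ [h4 h5 h6]; rewrite h2 h5.
    case: (csplit_types H) h1 h4 => -> -> h1 h4; split => //; first exact: sty_lets h1 h4.
    exact: cok_csplit H h3 h6.
case; move E: (unzip2 C) => G H.
elim: H C E => {n G t a} /=.
- move=> n G i a H C E _; rewrite -E in H => h; have [u [h1 h2 h3]] := cok_var_inv H h.
  exact: ht_var h1 h2 h3.
- by move=> n G C E _ h; constructor; apply: cok0_lin_free.
- by move=> n G C E _ h; constructor; apply: cok0_lin_free.
- move=> n G a b t wa _ IH C E /andP[h1 h2] h3; constructor => //; apply: IH => //=; first by rewrite E.
  by rewrite h1.
- move=> n G a b t u _ IHt _ IHu C E /andP[h1 h2] /cok_split[C1 [C2 [H h3 h4]]].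
  by have [E1 E2] := csplit_types H; apply: (ht_app H); [apply: IHt|apply: IHu] => //; rewrite ?E1 ?E2.
- move=> n G a b t u _ IHt _ IHu C E /andP[h1 h2] /cok_split[C1 [C2 [H h3 h4]]].
  by have [E1 E2] := csplit_types H; apply: (ht_tens H); [apply: IHt|apply: IHu] => //; rewrite ?E1 ?E2.
- by move=> n G a t _ IH C E h1 /cok2_lin_free[h2 h3]; constructor => //; apply: IH.
- move=> n G a t _ IH C E h1 h2; constructor; apply: IH => //; first by rewrite unzip2_shift E.
  by rewrite cok_shift.
- by move=> n G a b t _ IH wb C E h1 h2; constructor => //; apply: IH.
- move=> n G a b c s t _ IHs _ IHt C E /and4P[h1 h2 h3 h4] /cok_split[C1 [C2 [H h5 h6]]].
  have [E1 E2] := csplit_types H; apply: (ht_lett H (a := a) (b := b)); first by apply: IHs => //; rewrite E1.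
  by apply: IHt => //=; rewrite ?E2 ?E ?h2 ?h3.
- move=> n G a c s t _ IHs _ IHt C E /andP[h1 h2] /cok_split[C1 [C2 [H h5 h6]]].
  have [E1 E2] := csplit_types H; apply: (ht_letb H (a := a)); first by apply: IHs => //; rewrite E1.
  by apply: IHt => //=; rewrite ?E2 ?E.
- move=> n G c s t _ IHs _ IHt C E /andP[h1 h2] /cok_split[C1 [C2 [H h3 h4]]].
  by have [E1 E2] := csplit_types H; apply: (ht_lets H); [apply: IHs|apply: IHt] => //; rewrite ?E1 ?E2.
Qed.

Lemma cok_intu G k : cok [seq (Many, a) | a <- G] k.
Proof. by elim: G k => //= a G IH k; apply: IH. Qed.

Lemma unzip2_intu (G : seq ty) : unzip2 [seq (Many, a) | a <- G] = G.
Proof. by elim: G => //= a G ->. Qed.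

Lemma tm_inE c t a : tm_in c t a <-> sty (cty c) (ctm c) t a /\ lwf t.
Proof.
rewrite /tm_in has_typeE /intu unzip2_intu; split; first by case.
by case=> h1 h2; split => //; apply: cok_intu.
Qed.

Lemma wf_tren n m r a : (forall i, i < n -> r i < m) -> wf_ty n a -> wf_ty m (tren r a).
Proof.
elim: a n m r => //= [i|a IHa b IHb|a IHa b IHb|a IHa] n m r h; first exact: h.
- by case/andP=> /(IHa _ _ _ h) -> /(IHb _ _ _ h).
- by case/andP=> /(IHa _ _ _ h) -> /(IHb _ _ _ h).
- by apply: IHa => -[|i] //=; apply: h.
Qed.

Lemma wf_tsub n m s a : (forall i, i < n -> wf_ty m (s i)) -> wf_ty n a -> wf_ty m (tsub s a).
Proof.
elim: a n m s => //= [i|a IHa b IHb|a IHa b IHb|a IHa] n m s h; first exact: h.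
- by case/andP=> /(IHa _ _ _ h) -> /(IHb _ _ _ h).
- by case/andP=> /(IHa _ _ _ h) -> /(IHb _ _ _ h).
- by apply: IHa => -[|i] //= hi; apply: wf_tren (h i hi).
Qed.

Lemma eq_tsub n s s' a : wf_ty n a -> (forall i, i < n -> s i = s' i) -> tsub s a = tsub s' a.
Proof.
elim: a n s s' => //= [i|a IHa b IHb|a IHa b IHb|a IHa|a IHa] n s s'.
- by move=> hi; apply.
- by case/andP=> ha hb h; rewrite (IHa _ _ _ ha h) (IHb _ _ _ hb h).
- by case/andP=> ha hb h; rewrite (IHa _ _ _ ha h) (IHb _ _ _ hb h).
- by move=> ha h; rewrite (IHa _ _ _ ha h).
- by move=> ha h; rewrite (IHa _ _ (upt s') ha) // => -[|i] //= hi; rewrite h.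
Qed.

Lemma wf_ty_le n m a : n <= m -> wf_ty n a -> wf_ty m a.
Proof. by move=> h wa; rewrite -(tren_id a); apply: wf_tren wa => i /= hi; lia. Qed.

Lemma tsub_closed s a : wf_ty 0 a -> tsub s a = a.
Proof. by move=> wa; rewrite (eq_tsub (s' := TVar) wa) // tsub_id. Qed.

Lemma tren_closed r a : wf_ty 0 a -> tren r a = a.
Proof. by move=> wa; rewrite tren_as_tsub tsub_closed. Qed.

Lemma tsub_tapp s a b : tsub s (tapp a b) = tapp (tsub (upt s) a) (tsub s b).
Proof.
rewrite /tapp !tsub_tsub; congr tsub; fext => -[|i] //=.
by rewrite tsub_tren tsub_id.
Qed.

Lemma tren_tapp r a b : tren r (tapp a b) = tapp (tren (upr r) a) (tren r b).
Proof. by rewrite !tren_as_tsub tsub_tapp upt_var. Qed.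

Lemma onth_omap G (f : ty -> ty) i a : onth G i = Some a -> onth (map f G) i = Some (f a).
Proof. by rewrite onth_map => ->. Qed.

Lemma sty_ren n G t a : sty n G t a -> forall m D rt re,
  (forall i, i < n -> rt i < m) ->
  (forall i b, onth G i = Some b -> onth D (re i) = Some (tren rt b)) ->
  sty m D (eren rt re t) (tren rt a).
Proof.
have up G0 D a0 rt re :
  (forall i b, onth G0 i = Some b -> onth D (re i) = Some (tren rt b)) ->
  (forall i b, onth (a0 :: G0) i = Some b -> onth (tren rt a0 :: D) (upr re i) = Some (tren rt b)).
  by move=> h [|i] b0 /=; [case=> -> | apply: h].
elim=> {n G t a} /=.
- by move=> n G i a H m D rt re h1 h2; constructor; apply: h2.
- by move=> *; constructor.
- by move=> n G m D rt re _ _; exact: sty_Y.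
- move=> n G a b t wa _ IH m D rt re h1 h2; constructor; first exact: wf_tren wa.
  by apply: IH => //; apply: up.
- by move=> n G a b t u _ IHt _ IHu m D rt re h1 h2; apply: sty_app (IHt _ _ _ _ h1 h2) (IHu _ _ _ _ h1 h2).
- by move=> n G a b t u _ IHt _ IHu m D rt re h1 h2; apply: sty_tens (IHt _ _ _ _ h1 h2) (IHu _ _ _ _ h1 h2).
- by move=> n G a t _ IHt m D rt re h1 h2; constructor; apply: IHt.
- move=> n G a t _ IHt m D rt re h1 h2; constructor; apply: IHt; first by case=> //= i; apply: h1.
  move=> i b; rewrite onth_map; case E: onth => [b'|] //= [<-].
  by rewrite (onth_omap _ (h2 _ _ E)) !tren_tren.
- move=> n G a b t _ IHt wb m D rt re h1 h2; rewrite tren_tapp; constructor; first exact: IHt.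
  exact: wf_tren wb.
- move=> n G a b c s t _ IHs _ IHt m D rt re h1 h2; apply: sty_lett (IHs _ _ _ _ h1 h2) _.
  by apply: IHt => //; apply: (up); apply: (up).
- move=> n G a c s t _ IHs _ IHt m D rt re h1 h2; apply: sty_letb (IHs _ _ _ _ h1 h2) _.
  by apply: IHt => //; apply: up.
- by move=> n G c s t _ IHs _ IHt m D rt re h1 h2; apply: sty_lets (IHs _ _ _ _ h1 h2) (IHt _ _ _ _ h1 h2).
Qed.

Lemma sty_sub n G t a : sty n G t a -> forall m D st se,
  (forall i, i < n -> wf_ty m (st i)) ->
  (forall i b, onth G i = Some b -> sty m D (se i) (tsub st b)) ->
  sty m D (esub st se t) (tsub st a).
Proof.
have up m G0 D a0 st se :
  (forall i b, onth G0 i = Some b -> sty m D (se i) (tsub st b)) ->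
  (forall i b, onth (a0 :: G0) i = Some b -> sty m (tsub st a0 :: D) (upe se i) (tsub st b)).
  move=> h [|i] b0 /=; first by case=> ->; constructor.
  move/h => /sty_ren - /(_ m (tsub st a0 :: D) (addn 0) (addn 1)); rewrite tren0; apply => //.
elim=> {n G t a} /=.
- by move=> n G i a H m D rt re h1 h2; apply: h2.
- by move=> *; constructor.
- by move=> n G m D rt re _ _; exact: sty_Y.
- move=> n G a b t wa _ IH m D rt re h1 h2; constructor; first exact: wf_tsub wa.
  by apply: IH => //; apply: up.
- by move=> n G a b t u _ IHt _ IHu m D rt re h1 h2; apply: sty_app (IHt _ _ _ _ h1 h2) (IHu _ _ _ _ h1 h2).
- by move=> n G a b t u _ IHt _ IHu m D rt re h1 h2; apply: sty_tens (IHt _ _ _ _ h1 h2) (IHu _ _ _ _ h1 h2).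
- by move=> n G a t _ IHt m D rt re h1 h2; constructor; apply: IHt.
- move=> n G a t _ IHt m D rt re h1 h2; constructor; apply: IHt.
    case=> //= i hi; apply: wf_tren (h1 _ hi) => //.
  move=> i b; rewrite onth_map; case E: onth => [b'|] //= [<-].
  have -> : tsub (upt rt) (tren S b') = tren (addn 1) (tsub rt b') by rewrite tsub_tren tren_tsub.
  apply: (sty_ren (h2 _ _ E)) => // j d; exact: onth_omap.
- move=> n G a b t _ IHt wb m D rt re h1 h2; rewrite tsub_tapp; constructor; first exact: IHt.
  exact: wf_tsub wb.
- move=> n G a b c s t _ IHs _ IHt m D rt re h1 h2; apply: sty_lett (IHs _ _ _ _ h1 h2) _.
  by apply: IHt => //; apply: (up); apply: (up).
- move=> n G a c s t _ IHs _ IHt m D rt re h1 h2; apply: sty_letb (IHs _ _ _ _ h1 h2) _.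
  by apply: IHt => //; apply: up.
- by move=> n G c s t _ IHs _ IHt m D rt re h1 h2; apply: sty_lets (IHs _ _ _ _ h1 h2) (IHt _ _ _ _ h1 h2).
Qed.

Lemma sty_esub_id n G t a : sty n G t a -> forall st se,
  (forall i, i < n -> st i = TVar i) -> (forall i, i < size G -> se i = Var i) ->
  esub st se t = t.
Proof.
have ts n0 a0 st : wf_ty n0 a0 -> (forall i, i < n0 -> st i = TVar i) -> tsub st a0 = a0.
  by move=> wa h; rewrite (eq_tsub wa h) tsub_id.
have up k se : (forall i, i < k -> se i = Var i) -> (forall i, i < k.+1 -> upe se i = Var i).
  by move=> h [|i] //= /h ->.
elim=> {n G t a} //=.
- by move=> n G i a H st se _ h; apply: h; rewrite -onthTE H.
- by move=> n G a b t wa _ IH st se h1 h2; rewrite (ts _ _ _ wa h1) IH //; apply: up.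
- by move=> n G a b t u _ IHt _ IHu st se h1 h2; rewrite IHt ?IHu.
- by move=> n G a b t u _ IHt _ IHu st se h1 h2; rewrite IHt ?IHu.
- by move=> n G a t _ IHt st se h1 h2; rewrite IHt.
- move=> n G a t _ IHt st se h1 h2; rewrite IHt // => -[|i] //=; first by move/h1 ->.
    by rewrite size_map => /h2 ->.
  by rewrite size_map => /h2 ->.
- by move=> n G a b t _ IHt wb st se h1 h2; rewrite IHt ?(ts _ _ _ wb h1).
- by move=> n G a b c s t _ IHs _ IHt st se h1 h2; rewrite IHs ?IHt //; apply: (up); apply: (up).
- by move=> n G a c s t _ IHs _ IHt st se h1 h2; rewrite IHs ?IHt //; apply: up.
- by move=> n G c s t _ IHs _ IHt st se h1 h2; rewrite IHs ?IHt.
Qed.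

Lemma lcount_eren rt re j i t : (forall k, (re k == j) = (k == i)) ->
  lcount j (eren rt re t) = lcount i t.
Proof.
have up r j' i' : (forall k, (r k == j') = (k == i')) ->
  forall k, (upr r k == j'.+1) = (k == i'.+1) by move=> h [|k] //=; rewrite eqSS h.
elim: t rt re i j => //= [k|a t IH|t IHt u IHu|t IHt u IHu|t IH|t IH|s IHs t IHt|s IHs t IHt|s IHs t
  IHt] rt re i j h.
- by rewrite eq_sym h eq_sym.
- by apply: IH; apply: up.
- by rewrite (IHt _ _ i) ?(IHu _ _ i).
- by rewrite (IHt _ _ i) ?(IHu _ _ i).
- by rewrite (IH _ _ i).
- by rewrite (IH _ _ i).
- by rewrite (IHs _ _ i) ?(IHt _ _ i.+2) //; do 2 apply: (up).
- by rewrite (IHs _ _ i) ?(IHt _ _ i.+1) //; apply: up.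
- by rewrite (IHs _ _ i) ?(IHt _ _ i).
Qed.

Lemma lcount_eren0 rt re j t : (forall k, re k != j) -> lcount j (eren rt re t) = 0.
Proof.
have up r j' : (forall k, r k != j') -> forall k, upr r k != j'.+1 by move=> h [|k] //=; rewrite eqSS h.
elim: t rt re j => //= [k|a t IH|t IHt u IHu|t IHt u IHu|t IH|t IH|s IHs t IHt|s IHs t IHt|s IHs t IHt]
  rt re j h.
- by rewrite eq_sym (negPf (h k)).
- by apply: IH; apply: up.
- by rewrite IHt ?IHu.
- by rewrite IHt ?IHu.
- by rewrite IH.
- by rewrite IH.
- by rewrite IHs ?IHt //; do 2 apply: (up).
- by rewrite IHs ?IHt //; apply: up.
- by rewrite IHs ?IHt.
Qed.

Lemma lcount_eshift k m i t : lcount i (eshift k m t) = if i < m then 0 else lcount (i - m) t.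
Proof.
case: ltnP => h; first by apply: lcount_eren0 => j; apply/eqP => /=; lia.
by apply: lcount_eren => j; apply/eqP/eqP => /=; lia.
Qed.

Lemma lwf_eren rt re t : lwf (eren rt re t) = lwf t.
Proof.
have c0 rt0 r t0 : lcount 0 (eren rt0 (upr r) t0) = lcount 0 t0.
  by apply: lcount_eren => -[].
elim: t rt re => //= [a t IH|t IHt u IHu|t IHt u IHu|s IHs t IHt|s IHs t IHt|s IHs t IHt] rt re;
  rewrite ?IH ?IHt ?IHu ?IHs ?c0 //.
by rewrite (@lcount_eren _ _ _ 1) // => -[|[]].
Qed.

Lemma lcount_esub st se j i t : (forall k, lcount j (se k) = (k == i)) ->
  lcount j (esub st se t) = lcount i t.
Proof.
have up s j' i' : (forall k, lcount j' (s k) = (k == i')) ->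
  forall k, lcount j'.+1 (upe s k) = (k == i'.+1).
  by move=> h [|k] //=; rewrite lcount_eshift /= subn1 h eqSS.
elim: t st se i j => //= [k|a t IH|t IHt u IHu|t IHt u IHu|t IH|t IH|s IHs t IHt|s IHs t IHt|s IHs t
  IHt] st se i j h.
- by rewrite h eq_sym.
- by apply: IH; apply: up.
- by rewrite (IHt _ _ i) ?(IHu _ _ i).
- by rewrite (IHt _ _ i) ?(IHu _ _ i).
- by rewrite (IH _ _ i).
- by apply: IH => k; rewrite lcount_eshift subn0 h.
- by rewrite (IHs _ _ i) ?(IHt _ _ i.+2) //; do 2 apply: (up).
- by rewrite (IHs _ _ i) ?(IHt _ _ i.+1) //; apply: up.
- by rewrite (IHs _ _ i) ?(IHt _ _ i).
Qed.

Lemma lwf_esub st se t : (forall i, lwf (se i)) -> lwf t -> lwf (esub st se t).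
Proof.
have up s : (forall i, lwf (s i)) -> forall i, lwf (upe s i).
  by move=> h [|i] //=; rewrite /eshift lwf_eren.
have c0 s0 se0 t0 : lcount 0 (esub s0 (upe se0) t0) = lcount 0 t0.
  by apply: lcount_esub => -[|k] //=; rewrite lcount_eshift.
elim: t st se => //= [a t IH|t IHt u IHu|t IHt u IHu|t IH|s IHs t IHt|s IHs t IHt|s IHs t IHt] st se h;
  rewrite ?c0 //.
- by case/andP=> -> H; apply: IH => //; apply: up.
- by case/andP=> h1 h2; rewrite IHt ?IHu.
- by case/andP=> h1 h2; rewrite IHt ?IHu.
- by apply: IH => i; rewrite /eshift lwf_eren.
- case/and4P=> h1 -> h2 h3; rewrite IHs // (@lcount_esub _ _ _ 1) ?h2 /=; last first.
    by move=> [|[|k]] //=; rewrite !lcount_eshift.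
  by apply: IHt => //; do 2 apply: (up).
- by case/andP=> h1 h2; rewrite IHs ?IHt //; apply: up.
- by case/andP=> h1 h2; rewrite IHs ?IHt.
Qed.

(** * Derived rules of the logic *)

Notation "c ▷ a" := (ext c (BTm a)) (at level 50, left associativity).
Notation "c ▷□" := (ext c BTy) (at level 50, left associativity).
Notation wkH b H := (map (pren (wkb b)) H).
Notation pv := (prv parametric_schemes).
Notation wfp := (wf_prop parametric_schemes).
Notation wfr := (wf_rel parametric_schemes).
Notation admr := (adm parametric_schemes).
Notation admrs := (adms parametric_schemes).

Lemma tm_in_var c i a : onth (ctm c) i = Some a -> tm_in c (Var i) a.
Proof. by move=> h; apply/tm_inE; split => //; constructor. Qed.

Lemma tm_in_app c a b t u : tm_in c t (TLol a b) -> tm_in c u a -> tm_in c (App t u) b.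
Proof. by move=> /tm_inE[h1 h2] /tm_inE[h3 h4]; apply/tm_inE; rewrite /= h2; split => //; apply: sty_app
  h1 h3. Qed.

Lemma tm_in_tens c a b t u : tm_in c t a -> tm_in c u b -> tm_in c (Tens t u) (TTens a b).
Proof. by move=> /tm_inE[h1 h2] /tm_inE[h3 h4]; apply/tm_inE; rewrite /= h2; split => //; apply:
  sty_tens h1 h3. Qed.

Lemma tm_in_bang c a t : tm_in c t a -> tm_in c (Bang t) (TBang a).
Proof. by move=> /tm_inE[h1 h2]; apply/tm_inE; split => //; constructor. Qed.

Lemma tm_in_tapp c a b d t : tm_in c t (TPi a) -> wf_ty (cty c) b -> tapp a b = d ->
  tm_in c (TApp t b) d.
Proof. by move=> /tm_inE[h1 h2] wb <-; apply/tm_inE; split => //; constructor. Qed.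

Lemma tm_in_tlam c a t : tm_in (c ▷□) t a -> tm_in c (TLam t) (TPi a).
Proof. by move=> /tm_inE[h1 h2]; apply/tm_inE; split => //; constructor. Qed.

Lemma tm_in_lam c a b t : wf_ty (cty c) a -> tm_in (c ▷ a) t b -> lcount 0 t == 1 ->
  tm_in c (Lam a t) (TLol a b).
Proof. by move=> wa /tm_inE[h1 h2] h3; apply/tm_inE; rewrite /= h3; split => //; constructor. Qed.

Lemma tm_in_letb c a d s t : tm_in c s (TBang a) -> tm_in (c ▷ a) t d -> tm_in c (LetB s t) d.
Proof. by move=> /tm_inE[h1 h2] /tm_inE[h3 h4]; apply/tm_inE; rewrite /= h2; split => //; apply:
  sty_letb h1 h3. Qed.

Lemma tm_in_lett c a b d s t : tm_in c s (TTens a b) -> tm_in (c ▷ a ▷ b) t d ->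
  lcount 0 t == 1 -> lcount 1 t == 1 -> tm_in c (LetT s t) d.
Proof. by move=> /tm_inE[h1 h2] /tm_inE[h3 h4] h5 h6; apply/tm_inE; rewrite /= h2 h5 h6; split => //;
  apply: sty_lett h1 h3. Qed.

Lemma tm_in_Y c : tm_in c YC Y_ty.
Proof. by apply/tm_inE; split => //; constructor. Qed.

Lemma tm_in_ren c c' rt re t a : tm_in c t a ->
  (forall i, i < cty c -> rt i < cty c') ->
  (forall i b, onth (ctm c) i = Some b -> onth (ctm c') (re i) = Some (tren rt b)) ->
  tm_in c' (eren rt re t) (tren rt a).
Proof.
by move=> /tm_inE[h1 h2] h3 h4; apply/tm_inE; rewrite lwf_eren; split => //; apply: sty_ren h1 _ _ _ _ h3 h4.
Qed.

Lemma tm_in_sub c c' st se t a : tm_in c t a ->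
  (forall i, i < cty c -> wf_ty (cty c') (st i)) ->
  (forall i b, onth (ctm c) i = Some b -> tm_in c' (se i) (tsub st b)) ->
  (forall i, lwf (se i)) ->
  tm_in c' (esub st se t) (tsub st a).
Proof.
move=> /tm_inE[h1 h2] h3 h4 h5; apply/tm_inE; split; last exact: lwf_esub.
by apply: sty_sub h1 _ _ _ _ h3 _ => i b /h4 /tm_inE[].
Qed.

Lemma tm_in_wk c b t a : tm_in c t a -> tm_in (c ▷ b) (eshift 0 1 t) a.
Proof.
move=> h; have := @tm_in_ren c (c ▷ b) (addn 0) (addn 1) _ _ h.
by rewrite tren0; apply.
Qed.

Lemma tm_in_wkT c t a : tm_in c t a -> tm_in (c ▷□) (eshift 1 0 t) (tren S a).
Proof.
move=> h; apply: (@tm_in_ren c (c ▷□) (addn 1) (addn 0) _ _ h) => // i b.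
exact: onth_omap.
Qed.

Lemma tm_in_inst c a b t u : tm_in (c ▷ a) t b -> tm_in c u a ->
  tm_in c (esub TVar (scons u Var) t) b.
Proof.
move=> ht hu; rewrite -[b]tsub_id; apply: (tm_in_sub ht).
- by [].
- by case=> [|i] d /=; rewrite tsub_id; [case=> <- | move=> h; apply: tm_in_var].
- by case=> [|i] //=; case/tm_inE: hu.
Qed.

Lemma esub_eshift k m st se t : esub st se (eshift k m t) = esub (st \o addn k) (se \o addn m) t.
Proof. by rewrite /eshift esub_eren. Qed.

Lemma esub_inst_wk u t : esub TVar (scons u Var) (eshift 0 1 t) = t.
Proof. by rewrite esub_eshift; apply: esub_id. Qed.

Lemma esub_instT_wk a t : esub (scons a TVar) Var (eshift 1 0 t) = t.
Proof. by rewrite esub_eshift; apply: esub_id. Qed.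

Lemma tsub_inst_wk a b : tsub (scons a TVar) (tren S b) = b.
Proof. by rewrite tsub_tren; apply: tsub_id. Qed.

Section Basic.
Variables (c : ctx) (H : seq prop).

Lemma pv_hyp0 p : pv c (p :: H) p.
Proof. exact: (@prv_hyp _ _ _ 0). Qed.

(* Weakening of [prv] is not derived.  A known proposition is moved to the hypotheses by
   [pv_cut] before a binder is introduced, so that [wkH] carries it under the binder. *)
Lemma pv_cut p q : wfp c p -> pv c H p -> pv c (p :: H) q -> pv c H q.
Proof. by move=> wp hp hq; apply: prv_impE hp; apply: prv_impI. Qed.

Lemma peq_refl a t : tm_in c t a -> pv c H (PEq a t t).
Proof. by move=> h; apply: prv_eqI; apply: eeq_refl. Qed.

(** Leibniz's rule for the predicate t[u] = t, in which the left side is weakened so that only the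
    right side is replaced. *)
Lemma peq_subst a b t u v : tm_in (c ▷ a) t b -> tm_in c u a -> pv c H (PEq a u v) ->
  pv c H (PEq b (esub TVar (scons u Var) t) (esub TVar (scons v Var) t)).
Proof.
move=> ht hu huv; have htu := tm_in_inst ht hu.
have := @prv_eqE _ c H a u v (PEq b (eshift 0 1 (esub TVar (scons u Var) t)) t).
rewrite /= !tsub_id !esub_inst_wk; apply => //; last exact: peq_refl.
by constructor => //; apply: tm_in_wk.
Qed.

Lemma peq_trans a u t v : tm_in c t a -> pv c H (PEq a t u) -> pv c H (PEq a u v) -> pv c H (PEq a t v).
Proof.
move=> ht htu huv.
have := @prv_eqE _ c H a u v (PEq a (eshift 0 1 t) (Var 0)).
rewrite /= !tsub_id !esub_inst_wk; apply => //.
by constructor; [apply: tm_in_wk | apply: tm_in_var].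
Qed.

Lemma peq_sym a t u : tm_in c t a -> pv c H (PEq a t u) -> pv c H (PEq a u t).
Proof.
move=> ht htu.
have := @prv_eqE _ c H a t u (PEq a (Var 0) (eshift 0 1 t)).
rewrite /= !tsub_id !esub_inst_wk; apply => //; last exact: peq_refl.
by constructor; [apply: tm_in_var | apply: tm_in_wk].
Qed.

Lemma peq_appl a b f g x : tm_in c f (TLol a b) -> tm_in c x a ->
  pv c H (PEq (TLol a b) f g) -> pv c H (PEq b (App f x) (App g x)).
Proof.
move=> hf hx h; have := @peq_subst _ b (App (Var 0) (eshift 0 1 x)) _ _ _ hf h.
rewrite /= !esub_inst_wk; apply.
by apply: (@tm_in_app _ a); [apply: tm_in_var | apply: tm_in_wk].
Qed.

Lemma peq_appr a b f x y : tm_in c f (TLol a b) -> tm_in c x a ->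
  pv c H (PEq a x y) -> pv c H (PEq b (App f x) (App f y)).
Proof.
move=> hf hx h; have := @peq_subst _ b (App (eshift 0 1 f) (Var 0)) _ _ _ hx h.
rewrite /= !esub_inst_wk; apply.
by apply: (@tm_in_app _ a); [apply: tm_in_wk | apply: tm_in_var].
Qed.

Lemma peq_bang a x y : tm_in c x a ->
  pv c H (PEq a x y) -> pv c H (PEq (TBang a) (Bang x) (Bang y)).
Proof.
move=> hx h; have := @peq_subst _ (TBang a) (Bang (Var 0)) _ _ _ hx h.
by apply; apply: tm_in_bang; apply: tm_in_var.
Qed.

Lemma peq_tens a b x y x' y' : tm_in c x a -> tm_in c x' a -> tm_in c y b ->
  pv c H (PEq a x x') -> pv c H (PEq b y y') ->
  pv c H (PEq (TTens a b) (Tens x y) (Tens x' y')).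
Proof.
move=> hx hx' hy h1 h2; apply: (@peq_trans _ (Tens x' y)); first exact: tm_in_tens.
  have := @peq_subst _ (TTens a b) (Tens (Var 0) (eshift 0 1 y)) _ _ _ hx h1.
  rewrite /= !esub_inst_wk; apply.
  by apply: tm_in_tens; [apply: tm_in_var | apply: tm_in_wk].
have := @peq_subst _ (TTens a b) (Tens (eshift 0 1 x') (Var 0)) _ _ _ hy h2.
rewrite /= !esub_inst_wk; apply.
by apply: tm_in_tens; [apply: tm_in_wk | apply: tm_in_var].
Qed.

Lemma peq_tapp a b d f g : tm_in c f (TPi a) -> wf_ty (cty c) b -> tapp a b = d ->
  pv c H (PEq (TPi a) f g) -> pv c H (PEq d (TApp f b) (TApp g b)).
Proof.
move=> hf wb hd h; have := @peq_subst _ d (TApp (Var 0) b) _ _ _ hf h.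
rewrite /= !tsub_id; apply.
by apply: tm_in_tapp hd => //; apply: tm_in_var.
Qed.

Lemma peq_beta a b t u : wf_ty (cty c) a -> tm_in (c ▷ a) t b -> lcount 0 t == 1 -> tm_in c u a ->
  pv c H (PEq b (App (Lam a t) u) (esub TVar (scons u Var) t)).
Proof.
move=> wa ht h hu; apply: prv_eqI; apply: eeq_beta.
by apply: (@tm_in_app _ a) => //; apply: tm_in_lam.
Qed.

Lemma peq_tbeta a d b t : wf_ty (cty c) a -> tm_in (c ▷□) t b -> tapp b a = d ->
  pv c H (PEq d (TApp (TLam t) a) (esub (scons a TVar) Var t)).
Proof.
move=> wa ht h; apply: prv_eqI; apply: eeq_tbeta.
by apply: tm_in_tapp h => //; apply: tm_in_tlam.
Qed.

Lemma tm_in_ILam a b t : wf_ty (cty c) a -> tm_in (c ▷ a) t b -> tm_in c (ILam a t) (TArr a b).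
Proof.
move=> wa ht; apply: tm_in_lam => //=; last by rewrite lcount_eren0 // => -[].
apply: (@tm_in_letb _ a); first exact: tm_in_var.
rewrite -(tren_id b); apply: (tm_in_ren ht) => //.
by move=> -[|i] b0 /=; rewrite tren_id.
Qed.

Lemma peq_ibeta a b t u : wf_ty (cty c) a -> tm_in (c ▷ a) t b -> tm_in c u a ->
  pv c H (PEq b (App (ILam a t) (Bang u)) (esub TVar (scons u Var) t)).
Proof.
move=> wa ht hu; have hI := tm_in_ILam wa ht.
have e : tm_in c (App (ILam a t) (Bang u)) b.
  by apply: tm_in_app hI _; apply: tm_in_bang.
set v := esub _ _ _.
have E1 : esub TVar (scons (Bang u) Var) (LetB (Var 0) (eren id (upr S) t)) =
  LetB (Bang u) (eshift 0 0 t).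
  rewrite /= esub_eren /eshift eren_as_esub; congr (LetB _ (esub _ _ _)).
  by fext => -[|i].
have E2 : eshift 0 0 t = t by exact: eren_id.
apply: (@peq_trans _ (LetB (Bang u) t)) => //.
  by apply: prv_eqI; have := eeq_beta e; rewrite E1 E2.
apply: prv_eqI; apply: eeq_betaB; apply: (@tm_in_letb _ a) => //.
exact: tm_in_bang.
Qed.

Lemma peq_funext a b f g : wf_ty (cty c) a -> tm_in c f (TLol a b) -> tm_in c g (TLol a b) ->
  pv (c ▷ a) (wkH (BTm a) H) (PEq b (App (eshift 0 1 f) (Var 0)) (App (eshift 0 1 g) (Var 0))) ->
  pv c H (PEq (TLol a b) f g).
Proof.
move=> wa hf hg h; apply: prv_impE; first by apply: prv_ax; apply: ps_ext; apply: ext_lol hf hg.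
exact: prv_allI.
Qed.

Lemma peq_tfunext a f g : tm_in c f (TPi a) -> tm_in c g (TPi a) ->
  pv (c ▷□) (wkH BTy H) (PEq a (TApp (eshift 1 0 f) (TVar 0)) (TApp (eshift 1 0 g) (TVar 0))) ->
  pv c H (PEq (TPi a) f g).
Proof.
move=> hf hg h; apply: prv_impE; first by apply: prv_ax; apply: ps_ext; apply: ext_pi hf hg.
exact: prv_allI.
Qed.

Lemma peq_Y a f : wf_ty (cty c) a -> tm_in c f (TArr a a) ->
  pv c H (PEq a (App f (Bang (App (TApp YC a) (Bang f)))) (App (TApp YC a) (Bang f))).
Proof.
move=> wa hf; apply: prv_eqI; apply: eeq_Y => //.
by rewrite /intu; elim: (ctm c).
Qed.

End Basic.

(** * The relational interpretation *)

(** The graph is the reindexing of equality along [h] on the left and the identity on the right. The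
    identity is kept as an explicit application because this is literally the shape that
    [adm_reindex] produces. *)
Definition graph (a b : ty) (h : tm) : drel :=
  RComp a b (PRel (rel_eq b) (App (eshift 0 2 h) (Var 1)) (App (idtm b) (Var 0))).

(* The only relations at which parametricity is instantiated. *)
Inductive srel (c : ctx) : drel -> ty -> ty -> Prop :=
| srel_var i a b : onth (crel c) i = Some (true, a, b) -> srel c (RVar i) a b
| srel_eq a : wf_ty (cty c) a -> srel c (rel_eq a) a a
| srel_graph a b h : wf_ty (cty c) a -> wf_ty (cty c) b -> tm_in c h (TLol a b) ->
    srel c (graph a b h) a b.

Inductive srels (c : ctx) : seq drel -> seq ty -> seq ty -> Prop :=
| srels_nil : srels c [::] [::] [::]
| srels_cons r rs a l a' l' :
    wf_ty (cty c) a -> wf_ty (cty c) a' -> srel c r a a' -> srels c rs l l' ->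
    srels c (r :: rs) (a :: l) (a' :: l').

Definition ok_ren (c c' : ctx) (r : renaming) : Prop :=
  [/\ forall i, i < cty c -> rn_ty r i < cty c',
      forall i b, onth (ctm c) i = Some b -> onth (ctm c') (rn_tm r i) = Some (tren (rn_ty r) b) &
      forall i k a b, onth (crel c) i = Some (k, a, b) ->
        onth (crel c') (rn_rel r i) = Some (k, tren (rn_ty r) a, tren (rn_ty r) b)].

Definition idr : renaming := Ren id id id.

Lemma ok_id c : ok_ren c c idr.
Proof. by split => //= *; rewrite !tren_id. Qed.

Lemma ok_wk c c' b r : ok_ren c c' r -> ok_ren c (ext c' b) (rcomp (wkb b) r).
Proof.
case=> h1 h2 h3; case: b => [|d|k d e]; split => //=.
- by move=> i b /h2 h; rewrite (onth_omap _ h) tren_tren.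
- by move=> i k a b /h3 h; rewrite onth_map h /= !tren_tren.
Qed.

Lemma rren_graph r a b h :
  rren r (graph a b h) = graph (tren (rn_ty r) a) (tren (rn_ty r) b) (eren (rn_ty r) (rn_tm r) h).
Proof. by rewrite /graph /= /eshift !eren_eren. Qed.

Lemma rren_eq r a : rren r (rel_eq a) = rel_eq (tren (rn_ty r) a).
Proof. by []. Qed.

Lemma srel_ren c c' r q a b : ok_ren c c' r -> srel c q a b ->
  srel c' (rren r q) (tren (rn_ty r) a) (tren (rn_ty r) b).
Proof.
case=> h1 h2 h3; case=> {q a b}.
- by move=> i a b /h3 h; constructor.
- by move=> a wa; rewrite rren_eq; constructor; apply: wf_tren wa.
- move=> a b h wa wb hh; rewrite rren_graph; constructor.
  + exact: wf_tren wa.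
  + exact: wf_tren wb.
  + exact: (tm_in_ren hh).
Qed.

Lemma srels_ren c c' r rs l l' : ok_ren c c' r -> srels c rs l l' ->
  srels c' (map (rren r) rs) (map (tren (rn_ty r)) l) (map (tren (rn_ty r)) l').
Proof.
move=> h; elim=> /= [|q rs' a l0 a' l0' wa wa' hq _ IH]; constructor => //.
- by case: h => h _ _; apply: wf_tren wa.
- by case: h => h _ _; apply: wf_tren wa'.
- exact: srel_ren hq.
Qed.

Lemma tm_in_id c a : wf_ty (cty c) a -> tm_in c (idtm a) (TLol a a).
Proof. by move=> wa; apply: tm_in_lam => //; apply: tm_in_var. Qed.

Lemma srel_adm c r a b : srel c r a b -> admr c r a b.
Proof.
case=> {r a b}.
- by move=> i a b h; constructor.
- by move=> a wa; constructor.
- move=> a b h wa wb hh.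
  have := @adm_reindex parametric_schemes c (rel_eq b) b a b b h (idtm b).
  rewrite /= /eshift /= /rel_eq tren0; apply => //; first exact: adm_eq.
  exact: tm_in_id.
Qed.

Lemma wfr_eq c a : wf_ty (cty c) a -> wfr c (rel_eq a) a a.
Proof. by move=> wa; do 2 constructor => //; apply: tm_in_var. Qed.

Lemma srel_wfr c r a b : srel c r a b -> wfr c r a b.
Proof.
case=> {r a b}.
- by move=> i a b h; apply: wr_var h.
- exact: wfr_eq.
- move=> a b h wa wb hh; constructor => //; apply: (@wf_rel_app _ _ _ b b).
  + exact: wfr_eq.
  + apply: (@tm_in_app _ a); last by apply: tm_in_var.
    have -> : eshift 0 2 h = eshift 0 1 (eshift 0 1 h) by rewrite /eshift eren_eren.
    by do 2 apply: tm_in_wk.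
  + by apply: (@tm_in_app _ b); [apply: tm_in_id | apply: tm_in_var].
Qed.

Lemma srels_adms c rs l l' : srels c rs l l' -> admrs c rs l l'.
Proof. by elim=> [|r rs' a l0 a' l0' wa wa' hr _ IH]; constructor => //; apply: srel_adm. Qed.

Lemma srels_size c rs l l' : srels c rs l l' -> size l = size rs /\ size l' = size rs.
Proof. by elim=> //= r rs' a l0 a' l0' _ _ _ _ [-> ->]. Qed.

Lemma srels_wf c rs l l' : srels c rs l l' ->
  all (wf_ty (cty c)) l /\ all (wf_ty (cty c)) l'.
Proof. by elim=> //= r rs' a l0 a' l0' -> -> _ _ [-> ->]. Qed.

Lemma wf_tapps n s l : wf_ty (size l) s -> all (wf_ty n) l -> wf_ty n (tapps s l).
Proof. by move=> ws wl; apply: wf_tsub ws => i hi; move/(all_nthP TOne): wl; apply. Qed.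

Lemma tapps_map s l f : wf_ty (size l) s -> tapps s (map (tren f) l) = tren f (tapps s l).
Proof.
move=> ws; rewrite /tapps tren_tsub; apply: eq_tsub ws _ => i hi /=.
by rewrite (nth_map TOne).
Qed.

Lemma tapps_pi a l A : tapp (tsub (upt (nth TOne l)) a) A = tapps a (A :: l).
Proof.
rewrite /tapp /tapps tsub_tsub; congr tsub; fext => -[|i] //=.
exact: tsub_inst_wk.
Qed.

Lemma wfr_ty c s rs l l' : wf_ty (size rs) s -> srels c rs l l' ->
  wfr c (RTy s rs) (tapps s l) (tapps s l').
Proof. by move=> ws h; apply: wr_ty ws _; apply: srels_adms. Qed.

Lemma wfr_ty_ren c c' r s rs l l' : ok_ren c c' r -> wf_ty (size rs) s -> srels c rs l l' ->
  wfr c' (RTy s (map (rren r) rs)) (tren (rn_ty r) (tapps s l)) (tren (rn_ty r) (tapps s l')).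
Proof.
move=> h ws hs; have [s1 s2] := srels_size hs.
rewrite -tapps_map ?s1 // -tapps_map ?s2 //.
by apply: wfr_ty; [rewrite size_map | apply: (srels_ren h hs)].
Qed.

Section TyClause.
Variables (c : ctx) (H : seq prop) (s : ty) (rs : seq drel) (l l' : seq ty) (t u : tm).
Hypotheses (ws : wf_ty (size rs) s) (hrs : srels c rs l l').
Hypotheses (ht : tm_in c t (tapps s l)) (hu : tm_in c u (tapps s l')).

Lemma ty_clauseE : pv c H (PRel (RTy s rs) t u) -> pv c H (PRel (ty_clause s rs l l') t u).
Proof. by apply: prv_impE; apply: prv_andE1; apply: prv_ty => //; apply: srels_adms. Qed.

Lemma ty_clauseI : pv c H (PRel (ty_clause s rs l l') t u) -> pv c H (PRel (RTy s rs) t u).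
Proof. by apply: prv_impE; apply: prv_andE2; apply: prv_ty => //; apply: srels_adms. Qed.
End TyClause.

Lemma pv_eq c H p q : pv c H p -> p = q -> pv c H q.
Proof. by move=> h <-. Qed.

Lemma pv_all_relE c H p A B r :
  pv c H (PAll BTy (PAll BTy (PAll (BRel true (TVar 1) (TVar 0)) p))) ->
  wf_ty (cty c) A -> wf_ty (cty c) B -> srel c r A B ->
  pv c H (psub (Sub (scons B (scons A TVar)) Var (scons r RVar)) p).
Proof.
move=> h wA wB hr.
move: (prv_allE h (io_ty _ wA)) => /= {}h.
move: (prv_allE h (io_ty _ wB)); rewrite /= tsub_tren tsub_id => {}h.
move: (prv_allE h (io_adm (srel_adm hr))); rewrite !psub_psub => {}h.
apply: (pv_eq h); congr psub; rewrite /scomp /=; congr Sub; fext.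
- by move=> [|[|i]] //=; rewrite ?tsub_id ?tsub_tren ?tsub_id.
- by move=> [|i].
Qed.

Lemma pv_all_tmE c H a b p x y :
  pv c H (PAll (BTm a) (PAll (BTm b) p)) -> tm_in c x a -> tm_in c y b ->
  pv c H (psub (sub2 x y) p).
Proof.
move=> h hx hy.
move: (prv_allE h (io_tm _ hx)); rewrite /= tsub_id => {}h.
move: (prv_allE h (io_tm _ hy)); rewrite !psub_psub => {}h.
apply: (pv_eq h); congr psub; rewrite /scomp /sub2 /=; congr Sub; fext.
by move=> [|[|i]] //=; rewrite esub_inst_wk.
Qed.

Lemma tsub_ext s s' a : s =1 s' -> tsub s a = tsub s' a.
Proof. by move=> h; congr tsub; fext. Qed.

Lemma esub_ext st st' se se' t : st =1 st' -> se =1 se' -> esub st se t = esub st' se' t.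
Proof. by move=> h h'; congr esub; fext. Qed.

Lemma rsub_ext s s' r : sb_ty s =1 sb_ty s' -> sb_tm s =1 sb_tm s' -> sb_rel s =1 sb_rel s' ->
  rsub s r = rsub s' r.
Proof. by case: s s' => a b d [a' b' d'] /= h1 h2 h3; congr (rsub (Sub _ _ _)); fext. Qed.

(** Pointwise comparison of two substitutions: the index is split until both sides compute. This
    stops after as many cases as there are variables treated individually, since beyond them both
    sides are the same shift. *)
Ltac ncases := first [by [] | let i := fresh "i" in case=> [|i] //=; move: i; ncases].

Ltac tleaf :=
  rewrite ?tren_as_tsub ?tsub_tsub;
  lazymatch goal with
  | |- _ = TLol _ _ => congr TLol; tleaf
  | |- _ = TTens _ _ => congr TTens; tleaf
  | |- _ = TBang _ => congr TBang; tleaf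
  | |- tsub _ ?a = tsub _ ?a => apply: tsub_ext; ncases
  | |- tsub _ ?a = ?a => rewrite -[RHS]tsub_id; apply: tsub_ext; ncases
  | |- ?a = tsub _ ?a => rewrite -[LHS]tsub_id; apply: tsub_ext; ncases
  | _ => by []
  end.

Ltac eleaf :=
  rewrite /eshift ?eren_as_esub ?esub_esub;
  lazymatch goal with
  | |- esub _ _ ?a = esub _ _ ?a => apply: esub_ext; ncases
  | |- esub _ _ ?a = ?a => rewrite -[RHS]esub_id; apply: esub_ext; ncases
  | |- ?a = esub _ _ ?a => rewrite -[LHS]esub_id; apply: esub_ext; ncases
  | _ => by []
  end.

Ltac rleaf :=
  rewrite ?rren_as_rsub ?rsub_rsub;
  lazymatch goal with
  | |- rsub _ ?a = rsub _ ?a => apply: rsub_ext; ncases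
  | |- rsub _ ?a = ?a => rewrite -[RHS]rsub_id; apply: rsub_ext; ncases
  | |- ?a = rsub _ ?a => rewrite -[LHS]rsub_id; apply: rsub_ext; ncases
  | _ => by []
  end.

Ltac rsleaf :=
  rewrite -?map_comp;
  lazymatch goal with
  | |- map _ ?a = map _ ?a => apply: eq_map => ? /=; rleaf
  | |- map _ ?a = ?a => rewrite -[RHS]map_id; apply: eq_map => ? /=; rleaf
  | _ => by []
  end.

(* Descends to the leaves of an equation between instances of a common term, fuses all
   substitutions there into one on each side, and compares these pointwise. *)
Ltac sub_cong :=
  lazymatch goal with
  | |- @eq prop ?p ?q =>
    lazymatch q with
    | PEq _ _ _ => congr PEq; sub_cong
    | PRel _ _ _ => congr PRel; sub_cong
    | PImp _ _ => congr PImp; sub_cong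
    | PAll _ _ => congr PAll; sub_cong
    | _ => by []
    end
  | |- @eq bndr _ _ => first [by [] | congr BTm; tleaf | congr BRel; tleaf]
  | |- @eq ty _ _ => tleaf
  | |- @eq drel _ ?q =>
    lazymatch q with
    | RTy _ _ => congr RTy; sub_cong
    | RVar _ => by []
    | RComp _ _ _ => congr RComp; sub_cong
    | rel_lol _ _ _ _ _ _ => rewrite /rel_lol /=; congr RComp; sub_cong
    | _ => rleaf
    end
  | |- @eq (seq drel) _ (_ :: _) => congr cons; sub_cong
  | |- @eq (seq drel) _ _ => rsleaf
  | |- @eq tm _ ?q =>
    lazymatch q with
    | App _ _ => congr App; sub_cong
    | TApp _ _ => congr TApp; sub_cong
    | Bang _ => congr Bang; sub_cong
    | Tens _ _ => congr Tens; sub_cong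
    | LetT _ _ => congr LetT; sub_cong
    | LetB _ _ => congr LetB; sub_cong
    | Lam _ _ => congr Lam; sub_cong
    | TLam _ => congr TLam; sub_cong
    | Var _ => by []
    | _ => eleaf
    end
  end.

Ltac sub_eq := rewrite /= -/eren -/esub -/tren -/tsub; sub_cong.

Section RelRules.
Variables (c : ctx) (H : seq prop).

Lemma rel_eqE a t u : pv c H (PRel (rel_eq a) t u) -> pv c H (PEq a t u).
Proof. by move/prv_compE => /= h; apply: (pv_eq h); sub_eq. Qed.

Lemma rel_eqI a t u : wf_ty (cty c) a -> tm_in c t a -> tm_in c u a ->
  pv c H (PEq a t u) -> pv c H (PRel (rel_eq a) t u).
Proof.
move=> wa ht hu h; apply: prv_compI => //; first exact: wfr_eq.
by apply: (pv_eq h); sub_eq.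
Qed.

Lemma peq_id a t : wf_ty (cty c) a -> tm_in c t a -> pv c H (PEq a (App (idtm a) t) t).
Proof.
move=> wa ht; have := @peq_beta c H a a (Var 0) t wa; apply => //; exact: tm_in_var.
Qed.

Lemma rel_graphE a b h t u : wf_ty (cty c) b -> tm_in c h (TLol a b) -> tm_in c t a -> tm_in c u b ->
  pv c H (PRel (graph a b h) t u) -> pv c H (PEq b (App h t) u).
Proof.
move=> wb hh ht hu /prv_compE P.
have {P} : pv c H (PRel (rel_eq b) (App h t) (App (idtm b) u)).
  by apply: (pv_eq P); rewrite /= !tsub_id esub_eshift [esub _ _ h]esub_id.
move/rel_eqE => P; apply: (peq_trans _ P); first exact: tm_in_app hh ht.
exact: peq_id.
Qed.

Lemma rel_graphI a b h t u : wf_ty (cty c) a -> wf_ty (cty c) b -> tm_in c h (TLol a b) ->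
  tm_in c t a -> tm_in c u b ->
  pv c H (PEq b (App h t) u) -> pv c H (PRel (graph a b h) t u).
Proof.
move=> wa wb hh ht hu P; apply: prv_compI => //.
  by apply: srel_wfr; constructor.
have : pv c H (PRel (rel_eq b) (App h t) (App (idtm b) u)).
  have hi := tm_in_id wb.
  apply: rel_eqI => //; [exact: tm_in_app hh ht | exact: tm_in_app hi hu |].
  apply: (peq_trans _ P); first exact: tm_in_app hh ht.
  by apply: peq_sym; [exact: tm_in_app hi hu | exact: peq_id].
move=> {}P; apply: (pv_eq P).
by rewrite /= !tsub_id esub_eshift [esub _ _ h]esub_id.
Qed.

Lemma rel_varE i rs l l' t u : i < size rs -> srels c rs l l' ->
  tm_in c t (nth TOne l i) -> tm_in c u (nth TOne l' i) ->
  pv c H (PRel (RTy (TVar i) rs) t u) -> pv c H (PRel (nth (RVar 0) rs i) t u).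
Proof. by move=> hi hrs ht hu; exact: (@ty_clauseE c H (TVar i) rs l l' t u hi hrs ht hu). Qed.

Lemma rel_varI i rs l l' t u : i < size rs -> srels c rs l l' ->
  tm_in c t (nth TOne l i) -> tm_in c u (nth TOne l' i) ->
  pv c H (PRel (nth (RVar 0) rs i) t u) -> pv c H (PRel (RTy (TVar i) rs) t u).
Proof. by move=> hi hrs ht hu; exact: (@ty_clauseI c H (TVar i) rs l l' t u hi hrs ht hu). Qed.

Lemma rel_piE a rs l l' t u r A B : wf_ty (size rs).+1 a -> srels c rs l l' ->
  tm_in c t (tapps (TPi a) l) -> tm_in c u (tapps (TPi a) l') ->
  wf_ty (cty c) A -> wf_ty (cty c) B -> srel c r A B ->
  pv c H (PRel (RTy (TPi a) rs) t u) -> pv c H (PRel (RTy a (r :: rs)) (TApp t A) (TApp u B)).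
Proof.
move=> wa hrs ht hu wA wB hr /(@ty_clauseE _ _ (TPi a) _ _ _ _ _ wa hrs ht hu) /prv_compE h.
move: (pv_all_relE h wA wB hr) => {}h; apply: (pv_eq h).
by sub_eq.
Qed.

Lemma rel_lolE_gen a a' b b' r q f g x y : tm_in c x a -> tm_in c y a' ->
  pv c H (PRel (rel_lol a a' b b' r q) f g) -> pv c H (PRel r x y) ->
  pv c H (PRel q (App f x) (App g y)).
Proof.
move=> hx hy /prv_compE /= P; rewrite !tsub_id in P.
have Q := pv_all_tmE P hx hy; apply: prv_impE.
by apply: (pv_eq Q); sub_eq.
Qed.

End RelRules.

(** Weakenings by up to nine declarations. A composite of single weakenings is convertible to the
    corresponding [wk k m l], so the proof terms can be given directly. *)
Ltac okr :=
  first [ exact (ok_id _)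
        | exact (ok_wk _ (ok_id _))
        | exact (ok_wk _ (ok_wk _ (ok_id _)))
        | exact (ok_wk _ (ok_wk _ (ok_wk _ (ok_id _))))
        | exact (ok_wk _ (ok_wk _ (ok_wk _ (ok_wk _ (ok_id _)))))
        | exact (ok_wk _ (ok_wk _ (ok_wk _ (ok_wk _ (ok_wk _ (ok_id _))))))
        | exact (ok_wk _ (ok_wk _ (ok_wk _ (ok_wk _ (ok_wk _ (ok_wk _ (ok_id _)))))))
        | exact (ok_wk _ (ok_wk _ (ok_wk _ (ok_wk _ (ok_wk _ (ok_wk _ (ok_wk _ (ok_id _))))))))
        | exact (ok_wk _ (ok_wk _ (ok_wk _ (ok_wk _ (ok_wk _ (ok_wk _ (ok_wk _ (ok_wk _ (ok_id _)))))))))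
        | exact (ok_wk _ (ok_wk _ (ok_wk _
          (ok_wk _ (ok_wk _ (ok_wk _ (ok_wk _ (ok_wk _ (ok_wk _ (ok_id _)))))))))) ].

Lemma tm_in_okr c c' r t a : ok_ren c c' r -> tm_in c t a ->
  tm_in c' (eren (rn_ty r) (rn_tm r) t) (tren (rn_ty r) a).
Proof. by case=> h1 h2 h3 h; apply: tm_in_ren h h1 h2. Qed.

Lemma wf_okr c c' r a : ok_ren c c' r -> wf_ty (cty c) a -> wf_ty (cty c') (tren (rn_ty r) a).
Proof. by case=> h1 _ _; apply: wf_tren. Qed.

Section RelLol.
Variables (c : ctx) (a a' b b' : ty) (r q : drel).
Hypotheses (wa : wf_ty (cty c) a) (wa' : wf_ty (cty c) a').
Hypotheses (wb : wf_ty (cty c) b) (wb' : wf_ty (cty c) b').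

Let c4 := c ▷ TLol a b ▷ TLol a' b' ▷ a ▷ a'.

Lemma wfr_lol : wfr c4 (rren (wk 0 4 0) r) a a' -> wfr c4 (rren (wk 0 4 0) q) b b' ->
  wfr c (rel_lol a a' b b' r q) (TLol a b) (TLol a' b').
Proof.
move=> hr hq; constructor; rewrite /= ?wa ?wa' //.
do 2 constructor => //; constructor.
  by apply: (wf_rel_app hr); apply: tm_in_var.
apply: (wf_rel_app hq).
  by apply: (@tm_in_app _ a); apply: tm_in_var.
by apply: (@tm_in_app _ a'); apply: tm_in_var.
Qed.

Lemma rel_lolI_gen H f g : wfr c (rel_lol a a' b b' r q) (TLol a b) (TLol a' b') ->
  wfr (c ▷ a ▷ a') (rren (wk 0 2 0) r) a a' ->
  tm_in c f (TLol a b) -> tm_in c g (TLol a' b') ->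
  pv (c ▷ a ▷ a') (PRel (rren (wk 0 2 0) r) (Var 1) (Var 0) :: wkH (BTm a') (wkH (BTm a) H))
     (PRel (rren (wk 0 2 0) q) (App (eshift 0 2 f) (Var 1)) (App (eshift 0 2 g) (Var 0))) ->
  pv c H (PRel (rel_lol a a' b b' r q) f g).
Proof.
move=> hw hr hf hg P; apply: prv_compI => //.
(* The body of the comprehension with [f] and [g] already inserted, in a form to which the
   introduction rules apply; [sub_eq] then identifies it with the literal substitution instance. The
   other introduction rules follow the same pattern. *)
have : pv c H (PAll (BTm a) (PAll (BTm a') (PImp (PRel (rren (wk 0 2 0) r) (Var 1) (Var 0))
   (PRel (rren (wk 0 2 0) q) (App (eshift 0 2 f) (Var 1)) (App (eshift 0 2 g) (Var 0)))))).
  do 2 apply: prv_allI => //; apply: prv_impI => //.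
  by apply: (wf_rel_app hr); apply: tm_in_var.
by move=> Q; apply: (pv_eq Q); sub_eq.
Qed.
End RelLol.

Lemma wf_tapps_srels c s rs l l' : wf_ty (size rs) s -> srels c rs l l' ->
  wf_ty (cty c) (tapps s l) /\ wf_ty (cty c) (tapps s l').
Proof.
move=> ws h; have [s1 s2] := srels_size h; have [h1 h2] := srels_wf h.
by split; apply: wf_tapps; rewrite ?s1 ?s2.
Qed.

Section RelTy.
Variables (c : ctx) (H : seq prop) (a b : ty) (rs : seq drel) (l l' : seq ty).
Hypotheses (wa : wf_ty (size rs) a) (wb : wf_ty (size rs) b).
Hypothesis hrs : srels c rs l l'.

Lemma rel_lolE f g x y :
  tm_in c f (tapps (TLol a b) l) -> tm_in c g (tapps (TLol a b) l') ->
  tm_in c x (tapps a l) -> tm_in c y (tapps a l') ->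
  pv c H (PRel (RTy (TLol a b) rs) f g) -> pv c H (PRel (RTy a rs) x y) ->
  pv c H (PRel (RTy b rs) (App f x) (App g y)).
Proof.
move=> hf hg hx hy P; have wab : wf_ty (size rs) (TLol a b) by rewrite /= wa.
by move: P => /(ty_clauseE wab hrs hf hg) P; apply: rel_lolE_gen P.
Qed.

Lemma wfr_ty_wk0 c' r : ok_ren c c' r -> rn_ty r = addn 0 ->
  wfr c' (rren r (RTy a rs)) (tapps a l) (tapps a l').
Proof. by move=> h e; have := wfr_ty_ren h wa hrs; rewrite e tren0. Qed.
End RelTy.

Lemma rel_lolI c H a b rs l l' f g : wf_ty (size rs) a -> wf_ty (size rs) b -> srels c rs l l' ->
  tm_in c f (tapps (TLol a b) l) -> tm_in c g (tapps (TLol a b) l') ->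
  pv (c ▷ tapps a l ▷ tapps a l')
    (PRel (RTy a (map (rren (wk 0 2 0)) rs)) (Var 1) (Var 0) ::
      wkH (BTm (tapps a l')) (wkH (BTm (tapps a l)) H))
    (PRel (RTy b (map (rren (wk 0 2 0)) rs)) (App (eshift 0 2 f) (Var 1)) (App (eshift 0 2 g) (Var 0))) ->
  pv c H (PRel (RTy (TLol a b) rs) f g).
Proof.
move=> wa wb hrs hf hg P.
have [w1 w2] := wf_tapps_srels wa hrs; have [w3 w4] := wf_tapps_srels wb hrs.
have wab : wf_ty (size rs) (TLol a b) by rewrite /= wa.
apply: (ty_clauseI wab hrs hf hg); apply: rel_lolI_gen => //.
  by apply: wfr_lol => //; apply: (wfr_ty_wk0 _ hrs) => //; okr.
by apply: (wfr_ty_wk0 _ hrs) => //; okr.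
Qed.

Lemma rel_piI c H a rs l l' t u : wf_ty (size rs).+1 a -> srels c rs l l' ->
  tm_in c t (tapps (TPi a) l) -> tm_in c u (tapps (TPi a) l') ->
  pv (ext (c ▷□ ▷□) (BRel true (TVar 1) (TVar 0)))
     (wkH (BRel true (TVar 1) (TVar 0)) (wkH BTy (wkH BTy H)))
    (PRel (RTy a (RVar 0 :: map (rren (wk 2 0 1)) rs)) (TApp (eshift 2 0 t) (TVar 1))
       (TApp (eshift 2 0 u) (TVar 0))) ->
  pv c H (PRel (RTy (TPi a) rs) t u).
Proof.
move=> wa hrs ht hu P.
have [w1 w2] := @wf_tapps_srels c (TPi a) _ _ _ wa hrs.
apply: (@ty_clauseI _ _ (TPi a) _ _ _ _ _ wa hrs ht hu); apply: prv_compI => //.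
  constructor => //; do 3 constructor => //.
  set c5 := ext _ _.
  have hc5 : ok_ren c c5 (wk 2 2 1) by rewrite /c5; okr.
  have h5 := srels_ren hc5 hrs.
  have [s1 s2] := srels_size hrs.
  have h6 : srels c5 (RVar 0 :: map (rren (wk 2 2 1)) rs) (TVar 1 :: map (tren (addn 2)) l)
    (TVar 0 :: map (tren (addn 2)) l').
    by constructor => //; constructor.
  have h7 := @wfr_ty c5 a _ _ _ _ h6.
  apply: (wf_rel_app (h7 _)); rewrite /= ?size_map //.
    apply: (@tm_in_tapp _ (tsub (upt (nth TOne (map (tren (addn 2)) l))) a)) => //; last exact: tapps_pi.
    apply: tm_in_var; rewrite -[TPi _]/(tapps (TPi a) (map (tren (addn 2)) l)) tapps_map ?s1 //.
    by rewrite /= !tren_tren ?upr_comp.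
  apply: (@tm_in_tapp _ (tsub (upt (nth TOne (map (tren (addn 2)) l'))) a)) => //; last exact: tapps_pi.
  apply: tm_in_var; rewrite -[TPi _]/(tapps (TPi a) (map (tren (addn 2)) l')) tapps_map ?s2 //.
  by rewrite /= !tren_tren ?upr_comp.
have : pv c H (PAll BTy (PAll BTy (PAll (BRel true (TVar 1) (TVar 0))
  (PRel (RTy a (RVar 0 :: map (rren (wk 2 0 1)) rs)) (TApp (eshift 2 0 t) (TVar 1))
       (TApp (eshift 2 0 u) (TVar 0)))))) by do 3 apply: prv_allI => //.
by move=> Q; apply: (pv_eq Q); sub_eq.
Qed.

Ltac ctm_var := apply: tm_in_var; rewrite /= ?tren_tren ?upr_comp; exact: erefl.

Lemma pv_hyp1 c H p q : pv c (p :: q :: H) q.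
Proof. exact: (@prv_hyp _ _ _ 1). Qed.

Lemma rel_bangE_gen c H A A' q r B B' x x' f g :
  wf_ty (cty c) B -> wf_ty (cty c) B' -> srel c r B B' ->
  tm_in c f (TLol (TBang A) B) -> tm_in c g (TLol (TBang A') B') ->
  pv c H (PRel (rel_bang A A' q) x x') ->
  pv c H (PAll (BTm A) (PAll (BTm A') (PImp (PRel (rren (wk 0 2 0) q) (Var 1) (Var 0))
    (PRel (rren (wk 0 2 0) r) (App (eshift 0 2 f) (Bang (Var 1))) (App (eshift 0 2 g) (Bang (Var 0))))))) ->
  pv c H (PRel r (App f x) (App g x')).
Proof.
move=> wB wB' hr hf hg /prv_compE P.
move: (pv_all_relE P wB wB' hr) => {}P.
have {}P : pv c H (PAll (BTm (TLol (TBang A) B)) (PAll (BTm (TLol (TBang A') B'))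
  (PImp (PAll (BTm A) (PAll (BTm A') (PImp (PRel (rren (wk 0 4 0) q) (Var 1) (Var 0))
    (PRel (rren (wk 0 4 0) r) (App (Var 3) (Bang (Var 1))) (App (Var 2) (Bang (Var 0)))))))
    (PRel (rren (wk 0 2 0) r) (App (Var 1) (eshift 0 2 x)) (App (Var 0) (eshift 0 2 x')))))).
  by apply: (pv_eq P); sub_eq.
have {}P := pv_all_tmE P hf hg.
by apply: prv_impE; apply: (pv_eq P); sub_eq.
Qed.

Section RelBang.
Variables (c : ctx) (a : ty) (rs : seq drel) (l l' : seq ty).
Hypotheses (wa : wf_ty (size rs) a) (hrs : srels c rs l l').

Local Notation A := (tapps a l).
Local Notation A' := (tapps a l').

Lemma wfr_bang : wfr c (rel_bang A A' (RTy a rs)) (TBang A) (TBang A').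
Proof.
have [wA wA'] := wf_tapps_srels wa hrs.
have w k b : wf_ty k b -> wf_ty k.+2 (tren (addn 2) b) by apply: wf_tren.
apply: wr_comp => //; do 5 (apply: wf_all; first by rewrite /= ?w).
set c7 := ext _ _.
have h9 : ok_ren c (c7 ▷ tren (addn 2) A ▷ tren (addn 2) A') (wk 2 6 1) by rewrite /c7; okr.
have h7 := wfr_ty_ren h9 wa hrs.
constructor.
  do 2 (apply: wf_all; first by rewrite /= ?w); constructor.
    apply: (wf_rel_app h7); ctm_var.
  apply: (@wf_rel_app _ _ _ (TVar 1) (TVar 0)); first exact: wr_var.
    by apply: (@tm_in_app _ (TBang (tren (addn 2) A))); [ctm_var | apply: tm_in_bang; ctm_var].
  by apply: (@tm_in_app _ (TBang (tren (addn 2) A'))); [ctm_var | apply: tm_in_bang; ctm_var].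
apply: (@wf_rel_app _ _ _ (TVar 1) (TVar 0)); first exact: wr_var.
  by apply: (@tm_in_app _ (TBang (tren (addn 2) A))); ctm_var.
by apply: (@tm_in_app _ (TBang (tren (addn 2) A'))); ctm_var.
Qed.

(** The clause for [!] quantifies over all admissible relations R and all f, g that send [!u] and
    [!u'] to R-related values for related u, u'. Its premise, instantiated at the given pair, is
    already the conclusion. *)
Lemma rel_bangI H x x' : tm_in c x A -> tm_in c x' A' ->
  pv c H (PRel (RTy a rs) x x') -> pv c H (PRel (RTy (TBang a) rs) (Bang x) (Bang x')).
Proof.
move=> hx hx' P; have wa' : wf_ty (size rs) (TBang a) := wa.
apply: (ty_clauseI wa' hrs); try exact: tm_in_bang.
have w k b : wf_ty k b -> wf_ty k.+2 (tren (addn 2) b) by apply: wf_tren.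
have [wA wA'] := wf_tapps_srels wa hrs.
apply: prv_compI; [exact: wfr_bang | exact: tm_in_bang | exact: tm_in_bang |].
apply: (pv_cut _ P); first exact: (wf_rel_app (wfr_ty wa hrs)).
set H1 := _ :: H.
pose hy := PAll (BTm (tren (addn 2) A)) (PAll (BTm (tren (addn 2) A'))
          (PImp (PRel (RTy a (map (rren (wk 2 4 1)) rs)) (Var 1) (Var 0))
                  (PRel (RVar 0) (App (Var 3) (Bang (Var 1)))
                                 (App (Var 2) (Bang (Var 0)))))).
have : pv c H1 (PAll BTy (PAll BTy (PAll (BRel true (TVar 1) (TVar 0))
      (PAll (BTm (TLol (TBang (tren (addn 2) A)) (TVar 1)))
      (PAll (BTm (TLol (TBang (tren (addn 2) A')) (TVar 0)))
        (PImp hy (PRel (RVar 0) (App (Var 1) (Bang (eshift 2 2 x)))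
          (App (Var 0) (Bang (eshift 2 2 x')))))))))).
  do 5 (apply: prv_allI; first by rewrite /= ?w).
  set c5 := ext _ _.
  have h5 : ok_ren c c5 (wk 2 2 1). by rewrite /c5; okr.
  have h7 : ok_ren c (c5 ▷ tren (addn 2) A ▷ tren (addn 2) A') (wk 2 4 1). by rewrite /c5; okr.
  apply: prv_impI.
    rewrite /hy; do 2 (apply: wf_all; first by rewrite /= ?w); constructor.
      apply: (wf_rel_app (wfr_ty_ren h7 wa hrs)); ctm_var.
    apply: (@wf_rel_app _ _ _ (TVar 1) (TVar 0)); first exact: wr_var.
      by apply: (@tm_in_app _ (TBang (tren (addn 2) A))); [ctm_var | apply: tm_in_bang; ctm_var].
    by apply: (@tm_in_app _ (TBang (tren (addn 2) A'))); [ctm_var | apply: tm_in_bang; ctm_var].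
  set H5 := _ :: _.
  have P1 : pv c5 H5 hy by exact: pv_hyp0.
  have P2 := pv_all_tmE P1 (tm_in_okr h5 hx) (tm_in_okr h5 hx').
  have P3 : pv c5 H5 (PRel (RTy a (map (rren (wk 2 2 1)) rs)) (eshift 2 2 x) (eshift 2 2 x')).
    apply: pv_eq; first exact: pv_hyp1.
    by sub_eq.
  apply: prv_impE P3; apply: (pv_eq P2); sub_eq.
move=> Q; apply: (pv_eq Q); rewrite /hy; sub_eq.
Qed.

Lemma rel_bangE H r B B' x x' f g :
  wf_ty (cty c) B -> wf_ty (cty c) B' -> srel c r B B' ->
  tm_in c x (TBang A) -> tm_in c x' (TBang A') ->
  tm_in c f (TLol (TBang A) B) -> tm_in c g (TLol (TBang A') B') ->
  pv c H (PRel (RTy (TBang a) rs) x x') ->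
  pv (c ▷ A ▷ A')
    (PRel (RTy a (map (rren (wk 0 2 0)) rs)) (Var 1) (Var 0) :: wkH (BTm A') (wkH (BTm A) H))
    (PRel (rren (wk 0 2 0) r) (App (eshift 0 2 f) (Bang (Var 1))) (App (eshift 0 2 g) (Bang (Var 0)))) ->
  pv c H (PRel r (App f x) (App g x')).
Proof.
move=> wB wB' hr hx hx' hf hg P Q; have wa' : wf_ty (size rs) (TBang a) := wa.
have [wA wA'] := wf_tapps_srels wa hrs.
move: P => /(ty_clauseE wa' hrs hx hx') P.
apply: (rel_bangE_gen wB wB' hr hf hg P).
do 2 apply: prv_allI => //; apply: prv_impI => //.
have ok2 : ok_ren c (c ▷ A ▷ A') (wk 0 2 0) by okr.
by apply: (wf_rel_app (wfr_ty_wk0 wa hrs ok2 (erefl _))); ctm_var.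
Qed.
End RelBang.

(** The outermost quantifier binds the highest index, which belongs to the last element of [l];
    hence the induction from the end of the list. [st] records what the indices beyond [l] have been
    replaced by. *)
Lemma identity_extension_inst c H l p st :
  all (wf_ty (cty c)) l ->
  pv c H (psub (Sub st Var RVar) (iter (size l) (PAll BTy) p)) ->
  pv c H (psub (Sub (fun i => if i < size l then nth TOne l i else st (i - size l)) Var RVar) p).
Proof.
elim/last_ind: l st => [|l a IH] st wl.
  by move=> P; apply: (pv_eq P); congr (psub (Sub _ _ _)); fext => i /=; rewrite subn0.
rewrite all_rcons in wl; case/andP: wl => wa wl.
rewrite size_rcons iterS => /= P.
move: (prv_allE P (io_ty _ wa)); rewrite psub_psub.
have -> : scomp (sub1 (ITy a)) {| sb_ty := upt st; sb_tm := eshift 1 0 \o Var; sb_rel := fun i => RVar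
  (0 + i) |}
    = Sub (scons a st) Var RVar.
  rewrite /scomp /=; congr Sub; fext => -[|i] //=.
  by rewrite tsub_tren tsub_id.
move=> {}P; move: (IH _ wl P) => {}P; apply: (pv_eq P).
congr (psub (Sub _ _ _)); fext => i /=.
rewrite nth_rcons ltnS; case: (ltngtP i (size l)) => h //=.
  have -> : i - size l = (i - (size l).+1).+1 by lia.
  by [].
by rewrite h subnn.
Qed.

Lemma map_nth_iota (T : Type) (x0 : T) (l : seq T) : map (nth x0 l) (iota 0 (size l)) = l.
Proof. exact: (mkseq_nth x0 l). Qed.

Section IES.
Variables (c : ctx) (H : seq prop) (s : ty) (l : seq ty) (t u : tm).
Hypotheses (ws : wf_ty (size l) s) (wl : all (wf_ty (cty c)) l).
Hypotheses (ht : tm_in c t (tapps s l)) (hu : tm_in c u (tapps s l)).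

Lemma ies_iff : pv c H (PIff (PRel (RTy s (map rel_eq l)) t u) (PRel (rel_eq (tapps s l)) t u)).
Proof.
have P : pv c H (identity_extension (size l) s) by apply: prv_ax; apply: ps_ies.
rewrite /identity_extension -[iter _ _ _]psub_id in P.
have {}P := identity_extension_inst wl P.
set st := (fun i => _) in P.
have e : tsub st s = tapps s l by apply: eq_tsub ws _ => i hi; rewrite /st hi.
have {}P : pv c H (PAll (BTm (tapps s l)) (PAll (BTm (tapps s l))
   (PIff (PRel (RTy s (map rel_eq l)) (Var 1) (Var 0)) (PRel (rel_eq (tapps s l)) (Var 1) (Var 0))))).
  apply: (pv_eq P); rewrite /= -!e; do 2 congr PAll; congr PAnd; congr PImp; congr PRel => //.
  1,2: congr RTy; rewrite -map_comp -{2}(map_nth_iota TOne l) -map_comp; apply/eq_in_map => i.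
  1,2: by rewrite mem_iota /= /st => -> .
by move: (pv_all_tmE P ht hu) => {}P; apply: (pv_eq P); rewrite /= -map_comp /= /rel_eq tsub_id;
  do ! congr (PAnd _ _); do ! congr (PImp _ _); congr (PRel (RTy _ _)); apply: eq_map => i /=; rewrite
    tsub_id.
Qed.

(** Applied to reflexivity, this is parametricity of [t] with its parameters interpreted by
    equality: after that, the clause for the type of [t] can be opened and its quantified relations
    chosen. *)
Lemma iesI : pv c H (PEq (tapps s l) t u) -> pv c H (PRel (RTy s (map rel_eq l)) t u).
Proof.
move=> P; apply: prv_impE; first exact: prv_andE2 ies_iff.
by apply: rel_eqI => //; apply: wf_tapps.
Qed.
End IES.

Lemma srels_eq c l : all (wf_ty (cty c)) l -> srels c (map rel_eq l) l l.
Proof. by elim: l => /= [|a l IH]; [constructor | case/andP=> wa /IH h; constructor => //; constructor]. Qed.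

(** * Induction principles for [!] and tensor *)

(* Identity extension relates [x : !a] to itself; the clause for [!] instantiated at
   the equality on [d] is then exactly the induction principle. *)
Lemma bang_ind c H a d f g : wf_ty (cty c) a -> wf_ty (cty c) d ->
  tm_in c f (TLol (TBang a) d) -> tm_in c g (TLol (TBang a) d) ->
  pv (c ▷ a) (wkH (BTm a) H) (PEq d (App (eshift 0 1 f) (Bang (Var 0))) (App (eshift 0 1 g)
    (Bang (Var 0)))) ->
  pv c H (PEq (TLol (TBang a) d) f g).
Proof.
move=> wa wd hf hg P.
have ha : all (wf_ty (cty c)) [:: a] by rewrite /= wa.
pose q := PAll (BTm a) (PEq d (App (eshift 0 1 f) (Bang (Var 0))) (App (eshift 0 1 g) (Bang (Var 0)))).
have hb (h : tm) : tm_in c h (TLol (TBang a) d) -> tm_in (c ▷ a) (App (eshift 0 1 h) (Bang (Var 0))) d.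
  move=> hh; apply: (@tm_in_app _ (TBang a)); first exact: tm_in_wk.
  by apply: tm_in_bang; ctm_var.
apply: (@pv_cut _ _ q); first by constructor => //; constructor; apply: hb.
  exact: prv_allI.
apply: peq_funext => //.
set H1 := wkH _ _.
have R := @iesI (c ▷ TBang a) H1 (TBang (TVar 0)) [:: a] (Var 0) (Var 0).
have wd' : wf_ty (cty (c ▷ TBang a)) d by [].
have hv : tm_in (c ▷ TBang a) (Var 0) (TBang a) by ctm_var.
have {}R := R isT ha hv hv (peq_refl _ hv).
have hs1 : srels (c ▷ TBang a) [:: rel_eq a] [:: a] [:: a] by exact: (@srels_eq _ [:: a]).
have hd : srel (c ▷ TBang a) (rel_eq d) d d by constructor.
have hf1 : tm_in (c ▷ TBang a) (eshift 0 1 f) (TLol (TBang a) d) by exact: tm_in_wk.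
have hg1 : tm_in (c ▷ TBang a) (eshift 0 1 g) (TLol (TBang a) d) by exact: tm_in_wk.
apply: rel_eqE; apply: (@rel_bangE (c ▷ TBang a) (TVar 0) [:: rel_eq a] [:: a] [:: a] isT hs1 H1
  (rel_eq d) d d (Var 0) (Var 0) _ _ wd' wd' hd hv hv hf1 hg1 R).
change (tapps (TVar 0) [:: a]) with a; set H2 := (PRel _ _ _ :: _); set c3 := _ ▷ a ▷ a.
have h0 : tm_in c3 (Var 0) a by ctm_var.
have h1 : tm_in c3 (Var 1) a by ctm_var.
have E : pv c3 H2 (PEq a (Var 1) (Var 0)).
  apply: rel_eqE; have : pv c3 H2 (PRel (RTy (TVar 0) [:: rel_eq a]) (Var 1) (Var 0)).
    by apply: pv_eq; [exact: pv_hyp0|]; rewrite /= tren0.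
  exact: (@rel_varE c3 H2 0 [:: rel_eq a] [:: a] [:: a] _ _ isT (@srels_eq c3 [:: a] ha) h1 h0).
have hs (h : tm) : tm_in c h (TLol (TBang a) d) -> tm_in c3 (eshift 0 3 h) (TLol (TBang a) d).
  move=> hh; have -> : eshift 0 3 h = eshift 0 1 (eshift 0 1 (eshift 0 1 h)) by rewrite /eshift !eren_eren.
  by do 3 apply: tm_in_wk.
have hf3 := hs _ hf; have hg3 := hs _ hg.
have Q : pv c3 H2 (PEq d (App (eshift 0 3 f) (Bang (Var 1))) (App (eshift 0 3 g) (Bang (Var 1)))).
  have : pv c3 H2 (pren (wkb (BTm a)) (pren (wkb (BTm a)) (pren (wkb (BTm (TBang a))) q))) by apply: pv_hyp1.
  move=> Q; have {}Q : pv c3 H2 (PAll (BTm a) (PEq d (App (eshift 0 4 f) (Bang (Var 0)))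
    (App (eshift 0 4 g) (Bang (Var 0))))).
    by apply: (pv_eq Q); sub_eq.
  have {}Q := prv_allE Q (io_tm _ h1).
  by apply: (pv_eq Q); sub_eq.
have -> : rren (wk 0 2 0) (rel_eq d) = rel_eq d by rewrite rren_eq /= tren0.
have e h : eshift 0 2 (eshift 0 1 h) = eshift 0 3 h by rewrite /eshift eren_eren.
rewrite !e; apply: rel_eqI => //.
- by apply: tm_in_app hf3 _; apply: tm_in_bang.
- by apply: tm_in_app hg3 _; apply: tm_in_bang.
apply: (peq_trans _ Q); first by apply: tm_in_app hf3 _; apply: tm_in_bang.
by apply: peq_appr hg3 _ _; [apply: tm_in_bang | apply: peq_bang].
Qed.

Lemma csplit_intu G : csplit [seq (Many, a) | a <- G] [seq (Many, a) | a <- G] [seq (Many, a) | a <- G].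
Proof. by elim: G => //= [|a G IH]; constructor => //; constructor. Qed.

Lemma eeq_cast n C a t u u' : eeq n C t u a -> u = u' -> eeq n C t u' a.
Proof. by move=> h <-. Qed.

(** The clause for tensor speaks of curried continuations, whereas the induction principle is about
    maps out of the tensor; this converts one into the other. *)
Definition tcurry (a b : ty) (f : tm) : tm :=
  Lam a (Lam b (App (eshift 0 2 f) (Tens (Var 1) (Var 0)))).

Lemma tm_in_wk2 c a b f d : tm_in c f d -> tm_in (c ▷ a ▷ b) (eshift 0 2 f) d.
Proof.
by move=> h; have := tm_in_okr (r := wk 0 2 0) (c' := c ▷ a ▷ b) ltac:(okr) h; rewrite /= tren0.
Qed.

Lemma tm_in_wk3 c a b d f e : tm_in c f e -> tm_in (c ▷ a ▷ b ▷ d) (eshift 0 3 f) e.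
Proof.
by move=> h; have := tm_in_okr (r := wk 0 3 0) (c' := c ▷ a ▷ b ▷ d) ltac:(okr) h; rewrite /= tren0.
Qed.

Lemma tm_in_wk4 c a b d e f x : tm_in c f x -> tm_in (c ▷ a ▷ b ▷ d ▷ e) (eshift 0 4 f) x.
Proof.
by move=> h; have := tm_in_okr (r := wk 0 4 0) (c' := c ▷ a ▷ b ▷ d ▷ e) ltac:(okr) h; rewrite /= tren0.
Qed.

Section Curry.
Variables (c : ctx) (a b d : ty) (f : tm).
Hypotheses (wa : wf_ty (cty c) a) (wb : wf_ty (cty c) b).
Hypothesis hf : tm_in c f (TLol (TTens a b) d).

Lemma tm_in_tcurry : tm_in c (tcurry a b f) (TLol a (TLol b d)).
Proof.
apply: tm_in_lam; rewrite /= ?lcount_eshift //; apply: tm_in_lam; rewrite /= ?lcount_eshift //.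
apply: (@tm_in_app _ (TTens a b)); first exact: tm_in_wk2.
by apply: tm_in_tens; ctm_var.
Qed.

Lemma peq_tcurry H x y : tm_in c x a -> tm_in c y b ->
  pv c H (PEq d (App (App (tcurry a b f) x) y) (App f (Tens x y))).
Proof.
move=> hx hy.
have h1 : tm_in (c ▷ a) (Lam b (App (eshift 0 2 f) (Tens (Var 1) (Var 0)))) (TLol b d).
  apply: tm_in_lam; rewrite /= ?lcount_eshift //.
  apply: (@tm_in_app _ (TTens a b)); first exact: tm_in_wk2.
  by apply: tm_in_tens; ctm_var.
have l1 : lcount 0 (Lam b (App (eshift 0 2 f) (Tens (Var 1) (Var 0)))) == 1.
  by rewrite /= lcount_eshift.
have E1 := peq_beta H wa h1 l1 hx.
have h2 := tm_in_inst h1 hx.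
set F := esub _ _ _ in E1 h2.
have eF : F = Lam b (App (eshift 0 1 f) (Tens (eshift 0 1 x) (Var 0))).
  by rewrite /F /= tsub_id; congr (Lam _ (App _ _)); eleaf.
have hc := tm_in_tcurry.
apply: (@peq_trans _ _ _ (App F y)).
- exact: tm_in_app (tm_in_app hc hx) hy.
- exact: peq_appl (tm_in_app hc hx) hy E1.
rewrite eF.
have h3 : tm_in (c ▷ b) (App (eshift 0 1 f) (Tens (eshift 0 1 x) (Var 0))) d.
  apply: (@tm_in_app _ (TTens a b)); first exact: tm_in_wk.
  by apply: tm_in_tens; [exact: tm_in_wk | ctm_var].
have l3 : lcount 0 (App (eshift 0 1 f) (Tens (eshift 0 1 x) (Var 0))) == 1.
  by rewrite /= !lcount_eshift.
have := peq_beta H wb h3 l3 hy.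
by rewrite /= !esub_inst_wk.
Qed.

(** The [let] is moved into the argument position of [f] by a commuting conversion, after which the
    eta rule for tensor removes it. *)
Lemma peq_lett_tcurry H z : tm_in c z (TTens a b) ->
  pv c H (PEq d (LetT z (App (App (eshift 0 2 (tcurry a b f)) (Var 1)) (Var 0))) (App f z)).
Proof.
move=> hz; apply: prv_eqI; set C := intu c.
have hsp : csplit C C C by exact: csplit_intu.
move/tm_inE: (hf) => [sf lf]; move/tm_inE: (hz) => [sz lz].
have sf2 : sty (cty c) [:: b, a & ctm c] (eshift 0 2 f) (TLol (TTens a b) d).
  by have /tm_inE[] := tm_in_wk2 a b hf.
have sf3 : sty (cty c) [:: b, b, a & ctm c] (eshift 0 3 f) (TLol (TTens a b) d).
  by have /tm_inE[] := tm_in_wk3 a b b hf.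
have sf4 : sty (cty c) [:: b, a, b, a & ctm c] (eshift 0 4 f) (TLol (TTens a b) d).
  by have /tm_inE[] := tm_in_wk4 a b a b hf.
have lwf' k : lwf (eshift 0 k f) by rewrite /eshift lwf_eren.
have u2 : unzip2 C = ctm c by exact: unzip2_intu.
have e4 : eren (addn 0) (upr (upr (addn 2))) (eshift 0 2 f) = eshift 0 4 f.
  by rewrite /eshift eren_eren; apply: eq_trans (erefl _).
(* The body has two free linear variables, so its beta reductions are carried out in the external
   equality, with explicit splittings of the context. *)
have bodyE : eeq (cty c) [:: (One, b), (One, a) & C] (App (App (eshift 0 2 (tcurry a b f)) (Var 1)) (Var 0))
   (App (eshift 0 2 f) (Tens (Var 1) (Var 0))) d.
  have hs1 : csplit [:: (One, b), (One, a) & C] [:: (Zero, b), (One, a) & C] [:: (One, b), (Zero, a) & C].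
    by do 2 (constructor; first by constructor).
  apply: (@eeq_trans _ _ _ (App (Lam b (App (eshift 0 3 f) (Tens (Var 2) (Var 0)))) (Var 0))).
    apply: (eeq_app hs1 (a := b)); last first.
      by apply: eeq_refl; apply/has_typeE; split; [constructor | | rewrite /= cok_intu].
    have h : has_type (cty c) [:: (Zero, b), (One, a) & C] (App (eshift 0 2 (tcurry a b f)) (Var 1))
      (TLol b d).
      apply/has_typeE; split.
      - rewrite /= u2 /eshift /= !tren0; apply: (@sty_app _ _ a); last by constructor.
        constructor => //; constructor => //; apply: (@sty_app _ _ (TTens a b)); first by rewrite e4.
        by apply: (@sty_tens _ _ a b); constructor.
      - by rewrite /= e4 !lcount_eshift lwf'.
      - by rewrite /= e4 !lcount_eshift /= cok_intu.
    by apply: (eeq_cast (eeq_beta h)) => //; sub_eq.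
  have h : has_type (cty c) [:: (One, b), (One, a) & C]
    (App (Lam b (App (eshift 0 3 f) (Tens (Var 2) (Var 0)))) (Var 0)) d.
    apply/has_typeE; split.
    - rewrite /= u2; apply: (@sty_app _ _ b); last by constructor.
      constructor => //; apply: (@sty_app _ _ (TTens a b)) => //.
      by apply: (@sty_tens _ _ a b); constructor.
    - by rewrite /= lcount_eshift lwf'.
    - by rewrite /= !lcount_eshift cok_intu.
  have := eeq_beta h; rewrite /=.
  have -> : esub TVar (scons (Var 0) Var) (eshift 0 3 f) = eshift 0 2 f by eleaf.
  by [].
have hb2 : has_type (cty c) C (LetT z (App (eshift 0 2 f) (Tens (Var 1) (Var 0)))) d.
  apply: (@tm_in_lett c a b) => //; rewrite /= ?lcount_eshift //.
  apply: (@tm_in_app _ (TTens a b)); first exact: tm_in_wk2.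
  by apply: tm_in_tens; ctm_var.
apply: (@eeq_trans _ _ _ (LetT z (App (eshift 0 2 f) (Tens (Var 1) (Var 0))))).
  by apply: (eeq_lett hsp _ bodyE); apply: eeq_refl.
(* The linear context is [f] applied to the hole: let x, y be z in f (x, y) becomes f applied to let
   x, y be z in (x, y). *)
have := @eeq_commT _ _ (KAppR f KHole) _ (Tens (Var 1) (Var 0)) _ hb2.
rewrite /= [eshift 0 0 z]eren_id => h; apply: (eeq_trans h).
by apply: (eeq_app hsp); [apply: eeq_refl; exact: hf | apply: eeq_sym; apply: eeq_etaT].
Qed.
End Curry.

Lemma rel_tensE_gen c H A A' B B' q q' r D D' x x' f g :
  wf_ty (cty c) D -> wf_ty (cty c) D' -> srel c r D D' ->
  tm_in c f (TLol A (TLol B D)) -> tm_in c g (TLol A' (TLol B' D')) ->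
  pv c H (PRel (rel_tens A A' B B' q q') x x') ->
  pv c H (PRel (rel_lol A A' (TLol B D) (TLol B' D') q (rel_lol B B' D D' q' r)) f g) ->
  pv c H (PRel r (LetT x (App (App (eshift 0 2 f) (Var 1)) (Var 0)))
                 (LetT x' (App (App (eshift 0 2 g) (Var 1)) (Var 0)))).
Proof.
move=> wB wB' hr hf hg /prv_compE P.
move: (pv_all_relE P wB wB' hr) => {}P.
have {}P : pv c H (PAll (BTm (TLol A (TLol B D))) (PAll (BTm (TLol A' (TLol B' D')))
  (PImp (PRel (rel_lol A A' (TLol B D) (TLol B' D') (rren (wk 0 2 0) q) (rel_lol B B' D D'
    (rren (wk 0 2 0) q') (rren (wk 0 2 0) r))) (Var 1) (Var 0))
    (PRel (rren (wk 0 2 0) r) (LetT (eshift 0 2 x) (App (App (Var 3) (Var 1)) (Var 0)))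
                              (LetT (eshift 0 2 x') (App (App (Var 2) (Var 1)) (Var 0))))))).
  by apply: (pv_eq P); sub_eq.
have {}P := pv_all_tmE P hf hg.
by apply: prv_impE; apply: (pv_eq P); sub_eq.
Qed.

(** Each side is replaced by one use of [prv_eqE]. The predicate used there lives in a context with
    one more variable, which is why well-formedness of [r] is required after a weakening by an
    arbitrary type. *)
Lemma prel_conv c H a b r t t' u u' :
  (forall d, wfr (c ▷ d) (rren (wk 0 1 0) r) a b) ->
  tm_in c t a -> tm_in c t' a -> tm_in c u b -> tm_in c u' b ->
  pv c H (PEq a t t') -> pv c H (PEq b u u') ->
  pv c H (PRel r t u) -> pv c H (PRel r t' u').
Proof.
move=> hr ht ht' hu hu' E1 E2 P.
have {}P : pv c H (PRel r t' u).
  have := @prv_eqE _ c H a t t' (PRel (rren (wk 0 1 0) r) (Var 0) (eshift 0 1 u)).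
  rewrite /= !esub_inst_wk !rsub_rren.
  have e w : sren (sub1 (ITm w)) (wk 0 1 0) = sid by [].
  rewrite !e rsub_id; apply => //; apply: (wf_rel_app (hr a)); [ctm_var | exact: tm_in_wk].
have := @prv_eqE _ c H b u u' (PRel (rren (wk 0 1 0) r) (eshift 0 1 t') (Var 0)).
rewrite /= !esub_inst_wk !rsub_rren.
have e w : sren (sub1 (ITm w)) (wk 0 1 0) = sid by [].
rewrite !e rsub_id; apply => //; apply: (wf_rel_app (hr b)); [exact: tm_in_wk | ctm_var].
Qed.

Lemma rsub_lol s a a' b b' r q :
  rsub s (rel_lol a a' b b' r q) =
  rel_lol (tsub (sb_ty s) a) (tsub (sb_ty s) a') (tsub (sb_ty s) b) (tsub (sb_ty s) b') (rsub s r) (rsub s q).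
Proof.
rewrite /rel_lol /= -/eren -/esub -/tren -/tsub.
have e x : rsub (Sub (sb_ty s) (upe (upe (upe (upe (sb_tm s)))))
     (fun i => rren (wk 0 1 0) (rren (wk 0 1 0) (rren (wk 0 2 0) (sb_rel s i))))) (rren (wk 0 4 0) x)
     = rren (wk 0 4 0) (rsub s x).
  rewrite rsub_rren rren_rsub; apply: rsub_ext => i /=.
  - by rewrite tren0.
  - by rewrite /eshift !eren_eren.
  - by rewrite !rren_rren.
by rewrite !e.
Qed.

Lemma rren_lol ρ a a' b b' r q :
  rren ρ (rel_lol a a' b b' r q) =
  rel_lol (tren (rn_ty ρ) a) (tren (rn_ty ρ) a') (tren (rn_ty ρ) b) (tren (rn_ty ρ) b') (rren ρ r) (rren ρ q).
Proof. by rewrite rren_as_rsub rsub_lol -!tren_as_tsub -!rren_as_rsub. Qed.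

(* continuation-form elimination of a tensor by [f], as in the definition of [rel_tens] *)
Lemma tm_in_lett_app c a b d f t : wf_ty (cty c) a -> wf_ty (cty c) b ->
  tm_in c f (TLol a (TLol b d)) -> tm_in c t (TTens a b) ->
  tm_in c (LetT t (App (App (eshift 0 2 f) (Var 1)) (Var 0))) d.
Proof.
move=> wa wb hf ht; apply: (@tm_in_lett _ a b) => //; rewrite /= ?lcount_eshift //.
apply: (@tm_in_app _ b); last by ctm_var.
by apply: (@tm_in_app _ a); [exact: tm_in_wk2 | ctm_var].
Qed.

Lemma peq_lett_tens c H a b d f x y : wf_ty (cty c) a -> wf_ty (cty c) b ->
  tm_in c f (TLol a (TLol b d)) -> tm_in c x a -> tm_in c y b ->
  pv c H (PEq d (LetT (Tens x y) (App (App (eshift 0 2 f) (Var 1)) (Var 0))) (App (App f x) y)).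
Proof.
move=> wa wb hf hx hy; apply: prv_eqI.
have h := tm_in_lett_app wa wb hf (tm_in_tens hx hy).
by apply: (eeq_cast (eeq_betaT h)); sub_eq.
Qed.

Section TensRel.
Variables (c : ctx) (a b : ty) (rs : seq drel) (l l' : seq ty).
Hypotheses (wa : wf_ty (size rs) a) (wb : wf_ty (size rs) b) (hrs : srels c rs l l').

Local Notation A := (tapps a l).
Local Notation A' := (tapps a l').
Local Notation B := (tapps b l).
Local Notation B' := (tapps b l').
Local Notation sh := (tren (addn 2)).

Let cA := ext (c ▷□ ▷□) (BRel true (TVar 1) (TVar 0)).
Let cB := cA ▷ TLol (sh A) (TLol (sh B) (TVar 1)) ▷ TLol (sh A') (TLol (sh B') (TVar 0)).

(** The relation that the clause for tensor demands of the two continuations, at a place where [m]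
    term variables have been added. The values 4 and 2 occur: before and after the two related
    tensors are substituted. *)
Let rel_cont m : drel :=
  rel_lol (sh A) (sh A') (TLol (sh B) (TVar 1)) (TLol (sh B') (TVar 0))
    (rren (wk 2 m 1) (RTy a rs))
    (rel_lol (sh B) (sh B') (TVar 1) (TVar 0) (rren (wk 2 m 1) (RTy b rs)) (RVar 0)).

Lemma wfr_cont c' m : ok_ren c c' (wk 2 m 1) -> 1 < cty c' -> 
  onth (crel c') 0 = Some (true, TVar 1, TVar 0) ->
  wfr c' (rel_cont m) (TLol (sh A) (TLol (sh B) (TVar 1))) (TLol (sh A') (TLol (sh B') (TVar 0))).
Proof.
move=> ok h1 hr.
have [wA wA'] := wf_tapps_srels wa hrs; have [wB wB'] := wf_tapps_srels wb hrs.
have h0 : 0 < cty c' by apply: ltn_trans h1.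
have wT2 x : wf_ty (cty c) x -> wf_ty (cty c') (sh x) by exact: (wf_okr ok).
have e4 x : tren (addn 0) (tren (addn 2) x) = sh x by rewrite tren0.
apply: wfr_lol; try by rewrite /= ?wT2 ?h1 ?h0.
  have ok4 x y z w : ok_ren c (c' ▷ x ▷ y ▷ z ▷ w) (wk 2 (4 + m) 1) by exact
    (ok_wk _ (ok_wk _ (ok_wk _ (ok_wk _ ok)))).
  have := wfr_ty_ren (ok4 (TLol (sh A) (TLol (sh B) (TVar 1))) (TLol (sh A') (TLol (sh B') (TVar 0)))
    (sh A) (sh A')) wa hrs.
  by rewrite /= -!map_comp; congr (wf_rel _ _ (RTy _ _) _ _); apply: eq_map => q /=; rewrite rren_rren.
rewrite rren_lol [rn_ty _]/= !e4; apply: wfr_lol; try by rewrite /= ?wT2 ?h1 ?h0.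
  set c8 := _ ▷ sh B'.
  have ok8 : ok_ren c c8 (wk 2 (8 + m) 1) by exact
    (ok_wk _ (ok_wk _ (ok_wk _ (ok_wk _ (ok_wk _ (ok_wk _ (ok_wk _ (ok_wk _ ok)))))))).
  have := wfr_ty_ren ok8 wb hrs.
  by rewrite /= -!map_comp; congr (wf_rel _ _ (RTy _ _) _ _); apply: eq_map => q /=; rewrite !rren_rren.
by apply: (@wr_var _ _ _ true).
Qed.

Lemma wfr_tens : wfr c (rel_tens A A' B B' (RTy a rs) (RTy b rs)) (TTens A B) (TTens A' B').
Proof.
have [wA wA'] := wf_tapps_srels wa hrs; have [wB wB'] := wf_tapps_srels wb hrs.
have w k x : wf_ty k x -> wf_ty k.+2 (sh x) by apply: wf_tren.
apply: wr_comp; try by rewrite /= ?wA ?wA'.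
do 5 (apply: wf_all; first by rewrite /= ?w).
apply: wf_imp.
  set c7 := _ ▷ TLol (sh A') _.
  have ok7 : ok_ren c c7 (wk 2 4 1) by rewrite /c7; okr.
  by apply: (wf_rel_app (wfr_cont ok7 _ _)) => //; ctm_var.
apply: (@wf_rel_app _ _ _ (TVar 1) (TVar 0)); first exact: wr_var.
  apply: (@tm_in_lett _ (sh A) (sh B)) => //; first by ctm_var.
  apply: (@tm_in_app _ (sh B)); last by ctm_var.
  by apply: (@tm_in_app _ (sh A)); ctm_var.
apply: (@tm_in_lett _ (sh A') (sh B')) => //; first by ctm_var.
apply: (@tm_in_app _ (sh B')); last by ctm_var.
by apply: (@tm_in_app _ (sh A')); ctm_var.
Qed.

(** Relatedness of the continuations is applied to the first and then to the second components. The
    clause asks for a [let] over a pair instead of the iterated application; the two agree by the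
    beta rule for tensor, and [prel_conv] transfers the relation. *)
Lemma rel_tensI H x x' y y' : tm_in c x A -> tm_in c x' A' -> tm_in c y B -> tm_in c y' B' ->
  pv c H (PRel (RTy a rs) x x') -> pv c H (PRel (RTy b rs) y y') ->
  pv c H (PRel (RTy (TTens a b) rs) (Tens x y) (Tens x' y')).
Proof.
move=> hx hx' hy hy' P Q.
have wab : wf_ty (size rs) (TTens a b) by rewrite /= wa.
have [wA wA'] := wf_tapps_srels wa hrs; have [wB wB'] := wf_tapps_srels wb hrs.
have w k z : wf_ty k z -> wf_ty k.+2 (sh z) by apply: wf_tren.
apply: (ty_clauseI wab hrs); try exact: tm_in_tens.
apply: prv_compI; [exact: wfr_tens | exact: tm_in_tens | exact: tm_in_tens |].
apply: (pv_cut _ (prv_andI P Q)).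
  by apply: wf_and; [apply: (wf_rel_app (wfr_ty wa hrs)) | apply: (wf_rel_app (wfr_ty wb hrs))].
set H1 := _ :: H.
pose hy0 := PRel (rel_cont 2) (Var 1) (Var 0).
have : pv c H1 (PAll BTy (PAll BTy (PAll (BRel true (TVar 1) (TVar 0))
      (PAll (BTm (TLol (sh A) (TLol (sh B) (TVar 1))))
      (PAll (BTm (TLol (sh A') (TLol (sh B') (TVar 0))))
        (PImp hy0 (PRel (RVar 0) (LetT (Tens (eshift 2 2 x) (eshift 2 2 y)) (App (App (Var 3) (Var 1))
          (Var 0)))
           (LetT (Tens (eshift 2 2 x') (eshift 2 2 y')) (App (App (Var 2) (Var 1)) (Var 0)))))))))).
  do 5 (apply: prv_allI; first by rewrite /= ?w).
  rewrite -/cA -/cB.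
  have ok5 : ok_ren c cB (wk 2 2 1) by rewrite /cB /cA; okr.
  apply: prv_impI; first by apply: (wf_rel_app (wfr_cont ok5 _ _)) => //; ctm_var.
  set H5 := _ :: _.
  have P1 : pv cB H5 hy0 by exact: pv_hyp0.
  have P2 : pv cB H5 (PAnd (PRel (rren (wk 2 2 1) (RTy a rs)) (eshift 2 2 x) (eshift 2 2 x'))
     (PRel (rren (wk 2 2 1) (RTy b rs)) (eshift 2 2 y) (eshift 2 2 y'))).
    by apply: pv_eq; [exact: pv_hyp1|]; rewrite /=; congr PAnd; sub_cong.
  have kx := tm_in_okr ok5 hx; have kx' := tm_in_okr ok5 hx'.
  have ky := tm_in_okr ok5 hy; have ky' := tm_in_okr ok5 hy'.
  have kA : wf_ty (cty cB) (sh A) by apply: w.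
  have kB : wf_ty (cty cB) (sh B) by apply: w.
  have kA' : wf_ty (cty cB) (sh A') by apply: w.
  have kB' : wf_ty (cty cB) (sh B') by apply: w.
  have v1 : tm_in cB (Var 1) (TLol (sh A) (TLol (sh B) (TVar 1))) by ctm_var.
  have v0 : tm_in cB (Var 0) (TLol (sh A') (TLol (sh B') (TVar 0))) by ctm_var.
  have P3 := rel_lolE_gen kx kx' P1 (prv_andE1 P2).
  have P4 := rel_lolE_gen ky ky' P3 (prv_andE2 P2).
  have E1 := peq_lett_tens H5 kA kB v1 kx ky.
  have E0 := peq_lett_tens H5 kA' kB' v0 kx' ky'.
  have t1 := tm_in_lett_app kA kB v1 (tm_in_tens kx ky).
  have t0 := tm_in_lett_app kA' kB' v0 (tm_in_tens kx' ky').
  apply: (@prel_conv _ _ (TVar 1) (TVar 0)) P4 => //.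
  - by move=> d; apply: wr_var.
  - exact: tm_in_app (tm_in_app v1 kx) ky.
  - exact: tm_in_app (tm_in_app v0 kx') ky'.
  - exact: peq_sym E1.
  - exact: peq_sym E0.
move=> R; apply: (pv_eq R); rewrite /hy0 /rel_cont /rel_lol; sub_eq.
Qed.
End TensRel.

(** As for [!]: identity extension relates an element of the tensor to itself, and the clause is
    instantiated at equality on [d], here with the curried forms of [f] and [g] as continuations.
    The hypothesis says that these continuations agree on equal components, and [peq_lett_tcurry]
    turns the resulting [let] terms back into applications of [f] and [g]. *)
Lemma tens_ind c H a b d f g : wf_ty (cty c) a -> wf_ty (cty c) b -> wf_ty (cty c) d ->
  tm_in c f (TLol (TTens a b) d) -> tm_in c g (TLol (TTens a b) d) ->
  pv (c ▷ a ▷ b) (wkH (BTm b) (wkH (BTm a) H))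
    (PEq d (App (eshift 0 2 f) (Tens (Var 1) (Var 0))) (App (eshift 0 2 g) (Tens (Var 1) (Var 0)))) ->
  pv c H (PEq (TLol (TTens a b) d) f g).
Proof.
move=> wa wb wd hf hg P.
have ha : all (wf_ty (cty c)) [:: a; b] by rewrite /= wa wb.
pose q := PAll (BTm a) (PAll (BTm b) (PEq d (App (eshift 0 2 f) (Tens (Var 1) (Var 0)))
  (App (eshift 0 2 g) (Tens (Var 1) (Var 0))))).
have hb (h : tm) : tm_in c h (TLol (TTens a b) d) -> tm_in (c ▷ a ▷ b) (App (eshift 0 2 h)
  (Tens (Var 1) (Var 0))) d.
  move=> hh; apply: (@tm_in_app _ (TTens a b)); first exact: tm_in_wk2.
  by apply: tm_in_tens; ctm_var.
apply: (@pv_cut _ _ q); first by do 2 (apply: wf_all; first by []); constructor; apply: hb.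
  by do 2 (apply: prv_allI; first by []).
apply: peq_funext => //; first by rewrite /= wa.
set H1 := wkH _ _; set c1 := c ▷ _.
have hv : tm_in c1 (Var 0) (TTens a b) by ctm_var.
have R := @iesI c1 H1 (TTens (TVar 0) (TVar 1)) [:: a; b] (Var 0) (Var 0) isT ha hv hv (peq_refl _ hv).
have hs1 : srels c1 [:: rel_eq a; rel_eq b] [:: a; b] [:: a; b] by exact: (@srels_eq c1 [:: a; b]).
have hd : srel c1 (rel_eq d) d d by constructor.
have hf1 : tm_in c1 (eshift 0 1 f) (TLol (TTens a b) d) by exact: tm_in_wk.
have hg1 : tm_in c1 (eshift 0 1 g) (TLol (TTens a b) d) by exact: tm_in_wk.
have hfc := tm_in_tcurry (c := c1) wa wb hf1; have hgc := tm_in_tcurry (c := c1) wa wb hg1.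
have {}R := @ty_clauseE c1 H1 (TTens (TVar 0) (TVar 1)) [:: rel_eq a; rel_eq b] [:: a; b] [:: a; b] _ _
  isT hs1 hv hv R.
have {}R := rel_tensE_gen (wd : wf_ty (cty c1) d) wd hd hfc hgc R.
have Ef := peq_lett_tcurry (c := c1) wa wb hf1 H1 hv.
have Eg := peq_lett_tcurry (c := c1) wa wb hg1 H1 hv.
have tf := tm_in_lett_app (c := c1) wa wb hfc hv.
apply: (peq_trans (tm_in_app hf1 hv) (peq_sym tf Ef)).
apply: peq_trans Eg => //; apply: rel_eqE; apply: R; cbn [tapps tsub nth].
set rs := [:: rel_eq a; rel_eq b]; set r1 := rel_lol b b d d _ _.
have wE k : map (rren (wk 0 k 0)) rs = rs by rewrite /rs /= tren0.
have ers k i : rren (wk 0 k 0) (RTy (TVar i) rs) = RTy (TVar i) rs by rewrite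
  -[RHS](congr1 (RTy (TVar i)) (wE k)).
have er1 k : rren (wk 0 k 0) r1 = r1 by rewrite /r1 rren_lol ers rren_eq /= tren0.
have hE c' : wf_ty (cty c') a -> wf_ty (cty c') b -> srels c' rs [:: a; b] [:: a; b].
  by move=> h h'; apply: (@srels_eq c' [:: a; b]); rewrite /= h h'.
have w0 c' : wf_ty (cty c') a -> wf_ty (cty c') b -> wfr c' (RTy (TVar 0) rs) a a.
  by move=> h h'; apply: (@wfr_ty c' (TVar 0) rs [:: a; b] [:: a; b] isT (hE _ h h')).
have w1 c' : wf_ty (cty c') a -> wf_ty (cty c') b -> wfr c' (RTy (TVar 1) rs) b b.
  by move=> h h'; apply: (@wfr_ty c' (TVar 1) rs [:: a; b] [:: a; b] isT (hE _ h h')).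
have wr c' : wf_ty (cty c') a -> wf_ty (cty c') b -> wf_ty (cty c') d -> wfr c' r1 (TLol b d) (TLol b d).
  move=> h h' h''; apply: wfr_lol => //; first by rewrite ers; apply: w1.
  by rewrite rren_eq /= tren0; apply: wfr_eq.
apply: rel_lolI_gen => //.
- apply: wfr_lol; try by rewrite /= ?wb.
    by rewrite ers; apply: w0.
  by rewrite er1; apply: wr.
- by rewrite ers; apply: w0.
rewrite ers er1; set c3 := c1 ▷ a ▷ a; set H3 := _ :: _.
have hf3 : tm_in c3 (eshift 0 2 (tcurry a b (eshift 0 1 f))) (TLol a (TLol b d)) by apply: tm_in_wk2.
have hg3 : tm_in c3 (eshift 0 2 (tcurry a b (eshift 0 1 g))) (TLol a (TLol b d)) by apply: tm_in_wk2.
have v1 : tm_in c3 (Var 1) a by ctm_var.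
have v0 : tm_in c3 (Var 0) a by ctm_var.
apply: rel_lolI_gen => //.
- exact: wr.
- by rewrite ers; apply: w1.
- exact: tm_in_app hf3 v1.
- exact: tm_in_app hg3 v0.
rewrite ers; set c5 := c3 ▷ b ▷ b; set H5 := _ :: _.
have -> : rren (wk 0 2 0) (rel_eq d) = rel_eq d by rewrite rren_eq /= tren0.
have ee h x : App (eshift 0 2 (App (eshift 0 2 (tcurry a b (eshift 0 1 h))) x)) = 
   App (App (tcurry a b (eshift 0 5 h)) (eshift 0 2 x)).
  by congr App; rewrite /eshift /tcurry; sub_eq.
rewrite !ee.
have hf5 : tm_in c5 (eshift 0 5 f) (TLol (TTens a b) d).
  by have := tm_in_wk2 b b (tm_in_wk2 a a hf1); rewrite /eshift !eren_eren.
have hg5 : tm_in c5 (eshift 0 5 g) (TLol (TTens a b) d).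
  by have := tm_in_wk2 b b (tm_in_wk2 a a hg1); rewrite /eshift !eren_eren.
have u3 : tm_in c5 (Var 3) a by ctm_var.
have u2 : tm_in c5 (Var 2) a by ctm_var.
have u1 : tm_in c5 (Var 1) b by ctm_var.
have u0 : tm_in c5 (Var 0) b by ctm_var.
have Ea : pv c5 H5 (PEq a (Var 3) (Var 2)).
  apply: rel_eqE.
  refine (@rel_varE c5 H5 0 rs [:: a; b] [:: a; b] (Var 3) (Var 2) isT (hE c5 wa wb) u3 u2 _).
  by apply: pv_eq; [apply: pv_hyp1 | rewrite /= !tren0].
have Eb : pv c5 H5 (PEq b (Var 1) (Var 0)).
  apply: rel_eqE.
  by apply: (@rel_varE c5 H5 1 rs [:: a; b] [:: a; b] (Var 1) (Var 0) isT (hE c5 wa wb) u1 u0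
    (pv_hyp0 _ _ _)).
have Q : pv c5 H5 (PEq d (App (eshift 0 5 f) (Tens (Var 3) (Var 1))) (App (eshift 0 5 g)
  (Tens (Var 3) (Var 1)))).
  have Q : pv c5 H5 (PAll (BTm a) (PAll (BTm b) (PEq d (App (eshift 0 7 f) (Tens (Var 1) (Var 0)))
    (App (eshift 0 7 g) (Tens (Var 1) (Var 0)))))).
    (* Hypothesis number 2 is the weakened [q]; above it stand the two hypotheses that relate the
       first and the second components. *)
    by apply: pv_eq; [apply: (@prv_hyp _ _ _ 2) => //|]; sub_eq.
  by apply: pv_eq (pv_all_tmE Q u3 u1) _; sub_eq.
have wf' : forall x, wf_ty (cty c) x -> wf_ty (cty c5) x by [].
have cf := tm_in_tcurry (wf' a wa) (wf' b wb) hf5.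
have cg := tm_in_tcurry (wf' a wa) (wf' b wb) hg5.
apply: rel_eqI => //.
- exact: tm_in_app (tm_in_app cf u3) u1.
- exact: tm_in_app (tm_in_app cg u2) u0.
apply: (peq_trans (tm_in_app (tm_in_app cf u3) u1) (peq_tcurry (wf' a wa) (wf' b wb) hf5 H5 u3 u1)).
apply: (peq_trans (tm_in_app hf5 (tm_in_tens u3 u1)) Q).
apply: (@peq_trans _ _ _ (App (eshift 0 5 g) (Tens (Var 2) (Var 0)))).
- exact: tm_in_app hg5 (tm_in_tens u3 u1).
- by apply: peq_appr hg5 (tm_in_tens u3 u1) _; apply: peq_tens.
apply: peq_sym; first exact: tm_in_app (tm_in_app cg u2) u0.
exact: (peq_tcurry (wf' a wa) (wf' b wb) hg5 H5 u2 u0).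
Qed.

(** * The functorial action *)

(** This and the next three definitions are the clauses of [act] for the composite types with the
    recursive calls abstracted, so that typing, substitution and beta are treated once per type
    former. *)
Definition tens_map (A : ty) (f g : tm) : tm :=
  Lam A (LetT (Var 0) (Tens (App (eshift 0 3 f) (Var 1)) (App (eshift 0 3 g) (Var 0)))).
Definition bang_map (A : ty) (f : tm) : tm :=
  Lam A (LetB (Var 0) (Bang (App (eshift 0 2 f) (Var 0)))).
Definition lol_map (A B : ty) (f g : tm) : tm :=
  Lam A (tcomp B (eshift 0 1 g) (tcomp B (Var 0) (eshift 0 1 f))).
Definition pi_map (A : ty) (f : tm) : tm :=
  Lam A (TLam (App (eshift 0 1 f) (TApp (Var 0) (TVar 0)))).

Lemma actE k d e f s : act k d e f s =
  if closed_ty s then idtm s else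
  match s with
  | TVar i => if i == k then f else idtm (d i)
  | TOne => idtm TOne
  | TTens a b => tens_map (tsub d s) (act k d e f a) (act k d e f b)
  | TLol a b => lol_map (tsub d s) (tsub e a) (act k e d f a) (act k d e f b)
  | TBang a => bang_map (tsub d s) (act k d e f a)
  | TPi a => pi_map (tsub d s) (act k.+1 (upt d) (upt e) (eshift 1 0 f) a)
  end.
Proof. by case: s. Qed.

Lemma esub_idtm st se a : esub st se (idtm a) = idtm (tsub st a).
Proof. by []. Qed.

Lemma esub_idtm_closed st se a : closed_ty a -> esub st se (idtm a) = idtm a.
Proof. by move=> h; rewrite esub_idtm tsub_closed. Qed.

Lemma eren_idtm rt re a : eren rt re (idtm a) = idtm (tren rt a).
Proof. by []. Qed.

Lemma esub_upe st se t : esub st (upe se) (eshift 0 1 t) = eshift 0 1 (esub st se t).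
Proof. by rewrite /eshift esub_eren eren_esub; congr esub; fext => i /=; rewrite tren0. Qed.

Lemma esub_upe2 st se t : esub st (upe (upe se)) (eshift 0 2 t) = eshift 0 2 (esub st se t).
Proof. by rewrite /eshift esub_eren eren_esub; apply: esub_ext => i /=; rewrite ?tren0 // /eshift
  eren_eren. Qed.

Lemma esub_upe3 st se t : esub st (upe (upe (upe se))) (eshift 0 3 t) = eshift 0 3 (esub st se t).
Proof. by rewrite /eshift esub_eren eren_esub; apply: esub_ext => i /=; rewrite ?tren0 // /eshift
  !eren_eren. Qed.

Lemma esub_upt st se t : esub (upt st) (fun i => eshift 1 0 (se i)) (eshift 1 0 t) = eshift 1 0
  (esub st se t).
Proof. by rewrite /eshift esub_eren eren_esub. Qed.

Lemma esub_tcomp st se a g f : esub st se (tcomp a g f) = tcomp (tsub st a) (esub st se g) (esub st se f).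
Proof. by rewrite /tcomp /= !esub_upe. Qed.

Lemma eren_tcomp rt re a g f : eren rt re (tcomp a g f) = tcomp (tren rt a) (eren rt re g) (eren rt re f).
Proof. by rewrite !eren_as_esub esub_tcomp -tren_as_tsub. Qed.

Lemma esub_tens_map st se A f g :
  esub st se (tens_map A f g) = tens_map (tsub st A) (esub st se f) (esub st se g).
Proof. by rewrite /tens_map /= !esub_upe3. Qed.

Lemma esub_bang_map st se A f : esub st se (bang_map A f) = bang_map (tsub st A) (esub st se f).
Proof. by rewrite /bang_map /= !esub_upe2. Qed.

Lemma esub_lol_map st se A B f g :
  esub st se (lol_map A B f g) = lol_map (tsub st A) (tsub st B) (esub st se f) (esub st se g).
Proof. rewrite -[LHS]/(Lam (tsub st A) (esub st (upe se) (tcomp B (eshift 0 1 g) (tcomp B (Var 0)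
  (eshift 0 1 f))))).
by rewrite !esub_tcomp !esub_upe. Qed.

Lemma esub_pi_map st se A f :
  esub st se (pi_map A f) = pi_map (tsub st A) (esub (upt st) (fun i => eshift 1 0 (se i)) f).
Proof.
rewrite /pi_map /=; congr (Lam _ (TLam (App _ _))).
by rewrite /eshift esub_eren eren_esub; apply: esub_ext => i /=; rewrite ?tren0 // /eshift !eren_eren.
Qed.

Lemma act_esub s k d e f st se :
  esub st se (act k d e f s) = act k (tsub st \o d) (tsub st \o e) (esub st se f) s.
Proof.
elim: s k d e f st se => [i||a IHa b IHb|a IHa b IHb|a IHa|a IHa] k d e f st se;
  rewrite [in LHS]actE [RHS]actE; (case h: (closed_ty _); first exact: (esub_idtm_closed _ _ h)) => //.
- by case: ifP.
- by rewrite esub_tens_map IHa IHb tsub_tsub.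
- by rewrite esub_lol_map IHa IHb !tsub_tsub.
- by rewrite esub_bang_map IHa tsub_tsub.
- by rewrite esub_pi_map IHa tsub_tsub !upt_comp esub_upt.
Qed.

Lemma act_eren s k d e f rt re :
  eren rt re (act k d e f s) = act k (tren rt \o d) (tren rt \o e) (eren rt re f) s.
Proof.
rewrite eren_as_esub act_esub -eren_as_esub.
by congr act; fext => i /=; rewrite -tren_as_tsub.
Qed.

Lemma eq_act s n k d e d' e' f : wf_ty n s ->
  (forall i, i < n -> d i = d' i) -> (forall i, i < n -> e i = e' i) ->
  act k d e f s = act k d' e' f s.
Proof.
elim: s n k d e d' e' f => [i||a IHa b IHb|a IHa b IHb|a IHa|a IHa] n k d e d' e' f ws hd he;
  rewrite [LHS]actE [RHS]actE; (case h: (closed_ty _); first by []) => //.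
- by case: ifP => // _; rewrite hd.
- rewrite (eq_tsub ws hd); case/andP: ws => wa wb.
  by rewrite (IHa _ _ _ _ _ _ _ wa hd he) (IHb _ _ _ _ _ _ _ wb hd he).
- rewrite (eq_tsub ws hd); case/andP: ws => wa wb.
  by rewrite (IHa _ _ _ _ _ _ _ wa he hd) (IHb _ _ _ _ _ _ _ wb hd he) (eq_tsub wa he).
- by rewrite (eq_tsub ws hd) (IHa _ _ _ _ _ _ _ ws hd he).
- rewrite (eq_tsub ws hd) (IHa n.+1 _ _ _ (upt d') (upt e')) // => -[|i] //= hi.
    by rewrite hd.
  by rewrite he.
Qed.

(** Substitution also affects what [scons a TVar] assigns to indices above 0; since [s] mentions
    index 0 only, [eq_act] discards the difference. *)
Lemma esub_fmap s a b f st se : wf_ty 1 s ->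
  esub st se (fmap s a b f) = fmap s (tsub st a) (tsub st b) (esub st se f).
Proof. by move=> ws; rewrite /fmap act_esub; apply: eq_act ws _ _ => -[|i]. Qed.

Lemma eren_fmap s a b f rt re : wf_ty 1 s ->
  eren rt re (fmap s a b f) = fmap s (tren rt a) (tren rt b) (eren rt re f).
Proof. by move=> ws; rewrite !eren_as_esub esub_fmap // -!tren_as_tsub. Qed.

Lemma lcount_tcomp i a g f : lcount i (tcomp a g f) = lcount i g + lcount i f.
Proof. by rewrite /= !lcount_eshift /= subn1 addn0. Qed.

Lemma tm_in_tcomp c a b d f g : wf_ty (cty c) a -> tm_in c f (TLol a b) -> tm_in c g (TLol b d) ->
  tm_in c (tcomp a g f) (TLol a d).
Proof.
move=> wa hf hg; apply: tm_in_lam; rewrite /= ?lcount_eshift //.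
apply: (@tm_in_app _ b); first exact: tm_in_wk.
by apply: (@tm_in_app _ a); [exact: tm_in_wk | ctm_var].
Qed.

Lemma peq_tcomp c H a b d f g x : wf_ty (cty c) a -> tm_in c f (TLol a b) -> tm_in c g (TLol b d) ->
  tm_in c x a -> pv c H (PEq d (App (tcomp a g f) x) (App g (App f x))).
Proof.
move=> wa hf hg hx.
have ht : tm_in (c ▷ a) (App (eshift 0 1 g) (App (eshift 0 1 f) (Var 0))) d.
  apply: (@tm_in_app _ b); first exact: tm_in_wk.
  by apply: (@tm_in_app _ a); [exact: tm_in_wk | ctm_var].
have := peq_beta H wa ht _ hx; rewrite /= !lcount_eshift /= !esub_inst_wk; exact.
Qed.

Section Maps.
Variable c : ctx.

Lemma tm_in_tens_map a b a' b' f g : wf_ty (cty c) a -> wf_ty (cty c) b ->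
  tm_in c f (TLol a a') -> tm_in c g (TLol b b') ->
  tm_in c (tens_map (TTens a b) f g) (TLol (TTens a b) (TTens a' b')).
Proof.
move=> wa wb hf hg; apply: tm_in_lam; rewrite /= ?lcount_eshift ?wa //.
apply: (@tm_in_lett _ a b); rewrite /= ?lcount_eshift //; first by ctm_var.
by apply: tm_in_tens; [apply: (@tm_in_app _ a) | apply: (@tm_in_app _ b)]; try ctm_var; apply: tm_in_wk3.
Qed.

Lemma tm_in_bang_map a a' f : wf_ty (cty c) a -> tm_in c f (TLol a a') ->
  tm_in c (bang_map (TBang a) f) (TLol (TBang a) (TBang a')).
Proof.
move=> wa hf; apply: tm_in_lam; rewrite /= ?lcount_eshift ?wa //.
apply: (@tm_in_letb _ a); first by ctm_var.
by apply: tm_in_bang; apply: (@tm_in_app _ a); [exact: tm_in_wk2 | ctm_var].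
Qed.

Lemma tm_in_lol_map a b a' b' f g : wf_ty (cty c) a -> wf_ty (cty c) b -> wf_ty (cty c) a' ->
  tm_in c f (TLol a' a) -> tm_in c g (TLol b b') ->
  tm_in c (lol_map (TLol a b) a' f g) (TLol (TLol a b) (TLol a' b')).
Proof.
move=> wa wb wa' hf hg; apply: tm_in_lam; [by rewrite /= wa | | by rewrite !lcount_tcomp !lcount_eshift].
apply: (@tm_in_tcomp _ _ b) => //; last exact: tm_in_wk.
by apply: (@tm_in_tcomp _ _ a) => //; [exact: tm_in_wk | ctm_var].
Qed.

Lemma tapp_upr_var a : tapp (tren (upr S) a) (TVar 0) = a.
Proof. by rewrite /tapp tsub_tren -[RHS]tsub_id; apply: tsub_ext => -[]. Qed.

Lemma tm_in_wk_under a t b : tm_in (c ▷□) t b -> tm_in (c ▷ a ▷□) (eshift 0 1 t) b.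
Proof.
move=> h; have := @tm_in_ren (c ▷□) (c ▷ a ▷□) (addn 0) (addn 1) _ _ h.
by rewrite tren0; apply.
Qed.

Lemma tm_in_pi_map a a' f : wf_ty (cty c).+1 a -> tm_in (c ▷□) f (TLol a a') ->
  tm_in c (pi_map (TPi a) f) (TLol (TPi a) (TPi a')).
Proof.
move=> wa hf; apply: tm_in_lam; rewrite /= ?lcount_eshift ?wa //.
apply: tm_in_tlam; apply: (@tm_in_app _ a); first exact: tm_in_wk_under.
apply: (@tm_in_tapp _ (tren (upr S) a)) => //; first by ctm_var.
exact: tapp_upr_var.
Qed.

Lemma peq_tens_map H a b a' b' f g x y : wf_ty (cty c) a -> wf_ty (cty c) b ->
  tm_in c f (TLol a a') -> tm_in c g (TLol b b') -> tm_in c x a -> tm_in c y b ->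
  pv c H (PEq (TTens a' b') (App (tens_map (TTens a b) f g) (Tens x y)) (Tens (App f x) (App g y))).
Proof.
move=> wa wb hf hg hx hy; have h := tm_in_tens_map wa wb hf hg.
have hb := tm_in_app h (tm_in_tens hx hy).
apply: (@peq_trans _ _ _ (LetT (Tens x y) (Tens (App (eshift 0 2 f) (Var 1)) (App (eshift 0 2 g)
  (Var 0))))) => //.
  by apply: prv_eqI; apply: (eeq_cast (eeq_beta hb)); sub_eq.
have hl : tm_in c (LetT (Tens x y) (Tens (App (eshift 0 2 f) (Var 1)) (App (eshift 0 2 g) (Var 0))))
  (TTens a' b').
  apply: (@tm_in_lett _ a b); rewrite /= ?lcount_eshift //; first exact: tm_in_tens.
  by apply: tm_in_tens; [apply: (@tm_in_app _ a) | apply: (@tm_in_app _ b)]; try ctm_var; apply: tm_in_wk2.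
by apply: prv_eqI; apply: (eeq_cast (eeq_betaT hl)); sub_eq.
Qed.

Lemma peq_bang_map H a a' f x : wf_ty (cty c) a -> tm_in c f (TLol a a') -> tm_in c x a ->
  pv c H (PEq (TBang a') (App (bang_map (TBang a) f) (Bang x)) (Bang (App f x))).
Proof.
move=> wa hf hx; have h := tm_in_bang_map wa hf.
have hb := tm_in_app h (tm_in_bang hx).
apply: (@peq_trans _ _ _ (LetB (Bang x) (Bang (App (eshift 0 1 f) (Var 0))))) => //.
  by apply: prv_eqI; apply: (eeq_cast (eeq_beta hb)); sub_eq.
have hl : tm_in c (LetB (Bang x) (Bang (App (eshift 0 1 f) (Var 0)))) (TBang a').
  apply: (@tm_in_letb _ a); first exact: tm_in_bang.
  by apply: tm_in_bang; apply: (@tm_in_app _ a); [exact: tm_in_wk | ctm_var].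
by apply: prv_eqI; apply: (eeq_cast (eeq_betaB hl)); sub_eq.
Qed.

Lemma peq_lol_map H a b a' b' f g h x : wf_ty (cty c) a -> wf_ty (cty c) b -> wf_ty (cty c) a' ->
  tm_in c f (TLol a' a) -> tm_in c g (TLol b b') -> tm_in c h (TLol a b) -> tm_in c x a' ->
  pv c H (PEq b' (App (App (lol_map (TLol a b) a' f g) h) x) (App g (App h (App f x)))).
Proof.
move=> wa wb wa' hf hg hh hx; have hl := tm_in_lol_map wa wb wa' hf hg.
have hb := tm_in_app hl hh.
have hc1 := tm_in_tcomp wa' hf hh; have hc2 := tm_in_tcomp wa' hc1 hg.
have E : pv c H (PEq (TLol a' b') (App (lol_map (TLol a b) a' f g) h) (tcomp a' g (tcomp a' h f))).
  apply: prv_eqI; apply: (eeq_cast (eeq_beta hb)).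
  by rewrite !esub_tcomp !esub_inst_wk tsub_id.
apply: (peq_trans (tm_in_app hb hx) (peq_appl hb hx E)).
apply: (peq_trans (tm_in_app hc2 hx) (peq_tcomp H wa' hc1 hg hx)).
by apply: (peq_appr hg (tm_in_app hc1 hx)); exact: (peq_tcomp H wa' hf hh hx).
Qed.

Lemma peq_pi_map H a a' f u d : wf_ty (cty c).+1 a -> tm_in (c ▷□) f (TLol a a') ->
  tm_in c u (TPi a) -> wf_ty (cty c) d ->
  pv c H (PEq (tapp a' d) (TApp (App (pi_map (TPi a) f) u) d)
     (App (esub (scons d TVar) Var f) (TApp u d))).
Proof.
move=> wa hf hu wd; have h := tm_in_pi_map wa hf.
have hb := tm_in_app h hu.
have ht : tm_in (c ▷□) (App f (TApp (eshift 1 0 u) (TVar 0))) a'.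
  apply: (@tm_in_app _ a) => //; apply: (@tm_in_tapp _ (tren (upr S) a)) => //.
    exact: tm_in_wkT hu.
  exact: tapp_upr_var.
have E : pv c H (PEq (TPi a') (App (pi_map (TPi a) f) u) (TLam (App f (TApp (eshift 1 0 u) (TVar 0))))).
  apply: prv_eqI; apply: (eeq_cast (eeq_beta hb)).
  by sub_eq.
apply: (@peq_trans _ _ _ (TApp (TLam (App f (TApp (eshift 1 0 u) (TVar 0)))) d)).
- exact: tm_in_tapp hb wd (erefl _).
- exact: peq_tapp hb wd (erefl _) E.
have := @peq_tbeta c H d (tapp a' d) a' _ wd ht (erefl _).
by rewrite /= esub_instT_wk.
Qed.

End Maps.

Lemma wf_upt n m d : (forall i, i < n -> wf_ty m (d i)) -> forall i, i < n.+1 -> wf_ty m.+1 (upt d i).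
Proof. by move=> h [|i] //= hi; apply: wf_tren (h i hi). Qed.

(** Both polarities are proved together because the clause for linear functions exchanges the
    environments in its argument. *)
Lemma tm_in_act s n k d e f c : wf_ty n s ->
  (forall i, i < n -> wf_ty (cty c) (d i)) -> (forall i, i < n -> wf_ty (cty c) (e i)) ->
  (forall i, i < n -> i != k -> d i = e i) -> tm_in c f (TLol (d k) (e k)) ->
  (occurs_only true k s -> tm_in c (act k d e f s) (TLol (tsub d s) (tsub e s))) /\
  (occurs_only false k s -> tm_in c (act k e d f s) (TLol (tsub e s) (tsub d s))).
Proof.
elim: s n k d e f c => [i||a IHa b IHb|a IHa b IHb|a IHa|a IHa] n k d e f c ws hd he hde hf;
  rewrite ?[act _ _ _ _ (TVar _)]actE ?[act _ _ _ _ TOne]actE ?[act _ _ _ _ (TTens _ _)]actE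
    ?[act _ _ _ _ (TLol _ _)]actE ?[act _ _ _ _ (TBang _)]actE ?[act _ _ _ _ (TPi _)]actE.
all: have wd := wf_tsub hd ws; have we := wf_tsub he ws.
all: case h: (closed_ty _); first by split=> _; rewrite !(tsub_closed _ h); apply: tm_in_id; rewrite
  tsub_closed in wd.
- rewrite /=; case: eqP => [->|/eqP ik] /=; first by split.
  by rewrite -(hde i ws ik); split => _; apply: tm_in_id; apply: hd.
- by [].
- move: wd we ws => /= /andP[wda wdb] /andP[wea web] /andP[wa wb].
  have [h1 h2] := IHa _ _ _ _ _ _ wa hd he hde hf; have [h3 h4] := IHb _ _ _ _ _ _ wb hd he hde hf.
  split=> /andP[p q]; apply: tm_in_tens_map => //; [exact: h1 | exact: h3 | exact: h2 | exact: h4].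
- move: wd we ws => /= /andP[wda wdb] /andP[wea web] /andP[wa wb].
  have [h1 h2] := IHa _ _ _ _ _ _ wa hd he hde hf; have [h3 h4] := IHb _ _ _ _ _ _ wb hd he hde hf.
  split=> /andP[p q]; apply: tm_in_lol_map => //; [exact: h2 | exact: h3 | exact: h1 | exact: h4].
- have [h1 h2] := IHa _ _ _ _ _ _ ws hd he hde hf.
  by split=> /= p; apply: tm_in_bang_map => //; [exact: h1 | exact: h2].
- have hde' i : i < n.+1 -> i != k.+1 -> upt d i = upt e i.
    by case: i => [|i] //= hi ik; rewrite hde.
  have [h1 h2] := IHa _ _ _ _ _ (c ▷□) ws (wf_upt hd) (wf_upt he) hde' (tm_in_wkT hf).
  by split=> /= p; apply: tm_in_pi_map => //; [exact: h1 | exact: h2].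
Qed.

Lemma eshift_idtm m a : eshift 0 m (idtm a) = idtm a.
Proof. by rewrite /eshift eren_idtm tren0. Qed.

Lemma eshift_act s k d m b : eshift 0 m (act k d d (idtm b) s) = act k d d (idtm b) s.
Proof. by rewrite /eshift act_eren eren_idtm tren0. Qed.

Lemma idtm_ok c a b : wf_ty (cty c) b -> a = b ->
  tm_in c (idtm a) (TLol b b) /\ forall H, pv c H (PEq (TLol b b) (idtm a) (idtm b)).
Proof. by move=> w ->; split => [|H]; [|apply: peq_refl]; apply: tm_in_id. Qed.

(** The action on an identity is an identity only up to internal equality: each composite type
    former needs its own extensionality or induction principle before the induction hypothesis can
    be used. Source and target environments coincide, so typing holds without any condition on
    polarity. The induction ranges over all contexts because the hypothesis is applied below the
    variables introduced by these principles. *)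
Lemma peq_act_id s n k d c : wf_ty n s -> k < n -> (forall i, i < n -> wf_ty (cty c) (d i)) ->
  tm_in c (act k d d (idtm (d k)) s) (TLol (tsub d s) (tsub d s)) /\
  forall H, pv c H (PEq (TLol (tsub d s) (tsub d s)) (act k d d (idtm (d k)) s) (idtm (tsub d s))).
Proof.
elim: s n k d c => [i||a IHa b IHb|a IHa b IHb|a IHa|a IHa] n k d c ws kn hd;
  have wd := wf_tsub hd ws; rewrite actE;
  (case h: (closed_ty _); first by apply: idtm_ok => //; rewrite tsub_closed).
- rewrite /=; case: eqP => [->|_]; apply: idtm_ok => //; exact: hd.
- by [].
- move: wd ws => /= /andP[wda wdb] /andP[wa wb].
  have [ta _] := IHa _ _ _ _ wa kn hd; have [tb _] := IHb _ _ _ _ wb kn hd.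
  have wab : wf_ty (cty c) (TTens (tsub d a) (tsub d b)) by rewrite /= wda.
  have tm := tm_in_tens_map wda wdb ta tb.
  split => // H; apply: tens_ind => //; first exact: tm_in_id.
  rewrite /eshift eren_idtm (eren_as_esub _ _ (tens_map _ _ _)) esub_tens_map -!eren_as_esub.
  rewrite -/(eshift 0 2 _) -/(eshift 0 2 _) !eshift_act !tren0.
  have -> : tsub (TVar \o addn 0) (tsub d (TTens a b)) = tsub d (TTens a b) by rewrite -tren_as_tsub tren0.
  set c2 := c ▷ _ ▷ _; set H2 := wkH _ _.
  have [ta2 ea] := IHa _ _ _ c2 wa kn hd; have [tb2 eb] := IHb _ _ _ c2 wb kn hd.
  have v1 : tm_in c2 (Var 1) (tsub d a) by ctm_var.
  have v0 : tm_in c2 (Var 0) (tsub d b) by ctm_var.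
  have wda' : wf_ty (cty c2) (tsub d a) by [].
  have wdb' : wf_ty (cty c2) (tsub d b) by [].
  have tm2 := tm_in_tens_map wda' wdb' ta2 tb2.
  have tv := tm_in_tens v1 v0.
  apply: (peq_trans (tm_in_app tm2 tv) (peq_tens_map H2 wda' wdb' ta2 tb2 v1 v0)).
  have ia := tm_in_id wda'; have ib := tm_in_id wdb'.
  have iab := @tm_in_id c2 (TTens (tsub d a) (tsub d b)) wab.
  apply: (@peq_trans _ _ _ (Tens (Var 1) (Var 0))).
  + exact: tm_in_tens (tm_in_app ta2 v1) (tm_in_app tb2 v0).
  + apply: peq_tens => //; [exact: tm_in_app ta2 v1 | exact: tm_in_app tb2 v0 | |].
    * by apply: (peq_trans (tm_in_app ta2 v1) (peq_appl ta2 v1 (ea _))); apply: peq_id.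
    * by apply: (peq_trans (tm_in_app tb2 v0) (peq_appl tb2 v0 (eb _))); apply: peq_id.
  + apply: peq_sym; first exact: tm_in_app iab tv.
    by apply: peq_id.
- move: wd ws => /= /andP[wda wdb] /andP[wa wb].
  have [ta _] := IHa _ _ _ _ wa kn hd; have [tb _] := IHb _ _ _ _ wb kn hd.
  have wab : wf_ty (cty c) (TLol (tsub d a) (tsub d b)) by rewrite /= wda.
  have tm := tm_in_lol_map wda wdb wda ta tb.
  split => // H; apply: peq_funext => //; first exact: tm_in_id.
  set lm := lol_map _ _ _ _ in tm *.
  have e m : eshift 0 m lm = lm.
    rewrite /eshift (eren_as_esub _ _ lm) esub_lol_map -!eren_as_esub -/(eshift 0 m _) -/(eshift 0 m _)
      !eshift_act.
    by rewrite -!tren_as_tsub !tren0.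
  rewrite e eshift_idtm; set c1 := c ▷ _; set H1 := wkH _ _.
  have [ta1 _] := IHa _ _ _ c1 wa kn hd; have [tb1 _] := IHb _ _ _ c1 wb kn hd.
  have wda1 : wf_ty (cty c1) (tsub d a) by [].
  have wdb1 : wf_ty (cty c1) (tsub d b) by [].
  have v : tm_in c1 (Var 0) (TLol (tsub d a) (tsub d b)) by ctm_var.
  have tm1 := tm_in_lol_map wda1 wdb1 wda1 ta1 tb1.
  have tv := tm_in_app tm1 v.
  have i1 := @tm_in_id c1 (TLol (tsub d a) (tsub d b)) wab.
  apply: (@peq_trans _ _ _ (Var 0)) => //; last first.
    by apply: peq_sym; [exact: tm_in_app i1 v | apply: peq_id].
  apply: peq_funext => //.
  rewrite -[eshift 0 1 (App lm (Var 0))]/(App (eshift 0 1 lm) (Var 1)) e.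
  set c2 := c1 ▷ _; set H2 := wkH _ _.
  have [ta2 ea] := IHa _ _ _ c2 wa kn hd; have [tb2 eb] := IHb _ _ _ c2 wb kn hd.
  have v1 : tm_in c2 (Var 1) (TLol (tsub d a) (tsub d b)) by ctm_var.
  have v0 : tm_in c2 (Var 0) (tsub d a) by ctm_var.
  have wda2 : wf_ty (cty c2) (tsub d a) by [].
  have wdb2 : wf_ty (cty c2) (tsub d b) by [].
  have tm2 := tm_in_lol_map wda2 wdb2 wda2 ta2 tb2.
  apply: (peq_trans (tm_in_app (tm_in_app tm2 v1) v0) (peq_lol_map H2 wda2 wdb2 wda2 ta2 tb2 v1 v0)).
  have ia := tm_in_id wda2; have ib := tm_in_id wdb2.
  have t1 := tm_in_app v1 (tm_in_app ta2 v0).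
  apply: (peq_trans (tm_in_app tb2 t1) (peq_appl tb2 t1 (eb _))).
  apply: (peq_trans (tm_in_app ib t1) (peq_id H2 wdb2 t1)).
  apply: (peq_appr v1 (tm_in_app ta2 v0)).
  apply: (peq_trans (tm_in_app ta2 v0) (peq_appl ta2 v0 (ea _))).
  exact: peq_id.
- move: wd ws => /= wda wa.
  have [ta _] := IHa _ _ _ _ wa kn hd.
  have tm := tm_in_bang_map wda ta.
  split => // H; apply: bang_ind => //; first exact: tm_in_id.
  rewrite eshift_idtm /eshift (eren_as_esub _ _ (bang_map _ _)) esub_bang_map -!eren_as_esub.
  rewrite -/(eshift 0 1 _) !eshift_act -!tren_as_tsub !tren0.
  set c2 := c ▷ _; set H2 := wkH _ _.
  have [ta2 ea] := IHa _ _ _ c2 wa kn hd.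
  have v : tm_in c2 (Var 0) (tsub d a) by ctm_var.
  have wda2 : wf_ty (cty c2) (tsub d a) by [].
  have tm2 := tm_in_bang_map wda2 ta2.
  have tv := tm_in_bang v.
  apply: (peq_trans (tm_in_app tm2 tv) (peq_bang_map H2 wda2 ta2 v)).
  have ia := tm_in_id wda2.
  have iab := @tm_in_id c2 (TBang (tsub d a)) wda.
  apply: (@peq_trans _ _ _ (Bang (Var 0))).
  + exact: tm_in_bang (tm_in_app ta2 v).
  + apply: peq_bang; first exact: tm_in_app ta2 v.
    by apply: (peq_trans (tm_in_app ta2 v) (peq_appl ta2 v (ea _))); apply: peq_id.
  + by apply: peq_sym; [exact: tm_in_app iab tv | apply: peq_id].
- move: wd ws => /= wda wa; rewrite /eshift eren_idtm -[tren (addn 1) (d k)]/(upt d k.+1).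
  have [ta _] := IHa _ k.+1 _ (c ▷□) wa kn (wf_upt hd).
  have tm := tm_in_pi_map wda ta.
  split => // H; apply: peq_funext => //; first exact: tm_in_id.
  set lm := pi_map _ _ in tm *.
  have e m : eshift 0 m lm = lm.
    rewrite /eshift (eren_as_esub _ _ lm) esub_pi_map.
    have -> : (fun i => eren (addn 1) (addn 0) ((Var \o addn m) i)) = Var \o addn m by [].
    have -> : upt (TVar \o addn 0) = TVar \o addn 0 by rewrite upt_var; congr (_ \o _); exact: upr_id.
    by rewrite -eren_as_esub -/(eshift 0 m _) eshift_act -tren_as_tsub tren0.
  rewrite e eshift_idtm; set c1 := c ▷ _; set H1 := wkH _ _.
  have [ta1 _] := IHa _ k.+1 _ (c1 ▷□) wa kn (wf_upt hd).
  have v : tm_in c1 (Var 0) (TPi (tsub (upt d) a)) by ctm_var.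
  have tm1 := tm_in_pi_map (c := c1) wda ta1.
  have tv := tm_in_app tm1 v.
  have i1 := @tm_in_id c1 (TPi (tsub (upt d) a)) wda.
  apply: (@peq_trans _ _ _ (Var 0)) => //; last first.
    by apply: peq_sym; [exact: tm_in_app i1 v | apply: peq_id].
  apply: peq_tfunext => //.
  set c2 := c1 ▷□; set H2 := wkH _ _.
  pose d' := tren (addn 1) \o d.
  have ed : tren (upr (addn 1)) \o upt d = upt d' by rewrite upr_upt.
  have es : tren (upr (addn 1)) (tsub (upt d) a) = tsub (upt d') a by rewrite tren_tsub ed.
  have hd' : forall i, i < n -> wf_ty (cty c2) (d' i) by move=> i hi; apply: wf_tren (hd i hi).
  have e1 : eshift 1 0 lm = pi_map (TPi (tsub (upt d') a)) (act k.+1 (upt d') (upt d')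
    (idtm (upt d' k.+1)) a).
    rewrite /lm /eshift (eren_as_esub _ _ (pi_map _ _)) esub_pi_map -tren_as_tsub /= es; congr pi_map.
    have -> : upt (TVar \o addn 1) = TVar \o upr (addn 1) by rewrite upt_var.
    have -> : (fun i => eren (addn 1) (addn 0) (Var (0 + i))) = Var \o id by [].
    by rewrite -eren_as_esub act_eren ed eren_idtm -[tren _ (tren _ _)]/((tren (upr (addn 1)) \o upt d)
      k.+1) ed.
  rewrite -[eshift 1 0 (App lm (Var 0))]/(App (eshift 1 0 lm) (Var 0)) e1.
  set X' := act _ _ _ _ _.
  have wda2 : wf_ty (cty c2).+1 (tsub (upt d') a) by apply: wf_tsub (wf_upt hd') wa.
  have [ta3 _] := IHa _ k.+1 _ (c2 ▷□) wa kn (wf_upt hd').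
  have v2 : tm_in c2 (Var 0) (TPi (tsub (upt d') a)) by apply: tm_in_var; rewrite /= es.
  have w0 : wf_ty (cty c2) (TVar 0) by [].
  have ex : tapp (tsub (upt d') a) (TVar 0) = tsub (upt d) a by rewrite -es; apply: tapp_upr_var.
  (* Weakening by a fresh type variable and then instantiating the bound one with it gives back the
     action at [upt d], to which the induction hypothesis applies. *)
  have eX : esub (scons (TVar 0) TVar) Var X' = act k.+1 (upt d) (upt d) (idtm (upt d k.+1)) a.
    have e2 : tsub (scons (TVar 0) TVar) \o upt d' = upt d.
      by rewrite -ed; fext => i; exact: tapp_upr_var.
    by rewrite /X' act_esub e2 esub_idtm -[tsub _ (upt d' k.+1)]/((tsub (scons (TVar 0) TVar) \o upt d')
      k.+1) e2.
  have [tX eX2] := IHa _ k.+1 _ c2 wa kn (wf_upt hd).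
  have P := peq_pi_map H2 wda2 ta3 v2 w0; rewrite ex -/X' eX in P.
  have tm2 := tm_in_pi_map wda2 ta3.
  have tv2 := tm_in_tapp (tm_in_app tm2 v2) w0 ex.
  have tu := tm_in_tapp v2 w0 ex.
  apply: (peq_trans tv2 P).
  apply: (peq_trans (tm_in_app tX tu) (peq_appl tX tu (eX2 _))).
  by apply: peq_id => //; apply: wf_tsub (wf_upt hd) wa.
Qed.

(** Typability in the empty context serves as the notion of closedness. It makes [fold_tm], [in_tm],
    [pack_tm], [unfold_tm] and [out_tm] invariant under substitution without unfolding them. *)
Lemma closed_esub t a st se : tm_in (Ctx 0 [::] [::]) t a -> esub st se t = t.
Proof. by case/tm_inE => h _; apply: sty_esub_id h _ _ _ _. Qed.

Lemma esub_ILam st se A t : esub st se (ILam A t) = ILam (tsub st A) (esub st (upe se) t).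
Proof.
rewrite /ILam /= esub_eren eren_esub; congr (Lam _ (LetB _ _)); apply: esub_ext => i /=.
  by rewrite tren_id.
by case: i => [|i] //=; rewrite /eshift !eren_eren.
Qed.

Lemma lcount_ILam i A t : lcount i (ILam A t) = lcount i.+1 t.
Proof. by rewrite /ILam /= (@lcount_eren _ _ _ i.+1) // => -[|k]. Qed.

Lemma lcount_lol_map i A B f g : lcount i (lol_map A B f g) = lcount i g + lcount i f.
Proof.
change (lcount i.+1 (tcomp B (eshift 0 1 g) (tcomp B (Var 0) (eshift 0 1 f))) = lcount i g + lcount i f).
by rewrite !lcount_tcomp !lcount_eshift /= !subSS !subn0.
Qed.

Lemma lcount_act0 s i k d e f : lcount i f = 0 -> lcount i (act k d e f s) = 0.
Proof.
elim: s k d e f => [j||a IHa b IHb|a IHa b IHb|a IHa|a IHa] k d e f hf; rewrite actE;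
  (case: (closed_ty _); first by []).
- by case: eqP.
- by [].
- by rewrite /= !lcount_eshift /= !subSS !subn0 IHa ?IHb.
- by rewrite lcount_lol_map IHa ?IHb.
- by rewrite /= !lcount_eshift /= !subSS !subn0 IHa.
- by rewrite /= !lcount_eshift /= !subn1 /= IHa // lcount_eshift subn0.
Qed.

Lemma lcount_fmap0 s i a b f : lcount i f = 0 -> lcount i (fmap s a b f) = 0.
Proof. exact: lcount_act0. Qed.

Lemma closed_eshift t a k m : tm_in (Ctx 0 [::] [::]) t a -> eshift k m t = t.
Proof. by move=> h; rewrite /eshift eren_as_esub; apply: closed_esub h. Qed.

Lemma closed_lcount t a i : tm_in (Ctx 0 [::] [::]) t a -> lcount i t = 0.
Proof. by move=> h; rewrite -(closed_eshift 0 i.+1 h) lcount_eshift ltnSn. Qed.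

(** * The functor given by [s], and the equations of [fold] and [in] *)

Section Functor.
Variables (s : ty) (ws : wf_ty 1 s).

Lemma tsub_s d : tsub d s = tapp s (d 0).
Proof. by apply: eq_tsub ws _ => -[]. Qed.

Lemma tsub_tapp_s d a : tsub d (tapp s a) = tapp s (tsub d a).
Proof. by rewrite {1}/tapp tsub_tsub tsub_s. Qed.

Lemma tren_tapp_s r a : tren r (tapp s a) = tapp s (tren r a).
Proof. by rewrite !tren_as_tsub tsub_tapp_s. Qed.

Lemma tapp_s_var : tapp s (TVar 0) = s.
Proof. by rewrite -[RHS]tsub_id tsub_s. Qed.

Lemma wf_tapp_s n a : wf_ty n a -> wf_ty n (tapp s a).
Proof. by move=> wa; apply: wf_tsub ws => -[]. Qed.

Lemma wf_s n : wf_ty n.+1 s.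
Proof. exact: wf_ty_le ws. Qed.

Lemma wf_mu n : wf_ty n (mu s).
Proof. by apply: (@wf_ty_le 0) => //; rewrite /mu /= ws. Qed.

Lemma wf_nu n : wf_ty n (nu s).
Proof. by apply: (@wf_ty_le 0) => //; rewrite /nu /= wf_s. Qed.

Lemma tsub_mu d : tsub d (mu s) = mu s.
Proof. exact: tsub_closed (wf_mu 0). Qed.

Lemma tsub_nu d : tsub d (nu s) = nu s.
Proof. exact: tsub_closed (wf_nu 0). Qed.

Lemma tren_mu r : tren r (mu s) = mu s.
Proof. exact: tren_closed (wf_mu 0). Qed.

Lemma tren_nu r : tren r (nu s) = nu s.
Proof. exact: tren_closed (wf_nu 0). Qed.

Lemma muE : mu s = TPi (TArr (TLol s (TVar 0)) (TVar 0)).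
Proof. by []. Qed.

Lemma nuE : nu s = TPi (TLol (TPi (TLol (coalg_ty s) (TVar 1))) (TVar 0)).
Proof. by []. Qed.

Opaque mu nu fmap idtm tcomp fold_tm ILam.

Variable ps : occurs_only true 0 s.

Section Fmap.
Variables (c : ctx) (a b : ty).
Hypotheses (wa : wf_ty (cty c) a) (wb : wf_ty (cty c) b).

Lemma tm_in_fmap f : tm_in c f (TLol a b) -> tm_in c (fmap s a b f) (TLol (tapp s a) (tapp s b)).
Proof.
move=> hf; apply: (@tm_in_act s 1 0 (scons a TVar) (scons b TVar) f c ws _ _ _ hf).1 => //.
- by case.
- by case.
- by case.
Qed.

Lemma peq_fmap_id H : pv c H (PEq (TLol (tapp s a) (tapp s a)) (fmap s a a (idtm a)) (idtm (tapp s a))).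
Proof.
by apply: (@peq_act_id s 1 0 (scons a TVar) c ws _ _).2 => // -[].
Qed.

End Fmap.

Lemma peq_fmap c H a b f g : wf_ty (cty c) a -> wf_ty (cty c) b -> tm_in c f (TLol a b) ->
  pv c H (PEq (TLol a b) f g) ->
  pv c H (PEq (TLol (tapp s a) (tapp s b)) (fmap s a b f) (fmap s a b g)).
Proof.
move=> wa wb hf E.
have ht : tm_in (c ▷ TLol a b) (fmap s a b (Var 0)) (TLol (tapp s a) (tapp s b)).
  by apply: tm_in_fmap => //; ctm_var.
by have := peq_subst ht hf E; rewrite !esub_fmap //= !tsub_id.
Qed.

Lemma tm_in_fold_body c b : wf_ty (cty c) b ->
  tm_in (c ▷ TLol (tapp s b) b) (Lam (mu s) (App (TApp (Var 0) b) (Bang (Var 1)))) (TLol (mu s) b).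
Proof.
move=> wb; apply: tm_in_lam => //; first exact: wf_mu.
apply: (@tm_in_app _ (TBang (TLol (tapp s b) b))); last by apply: tm_in_bang; ctm_var.
by apply: (@tm_in_tapp _ (TArr (TLol s (TVar 0)) (TVar 0))) => //; rewrite -muE; ctm_var.
Qed.

Lemma tm_in_fold c : tm_in c (fold_tm s) (TPi (TArr (TLol s (TVar 0)) (TLol (mu s) (TVar 0)))).
Proof.
have w0 : wf_ty (cty (c ▷□)) (TVar 0) by [].
apply: tm_in_tlam; have h := tm_in_fold_body w0; rewrite tapp_s_var in h.
by apply: (tm_in_ILam _ h); rewrite /= wf_s.
Qed.

Lemma fold_esub st se : esub st se (fold_tm s) = fold_tm s.
Proof. exact: closed_esub (tm_in_fold _). Qed.

Lemma fold_tapp b : tapp (TArr (TLol s (TVar 0)) (TLol (mu s) (TVar 0))) b = TArr (TLol (tapp s b) b)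
  (TLol (mu s) b).
Proof. by rewrite /tapp /= tsub_mu. Qed.

Section Fold.
Variables (c : ctx) (H : seq prop) (b : ty) (g u : tm).
Hypotheses (wb : wf_ty (cty c) b) (hg : tm_in c g (TLol (tapp s b) b)) (hu : tm_in c u (mu s)).

Lemma tm_in_foldg : tm_in c (App (TApp (fold_tm s) b) (Bang g)) (TLol (mu s) b).
Proof.
apply: (@tm_in_app _ (TBang (TLol (tapp s b) b))); last exact: tm_in_bang.
by apply: (tm_in_tapp (tm_in_fold c) wb); exact: fold_tapp.
Qed.

Lemma tm_in_mu_app : tm_in c (App (TApp u b) (Bang g)) b.
Proof.
apply: (@tm_in_app _ (TBang (TLol (tapp s b) b))); last exact: tm_in_bang.
by apply: (@tm_in_tapp _ (TArr (TLol s (TVar 0)) (TVar 0))) => //; rewrite -muE.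
Qed.

Lemma peq_fold : pv c H (PEq b (App (App (TApp (fold_tm s) b) (Bang g)) u) (App (TApp u b) (Bang g))).
Proof.
have hF := tm_in_tapp (tm_in_fold c) wb (fold_tapp b).
have hb := tm_in_bang hg.
have w0 : wf_ty (cty (c ▷□)) (TVar 0) by [].
have h0 := tm_in_fold_body w0; rewrite tapp_s_var in h0.
have h1 := tm_in_ILam (c := c ▷□) (a := TLol s (TVar 0)) _ h0.
have {}h1 := h1 ltac:(by rewrite /= wf_s).
have E1 := peq_tbeta H wb h1 (fold_tapp b).
rewrite esub_ILam /= !tsub_s /= tsub_mu in E1.
have h2 := tm_in_fold_body wb.
have wB : wf_ty (cty c) (TLol (tapp s b) b) by rewrite /= wf_tapp_s.
have E2 := peq_ibeta H wB h2 hg.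
have t2 := tm_in_inst h2 hg.
rewrite /= tsub_mu tsub_id -/(eshift 0 1 g) in E2 t2.
have h3 : tm_in (c ▷ mu s) (App (TApp (Var 0) b) (Bang (eshift 0 1 g))) b.
  apply: (@tm_in_app _ (TBang (TLol (tapp s b) b))); last by apply: tm_in_bang; apply: tm_in_wk.
  by apply: (@tm_in_tapp _ (TArr (TLol s (TVar 0)) (TVar 0))) => //; rewrite -muE; ctm_var.
have E3 := peq_beta H (wf_mu _) h3 _ hu; rewrite /= lcount_eshift /= esub_inst_wk tsub_id in E3.
apply: (peq_trans (tm_in_app (tm_in_app hF hb) hu) _ (E3 isT)).
apply: (peq_appl (tm_in_app hF hb) hu).
apply: (peq_trans (tm_in_app hF hb) _ E2).
exact: (peq_appl hF hb E1).
Qed.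
End Fold.
End Functor.

Opaque mu nu fmap idtm tcomp fold_tm ILam.

Section InOut.
Variables (s : ty) (ws : wf_ty 1 s) (ps : occurs_only true 0 s).

Local Notation foldg b g := (App (TApp (fold_tm s) b) (Bang g)).

Lemma in_esub_body st se b g :
  esub st se (fmap s (mu s) b (foldg b g)) = fmap s (mu s) (tsub st b) (foldg (tsub st b) (esub st se g)).
Proof. by rewrite esub_fmap //= (fold_esub ws) (tsub_mu ws). Qed.

Lemma eshift_fmap m a b f : eshift 0 m (fmap s a b f) = fmap s a b (eshift 0 m f).
Proof. by rewrite /eshift eren_fmap // !tren0. Qed.

Lemma tm_in_in_body c b z : wf_ty (cty c) b -> tm_in c z (tapp s (mu s)) ->
  tm_in (c ▷ TLol (tapp s b) b) (App (Var 0) (App (fmap s (mu s) b (foldg b (Var 0))) (eshift 0 1 z))) b.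
Proof.
move=> wb hz; apply: (@tm_in_app _ (tapp s b)); first by ctm_var.
apply: (@tm_in_app _ (tapp s (mu s))); last exact: tm_in_wk.
apply: tm_in_fmap => //; first exact: wf_mu.
by apply: tm_in_foldg => //; ctm_var.
Qed.

Lemma tm_in_in_body2 c z : tm_in c z (tapp s (mu s)) ->
  tm_in c (TLam (ILam (TLol s (TVar 0))
    (App (Var 0) (App (fmap s (mu s) (TVar 0) (foldg (TVar 0) (Var 0))) (eshift 1 1 z))))) (mu s).
Proof.
move=> hz; rewrite muE; apply: tm_in_tlam.
have w0 : wf_ty (cty (c ▷□)) (TVar 0) by [].
have hz' := tm_in_wkT hz; rewrite (tren_tapp_s ws) (tren_mu ws) in hz'.
have h := tm_in_in_body w0 hz'; rewrite (tapp_s_var ws) in h.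
have -> : eshift 1 1 z = eshift 0 1 (eshift 1 0 z) by rewrite /eshift eren_eren.
by apply: (tm_in_ILam _ h); rewrite /= wf_s.
Qed.

Lemma tm_in_in c : tm_in c (in_tm s) (TLol (tapp s (mu s)) (mu s)).
Proof.
have wm := wf_tapp_s ws (wf_mu ws (cty c)).
apply: tm_in_lam => //; last first.
  by rewrite /= lcount_ILam /= lcount_fmap0 //= (closed_lcount _ (tm_in_fold ws _)).
have hv : tm_in (c ▷ tapp s (mu s)) (Var 0) (tapp s (mu s)) by ctm_var.
exact: tm_in_in_body2 hv.
Qed.

Lemma peq_in c H b g z : wf_ty (cty c) b -> tm_in c g (TLol (tapp s b) b) -> tm_in c z (tapp s (mu s)) ->
  pv c H (PEq b (App (TApp (App (in_tm s) z) b) (Bang g)) (App g (App (fmap s (mu s) b (foldg b g)) z))).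
Proof.
move=> wb hg hz.
have hi := tm_in_app (tm_in_in c) hz.
set bd := fun z => TLam (ILam (TLol s (TVar 0))
  (App (Var 0) (App (fmap s (mu s) (TVar 0) (foldg (TVar 0) (Var 0))) (eshift 1 1 z)))).
have hbd := tm_in_in_body2 hz; rewrite -/(bd z) in hbd.
have E1 : pv c H (PEq (mu s) (App (in_tm s) z) (bd z)).
  apply: prv_eqI; apply: (eeq_cast (eeq_beta hi)).
  rewrite /bd /= esub_ILam /= in_esub_body ?upt_TVar /= ?tsub_id; congr
    (TLam (ILam _ (App _ (App _ _)))); by rewrite /eshift eren_eren.
have eT : tapp (TArr (TLol s (TVar 0)) (TVar 0)) b = TArr (TLol (tapp s b) b) b by [].
have w0 : wf_ty (cty (c ▷□)) (TVar 0) by [].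
have hz' := tm_in_wkT hz; rewrite (tren_tapp_s ws) (tren_mu ws) in hz'.
have h := tm_in_in_body w0 hz'; rewrite (tapp_s_var ws) in h.
have e2 : eshift 0 1 (eshift 1 0 z) = eshift 1 1 z by rewrite /eshift eren_eren.
rewrite e2 in h.
have wS : wf_ty (cty (c ▷□)) (TLol s (TVar 0)) by rewrite /= wf_s.
have E2 := peq_tbeta H wb (tm_in_ILam wS h) eT.
have e3 : esub (scons b TVar) (upe Var) (eshift 1 1 z) = eshift 0 1 z by eleaf.
rewrite esub_ILam /= in_esub_body e3 /= (tsub_s ws) /= in E2.
have hb := tm_in_bang hg.
have tA : tm_in c (TApp (App (in_tm s) z) b) (TArr (TLol (tapp s b) b) b).
  by apply: (@tm_in_tapp _ (TArr (TLol s (TVar 0)) (TVar 0))) => //; rewrite -muE.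
have tB : tm_in c (TApp (bd z) b) (TArr (TLol (tapp s b) b) b).
  by apply: (@tm_in_tapp _ (TArr (TLol s (TVar 0)) (TVar 0))) => //; rewrite -muE.
have h3 := tm_in_in_body wb hz.
have wB : wf_ty (cty c) (TLol (tapp s b) b) by rewrite /= wf_tapp_s.
have E3 := peq_ibeta H wB h3 hg.
rewrite /= in_esub_body /= tsub_id esub_inst_wk in E3.
apply: (peq_trans (tm_in_app tA hb) _ E3); apply: (peq_appl tA hb).
apply: (peq_trans tA _ E2); apply: (@peq_tapp _ _ (TArr (TLol s (TVar 0)) (TVar 0))) => //; by rewrite -muE.
Qed.

End InOut.

Opaque in_tm.

(** * The equations of [pack], [unfold] and [out] *)

Section PackOut.
Variables (s : ty) (ws : wf_ty 1 s) (ps : occurs_only true 0 s).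

Definition coalgT (a : ty) : ty := TTens (TBang (TLol a (tapp s a))) a.
(** Continuations that consume a coalgebra together with a state, uniformly in the state type. An
    element of [nu s] at the type [b] is a map from [contT b] to [b], so that [nu s] encodes the
    existential type of pairs of a coalgebra and a state. *)
Definition contT (b : ty) : ty := TPi (TLol (coalg_ty s) (tren S b)).

Lemma tsub_coalgT d a : tsub d (coalgT a) = coalgT (tsub d a).
Proof. by rewrite /coalgT /= (tsub_tapp_s ws). Qed.

Lemma tren_coalgT r a : tren r (coalgT a) = coalgT (tren r a).
Proof. by rewrite /coalgT /= (tren_tapp_s ws). Qed.

Lemma coalg_tyE : coalg_ty s = coalgT (TVar 0).
Proof. by rewrite /coalgT (tapp_s_var ws). Qed.

Lemma tsub_coalg_ty d : tsub d (coalg_ty s) = coalgT (d 0).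
Proof. by rewrite coalg_tyE tsub_coalgT. Qed.

Lemma wf_coalgT n a : wf_ty n a -> wf_ty n (coalgT a).
Proof. by move=> wa; rewrite /= wa wf_tapp_s. Qed.

Lemma wf_coalg_ty n : wf_ty n.+1 (coalg_ty s).
Proof. by rewrite coalg_tyE wf_coalgT. Qed.

Lemma wf_contT n b : wf_ty n b -> wf_ty n (contT b).
Proof.
move=> wb; change (wf_ty n.+1 (coalg_ty s) && wf_ty n.+1 (tren S b)).
by rewrite wf_coalg_ty; apply: wf_tren wb.
Qed.

Lemma tren_contT r b : tren r (contT b) = contT (tren r b).
Proof.
rewrite /contT [LHS]/= -/(coalg_ty s) !tren_tren; congr (TPi (TLol _ _)).
by rewrite -[LHS]/(tren (upr r) (coalg_ty s)) coalg_tyE tren_coalgT.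
Qed.

Lemma tsub_contT d b : tsub d (contT b) = contT (tsub d b).
Proof.
rewrite /contT -[LHS]/(TPi (TLol (tsub (upt d) (coalg_ty s)) (tsub (upt d) (tren S b)))) tsub_coalg_ty
  -coalg_tyE.
by rewrite tsub_tren tren_tsub.
Qed.

Lemma nu_contT : nu s = TPi (TLol (contT (TVar 0)) (TVar 0)).
Proof. exact: nuE. Qed.

Lemma tapp_cont a b : tapp (TLol (coalg_ty s) (tren S b)) a = TLol (coalgT a) b.
Proof.
by rewrite -[LHS]/(TLol (tsub (scons a TVar) (coalg_ty s)) (tsub (scons a TVar) (tren S b)))
  tsub_coalg_ty tsub_inst_wk.
Qed.

Lemma tapp_nu b : tapp (TLol (contT (TVar 0)) (TVar 0)) b = TLol (contT b) b.
Proof. by rewrite -[LHS]/(TLol (tsub (scons b TVar) (contT (TVar 0))) b) tsub_contT. Qed.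

Lemma tm_in_cont_app c a b k z : wf_ty (cty c) a -> tm_in c k (contT b) -> tm_in c z (coalgT a) ->
  tm_in c (App (TApp k a) z) b.
Proof.
move=> wa hk hz; apply: (@tm_in_app _ (coalgT a)) => //.
exact: (tm_in_tapp hk wa (tapp_cont a b)).
Qed.

Lemma tm_in_nu_app c b u k : wf_ty (cty c) b -> tm_in c u (nu s) -> tm_in c k (contT b) ->
  tm_in c (App (TApp u b) k) b.
Proof.
move=> wb hu hk; apply: (@tm_in_app _ (contT b)) => //.
by apply: tm_in_tapp wb (tapp_nu b); rewrite -nu_contT.
Qed.

Definition packz (a : ty) (z : tm) : tm :=
  TLam (Lam (contT (TVar 0)) (App (TApp (Var 0) (tren S a)) (eshift 1 1 z))).

Lemma tm_in_packz_body c a b z : wf_ty (cty c) a -> tm_in c z (coalgT a) ->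
  tm_in (c ▷ contT b) (App (TApp (Var 0) a) (eshift 0 1 z)) b.
Proof.
by move=> wa hz; apply: tm_in_cont_app => //; [ctm_var | apply: tm_in_wk].
Qed.

Lemma tm_in_packz_lam c a z : wf_ty (cty c) a -> tm_in c z (coalgT a) ->
  tm_in (c ▷□) (Lam (contT (TVar 0)) (App (TApp (Var 0) (tren S a)) (eshift 1 1 z)))
    (TLol (contT (TVar 0)) (TVar 0)).
Proof.
move=> wa hz; apply: tm_in_lam => //; first exact: wf_contT; last by rewrite /= lcount_eshift.
have -> : eshift 1 1 z = eshift 0 1 (eshift 1 0 z) by rewrite /eshift eren_eren.
apply: (@tm_in_packz_body (c ▷□)); first by apply: wf_tren wa.
by rewrite -tren_coalgT; apply: tm_in_wkT.
Qed.

Lemma tm_in_packz c a z : wf_ty (cty c) a -> tm_in c z (coalgT a) -> tm_in c (packz a z) (nu s).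
Proof. by move=> wa hz; rewrite nu_contT; apply: tm_in_tlam; apply: tm_in_packz_lam. Qed.

Lemma tm_in_pack_body c a : wf_ty (cty c) a -> 
  tm_in c (Lam (coalgT a) (packz a (Var 0))) (TLol (coalgT a) (nu s)).
Proof.
move=> wa; apply: tm_in_lam => //; first exact: wf_coalgT.
by apply: tm_in_packz => //; ctm_var.
Qed.

Lemma pack_tmE : pack_tm s = TLam (Lam (coalgT (TVar 0)) (packz (TVar 0) (Var 0))).
Proof. by rewrite /packz -!coalg_tyE. Qed.

Lemma tm_in_pack c : tm_in c (pack_tm s) (TPi (TLol (coalg_ty s) (nu s))).
Proof. by rewrite pack_tmE coalg_tyE; apply: tm_in_tlam; apply: tm_in_pack_body. Qed.

Lemma tapp_pack a : tapp (TLol (coalg_ty s) (nu s)) a = TLol (coalgT a) (nu s).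
Proof. by rewrite -[nu s in LHS](tren_nu ws S); exact: tapp_cont. Qed.

Lemma pack_esub st se : esub st se (pack_tm s) = pack_tm s.
Proof. exact: closed_esub (tm_in_pack _). Qed.

Lemma tm_in_packa c a z : wf_ty (cty c) a -> tm_in c z (coalgT a) -> tm_in c (App (TApp (pack_tm s) a)
  z) (nu s).
Proof. by move=> wa hz; apply: tm_in_app (tm_in_tapp (tm_in_pack c) wa (tapp_pack a)) hz. Qed.

Lemma peq_pack c H a b z k : wf_ty (cty c) a -> wf_ty (cty c) b -> tm_in c z (coalgT a) -> tm_in c k
  (contT b) ->
  pv c H (PEq b (App (TApp (App (TApp (pack_tm s) a) z) b) k) (App (TApp k a) z)).
Proof.
move=> wa wb hz hk.
have hp := tm_in_tapp (tm_in_pack c) wa (tapp_pack a).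
have w0 : wf_ty (cty (c ▷□)) (TVar 0) by [].
have E1 : pv c H (PEq (TLol (coalgT a) (nu s)) (TApp (pack_tm s) a) (Lam (coalgT a) (packz a (Var 0)))).
  have h := tm_in_pack_body w0; rewrite -coalg_tyE in h.
  have := peq_tbeta H wa h (tapp_pack a); rewrite {1}coalg_tyE -pack_tmE => E.
  apply: (pv_eq E); congr PEq.
  rewrite -[LHS]/(Lam (tsub (scons a TVar) (coalg_ty s))
    (TLam (Lam (tsub (upt (scons a TVar)) (contT (TVar 0)))
    (App (TApp (Var 0) (tren S a)) (Var 1))))).
  by rewrite tsub_coalg_ty tsub_contT.
have hpb := tm_in_pack_body wa.
have E2 : pv c H (PEq (nu s) (App (Lam (coalgT a) (packz a (Var 0))) z) (packz a z)).
  apply: prv_eqI; apply: (eeq_cast (eeq_beta (tm_in_app hpb hz))).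
  rewrite /packz -[LHS]/(TLam (Lam (tsub (upt TVar) (contT (TVar 0)))
    (App (TApp (Var 0) (tsub (upt TVar) (tren S a))) _))).
  by rewrite tsub_contT upt_TVar !tsub_id; congr (TLam (Lam _ (App _ _))); rewrite /= /eshift eren_eren.
have hz1 := tm_in_packz_lam wa hz; have hz2 := tm_in_packz wa hz.
have E3 := peq_tbeta H wb hz1 (tapp_nu b); rewrite -/(packz a z) in E3.
have hb := tm_in_packz_body b wa hz.
have E4 := peq_beta H (wf_contT wb) hb _ hk; rewrite /= lcount_eshift /= tsub_id esub_inst_wk in E4.
have e3 : esub (scons b TVar) Var (Lam (contT (TVar 0)) (App (TApp (Var 0) (tren succn a)) (eshift 1 1 z))) =
  Lam (contT b) (App (TApp (Var 0) a) (eshift 0 1 z)).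
  rewrite -[LHS]/(Lam (tsub (scons b TVar) (contT (TVar 0)))
    (App (TApp (Var 0) (tsub (scons b TVar) (tren succn a))) (esub (scons b TVar) (upe Var) (eshift 1 1 z)))).
  by rewrite tsub_contT tsub_inst_wk; congr (Lam _ (App _ _)); eleaf.
rewrite e3 in E3.
have tz := tm_in_packa wa hz.
have t1 : tm_in c (TApp (App (TApp (pack_tm s) a) z) b) (TLol (contT b) b).
  by apply: tm_in_tapp wb (tapp_nu b); rewrite -nu_contT.
apply: (peq_trans (tm_in_app t1 hk) _ (E4 isT)); apply: (peq_appl t1 hk).
apply: (peq_trans t1 _ E3); apply: (peq_tapp _ wb (tapp_nu b)); rewrite -nu_contT //.
apply: (peq_trans tz _ E2); exact: (peq_appl hp hz E1).
Qed.
End PackOut.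

Opaque pack_tm.

Section UnfoldOut.
Variables (s : ty) (ws : wf_ty 1 s) (ps : occurs_only true 0 s).

Local Notation coT := (coalgT s).
Local Notation mor a := (TLol a (tapp s a)).
Local Notation packa a := (TApp (pack_tm s) a).
Local Notation unfoldf a f := (App (TApp (unfold_tm s) a) (Bang f)).

Definition unfold_lam (a : ty) : tm :=
  Lam (TBang (mor a)) (Lam a (App (packa a) (Tens (Var 1) (Var 0)))).

Lemma wf_mor n a : wf_ty n a -> wf_ty n (mor a).
Proof. by move=> wa; rewrite /= wa wf_tapp_s. Qed.

Lemma tm_in_unfold_body c a w : wf_ty (cty c) a -> tm_in c w (TBang (mor a)) ->
  tm_in c (Lam a (App (packa a) (Tens (eshift 0 1 w) (Var 0)))) (TLol a (nu s)).
Proof.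
move=> wa hw; apply: tm_in_lam => //; last by rewrite /= (closed_lcount _ (tm_in_pack ws _)) lcount_eshift.
by apply: tm_in_packa => //; apply: tm_in_tens; [apply: tm_in_wk | ctm_var].
Qed.

Lemma tm_in_unfold_lam c a : wf_ty (cty c) a ->
  tm_in c (unfold_lam a) (TLol (TBang (mor a)) (TLol a (nu s))).
Proof.
move=> wa; apply: tm_in_lam; first exact: wf_mor.
  by apply: (@tm_in_unfold_body _ a (Var 0)) => //; ctm_var.
by rewrite /= (closed_lcount _ (tm_in_pack ws _)).
Qed.

Lemma unfold_tmE : unfold_tm s = TLam (unfold_lam (TVar 0)).
Proof. by rewrite /unfold_lam (tapp_s_var ws). Qed.

Lemma tm_in_unfold c : tm_in c (unfold_tm s) (TPi (TLol (TBang (TLol (TVar 0) s)) (TLol (TVar 0) (nu s)))).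
Proof.
rewrite unfold_tmE; apply: tm_in_tlam.
by have := @tm_in_unfold_lam (c ▷□) (TVar 0) isT; rewrite (tapp_s_var ws).
Qed.

Lemma unfold_esub st se : esub st se (unfold_tm s) = unfold_tm s.
Proof. exact: closed_esub (tm_in_unfold _). Qed.

Lemma tapp_unfold a : tapp (TLol (TBang (TLol (TVar 0) s)) (TLol (TVar 0) (nu s))) a = TLol
  (TBang (mor a)) (TLol a (nu s)).
Proof. by rewrite -[LHS]/(TLol (TBang (mor a)) (TLol a (tsub (scons a TVar) (nu s)))) (tsub_nu ws). Qed.

Lemma tm_in_unfoldf c a f : wf_ty (cty c) a -> tm_in c f (mor a) -> tm_in c (unfoldf a f) (TLol a (nu s)).
Proof.
move=> wa hf; apply: tm_in_app (tm_in_bang hf).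
exact: tm_in_tapp (tm_in_unfold c) wa (tapp_unfold a).
Qed.

Lemma unfoldf_esub st se a f : esub st se (unfoldf a f) = unfoldf (tsub st a) (esub st se f).
Proof. by rewrite -[LHS]/(App (TApp (esub st se (unfold_tm s)) (tsub st a)) (Bang (esub st se f)))
  unfold_esub. Qed.

Lemma peq_unfold c H a f x : wf_ty (cty c) a -> tm_in c f (mor a) -> tm_in c x a ->
  pv c H (PEq (nu s) (App (unfoldf a f) x) (App (packa a) (Tens (Bang f) x))).
Proof.
move=> wa hf hx.
have hu := tm_in_tapp (tm_in_unfold c) wa (tapp_unfold a).
have hb := tm_in_bang hf.
have h0 := @tm_in_unfold_lam (c ▷□) (TVar 0) isT; rewrite (tapp_s_var ws) in h0.
have E1 := peq_tbeta H wa h0 (tapp_unfold a); rewrite -unfold_tmE in E1.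
have e1 : esub (scons a TVar) Var (unfold_lam (TVar 0)) = unfold_lam a.
  rewrite -[LHS]/(Lam (TBang (TLol a (tsub (scons a TVar) (tapp s (TVar 0)))))
    (Lam a (App (TApp (esub _ _ (pack_tm s)) a) (Tens (Var 1) (Var 0))))).
  by rewrite (tsub_tapp_s ws) (pack_esub ws).
rewrite e1 in E1.
have hl := tm_in_unfold_lam wa.
have E2 : pv c H (PEq (TLol a (nu s)) (App (unfold_lam a) (Bang f))
  (Lam a (App (packa a) (Tens (eshift 0 1 (Bang f)) (Var 0))))).
  apply: prv_eqI; apply: (eeq_cast (eeq_beta (tm_in_app hl hb))).
  rewrite -[LHS]/(Lam (tsub TVar a) (App (TApp (esub _ _ (pack_tm s)) (tsub TVar a))
    (Tens (eshift 0 1 (Bang f)) (Var 0)))).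
  by rewrite tsub_id (pack_esub ws).
have hbd := tm_in_unfold_body wa hb.
have E3 : pv c H (PEq (nu s) (App (Lam a (App (packa a) (Tens (eshift 0 1 (Bang f)) (Var 0)))) x)
  (App (packa a) (Tens (Bang f) x))).
  apply: prv_eqI; apply: (eeq_cast (eeq_beta (tm_in_app hbd hx))).
  rewrite -[LHS]/(App (TApp (esub _ _ (pack_tm s)) (tsub TVar a))
    (Tens (Bang (esub TVar (scons x Var) (eshift 0 1 f))) x)).
  by rewrite tsub_id (pack_esub ws) esub_inst_wk.
have t1 := tm_in_app hu hb.
apply: (peq_trans (tm_in_app t1 hx) _ E3); apply: (peq_appl t1 hx).
apply: (peq_trans t1 _ E2); exact: (peq_appl hu hb E1).
Qed.

Definition out_lam (a : ty) : tm :=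
  Lam (coT a) (LetT (Var 0) (LetB (Var 1)
      (App (fmap s a (nu s) (unfoldf a (Var 0))) (App (Var 0) (Var 1))))).

Lemma tm_in_out_core c a x : wf_ty (cty c) a -> tm_in c x a ->
  tm_in (c ▷ mor a) (App (fmap s a (nu s) (unfoldf a (Var 0))) (App (Var 0) (eshift 0 1 x))) (tapp s (nu s)).
Proof.
move=> wa hx; apply: (@tm_in_app _ (tapp s a)).
  apply: tm_in_fmap => //; first exact: wf_nu.
  by apply: tm_in_unfoldf => //; ctm_var.
by apply: (@tm_in_app _ a); [ctm_var | apply: tm_in_wk].
Qed.

Lemma lcount_unfoldf0 i a f : lcount i f = 0 -> lcount i (unfoldf a f) = 0.
Proof.
move=> h; rewrite -[LHS]/(lcount i (unfold_tm s) + (lcount i f).*2) h.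
by rewrite (closed_lcount _ (tm_in_unfold _)).
Qed.

Lemma tm_in_out_let c a w x : wf_ty (cty c) a -> tm_in c w (TBang (mor a)) -> tm_in c x a ->
  tm_in c (LetB w (App (fmap s a (nu s) (unfoldf a (Var 0))) (App (Var 0) (eshift 0 1 x)))) (tapp s (nu s)).
Proof. by move=> wa hw hx; apply: tm_in_letb hw _; apply: tm_in_out_core. Qed.

Lemma lcount_core i a : lcount i.+1 (App (fmap s a (nu s) (unfoldf a (Var 0))) (App (Var 0) (Var 1))) =
  (i.+1 == 1).
Proof. by rewrite -[LHS]/(lcount i.+1 (fmap _ _ _ _) + (0 + (i.+1 == 1))) lcount_fmap0 //
  lcount_unfoldf0. Qed.

Lemma tm_in_out_letT c a z : wf_ty (cty c) a -> tm_in c z (coT a) ->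
  tm_in c (LetT z (LetB (Var 1) (App (fmap s a (nu s) (unfoldf a (Var 0))) (App (Var 0) (Var 1)))))
    (tapp s (nu s)).
Proof.
move=> wa hz; apply: (@tm_in_lett _ (TBang (mor a)) a) => //.
- by apply: (@tm_in_out_let _ a (Var 1) (Var 0)) => //; ctm_var.
- by apply/eqP; exact: (lcount_core 0 a).
- by apply/eqP; exact: (congr1 S (lcount_core 1 a)).
Qed.

Lemma tm_in_out_lam c a : wf_ty (cty c) a -> tm_in c (out_lam a) (TLol (coT a) (tapp s (nu s))).
Proof.
move=> wa; apply: tm_in_lam; first exact: wf_coalgT.
  by apply: tm_in_out_letT => //; ctm_var.
by apply/eqP; exact: (congr1 S (lcount_core 2 a)).
Qed.

Lemma out_bodyE : out_body s = TLam (out_lam (TVar 0)).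
Proof. by rewrite /out_lam -coalg_tyE. Qed.

Lemma tm_in_out_body c : tm_in c (out_body s) (contT s (tapp s (nu s))).
Proof.
rewrite out_bodyE /contT (tren_tapp_s ws) (tren_nu ws) (coalg_tyE ws); apply: tm_in_tlam.
exact: (@tm_in_out_lam (c ▷□) (TVar 0)).
Qed.

Lemma out_body_esub st se : esub st se (out_body s) = out_body s.
Proof. exact: closed_esub (tm_in_out_body _). Qed.

Lemma tm_in_out_bd c u : tm_in c u (nu s) -> tm_in c (App (TApp u (tapp s (nu s))) (out_body s))
  (tapp s (nu s)).
Proof.
move=> hu; apply: (tm_in_nu_app ws) => //; first exact: (wf_tapp_s ws (wf_nu ws _)).
exact: tm_in_out_body.
Qed.

Lemma tm_in_out c : tm_in c (out_tm s) (TLol (nu s) (tapp s (nu s))).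
Proof.
apply: tm_in_lam; first exact: wf_nu.
  by apply: tm_in_out_bd; ctm_var.
by rewrite -[lcount _ _]/(1 + lcount 0 (out_body s)) (closed_lcount _ (tm_in_out_body _)).
Qed.

Lemma out_esub st se : esub st se (out_tm s) = out_tm s.
Proof. exact: closed_esub (tm_in_out _). Qed.

(** [E1] to [E6] follow the evaluation: [out] calls the packed element at [s(nu s)] with [out_body],
    packing passes the coalgebra and the state to it, and the type abstraction, the linear
    abstraction, the tensor pattern and the [!] pattern are opened in turn. *)
Lemma peq_out c H a f x : wf_ty (cty c) a -> tm_in c f (mor a) -> tm_in c x a ->
  pv c H (PEq (tapp s (nu s)) (App (out_tm s) (App (packa a) (Tens (Bang f) x)))
     (App (fmap s a (nu s) (unfoldf a f)) (App f x))).
Proof.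
move=> wa hf hx.
have wn := wf_tapp_s ws (wf_nu ws (cty c)).
have hz : tm_in c (Tens (Bang f) x) (coT a) := tm_in_tens (tm_in_bang hf) hx.
have hp := tm_in_packa ws wa hz.
have ho := tm_in_app (tm_in_out c) hp.
have E1 : pv c H (PEq (tapp s (nu s)) (App (out_tm s) (App (packa a) (Tens (Bang f) x)))
   (App (TApp (App (packa a) (Tens (Bang f) x)) (tapp s (nu s))) (out_body s))).
  apply: prv_eqI; apply: (eeq_cast (eeq_beta ho)).
  rewrite -[LHS]/(App (TApp (App (packa a) (Tens (Bang f) x)) (tsub TVar (tapp s (nu s))))
    (esub TVar _ (out_body s))).
  by rewrite tsub_id out_body_esub.
have E2 := peq_pack ws H wa wn hz (tm_in_out_body c).
have h0 := @tm_in_out_lam (c ▷□) (TVar 0) isT.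
have et : tapp (TLol (coT (TVar 0)) (tapp s (nu s))) a = TLol (coT a) (tapp s (nu s)).
  rewrite -[LHS]/(TLol (tsub _ (coT (TVar 0))) (tsub _ (tapp s (nu s)))) (tsub_coalgT ws) (tsub_tapp_s ws).
  by rewrite (tsub_nu ws).
have E3 := peq_tbeta H wa h0 et; rewrite -out_bodyE in E3.
have e3 : esub (scons a TVar) Var (out_lam (TVar 0)) = out_lam a.
  rewrite -[LHS]/(Lam (tsub (scons a TVar) (coT (TVar 0)))
    (LetT (Var 0) (LetB (Var 1) (App (esub (scons a TVar) (upe (upe (upe (upe Var)))) (fmap s (TVar 0)
      (nu s) (unfoldf (TVar 0) (Var 0)))) (App (Var 0) (Var 1)))))).
  by rewrite (tsub_coalgT ws) esub_fmap // unfoldf_esub (tsub_nu ws).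
rewrite e3 in E3.
have hl := tm_in_out_lam wa.
have hlz := tm_in_app hl hz.
have E4 : pv c H (PEq (tapp s (nu s)) (App (out_lam a) (Tens (Bang f) x))
   (LetT (Tens (Bang f) x) (LetB (Var 1) (App (fmap s a (nu s) (unfoldf a (Var 0))) (App (Var 0) (Var 1)))))).
  apply: prv_eqI; apply: (eeq_cast (eeq_beta hlz)).
  set se := scons _ Var.
  rewrite -[LHS]/(LetT (Tens (Bang f) x) (LetB (Var 1) (App (esub TVar (upe (upe (upe se)))
    (fmap s a (nu s) (unfoldf a (Var 0)))) (App (Var 0) (Var 1))))).
  by rewrite esub_fmap // unfoldf_esub !tsub_id.
have hlt := tm_in_out_letT wa hz.
have E5 : pv c H (PEq (tapp s (nu s)) (LetT (Tens (Bang f) x)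
  (LetB (Var 1) (App (fmap s a (nu s) (unfoldf a (Var 0))) (App (Var 0) (Var 1)))))
   (LetB (Bang f) (App (fmap s a (nu s) (unfoldf a (Var 0))) (App (Var 0) (eshift 0 1 x))))).
  apply: prv_eqI; apply: (eeq_cast (eeq_betaT hlt)).
  set se := scons _ (scons _ Var).
  rewrite -[LHS]/(LetB (Bang f) (App (esub TVar (upe se) (fmap s a (nu s) (unfoldf a (Var 0))))
    (App (Var 0) (eshift 0 1 x)))).
  by rewrite esub_fmap // unfoldf_esub !tsub_id.
have hlb := tm_in_out_let wa (tm_in_bang hf) hx.
have E6 : pv c H (PEq (tapp s (nu s)) (LetB (Bang f) (App (fmap s a (nu s) (unfoldf a (Var 0)))
  (App (Var 0) (eshift 0 1 x))))
   (App (fmap s a (nu s) (unfoldf a f)) (App f x))).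
  apply: prv_eqI; apply: (eeq_cast (eeq_betaB hlb)).
  rewrite -[LHS]/(App (esub TVar (scons f Var) (fmap s a (nu s) (unfoldf a (Var 0))))
    (App f (esub TVar (scons f Var) (eshift 0 1 x)))).
  by rewrite esub_fmap // unfoldf_esub !tsub_id esub_inst_wk.
apply: (peq_trans ho E1).
apply: (peq_trans (tm_in_out_bd hp) E2).
have tob : tm_in c (TApp (out_body s) a) (TLol (coT a) (tapp s (nu s))).
  apply: tm_in_tapp (tm_in_out_body c) wa _; exact: tapp_cont.
apply: (peq_trans (tm_in_app tob hz) (peq_appl tob hz E3)).
apply: (peq_trans hlz E4).
exact: (peq_trans hlt E5 E6).
Qed.
End UnfoldOut.

Opaque unfold_tm out_tm.

(** * Naturality from identity extension *)

(* Index 0, the recursion variable, gets the graph of [h]; the types in [L] are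
   parameters, which get their equality. *)
Definition grels (a b : ty) (h : tm) (L : seq ty) : seq drel := graph a b h :: map rel_eq L.

Lemma grels_ren a b h L m : map (rren (wk 0 m 0)) (grels a b h L) = grels a b (eshift 0 m h) L.
Proof.
rewrite /grels map_cons rren_graph /= !tren0; congr cons.
by rewrite -map_comp; apply: eq_map => x; rewrite /= tren0.
Qed.

Lemma grels_srels c a b h L : wf_ty (cty c) a -> wf_ty (cty c) b -> tm_in c h (TLol a b) ->
  all (wf_ty (cty c)) L -> srels c (grels a b h L) (a :: L) (b :: L).
Proof. by move=> wa wb hh wL; constructor => //; [constructor | apply: srels_eq]. Qed.

Lemma size_grels a b h L : size (grels a b h L) = (size L).+1.
Proof. by rewrite /= size_map. Qed.

Section GRels.
Variables (c : ctx) (a b : ty) (h : tm) (L : seq ty) (H : seq prop).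
Hypotheses (wa : wf_ty (cty c) a) (wb : wf_ty (cty c) b) (hh : tm_in c h (TLol a b)).
Hypothesis wL : all (wf_ty (cty c)) L.

Local Notation rs := (grels a b h L).
Let hrs := grels_srels wa wb hh wL.

Lemma grel0E t u : tm_in c t a -> tm_in c u b ->
  pv c H (PRel (RTy (TVar 0) rs) t u) -> pv c H (PEq b (App h t) u).
Proof.
move=> ht hu P; apply: (rel_graphE wb hh ht hu).
exact: (@rel_varE c H 0 rs (a :: L) (b :: L) t u isT hrs ht hu P).
Qed.

Lemma grel0I t u : tm_in c t a -> tm_in c u b ->
  pv c H (PEq b (App h t) u) -> pv c H (PRel (RTy (TVar 0) rs) t u).
Proof.
move=> ht hu P; apply: (@rel_varI c H 0 rs (a :: L) (b :: L) t u isT hrs ht hu).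
exact: (rel_graphI wa wb hh ht hu).
Qed.

Lemma nth_grels i : i < size L -> nth (RVar 0) rs i.+1 = rel_eq (nth TOne L i).
Proof. by move=> hi; rewrite /= (nth_map TOne). Qed.

Lemma grelSE i t u : i < size L -> tm_in c t (nth TOne L i) -> tm_in c u (nth TOne L i) ->
  pv c H (PRel (RTy (TVar i.+1) rs) t u) -> pv c H (PEq (nth TOne L i) t u).
Proof.
move=> hi ht hu P; apply: rel_eqE; rewrite -nth_grels //.
by apply: (@rel_varE c H i.+1 rs (a :: L) (b :: L) t u _ hrs ht hu P); rewrite size_grels.
Qed.

Lemma grelSI i t u : i < size L -> tm_in c t (nth TOne L i) -> tm_in c u (nth TOne L i) ->
  pv c H (PEq (nth TOne L i) t u) -> pv c H (PRel (RTy (TVar i.+1) rs) t u).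
Proof.
move=> hi ht hu P; apply: (@rel_varI c H i.+1 rs (a :: L) (b :: L) t u _ hrs ht hu); rewrite ?size_grels //.
rewrite nth_grels //; apply: rel_eqI => //.
by move/(all_nthP TOne): wL; apply.
Qed.
End GRels.

Section GraphLemmas.
Variables (s : ty) (ws : wf_ty 1 s) (ps : occurs_only true 0 s).

(** One list of parameters for all uses of parametricity at a graph. With the recursion variable at
    index 0, the indices 1 to 5 denote d, a, s(a), e and s(e). The types s(a) and s(e) are
    parameters of their own so that their relation is plainly equality; [d] is free for the result
    type of a continuation. *)
Definition fL (d a e : ty) : seq ty := [:: d; a; tapp s a; e; tapp s e].

Lemma wf_fL n d a e : wf_ty n d -> wf_ty n a -> wf_ty n e -> all (wf_ty n) (fL d a e).
Proof. by move=> wd wa we; rewrite /= wd wa we !wf_tapp_s. Qed.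

Lemma tapps_s a l : tapps s (a :: l) = tapp s a.
Proof. exact: tsub_s. Qed.

(** The functorial action with its source fixed and its target abstracted; [functor_to] is the
    opposite case. Parametricity in the abstracted end is what allows a graph to be inserted
    there. *)
Definition functor_from (a : ty) : tm :=
  TLam (ILam (TLol (tren S a) (TVar 0)) (fmap s (tren S a) (TVar 0) (Var 0))).
Definition functor_to (a : ty) : tm :=
  TLam (ILam (TLol (TVar 0) (tren S a)) (fmap s (TVar 0) (tren S a) (Var 0))).

Section Functor.
Variables (c : ctx) (a : ty).
Hypothesis wa : wf_ty (cty c) a.

Let wa' : wf_ty (cty (c ▷□)) (tren S a). Proof. exact: wf_tren wa. Qed.

Lemma tm_in_ff_body : tm_in (c ▷□) (ILam (TLol (tren S a) (TVar 0)) (fmap s (tren S a) (TVar 0) (Var 0)))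
   (TLol (TBang (TLol (tren S a) (TVar 0))) (TLol (tren S (tapp s a)) s)).
Proof.
apply: tm_in_ILam; first by rewrite /= wa'.
have -> : TLol (tren S (tapp s a)) s = TLol (tapp s (tren S a)) (tapp s (TVar 0)) by rewrite
  (tren_tapp_s ws) (tapp_s_var ws).
by apply: tm_in_fmap => //; ctm_var.
Qed.

Lemma tm_in_ft_body : tm_in (c ▷□) (ILam (TLol (TVar 0) (tren S a)) (fmap s (TVar 0) (tren S a) (Var 0)))
   (TLol (TBang (TLol (TVar 0) (tren S a))) (TLol s (tren S (tapp s a)))).
Proof.
apply: tm_in_ILam; first by rewrite /= wa'.
have -> : TLol s (tren S (tapp s a)) = TLol (tapp s (TVar 0)) (tapp s (tren S a)) by rewrite
  (tren_tapp_s ws) (tapp_s_var ws).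
by apply: tm_in_fmap => //; ctm_var.
Qed.

Lemma tapp_ff b : tapp (TLol (TBang (TLol (tren S a) (TVar 0))) (TLol (tren S (tapp s a)) s)) b =
  TLol (TBang (TLol a b)) (TLol (tapp s a) (tapp s b)).
Proof.
rewrite -[LHS]/(TLol (TBang (TLol (tsub (scons b TVar) (tren S a)) b))
  (TLol (tsub (scons b TVar) (tren S (tapp s a))) (tapp s b))).
by rewrite !tsub_inst_wk.
Qed.

Lemma tapp_ft b : tapp (TLol (TBang (TLol (TVar 0) (tren S a))) (TLol s (tren S (tapp s a)))) b =
  TLol (TBang (TLol b a)) (TLol (tapp s b) (tapp s a)).
Proof.
rewrite -[LHS]/(TLol (TBang (TLol b (tsub (scons b TVar) (tren S a)))) (TLol (tapp s b)
  (tsub (scons b TVar) (tren S (tapp s a))))).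
by rewrite !tsub_inst_wk.
Qed.

Lemma tm_in_ff : tm_in c (functor_from a) (TPi (TLol (TBang (TLol (tren S a) (TVar 0)))
  (TLol (tren S (tapp s a)) s))).
Proof. by apply: tm_in_tlam; exact: tm_in_ff_body. Qed.

Lemma tm_in_ft : tm_in c (functor_to a) (TPi (TLol (TBang (TLol (TVar 0) (tren S a)))
  (TLol s (tren S (tapp s a))))).
Proof. by apply: tm_in_tlam; exact: tm_in_ft_body. Qed.

Variables (H : seq prop) (b : ty) (f : tm).
Hypothesis wb : wf_ty (cty c) b.

Lemma tm_in_ffb : tm_in c (TApp (functor_from a) b) (TLol (TBang (TLol a b)) (TLol (tapp s a) (tapp s b))).
Proof. exact: tm_in_tapp tm_in_ff wb (tapp_ff b). Qed.

Lemma tm_in_ftb : tm_in c (TApp (functor_to a) b) (TLol (TBang (TLol b a)) (TLol (tapp s b) (tapp s a))).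
Proof. exact: tm_in_tapp tm_in_ft wb (tapp_ft b). Qed.

Lemma peq_ff : tm_in c f (TLol a b) ->
  pv c H (PEq (TLol (tapp s a) (tapp s b)) (App (TApp (functor_from a) b) (Bang f)) (fmap s a b f)).
Proof.
move=> hf; have hb := tm_in_bang hf.
have E1 := peq_tbeta H wb tm_in_ff_body (tapp_ff b).
rewrite esub_ILam esub_fmap //= tsub_inst_wk in E1.
have wab : wf_ty (cty c) (TLol a b) by rewrite /= wa.
have h1 : tm_in (c ▷ TLol a b) (fmap s a b (Var 0)) (TLol (tapp s a) (tapp s b)).
  by apply: tm_in_fmap => //; ctm_var.
have E2 := peq_ibeta H wab h1 hf; rewrite esub_fmap //= !tsub_id in E2.
apply: (peq_trans (tm_in_app tm_in_ffb hb) _ E2).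
exact: (peq_appl tm_in_ffb hb E1).
Qed.

Lemma peq_ft : tm_in c f (TLol b a) ->
  pv c H (PEq (TLol (tapp s b) (tapp s a)) (App (TApp (functor_to a) b) (Bang f)) (fmap s b a f)).
Proof.
move=> hf; have hb := tm_in_bang hf.
have E1 := peq_tbeta H wb tm_in_ft_body (tapp_ft b).
rewrite esub_ILam esub_fmap //= tsub_inst_wk in E1.
have wab : wf_ty (cty c) (TLol b a) by rewrite /= wb.
have h1 : tm_in (c ▷ TLol b a) (fmap s b a (Var 0)) (TLol (tapp s b) (tapp s a)).
  by apply: tm_in_fmap => //; ctm_var.
have E2 := peq_ibeta H wab h1 hf; rewrite esub_fmap //= !tsub_id in E2.
apply: (peq_trans (tm_in_app tm_in_ftb hb) _ E2).
exact: (peq_appl tm_in_ftb hb E1).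
Qed.
End Functor.

Section Graph.
Variables (c : ctx) (H : seq prop) (d a b e : ty) (h : tm).
Hypotheses (wd : wf_ty (cty c) d) (wa : wf_ty (cty c) a) (wb : wf_ty (cty c) b) (we : wf_ty (cty c) e).
Hypothesis hh : tm_in c h (TLol a b).

Local Notation L := (fL d a e).
Local Notation rs := (grels a b h L).
Let wL := wf_fL wd wa we.
Let hrs : srels c rs (a :: L) (b :: L) := grels_srels wa wb hh wL.

Definition ff_ty : ty := TLol (TBang (TLol (TVar 2) (TVar 0))) (TLol (TVar 3) s).
Definition ft_ty : ty := TLol (TBang (TLol (TVar 0) (TVar 4))) (TLol s (TVar 5)).

Lemma wf_ff_ty : wf_ty 6 ff_ty. Proof. by rewrite /= wf_s. Qed.
Lemma wf_ft_ty : wf_ty 6 ft_ty. Proof. by rewrite /= wf_s. Qed.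

Lemma tapps_ff : tapps (TPi ff_ty) L = TPi (TLol (TBang (TLol (tren S a) (TVar 0)))
  (TLol (tren S (tapp s a)) s)).
Proof.
rewrite -[LHS]/(TPi (TLol (TBang (TLol (tren S a) (TVar 0))) (TLol (tren S (tapp s a))
  (tsub (upt (nth TOne L)) s)))).
by rewrite tsub_s // tapp_s_var.
Qed.

Lemma tapps_ft : tapps (TPi ft_ty) L = TPi (TLol (TBang (TLol (TVar 0) (tren S e)))
  (TLol s (tren S (tapp s e)))).
Proof.
rewrite -[LHS]/(TPi (TLol (TBang (TLol (TVar 0) (tren S e))) (TLol (tsub (upt (nth TOne L)) s)
  (tren S (tapp s e))))).
by rewrite tsub_s // tapp_s_var.
Qed.

Lemma wfr_s : forall k, wfr (c ▷ k) (rren (wk 0 1 0) (RTy s rs)) (tapp s a) (tapp s b).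
Proof.
move=> k; have := @wfr_ty_wk0 c s rs _ _ (wf_s ws _) hrs (c ▷ k) (wk 0 1 0) ltac:(okr) (erefl _).
by rewrite !tapps_s.
Qed.

(* Parametricity of [functor_from a], which is [fmap s a _], applied to the related
   arguments [idtm a] and [h]. *)
Lemma graph_intro x : tm_in c x (tapp s a) ->
  pv c H (PRel (RTy s rs) x (App (fmap s a b h) x)).
Proof.
move=> hx.
have hT := tm_in_ff wa; rewrite -tapps_ff in hT.
have ia := tm_in_id wa.
have R0 := @iesI c H (TPi ff_ty) L _ _ wf_ff_ty wL hT hT (peq_refl H hT).
have R1 := @rel_piE c H ff_ty (map rel_eq L) L L _ _ (graph a b h) a b wf_ff_ty (srels_eq wL) hT hT wa
  wb (srel_graph wa wb hh) R0.
rewrite -/(grels a b h L) in R1.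
have ta := tm_in_ffb wa wa; have tb := tm_in_ffb wa wb.
(* The identity of [a] and [h] are related at the type of maps from the parameter [a] to the
   recursion variable: for x = x' this means h (id x) = h x'. *)
have R2 : pv c H (PRel (RTy (TBang (TLol (TVar 2) (TVar 0))) rs) (Bang (idtm a)) (Bang h)).
  apply: (@rel_bangI c (TLol (TVar 2) (TVar 0)) rs (a :: L) (b :: L) isT hrs H) => //.
  apply: (@rel_lolI c H (TVar 2) (TVar 0) rs (a :: L) (b :: L) _ _ isT isT hrs) => //.
  rewrite grels_ren; change (tapps (TVar 2) (a :: L)) with a; change (tapps (TVar 2) (b :: L)) with a.
  set c2 := c ▷ a ▷ a; set H2 := _ :: _; rewrite eshift_idtm.
  have h2 : tm_in c2 (eshift 0 2 h) (TLol a b) by apply: tm_in_wk2.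
  have i2 := @tm_in_id c2 a wa.
  have v1 : tm_in c2 (Var 1) a by ctm_var.
  have v0 : tm_in c2 (Var 0) a by ctm_var.
  apply: (@grel0I c2 a b (eshift 0 2 h) L H2 wa wb h2 wL _ _ (tm_in_app i2 v1) (tm_in_app h2 v0)).
  apply: (peq_appr h2 (tm_in_app i2 v1)); apply: (peq_trans (tm_in_app i2 v1) (@peq_id c2 H2 a _ wa v1)).
  by apply: (@grelSE c2 a b (eshift 0 2 h) L H2 wa wb h2 wL 1 _ _ isT v1 v0 (pv_hyp0 _ _ _)).
have wf1 : wf_ty (size rs) (TBang (TLol (TVar 2) (TVar 0))) by [].
have wf2 : wf_ty (size rs) (TLol (TVar 3) s) by rewrite /= wf_s.
have e1 x0 : tapps ff_ty (x0 :: L) = TLol (TBang (TLol a x0)) (TLol (tapp s a) (tapp s x0)).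
  by rewrite -[LHS]/(TLol (TBang (TLol a x0)) (TLol (tapp s a) (tapps s (x0 :: L)))) tapps_s.
have ta' := ta; rewrite -e1 in ta'; have tb' := tb; rewrite -e1 in tb'.
have R3 := rel_lolE wf1 wf2 hrs ta' tb' (tm_in_bang ia) (tm_in_bang hh) R1 R2.
have wf3 : wf_ty (size rs) (TVar 3) by [].
have wf4 : wf_ty (size rs) s by apply: wf_s.
have e2 x0 : tapps (TLol (TVar 3) s) (x0 :: L) = TLol (tapp s a) (tapp s x0).
  by rewrite -[LHS]/(TLol (tapp s a) (tapps s (x0 :: L))) tapps_s.
have ta2 := tm_in_app ta (tm_in_bang ia); have tb2 := tm_in_app tb (tm_in_bang hh).
have ta2' := ta2; rewrite -e2 in ta2'; have tb2' := tb2; rewrite -e2 in tb2'.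
have R4 : pv c H (PRel (RTy (TVar 3) rs) x x).
  by apply: (@grelSI c a b h L H wa wb hh wL 2 x x isT hx hx); apply: peq_refl hx.
have R5 := rel_lolE wf3 wf4 hrs ta2' tb2' (hx : tm_in c x (tapps (TVar 3) (a :: L)))
  (hx : tm_in c x (tapps (TVar 3) (b :: L))) R3 R4.
have fa := tm_in_fmap ws ps wa wa ia; have fb := tm_in_fmap ws ps wa wb hh.
apply: (prel_conv wfr_s _ _ _ _ _ _ R5).
- exact: tm_in_app ta2 hx.
- by [].
- exact: tm_in_app tb2 hx.
- exact: tm_in_app fb hx.
(* On the left, parametricity yields s(id) x, which is x because the action preserves identities. *)
- apply: (peq_trans (tm_in_app ta2 hx) (peq_appl ta2 hx (peq_ff wa H wa ia))).
  apply: (peq_trans (tm_in_app fa hx) (peq_appl fa hx (peq_fmap_id ws wa H))).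
  by apply: peq_id hx; apply: wf_tapp_s.
- exact: (peq_appl tb2 hx (peq_ff wa H wb hh)).
Qed.

(* Parametricity of [functor_to e], which is [fmap s _ e], applied to [p] and [q], related
   because [p = q o h]. *)
Lemma graph_elim p q x y : tm_in c p (TLol a e) -> tm_in c q (TLol b e) ->
  tm_in c x (tapp s a) -> tm_in c y (tapp s b) ->
  pv c H (PEq (TLol a e) p (tcomp a q h)) ->
  pv c H (PRel (RTy s rs) x y) ->
  pv c H (PEq (tapp s e) (App (fmap s a e p) x) (App (fmap s b e q) y)).
Proof.
move=> hp hq hx hy E P.
have hT := tm_in_ft we; rewrite -tapps_ft in hT.
have R0 := @iesI c H (TPi ft_ty) L _ _ wf_ft_ty wL hT hT (peq_refl H hT).
have R1 := @rel_piE c H ft_ty (map rel_eq L) L L _ _ (graph a b h) a b wf_ft_ty (srels_eq wL) hT hT wa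
  wb (srel_graph wa wb hh) R0.
rewrite -/(grels a b h L) in R1.
have ta := tm_in_ftb we wa; have tb := tm_in_ftb we wb.
have tc := tm_in_tcomp wa hh hq.
have R2 : pv c H (PRel (RTy (TBang (TLol (TVar 0) (TVar 4))) rs) (Bang p) (Bang q)).
  apply: (pv_cut _ E); first by apply: wf_eq.
  set H1 := _ :: H.
  apply: (@rel_bangI c (TLol (TVar 0) (TVar 4)) rs (a :: L) (b :: L) isT hrs H1) => //.
  apply: (@rel_lolI c H1 (TVar 0) (TVar 4) rs (a :: L) (b :: L) _ _ isT isT hrs) => //.
  rewrite grels_ren; change (tapps (TVar 0) (a :: L)) with a; change (tapps (TVar 0) (b :: L)) with b.
  set c2 := c ▷ a ▷ b; set H2 := (PRel _ _ _ :: _).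
  have h2 : tm_in c2 (eshift 0 2 h) (TLol a b) by apply: tm_in_wk2.
  have p2 : tm_in c2 (eshift 0 2 p) (TLol a e) by apply: tm_in_wk2.
  have q2 : tm_in c2 (eshift 0 2 q) (TLol b e) by apply: tm_in_wk2.
  have v1 : tm_in c2 (Var 1) a by ctm_var.
  have v0 : tm_in c2 (Var 0) b by ctm_var.
  have E0 := @grel0E c2 a b (eshift 0 2 h) L H2 wa wb h2 wL _ _ v1 v0 (pv_hyp0 _ _ _).
  have E1 : pv c2 H2 (PEq (TLol a e) (eshift 0 2 p) (tcomp a (eshift 0 2 q) (eshift 0 2 h))).
    apply: pv_eq; first exact: pv_hyp1.
    by rewrite /= !eren_tcomp !tren0; congr PEq; rewrite /eshift ?eren_eren.
  apply: (@grelSI c2 a b (eshift 0 2 h) L H2 wa wb h2 wL 3 _ _ isT (tm_in_app p2 v1) (tm_in_app q2 v0)).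
  have tc2 := @tm_in_tcomp c2 _ _ _ _ _ wa h2 q2.
  apply: (peq_trans (tm_in_app p2 v1) (peq_appl p2 v1 E1)).
  apply: (peq_trans (tm_in_app tc2 v1) (@peq_tcomp c2 H2 _ _ _ _ _ _ wa h2 q2 v1)).
  exact: (peq_appr q2 (tm_in_app h2 v1) E0).
have wf1 : wf_ty (size rs) (TBang (TLol (TVar 0) (TVar 4))) by [].
have wf2 : wf_ty (size rs) (TLol s (TVar 5)) by rewrite /= wf_s.
have e1 x0 : tapps ft_ty (x0 :: L) = TLol (TBang (TLol x0 e)) (TLol (tapp s x0) (tapp s e)).
  by rewrite -[LHS]/(TLol (TBang (TLol x0 e)) (TLol (tapps s (x0 :: L)) (tapp s e))) tapps_s.
have ta' := ta; rewrite -e1 in ta'; have tb' := tb; rewrite -e1 in tb'.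
have R3 := rel_lolE wf1 wf2 hrs ta' tb' (tm_in_bang hp) (tm_in_bang hq) R1 R2.
have wf3 : wf_ty (size rs) (TVar 5) by [].
have wf4 : wf_ty (size rs) s by apply: wf_s.
have e2 x0 : tapps (TLol s (TVar 5)) (x0 :: L) = TLol (tapp s x0) (tapp s e).
  by rewrite -[LHS]/(TLol (tapps s (x0 :: L)) (tapp s e)) tapps_s.
have ta2 := tm_in_app ta (tm_in_bang hp); have tb2 := tm_in_app tb (tm_in_bang hq).
have ta2' := ta2; rewrite -e2 in ta2'; have tb2' := tb2; rewrite -e2 in tb2'.
have hx' := hx; rewrite -(tapps_s a L) in hx'; have hy' := hy; rewrite -(tapps_s b L) in hy'.
have R5 := rel_lolE wf4 wf3 hrs ta2' tb2' hx' hy' R3 P.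
have tax := tm_in_app ta2 hx; have tby := tm_in_app tb2 hy.
have E5 := @grelSE c a b h L H wa wb hh wL 4 _ _ isT tax tby R5.
have fa := tm_in_fmap ws ps wa we hp; have fb := tm_in_fmap ws ps wb we hq.
apply: (@peq_trans _ _ _ _ _ _ (tm_in_app fa hx) (peq_sym tax (peq_appl ta2 hx (peq_ft we H wa hp)))).
exact: (peq_trans tax E5 (peq_appl tb2 hy (peq_ft we H wb hq))).
Qed.
End Graph.

(** By [graph_intro], x and s(h) x are related by s[graph h]; [graph_elim] for p = q o h at this
    pair is the claim. The parameter [d] of these lemmas is filled with [TOne]. *)
Lemma peq_fmap_comp c H a b e h p q x : wf_ty (cty c) a -> wf_ty (cty c) b -> wf_ty (cty c) e ->
  tm_in c h (TLol a b) -> tm_in c q (TLol b e) -> tm_in c p (TLol a e) -> tm_in c x (tapp s a) ->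
  pv c H (PEq (TLol a e) p (tcomp a q h)) ->
  pv c H (PEq (tapp s e) (App (fmap s a e p) x) (App (fmap s b e q) (App (fmap s a b h) x))).
Proof.
move=> wa wb we hh hq hp hx E.
have fh := tm_in_fmap ws ps wa wb hh.
apply: (graph_elim (d := TOne) isT wa wb we hh hp hq hx (tm_in_app fh hx) E).
exact: graph_intro.
Qed.
End GraphLemmas.

Lemma peq_tcomp_app c H a b b' d f g f' g' x : wf_ty (cty c) a ->
  tm_in c f (TLol a b) -> tm_in c g (TLol b d) -> tm_in c f' (TLol a b') -> tm_in c g' (TLol b' d) ->
  tm_in c x a -> pv c H (PEq (TLol a d) (tcomp a g f) (tcomp a g' f')) ->
  pv c H (PEq d (App g (App f x)) (App g' (App f' x))).
Proof.
move=> wa hf hg hf' hg' hx E.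
have h1 := tm_in_tcomp wa hf hg; have h2 := tm_in_tcomp wa hf' hg'.
apply: (peq_trans (tm_in_app hg (tm_in_app hf hx)) (peq_sym (tm_in_app h1 hx) (peq_tcomp H wa hf hg hx))).
exact: (peq_trans (tm_in_app h1 hx) (peq_appl h1 hx E) (peq_tcomp H wa hf' hg' hx)).
Qed.

Lemma peq_tcomp_ext c H a b b' d f g f' g' : wf_ty (cty c) a ->
  tm_in c f (TLol a b) -> tm_in c g (TLol b d) -> tm_in c f' (TLol a b') -> tm_in c g' (TLol b' d) ->
  pv (c ▷ a) (wkH (BTm a) H) (PEq d (App (eshift 0 1 g) (App (eshift 0 1 f) (Var 0)))
     (App (eshift 0 1 g') (App (eshift 0 1 f') (Var 0)))) ->
  pv c H (PEq (TLol a d) (tcomp a g f) (tcomp a g' f')).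
Proof.
move=> wa hf hg hf' hg' E.
have h1 := tm_in_tcomp wa hf hg; have h2 := tm_in_tcomp wa hf' hg'.
apply: peq_funext => //; rewrite /eshift !eren_tcomp !tren0 -!/(eshift 0 1 _).
set c1 := c ▷ a; set H1 := wkH _ _.
have kf := tm_in_wk a hf; have kg := tm_in_wk a hg; have kf' := tm_in_wk a hf'; have kg' := tm_in_wk a hg'.
have v : tm_in c1 (Var 0) a by ctm_var.
have wa1 : wf_ty (cty c1) a by [].
have k1 := tm_in_tcomp wa1 kf kg; have k2 := tm_in_tcomp wa1 kf' kg'.
apply: (peq_trans (tm_in_app k1 v) (peq_tcomp H1 wa1 kf kg v)).
apply: (peq_trans (tm_in_app kg (tm_in_app kf v)) E).
exact: (peq_sym (tm_in_app k2 v) (peq_tcomp H1 wa1 kf' kg' v)).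
Qed.

Lemma peq_tcomp_idl c H a b h : wf_ty (cty c) a -> wf_ty (cty c) b -> tm_in c h (TLol a b) ->
  pv c H (PEq (TLol a b) h (tcomp a (idtm b) h)).
Proof.
move=> wa wb hh; have hi := tm_in_id wb; have hc := tm_in_tcomp wa hh hi.
apply: peq_funext => //; rewrite {2}/eshift eren_tcomp tren0 -/(eshift 0 1 _) -/(eshift 0 1 _) eshift_idtm.
set c1 := c ▷ a; set H1 := wkH _ _.
have kh := tm_in_wk a hh; have v : tm_in c1 (Var 0) a by ctm_var.
have wb1 : wf_ty (cty c1) b by [].
have wa1 : wf_ty (cty c1) a by [].
have ki := tm_in_id wb1; have k1 := tm_in_tcomp wa1 kh ki.
have kv := tm_in_app kh v.
apply: peq_sym; first exact: tm_in_app k1 v.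
apply: (peq_trans (tm_in_app k1 v) (peq_tcomp H1 wa1 kh ki v)).
exact: (@peq_id c1 H1 b _ wb1 kv).
Qed.

(** * Endomorphisms of the initial algebra *)

Section Mu.
Variables (s : ty) (ws : wf_ty 1 s) (ps : occurs_only true 0 s).
Local Notation foldg b g := (App (TApp (fold_tm s) b) (Bang g)).

Definition mu_body : ty := TArr (TLol s (TVar 0)) (TVar 0).

(* Parametricity of [u] at the graph of [h]. *)
Lemma mu_nat c H a b h f g u : wf_ty (cty c) a -> wf_ty (cty c) b -> tm_in c h (TLol a b) ->
  tm_in c f (TLol (tapp s a) a) -> tm_in c g (TLol (tapp s b) b) -> tm_in c u (mu s) ->
  pv c H (PEq (TLol (tapp s a) b) (tcomp (tapp s a) h f) (tcomp (tapp s a) g (fmap s a b h))) ->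
  pv c H (PEq b (App h (App (TApp u a) (Bang f))) (App (TApp u b) (Bang g))).
Proof.
move=> wa wb hh hf hg hu E.
set L := fL s TOne a b; set rs := grels a b h L.
have wL : all (wf_ty (cty c)) L by exact: wf_fL.
have hrs : srels c rs (a :: L) (b :: L) := grels_srels wa wb hh wL.
have wmb : wf_ty 6 mu_body by rewrite /= wf_s.
have eL : tapps (TPi mu_body) L = mu s by rewrite -[TPi _]/(mu s); exact: tsub_mu.
have hu' := hu; rewrite -eL in hu'.
have R0 := @iesI c H (TPi mu_body) L u u wmb wL hu' hu' (peq_refl H hu').
have R1 := @rel_piE c H mu_body (map rel_eq L) L L _ _ (graph a b h) a b wmb (srels_eq wL) hu' hu' wa wb
  (srel_graph wa wb hh) R0.
rewrite -/(grels a b h L) -/rs in R1.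
have wsa := wf_tapp_s ws wa; have wsb := wf_tapp_s ws wb.
have fh := tm_in_fmap ws ps wa wb hh.
have R2 : pv c H (PRel (RTy (TBang (TLol s (TVar 0))) rs) (Bang f) (Bang g)).
  apply: (pv_cut _ E); first by apply: wf_eq; [exact: tm_in_tcomp wsa hf hh | exact: tm_in_tcomp wsa fh hg].
  set H1 := _ :: H.
  have e1 x : tapps (TLol s (TVar 0)) (x :: L) = TLol (tapp s x) x.
    by rewrite -[LHS]/(TLol (tapps s (x :: L)) x) tapps_s.
  apply: (@rel_bangI c (TLol s (TVar 0)) rs (a :: L) (b :: L) _ hrs H1); rewrite ?e1 //; first by
    rewrite /= wf_s.
  apply: (@rel_lolI c H1 s (TVar 0) rs (a :: L) (b :: L) _ _ _ isT hrs); rewrite ?e1 //; first exact: wf_s.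
  rewrite grels_ren !tapps_s //.
  set c2 := c ▷ _ ▷ _; set H2 := (PRel _ _ _ :: _).
  have h2 : tm_in c2 (eshift 0 2 h) (TLol a b) by apply: tm_in_wk2.
  have f2 : tm_in c2 (eshift 0 2 f) (TLol (tapp s a) a) by apply: tm_in_wk2.
  have g2 : tm_in c2 (eshift 0 2 g) (TLol (tapp s b) b) by apply: tm_in_wk2.
  have v1 : tm_in c2 (Var 1) (tapp s a) by ctm_var.
  have v0 : tm_in c2 (Var 0) (tapp s b) by ctm_var.
  have wb2 : wf_ty (cty c2) b by [].

  have wsa2 : wf_ty (cty c2) (tapp s a) by [].
  have i2 := tm_in_id wb2.
  have fh2 := tm_in_fmap ws ps (wa : wf_ty (cty c2) a) wb2 h2.
  have fi2 := tm_in_fmap ws ps wb2 wb2 i2.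
  apply: (@grel0I c2 a b (eshift 0 2 h) L H2 wa wb h2 wL _ _ (tm_in_app f2 v1) (tm_in_app g2 v0)).
  have E1 : pv c2 H2 (PEq (TLol (tapp s a) b) (tcomp (tapp s a) (eshift 0 2 h) (eshift 0 2 f))
       (tcomp (tapp s a) (eshift 0 2 g) (fmap s a b (eshift 0 2 h)))).
    apply: pv_eq; first exact: pv_hyp1.
    by rewrite /= !eren_tcomp !eren_fmap // !tren0; congr PEq; rewrite /eshift ?eren_eren.
  have E2 := peq_tcomp_app wsa2 f2 h2 fh2 g2 v1 E1.
  apply: (peq_trans (tm_in_app h2 (tm_in_app f2 v1)) E2).
  apply: (peq_appr g2 (tm_in_app fh2 v1)).
  have P := pv_hyp0 c2 (wkH (BTm (tapp s b)) (wkH (BTm (tapp s a)) H1))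
    (PRel (RTy s (grels a b (eshift 0 2 h) L)) (Var 1) (Var 0)).
  (* The choice p = h and q = id turns relatedness of x and y by s[graph h] into s(h) x = s(id) y,
     hence into s(h) x = y. So h (f x) = g (s(h) x) = g y, which is relatedness of [f] and [g]. *)
  have E3 := @graph_elim s ws ps c2 H2 TOne a b b (eshift 0 2 h) isT wa wb wb h2 (eshift 0 2 h) (idtm b)
    (Var 1) (Var 0) h2 i2 v1 v0 (@peq_tcomp_idl c2 H2 a b _ wa wb h2) P.
  apply: (peq_trans (tm_in_app fh2 v1) E3).
  apply: (peq_trans (tm_in_app fi2 v0) (peq_appl fi2 v0 (peq_fmap_id ws wb2 H2))).
  exact: peq_id.
have wf1 : wf_ty (size rs) (TBang (TLol s (TVar 0))) by rewrite /= wf_s.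
have e2 x : tapps mu_body (x :: L) = TArr (TLol (tapp s x) x) x.
  by rewrite -[LHS]/(TArr (TLol (tapps s (x :: L)) x) x) tapps_s.
have e3 x : tapps (TBang (TLol s (TVar 0))) (x :: L) = TBang (TLol (tapp s x) x).
  by rewrite -[LHS]/(TBang (TLol (tapps s (x :: L)) x)) tapps_s.
have tu x : wf_ty (cty c) x -> tm_in c (TApp u x) (TArr (TLol (tapp s x) x) x).
  by move=> wx; apply: (@tm_in_tapp _ mu_body).
have ta := tu _ wa; have tb := tu _ wb; rewrite -e2 in ta; rewrite -e2 in tb.
have hbf := tm_in_bang hf; have hbg := tm_in_bang hg; rewrite -e3 in hbf; rewrite -e3 in hbg.
have R3 := @rel_lolE c H (TBang (TLol s (TVar 0))) (TVar 0) rs (a :: L) (b :: L) wf1 isT hrs _ _ _ _ ta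
  tb hbf hbg R1 R2.
apply: (@grel0E c a b h L H wa wb hh wL _ _ _ _ R3).
- exact: tm_in_app (tu _ wa) (tm_in_bang hf).
- exact: tm_in_app (tu _ wb) (tm_in_bang hg).
Qed.

Lemma fold_alg c H b g : wf_ty (cty c) b -> tm_in c g (TLol (tapp s b) b) ->
  pv c H (PEq (TLol (tapp s (mu s)) b) (tcomp (tapp s (mu s)) (foldg b g) (in_tm s))
    (tcomp (tapp s (mu s)) g (fmap s (mu s) b (foldg b g)))).
Proof.
move=> wb hg; have wm := wf_mu ws (cty c); have wsm := wf_tapp_s ws wm.
have hF := tm_in_foldg ws wb hg; have hi := tm_in_in ws ps c.
have fF := tm_in_fmap ws ps wm wb hF.
apply: (peq_tcomp_ext wsm hi hF fF hg).
rewrite eshift_fmap // (closed_eshift 0 1 (tm_in_in ws ps _)).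
have -> : eshift 0 1 (foldg b g) = foldg b (eshift 0 1 g).
  by rewrite /eshift /= tren0 -/(eshift 0 1 _) (closed_eshift 0 1 (tm_in_fold ws _)).
set c1 := c ▷ _; set H1 := wkH _ _.
have g1 := tm_in_wk (tapp s (mu s)) hg.
have v : tm_in c1 (Var 0) (tapp s (mu s)) by ctm_var.
have wb1 : wf_ty (cty c1) b by [].
have iv := tm_in_app (tm_in_in ws ps c1) v.
have F1 := tm_in_foldg ws wb1 g1.
apply: (peq_trans (tm_in_app F1 iv) (peq_fold ws H1 wb1 g1 iv)).
exact: peq_in.
Qed.

(** By extensionality both sides are compared at a type variable and an arbitrary algebra f on it;
    [bang_ind] applies because the algebra is passed under [!]. The left side is the fold of f
    applied to u (mu s) in, and since this fold is an algebra map from [in] to f, [mu_nat] sends it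
    to u at f. *)
Lemma mu_in c H u : tm_in c u (mu s) -> pv c H (PEq (mu s) (App (TApp u (mu s)) (Bang (in_tm s))) u).
Proof.
move=> hu; have wm := wf_mu ws (cty c).
have hi := tm_in_in ws ps c.
have hU := tm_in_mu_app wm hi hu.
have tA c' v b : wf_ty (cty c') b -> tm_in c' v (mu s) -> tm_in c' (TApp v b) (TArr (TLol (tapp s b) b) b).
  by move=> wb hv; apply: (@tm_in_tapp _ mu_body).
rewrite {1}muE; apply: peq_tfunext; rewrite -?muE //.
set c1 := c ▷□; set H1 := wkH _ _.
have hu1 := tm_in_wkT hu; have hU1 := tm_in_wkT hU; rewrite (tren_mu ws) in hu1 hU1.
have w0 : wf_ty (cty c1) (TVar 0) by [].
have w1 : wf_ty (cty c1) (TLol s (TVar 0)) by rewrite /= wf_s.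
have tu := tA c1 _ _ w0 hu1; have tU := tA c1 _ _ w0 hU1; rewrite (tapp_s_var ws) in tu tU.
apply: bang_ind => //.
set c2 := c1 ▷ _; set H2 := wkH _ _.
have hu2 := tm_in_wk (TLol s (TVar 0)) hu1; have hU2 := tm_in_wk (TLol s (TVar 0)) hU1.
rewrite -!/(eshift 1 0 _).
set u1 := eshift 1 0 u in hu1 hu2 tu *.
have e1 : eshift 1 0 (App (TApp u (mu s)) (Bang (in_tm s))) = App (TApp u1 (mu s)) (Bang (in_tm s)).
  by rewrite -[LHS]/(App (TApp u1 (tren _ (mu s))) (Bang (eshift 1 0 (in_tm s)))) (tren_mu ws)
    (closed_eshift 1 0 (tm_in_in ws ps _)).
have e2 : eshift 0 1 (App (TApp u1 (mu s)) (Bang (in_tm s))) = App (TApp (eshift 0 1 u1) (mu s))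
  (Bang (in_tm s)).
  by rewrite -[LHS]/(App (TApp (eshift 0 1 u1) (tren _ (mu s))) (Bang (eshift 0 1 (in_tm s))))
    (tren_mu ws) (closed_eshift 0 1 (tm_in_in ws ps _)).
rewrite e1 e2 in hU2.
rewrite e1 -[eshift 0 1 (TApp _ _)]/(TApp (eshift 0 1 (App (TApp u1 (mu s)) (Bang (in_tm s)))) (TVar 0)) e2.
rewrite -[eshift 0 1 (TApp u1 _)]/(TApp (eshift 0 1 u1) (TVar 0)).
set u2 := eshift 0 1 u1 in hu2 hU2 *.
have v : tm_in c2 (Var 0) (TLol (tapp s (TVar 0)) (TVar 0)) by rewrite (tapp_s_var ws); ctm_var.
have w2 : wf_ty (cty c2) (TVar 0) by [].
have wm2 := wf_mu ws (cty c2).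
have hF := tm_in_foldg ws w2 v.
have N := mu_nat wm2 w2 hF (tm_in_in ws ps c2) v hu2 (@fold_alg c2 H2 _ _ w2 v).
have hUv := tm_in_mu_app w2 v hU2.
apply: (peq_trans hUv _ N).
by apply: peq_sym; [exact: tm_in_app hF hU2 | apply: peq_fold].
Qed.

(** For u of type [mu s], write u as u (mu s) in by [mu_in]. Naturality of u along the endomorphism
    [h] gives h u = u (mu s) in, which is u again. *)
Lemma mu_endo c H h : tm_in c h (TLol (mu s) (mu s)) ->
  pv c H (PEq (TLol (tapp s (mu s)) (mu s)) (tcomp (tapp s (mu s)) h (in_tm s))
    (tcomp (tapp s (mu s)) (in_tm s) (fmap s (mu s) (mu s) h))) ->
  pv c H (PEq (TLol (mu s) (mu s)) h (idtm (mu s))).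
Proof.
move=> hh E; have wm := wf_mu ws (cty c); have wsm := wf_tapp_s ws wm.
have hi := tm_in_in ws ps c; have hI := tm_in_id wm.
have fh := tm_in_fmap ws ps wm wm hh.
apply: (pv_cut _ E); first by apply: wf_eq; [exact: tm_in_tcomp wsm hi hh | exact: tm_in_tcomp wsm fh hi].
apply: peq_funext => //; rewrite eshift_idtm.
set c1 := c ▷ _; set H1 := wkH _ _.
have h1 := tm_in_wk (mu s) hh; have v : tm_in c1 (Var 0) (mu s) by ctm_var.
have E1 : pv c1 H1 (PEq (TLol (tapp s (mu s)) (mu s)) (tcomp (tapp s (mu s)) (eshift 0 1 h) (in_tm s))
    (tcomp (tapp s (mu s)) (in_tm s) (fmap s (mu s) (mu s) (eshift 0 1 h)))).
  apply: pv_eq; first exact: pv_hyp0.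
  rewrite /= !eren_tcomp !eren_fmap // !tren0 -![eren _ _ (in_tm s)]/(eshift 0 1 (in_tm s)).
  by rewrite !(closed_eshift 0 1 (tm_in_in ws ps _)).
have wm1 : wf_ty (cty c1) (mu s) := wm.
have hi1 := tm_in_in ws ps c1.
have N := mu_nat wm1 wm1 h1 hi1 hi1 v E1.
have M := @mu_in c1 H1 _ v.
have hvm := tm_in_mu_app wm1 hi1 v.
apply: (peq_trans (tm_in_app h1 v) (peq_appr h1 v (peq_sym hvm M))).
apply: (peq_trans (tm_in_app h1 hvm) N).
apply: (peq_trans hvm M).
by apply: peq_sym; [exact: tm_in_app (@tm_in_id c1 _ wm1) v | exact: (@peq_id c1 H1 _ _ wm1 v)].
Qed.
End Mu.

(** * Parametricity of continuations and of elements of [nu s] *)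

Section Nu.
Variables (s : ty) (ws : wf_ty 1 s) (ps : occurs_only true 0 s).
Local Notation coT := (coalgT s).
Local Notation mor a := (TLol a (tapp s a)).
Local Notation packa a := (TApp (pack_tm s) a).
Local Notation unfoldf a f := (App (TApp (unfold_tm s) a) (Bang f)).
Local Notation cT := (contT s).

Lemma tapps_coalg x l : tapps (coalg_ty s) (x :: l) = coT x.
Proof. by rewrite /tapps (tsub_coalg_ty ws). Qed.

(** A polymorphic continuation cannot distinguish a state from its image under a coalgebra map: the
    pairs formed by f and x, and by g and h x, are related at [coalg_ty s] over the graph of [h],
    while the result type [d] is interpreted by equality. *)
Lemma nu_cont_nat c H a b d h f g k x : wf_ty (cty c) a -> wf_ty (cty c) b -> wf_ty (cty c) d ->
  tm_in c h (TLol a b) -> tm_in c f (mor a) -> tm_in c g (mor b) -> tm_in c k (cT d) -> tm_in c x a ->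
  pv c H (PEq (TLol a (tapp s b)) (tcomp a g h) (tcomp a (fmap s a b h) f)) ->
  pv c H (PEq d (App (TApp k a) (Tens (Bang f) x)) (App (TApp k b) (Tens (Bang g) (App h x)))).
Proof.
move=> wa wb wd hh hf hg hk hx E.
set L := fL s d a TOne; set rs := grels a b h L.
have wL : all (wf_ty (cty c)) L by exact: wf_fL.
have hrs : srels c rs (a :: L) (b :: L) := grels_srels wa wb hh wL.
pose kb := TLol (coalg_ty s) (TVar 1).
have wkb : wf_ty 6 kb by rewrite -[wf_ty _ _]/(wf_ty 6 (coalg_ty s) && true) wf_coalg_ty.
have eL : tapps (TPi kb) L = cT d.
  by rewrite -[LHS]/(TPi (TLol (tsub (upt (nth TOne L)) (coalg_ty s)) (tren S d))) (tsub_coalg_ty ws)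
    -coalg_tyE.
have hk' := hk; rewrite -eL in hk'.
have R0 := @iesI c H (TPi kb) L k k wkb wL hk' hk' (peq_refl H hk').
have R1 := @rel_piE c H kb (map rel_eq L) L L _ _ (graph a b h) a b wkb (srels_eq wL) hk' hk' wa wb
  (srel_graph wa wb hh) R0.
rewrite -/(grels a b h L) -/rs in R1.
have wsa := wf_tapp_s ws wa; have wsb := wf_tapp_s ws wb.
have fh := tm_in_fmap ws ps wa wb hh.
have hhx := tm_in_app hh hx.
have wm : wf_ty (size rs) (TLol (TVar 0) s) by rewrite /= wf_s.
have e1 y : tapps (TLol (TVar 0) s) (y :: L) = mor y.
  by rewrite -[LHS]/(TLol y (tapps s (y :: L))) tapps_s.
have hf1 := hf; rewrite -e1 in hf1. have hg1 := hg; rewrite -e1 in hg1.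
have R2 : pv c H (PRel (RTy (TBang (TLol (TVar 0) s)) rs) (Bang f) (Bang g)).
  apply: (pv_cut _ E); first by apply: wf_eq; [exact: tm_in_tcomp wa hh hg | exact: tm_in_tcomp wa hf fh].
  set H1 := _ :: H.
  apply: (@rel_bangI c (TLol (TVar 0) s) rs (a :: L) (b :: L) wm hrs H1 f g hf1 hg1).
  apply: (@rel_lolI c H1 (TVar 0) s rs (a :: L) (b :: L) _ _ isT (wf_s ws _) hrs hf1 hg1).
  rewrite grels_ren; change (tapps (TVar 0) (a :: L)) with a; change (tapps (TVar 0) (b :: L)) with b.
  set c2 := c ▷ _ ▷ _; set H2 := (PRel _ _ _ :: _).
  have h2 : tm_in c2 (eshift 0 2 h) (TLol a b) by apply: tm_in_wk2.
  have f2 : tm_in c2 (eshift 0 2 f) (mor a) by apply: tm_in_wk2.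
  have g2 : tm_in c2 (eshift 0 2 g) (mor b) by apply: tm_in_wk2.
  have v1 : tm_in c2 (Var 1) a by ctm_var.
  have v0 : tm_in c2 (Var 0) b by ctm_var.
  have wa2 : wf_ty (cty c2) a by []. have wb2 : wf_ty (cty c2) b by []. have wd2 : wf_ty (cty c2) d by [].
  have fh2 := tm_in_fmap ws ps wa2 wb2 h2.
  have fv := tm_in_app f2 v1. have gv := tm_in_app g2 v0.
  (* For h x = y the values f x and g y must be related by s[graph h]. [graph_intro] relates f x to
     s(h) (f x), which equals g (h x) because [h] is a coalgebra map, hence equals g y. *)
  have G := @graph_intro s ws ps c2 H2 d a b TOne _ wd2 wa2 wb2 isT h2 _ fv.
  have wL2 : all (wf_ty (cty c2)) L by [].
  apply: (prel_conv (wfr_s (d := d) (e := TOne) ws wd2 wa2 wb2 isT h2) fv fv (tm_in_app fh2 fv) gv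
    (peq_refl H2 fv) _ G).
  have E1 : pv c2 H2 (PEq (TLol a (tapp s b)) (tcomp a (eshift 0 2 g) (eshift 0 2 h))
       (tcomp a (fmap s a b (eshift 0 2 h)) (eshift 0 2 f))).
    apply: pv_eq; first exact: pv_hyp1.
    by rewrite /= !eren_tcomp !eren_fmap // !tren0; congr PEq; rewrite /eshift ?eren_eren.
  have E2 := peq_tcomp_app wa2 h2 g2 f2 fh2 v1 E1.
  have E0 := @grel0E c2 a b _ L H2 wa2 wb2 h2 wL2 _ _ v1 v0 (pv_hyp0 _ _ _).
  apply: (peq_trans (tm_in_app fh2 fv) (peq_sym (tm_in_app g2 (tm_in_app h2 v1)) E2)).
  exact: (peq_appr g2 (tm_in_app h2 v1) E0).
have R3 : pv c H (PRel (RTy (TVar 0) rs) x (App h x)).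
  by apply: (@grel0I c a b h L H wa wb hh wL _ _ hx hhx); apply: peq_refl.
have wmb : wf_ty (size rs) (TBang (TLol (TVar 0) s)) := wm.
have hbf : tm_in c (Bang f) (tapps (TBang (TLol (TVar 0) s)) (a :: L)) by exact: tm_in_bang hf1.
have hbg : tm_in c (Bang g) (tapps (TBang (TLol (TVar 0) s)) (b :: L)) by exact: tm_in_bang hg1.
have R4 := @rel_tensI c (TBang (TLol (TVar 0) s)) (TVar 0) rs (a :: L) (b :: L) wmb isT hrs H _ _ _ _
  hbf hbg hx hhx R2 R3.
have wco : wf_ty (size rs) (coalg_ty s) by exact: wf_coalg_ty.
have ta := tm_in_tapp hk wa (tapp_cont ws a d). have tb := tm_in_tapp hk wb (tapp_cont ws b d).
have e2 y : tapps kb (y :: L) = TLol (coT y) d by rewrite -[LHS]/(TLol (tapps (coalg_ty s) (y :: L)) d)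
  tapps_coalg.
have ta' := ta; rewrite -e2 in ta'. have tb' := tb; rewrite -e2 in tb'.
have zf := tm_in_tens (tm_in_bang hf) hx. have zg := tm_in_tens (tm_in_bang hg) hhx.
have zf' := zf; rewrite -[TTens _ _]/(coT a) -(tapps_coalg a L) in zf'.
have zg' := zg; rewrite -[TTens _ _]/(coT b) -(tapps_coalg b L) in zg'.
have R5 := @rel_lolE c H (coalg_ty s) (TVar 1) rs (a :: L) (b :: L) wco isT hrs _ _ _ _ ta' tb' zf' zg' R1 R4.
exact: (@grelSE c a b h L H wa wb hh wL 0 _ _ isT (tm_in_app ta zf) (tm_in_app tb zg) R5).
Qed.

(** Combines the two extensionality schemes: elements of [nu s] are equal if they agree on a
    variable continuation at a variable type. *)
Lemma nu_ext c H u v : tm_in c u (nu s) -> tm_in c v (nu s) ->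
  pv (c ▷□ ▷ cT (TVar 0)) (wkH (BTm (cT (TVar 0))) (wkH BTy H))
    (PEq (TVar 0) (App (TApp (eshift 1 1 u) (TVar 0)) (Var 0)) (App (TApp (eshift 1 1 v) (TVar 0))
      (Var 0))) ->
  pv c H (PEq (nu s) u v).
Proof.
move=> hu hv P; rewrite nu_contT; apply: peq_tfunext; rewrite -?nu_contT //.
have tA t : tm_in c t (nu s) -> tm_in (c ▷□) (TApp (eshift 1 0 t) (TVar 0)) (TLol (cT (TVar 0)) (TVar 0)).
  move=> ht; apply: (tm_in_tapp _ _ (tapp_nu ws (TVar 0))) => //; rewrite -nu_contT -(tren_nu ws S).
  exact: tm_in_wkT.
apply: peq_funext; [exact: wf_contT | exact: tA | exact: tA |].
rewrite -![eshift 0 1 (TApp _ _)]/(TApp (eshift 0 1 (eshift 1 0 _)) (TVar 0)).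
have e t : eshift 0 1 (eshift 1 0 t) = eshift 1 1 t by rewrite /eshift eren_eren.
by rewrite !e.
Qed.

(** [pack_tm s] is itself a continuation, with result type [nu s], so [nu_cont_nat] applies to
    it. *)
Lemma pack_nat c H a b h f g x : wf_ty (cty c) a -> wf_ty (cty c) b ->
  tm_in c h (TLol a b) -> tm_in c f (mor a) -> tm_in c g (mor b) -> tm_in c x a ->
  pv c H (PEq (TLol a (tapp s b)) (tcomp a g h) (tcomp a (fmap s a b h) f)) ->
  pv c H (PEq (nu s) (App (packa a) (Tens (Bang f) x)) (App (packa b) (Tens (Bang g) (App h x)))).
Proof.
move=> wa wb hh hf hg hx E.
have hn := tm_in_pack ws c; rewrite -[coalg_ty s]/(coalg_ty s) in hn.
have hp : tm_in c (pack_tm s) (cT (nu s)) by rewrite /contT (tren_nu ws).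
exact: (nu_cont_nat wa wb (wf_nu ws _) hh hf hg hp hx E).
Qed.

Lemma unfold_coalg c H a f : wf_ty (cty c) a -> tm_in c f (mor a) ->
  pv c H (PEq (TLol a (tapp s (nu s))) (tcomp a (out_tm s) (unfoldf a f))
     (tcomp a (fmap s a (nu s) (unfoldf a f)) f)).
Proof.
move=> wa hf.
have wn := wf_nu ws (cty c).
have hu := tm_in_unfoldf ws wa hf; have ho := tm_in_out ws ps c.
have fu := tm_in_fmap ws ps wa wn hu.
apply: (peq_tcomp_ext wa hu ho hf fu).
have -> : eshift 0 1 (fmap s a (nu s) (unfoldf a f)) = fmap s a (nu s) (eshift 0 1 (unfoldf a f)) by
  rewrite eshift_fmap.
rewrite (closed_eshift 0 1 (tm_in_out ws ps _)).
have -> : eshift 0 1 (unfoldf a f) = unfoldf a (eshift 0 1 f).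
  by rewrite /eshift /= tren0 -/(eshift 0 1 _) (closed_eshift 0 1 (tm_in_unfold ws _)).
set c1 := c ▷ _; set H1 := wkH _ _.
have f1 := tm_in_wk a hf. have v : tm_in c1 (Var 0) a by ctm_var.
have wa1 : wf_ty (cty c1) a by [].
have u1 := tm_in_unfoldf ws wa1 f1. have uv := tm_in_app u1 v.
have ho1 := tm_in_out ws ps c1.
apply: (peq_trans (tm_in_app ho1 uv) (peq_appr ho1 uv (@peq_unfold s ws c1 H1 _ _ _ wa1 f1 v))).
exact: peq_out.
Qed.

(** The statement that [K] composed with packing is [k], as a formula of the logic, so that it can
    be kept among the hypotheses and weakened below binders. *)
Definition pack_eq (d : ty) (K k : tm) : prop :=
  PAll BTy (PAll (BTm (coT (TVar 0))) (PEq (tren S d)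
    (App (eshift 1 1 K) (App (packa (TVar 0)) (Var 0))) (App (TApp (eshift 1 1 k) (TVar 0)) (Var 0)))).

Lemma pren_pack_eq r d K k :
  pren r (pack_eq d K k) = pack_eq (tren (rn_ty r) d) (eren (rn_ty r) (rn_tm r) K)
    (eren (rn_ty r) (rn_tm r) k).
Proof.
rewrite -[LHS]/(PAll BTy (PAll (BTm (tren (upr (rn_ty r)) (coT (TVar 0))))
  (PEq (tren (upr (rn_ty r)) (tren S d))
    (App (eren (upr (rn_ty r)) (upr (rn_tm r)) (eshift 1 1 K))
      (App (TApp (eren (upr (rn_ty r)) (upr (rn_tm r)) (pack_tm s)) (TVar 0)) (Var 0)))
    (App (TApp (eren (upr (rn_ty r)) (upr (rn_tm r)) (eshift 1 1 k)) (TVar 0)) (Var 0))))).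
rewrite (tren_coalgT ws) (eren_as_esub _ _ (pack_tm s)) (pack_esub ws) !tren_tren /eshift !eren_eren.
by rewrite /pack_eq /eshift !tren_tren !eren_eren.
Qed.

Lemma pack_eqE c H d K k a z : wf_ty (cty c) a -> tm_in c z (coT a) -> pv c H (pack_eq d K k) ->
  pv c H (PEq d (App K (App (packa a) z)) (App (TApp k a) z)).
Proof.
move=> wa hz P.
have {}P := prv_allE P (io_ty _ wa).
have {}P : pv c H (PAll (BTm (coT a)) (PEq d (App (eshift 0 1 K) (App (packa a) (Var 0)))
  (App (TApp (eshift 0 1 k) a) (Var 0)))).
  apply: (pv_eq P).
  rewrite -[LHS]/(PAll (BTm (tsub (scons a TVar) (coT (TVar 0)))) (PEq (tsub (scons a TVar) (tren S d))
    (App (esub (scons a TVar) (upe Var) (eshift 1 1 K))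
      (App (TApp (esub (scons a TVar) (upe Var) (pack_tm s)) a) (Var 0)))
    (App (TApp (esub (scons a TVar) (upe Var) (eshift 1 1 k)) a) (Var 0)))).
  rewrite (tsub_coalgT ws) tsub_inst_wk (pack_esub ws).
  have e t : esub (scons a TVar) (upe Var) (eshift 1 1 t) = eshift 0 1 t by eleaf.
  by rewrite !e.
have {}P := prv_allE P (io_tm _ hz).
apply: (pv_eq P).
rewrite -[LHS]/(PEq (tsub TVar d) (App (esub TVar (scons z Var) (eshift 0 1 K))
  (App (TApp (esub TVar (scons z Var) (pack_tm s)) (tsub TVar a)) z))
  (App (TApp (esub TVar (scons z Var) (eshift 0 1 k)) (tsub TVar a)) z)).
by rewrite !tsub_id !esub_inst_wk (pack_esub ws).
Qed.

Lemma wf_pack_eq c d K k : wf_ty (cty c) d -> tm_in c K (TLol (nu s) d) -> tm_in c k (cT d) ->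
  wfp c (pack_eq d K k).
Proof.
move=> wd hK hk; apply: wf_all => //; apply: wf_all; first exact: wf_coalgT.
set c2 := _ ▷ _.
have ok : ok_ren c c2 (wk 1 1 0) by okr.
have K2 := tm_in_okr ok hK. have k2 := tm_in_okr ok hk.
rewrite [rn_ty _]/= (tren_contT ws) in k2.
rewrite /= (tren_nu ws) in K2.
have v : tm_in c2 (Var 0) (coT (TVar 0)) by ctm_var.
by apply: wf_eq; [apply: tm_in_app K2 _; apply: tm_in_packa | apply: tm_in_cont_app k2 v].
Qed.

(* [k] is abstracted over a dummy type variable to be related to itself over the graph of [K]. *)
Lemma nu_pack_nat c H d K k u : wf_ty (cty c) d -> tm_in c K (TLol (nu s) d) -> tm_in c k (cT d) ->
  tm_in c u (nu s) ->
  pv c H (pack_eq d K k) ->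
  pv c H (PEq d (App K (App (TApp u (nu s)) (pack_tm s))) (App (TApp u d) k)).
Proof.
move=> wd hK hk hu Q.
have wn := wf_nu ws (cty c).
have wL : all (wf_ty (cty c)) [:: d] by rewrite /= wd.
set L := [:: d]; set rs := grels (nu s) d K L.
have hrs : srels c rs (nu s :: L) (d :: L) := grels_srels wn wd hK wL.
pose cb := TPi (TLol (coalg_ty s) (TVar 1)).
pose nb := TLol cb (TVar 0).
have wco n : wf_ty n.+1 (coalg_ty s) by exact: wf_coalg_ty.
have wcb n : wf_ty n.+1 cb by rewrite -[wf_ty _ _]/(wf_ty n.+2 (coalg_ty s) && true) wco.
have wnb : wf_ty 2 nb by rewrite -[wf_ty _ _]/(wf_ty 2 cb && true) wcb.
have enb : TPi nb = nu s by [].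
have eL : tapps (TPi nb) L = nu s by rewrite enb; exact: tsub_nu.
have hu' := hu; rewrite -eL in hu'.
have R0 := @iesI c H (TPi nb) L u u wnb wL hu' hu' (peq_refl H hu').
have R1 := @rel_piE c H nb (map rel_eq L) L L _ _ (graph (nu s) d K) (nu s) d wnb (srels_eq wL) hu' hu'
  wn wd (srel_graph wn wd hK) R0.
rewrite -/(grels (nu s) d K L) -/rs in R1.
have ecb y : tapps cb (y :: L) = cT y.
  by rewrite -[LHS]/(TPi (TLol (tsub _ (coalg_ty s)) (tren S y))) (tsub_coalg_ty ws) -coalg_tyE.
have hp : tm_in c (pack_tm s) (cT (nu s)) by rewrite /contT (tren_nu ws); exact: tm_in_pack.
have tu y : wf_ty (cty c) y -> tm_in c (TApp u y) (TLol (cT y) y).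
  by move=> wy; apply: (tm_in_tapp _ wy (tapp_nu ws y)); rewrite -nu_contT.
have enb2 y : tapps nb (y :: L) = TLol (cT y) y by rewrite -[LHS]/(TLol (tapps cb (y :: L)) y) ecb.
have R2 : pv c H (PRel (RTy cb rs) (pack_tm s) k).
  apply: (pv_cut _ Q); first exact: wf_pack_eq.
  set H1 := _ :: H.
  have hpc : tm_in c (pack_tm s) (tapps cb (nu s :: L)) by rewrite ecb.
  have hkc : tm_in c k (tapps cb (d :: L)) by rewrite ecb.
  apply: (@rel_piI c H1 (TLol (coalg_ty s) (TVar 1)) rs (nu s :: L) (d :: L) _ _ _ hrs hpc hkc).
    by rewrite -[wf_ty _ _]/(wf_ty 3 (coalg_ty s) && true) wco.
  set c3 := ext _ _; set H3 := wkH _ (wkH _ (wkH _ _)).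
  have ok3 : ok_ren c c3 (wk 2 0 1) by rewrite /c3; okr.
  pose d3 := tren (addn 2) d. pose K3 := eshift 2 0 K. pose k3 := eshift 2 0 k.
  have wd3 : wf_ty (cty c3) d3 := wf_okr ok3 wd.
  have wn3 := wf_nu ws (cty c3).
  have hK3 : tm_in c3 K3 (TLol (nu s) d3) by have := tm_in_okr ok3 hK; rewrite /= (tren_nu ws).
  have hk3 : tm_in c3 k3 (cT d3) by have := tm_in_okr ok3 hk; rewrite (tren_contT ws).
  have e3 : map (rren (wk 2 0 1)) rs = grels (nu s) d3 K3 [:: d3].
    by rewrite /rs /grels map_cons rren_graph /= (tren_nu ws).
  rewrite e3 (closed_eshift 2 0 (tm_in_pack ws _)) -/k3.
  have hr0 : srel c3 (RVar 0) (TVar 1) (TVar 0) by constructor.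
  have wL3 : all (wf_ty (cty c3)) [:: d3] by rewrite /= wd3.
  have hrs3' := grels_srels wn3 wd3 hK3 wL3.
  have hrs3 : srels c3 (RVar 0 :: grels (nu s) d3 K3 [:: d3]) [:: TVar 1, nu s & [:: d3]]
    [:: TVar 0, d3 & [:: d3]].
    by constructor.
  have w1 : wf_ty (cty c3) (TVar 1) by []. have w0 : wf_ty (cty c3) (TVar 0) by [].
  have hp3 : tm_in c3 (pack_tm s) (cT (nu s)) by rewrite /contT (tren_nu ws); exact: tm_in_pack.
  have tp1 := tm_in_tapp hp3 w1 (tapp_cont ws _ _). have tk0 := tm_in_tapp hk3 w0 (tapp_cont ws _ _).
  have e4 x y l : tapps (TLol (coalg_ty s) (TVar 1)) [:: x, y & l] = TLol (coT x) y.
    by rewrite -[LHS]/(TLol (tapps (coalg_ty s) (x :: y :: l)) y) tapps_coalg.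
  have tp1' := tp1; rewrite -(e4 _ _ [:: d3]) in tp1'. have tk0' := tk0; rewrite -(e4 _ _ [:: d3]) in tk0'.
  apply: (@rel_lolI c3 H3 (coalg_ty s) (TVar 1) (RVar 0 :: grels (nu s) d3 K3 [:: d3]) [:: TVar 1; nu s;
    d3] [:: TVar 0; d3; d3] _ _ (wco _) isT hrs3 tp1' tk0').
  rewrite !tapps_coalg map_cons grels_ren.
  have -> : rren (wk 0 2 0) (RVar 0) = RVar 0 by [].
  set c5 := c3 ▷ _ ▷ _; set H5 := (PRel _ _ _ :: _).
  have ok5 : ok_ren c c5 (wk 2 2 1) by rewrite /c5 /c3; okr.
  have wn5 : wf_ty (cty c5) (nu s) := wn3. have wd5 : wf_ty (cty c5) d3 := wd3.
  have wL5 : all (wf_ty (cty c5)) [:: d3] := wL3.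
  have hK5 : tm_in c5 (eshift 0 2 K3) (TLol (nu s) d3) by exact: tm_in_wk2.
  have hk5 : tm_in c5 (eshift 0 2 k3) (cT d3) by exact: tm_in_wk2.
  have hp5 : tm_in c5 (pack_tm s) (cT (nu s)) by rewrite /contT (tren_nu ws); exact: tm_in_pack.
  set K5 := eshift 0 2 K3 in hK5 *; set k5 := eshift 0 2 k3 in hk5 *.
  have v1 : tm_in c5 (Var 1) (coT (TVar 1)) by ctm_var.
  have v0 : tm_in c5 (Var 0) (coT (TVar 0)) by ctm_var.
  have w51 : wf_ty (cty c5) (TVar 1) by []. have w50 : wf_ty (cty c5) (TVar 0) by [].
  have Q5 : pv c5 H5 (pack_eq d3 K5 k5).
    apply: pv_eq; first exact: pv_hyp1.
    by rewrite !pren_pack_eq /= !tren_tren !eren_eren /K5 /K3 /k5 /k3 /d3 /eshift !eren_eren.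
  have QA := pack_eqE w51 v1 Q5.
  have hr5 : srel c5 (RVar 0) (TVar 1) (TVar 0) by constructor.
  have hrs5' := grels_srels wn5 wd5 hK5 wL5.
  set rs5 := _ :: grels _ _ _ _.
  have hrs5 : srels c5 rs5 [:: TVar 1, nu s & [:: d3]] [:: TVar 0, d3 & [:: d3]] by constructor.
  have tp5 := tm_in_packa ws w51 v1.
  have tk5 := tm_in_cont_app ws w50 hk5 v0.
  have tk5' := tm_in_cont_app ws w51 hk5 v1.
  rewrite -[eshift 0 2 (TApp (pack_tm s) (TVar 1))]/(TApp (eshift 0 2 (pack_tm s)) (TVar 1))
    (closed_eshift 0 2 (tm_in_pack ws _)).
  rewrite -[eshift 0 2 (TApp k3 (TVar 0))]/(TApp k5 (TVar 0)).
  apply: (@rel_varI c5 H5 1 rs5 _ _ _ _ isT hrs5 tp5 tk5).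
  apply: (rel_graphI wn5 wd5 hK5 tp5 tk5).
  apply: (peq_trans (tm_in_app hK5 tp5) QA).
  (* It remains to see that [k] takes equal values at the two states, which are related by an
     arbitrary R. That relatedness is stated over the list [rs5], whose second entry is the graph of
     [K]; abstracting [k] over a dummy type variable makes its own interpretation refer to the same
     list. The dummy instantiations are undone by type beta in [B] and [B2]. *)
  pose kd := TLam (eshift 1 0 k5).
  pose pb := TPi (TLol (coalg_ty s) (TVar 2)).
  have wpb : wf_ty 2 pb by rewrite -[wf_ty _ _]/(wf_ty 3 (coalg_ty s) && true) wco.
  have hkd0 : tm_in (c5 ▷□) (eshift 1 0 k5) (cT (tren S d3)) by rewrite -(tren_contT ws); exact: tm_in_wkT.
  have hkd : tm_in c5 kd (TPi (cT (tren S d3))) by apply: tm_in_tlam.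
  have epb : tapps (TPi pb) [:: d3] = TPi (cT (tren S d3)).
    by rewrite -[LHS]/(TPi (TPi (TLol (tsub _ (coalg_ty s)) (tren S (tren S d3))))) (tsub_coalg_ty ws)
      -coalg_tyE.
  have hkd' := hkd; rewrite -epb in hkd'.
  have S0 := @iesI c5 H5 (TPi pb) [:: d3] kd kd wpb wL5 hkd' hkd' (peq_refl H5 hkd').
  have S1 := @rel_piE c5 H5 pb (map rel_eq [:: d3]) _ _ _ _ (graph (nu s) d3 K5) (nu s) d3 wpb
    (srels_eq wL5) hkd' hkd' wn5 wd5 (srel_graph wn5 wd5 hK5) S0.
  rewrite -/(grels (nu s) d3 K5 [:: d3]) in S1.
  have ecd x : tapp (cT (tren S d3)) x = cT d3 by rewrite /tapp (tsub_contT ws) tsub_inst_wk.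
  have tkd x : wf_ty (cty c5) x -> tm_in c5 (TApp kd x) (cT d3).
    by move=> wx; apply: tm_in_tapp hkd wx (ecd x).
  have epb2 x : tapps pb [:: x; d3] = cT d3.
    by rewrite -[LHS]/(TPi (TLol (tsub _ (coalg_ty s)) (tren S d3))) (tsub_coalg_ty ws) -coalg_tyE.
  have tn := tkd _ wn5. have td := tkd _ wd5. rewrite -(epb2 (nu s)) in tn. rewrite -(epb2 d3) in td.
  have S2 := @rel_piE c5 H5 (TLol (coalg_ty s) (TVar 2)) (grels (nu s) d3 K5 [:: d3]) [:: nu s; d3]
    [:: d3; d3] _ _ (RVar 0) (TVar 1) (TVar 0) wpb hrs5' tn td w51 w50 hr5 S1.
  have tn1 := tm_in_tapp (tkd _ wn5) w51 (tapp_cont ws _ _).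
  have td0 := tm_in_tapp (tkd _ wd5) w50 (tapp_cont ws _ _).
  have e6 x y : tapps (TLol (coalg_ty s) (TVar 2)) [:: x; y; d3] = TLol (coT x) d3.
    by rewrite -[LHS]/(TLol (tapps (coalg_ty s) [:: x; y; d3]) d3) tapps_coalg.
  have tn1' := tn1; rewrite -(e6 _ (nu s)) in tn1'. have td0' := td0; rewrite -(e6 _ d3) in td0'.
  have v1' := v1; rewrite -(tapps_coalg (TVar 1) [:: nu s; d3]) in v1'.
  have v0' := v0; rewrite -(tapps_coalg (TVar 0) [:: d3; d3]) in v0'.
  have S3 := @rel_lolE c5 H5 (coalg_ty s) (TVar 2) rs5 [:: TVar 1; nu s; d3] [:: TVar 0; d3; d3] (wco _)
    isT hrs5 _ _ _ _ tn1' td0' v1' v0' S2 (pv_hyp0 _ _ _).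
  have tn2 := tm_in_app tn1 v1. have td2 := tm_in_app td0 v0.
  have S4 := rel_eqE (@rel_varE c5 H5 2 rs5 [:: TVar 1; nu s; d3] [:: TVar 0; d3; d3] _ _ isT hrs5 tn2
    td2 S3).
  have B x : wf_ty (cty c5) x -> pv c5 H5 (PEq (cT d3) (TApp kd x) k5).
    by move=> wx; have := peq_tbeta H5 wx hkd0 (ecd x); rewrite esub_instT_wk.
  have B2 x y z : wf_ty (cty c5) x -> wf_ty (cty c5) y -> tm_in c5 z (coT y) ->
     pv c5 H5 (PEq d3 (App (TApp (TApp kd x) y) z) (App (TApp k5 y) z)).
    move=> wx wy hz; have t1 := tm_in_tapp (tkd x wx) wy (tapp_cont ws _ _).
    apply: (peq_appl t1 hz); exact: (peq_tapp (tkd x wx) wy (tapp_cont ws _ _) (B x wx)).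
  apply: (peq_trans tk5' (peq_sym tn2 (B2 _ _ _ wn5 w51 v1))).
  exact: (peq_trans tn2 S4 (B2 _ _ _ wd5 w50 v0)).
have wf1 : wf_ty (size rs) cb by exact: wcb.
have tn := tu _ wn. have td := tu _ wd. rewrite -enb2 in tn. rewrite -enb2 in td.
have hp' := hp; rewrite -ecb in hp'. have hk' := hk; rewrite -ecb in hk'.
have R3 := @rel_lolE c H cb (TVar 0) rs (nu s :: L) (d :: L) wf1 isT hrs _ _ _ _ tn td hp' hk' R1 R2.
exact: (@grel0E c (nu s) d K L H wn wd hK wL _ _ (tm_in_app (tu _ wn) hp) (tm_in_app (tu _ wd) hk) R3).
Qed.
End Nu.

(** After [tens_ind] the first component is a variable of type [TBang m] inside a pair. Abstracting
    it, as in [F], gives maps out of [TBang m], which [bang_ind] can compare. *)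
Lemma tens_bang_ind c H m a d f g : wf_ty (cty c) m -> wf_ty (cty c) a -> wf_ty (cty c) d ->
  tm_in c f (TLol (TTens (TBang m) a) d) -> tm_in c g (TLol (TTens (TBang m) a) d) ->
  pv (c ▷ TBang m ▷ a ▷ m) (wkH (BTm m) (wkH (BTm a) (wkH (BTm (TBang m)) H)))
    (PEq d (App (eshift 0 3 f) (Tens (Bang (Var 0)) (Var 1)))
           (App (eshift 0 3 g) (Tens (Bang (Var 0)) (Var 1)))) ->
  pv c H (PEq (TLol (TTens (TBang m) a) d) f g).
Proof.
move=> wm wa wd hf hg P; apply: tens_ind => //.
set c2 := c ▷ _ ▷ _ in P *; set H2 := wkH (BTm a) _ in P *.
pose F t := Lam (TBang m) (App (eshift 0 3 t) (Tens (Var 0) (Var 1))).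
have v1 : tm_in c2 (Var 1) (TBang m) by ctm_var.
have v0 : tm_in c2 (Var 0) a by ctm_var.
have hFb t : tm_in c t (TLol (TTens (TBang m) a) d) ->
  tm_in (c2 ▷ TBang m) (App (eshift 0 3 t) (Tens (Var 0) (Var 1))) d.
  move=> ht; apply: (@tm_in_app _ (TTens (TBang m) a)); first exact: tm_in_wk3.
  by apply: tm_in_tens; ctm_var.
have l t : lcount 0 (App (eshift 0 3 t) (Tens (Var 0) (Var 1))) == 1 by rewrite /= lcount_eshift.
have hF t : tm_in c t (TLol (TTens (TBang m) a) d) -> tm_in c2 (F t) (TLol (TBang m) d).
  by move=> ht; apply: tm_in_lam => //; exact: hFb.
have E t : tm_in c t (TLol (TTens (TBang m) a) d) -> pv c2 H2 (PEq d (App (F t) (Var 1))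
  (App (eshift 0 2 t) (Tens (Var 1) (Var 0)))).
  move=> ht; have := @peq_beta c2 H2 _ _ _ _ (wm : wf_ty (cty c2) (TBang m)) (hFb _ ht) (l t) v1.
  by move=> Q; apply: (pv_eq Q); sub_eq.
apply: (peq_trans _ (peq_sym (tm_in_app (hF _ hf) v1) (E _ hf))).
  by apply: (@tm_in_app _ (TTens (TBang m) a)); [exact: tm_in_wk2 | exact: tm_in_tens].
apply: (peq_trans (tm_in_app (hF _ hf) v1) _ (E _ hg)).
apply: (peq_appl (hF _ hf) v1); apply: bang_ind => //; [exact: hF | exact: hF |].
set c3 := c2 ▷ m in P *; set H3 := wkH (BTm m) _ in P *.
have vm : tm_in c3 (Bang (Var 0)) (TBang m) by apply: tm_in_bang; ctm_var.
have hFb3 t : tm_in c t (TLol (TTens (TBang m) a) d) ->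
  tm_in (c3 ▷ TBang m) (App (eshift 0 4 t) (Tens (Var 0) (Var 2))) d.
  move=> ht; apply: (@tm_in_app _ (TTens (TBang m) a)); first exact: tm_in_wk4.
  by apply: tm_in_tens; ctm_var.
have l3 t : lcount 0 (App (eshift 0 4 t) (Tens (Var 0) (Var 2))) == 1 by rewrite /= lcount_eshift.
have e3 t : eshift 0 1 (F t) = Lam (TBang m) (App (eshift 0 4 t) (Tens (Var 0) (Var 2))).
  by rewrite /F /eshift; sub_eq.
have hF3 t : tm_in c t (TLol (TTens (TBang m) a) d) -> tm_in c3 (eshift 0 1 (F t)) (TLol (TBang m) d).
  by move=> ht; apply: tm_in_wk; exact: hF.
have E3 t : tm_in c t (TLol (TTens (TBang m) a) d) ->
   pv c3 H3 (PEq d (App (eshift 0 1 (F t)) (Bang (Var 0))) (App (eshift 0 3 t) (Tens (Bang (Var 0))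
     (Var 1)))).
  move=> ht; rewrite e3.
  have := @peq_beta c3 H3 _ _ _ _ (wm : wf_ty (cty c3) (TBang m)) (hFb3 _ ht) (l3 t) vm.
  by move=> Q; apply: (pv_eq Q); sub_eq.
apply: (peq_trans (tm_in_app (hF3 _ hf) vm) (E3 _ hf)).
apply: (peq_trans _ P).
  apply: (@tm_in_app _ (TTens (TBang m) a)); first exact: tm_in_wk3.
  by apply: tm_in_tens => //; ctm_var.
exact: (peq_sym (tm_in_app (hF3 _ hg) vm) (E3 _ hg)).
Qed.

(** * Endomorphisms of the final coalgebra *)

Section Nu.
Variables (s : ty) (ws : wf_ty 1 s) (ps : occurs_only true 0 s).
Local Notation coT := (coalgT s).
Local Notation mor a := (TLol a (tapp s a)).
Local Notation packa a := (TApp (pack_tm s) a).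
Local Notation unfoldf a f := (App (TApp (unfold_tm s) a) (Bang f)).
Local Notation cT := (contT s).
Local Notation N := (nu s).
Local Notation U := (unfoldf N (out_tm s)).

Lemma pack_eqI c H d K k : wf_ty (cty c) d -> tm_in c K (TLol N d) -> tm_in c k (cT d) ->
  pv (c ▷□ ▷ coT (TVar 0)) (wkH (BTm (coT (TVar 0))) (wkH BTy H)) (PEq (tren S d)
    (App (eshift 1 1 K) (App (packa (TVar 0)) (Var 0))) (App (TApp (eshift 1 1 k) (TVar 0)) (Var 0))) ->
  pv c H (pack_eq s d K k).
Proof. by move=> wd hK hk P; apply: prv_allI => //; apply: prv_allI => //; exact: wf_coalgT. Qed.

(** For a continuation [k], this and [out_at] are two maps from [nu s] to the result type that both
    agree with [k] on packed pairs: one runs the element on [k], the other hands [k] the coalgebra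
    [out] with the element as its state. [nu_pack_nat] for the first yields [nu_pack], for the
    second [nu_unfold_out]. *)
Definition app_at (d : ty) (k : tm) : tm := Lam N (App (TApp (Var 0) d) (eshift 0 1 k)).
Definition out_at (k : tm) : tm := Lam N (App (TApp (eshift 0 1 k) N) (Tens (Bang (out_tm s)) (Var 0))).

Lemma tm_in_app_at c d k : wf_ty (cty c) d -> tm_in c k (cT d) -> tm_in c (app_at d k) (TLol N d).
Proof.
move=> wd hk; apply: tm_in_lam; [exact: wf_nu | | by rewrite /= lcount_eshift].
by apply: (tm_in_nu_app ws) => //; [ctm_var | exact: tm_in_wk].
Qed.

Lemma peq_app_at c H d k u : wf_ty (cty c) d -> tm_in c k (cT d) -> tm_in c u N ->
  pv c H (PEq d (App (app_at d k) u) (App (TApp u d) k)).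
Proof.
move=> wd hk hu; apply: prv_eqI; apply: (eeq_cast (eeq_beta (tm_in_app (tm_in_app_at wd hk) hu))).
by rewrite /= tsub_id esub_inst_wk.
Qed.

Lemma tm_in_out_at_body c d k u : wf_ty (cty c) d -> tm_in c k (cT d) -> tm_in c u N ->
  tm_in c (App (TApp k N) (Tens (Bang (out_tm s)) u)) d.
Proof.
move=> wd hk hu; apply: (tm_in_cont_app ws (wf_nu ws _) hk).
by apply: tm_in_tens hu; apply: tm_in_bang; exact: tm_in_out.
Qed.

Lemma tm_in_out_at c d k : wf_ty (cty c) d -> tm_in c k (cT d) -> tm_in c (out_at k) (TLol N d).
Proof.
move=> wd hk; apply: tm_in_lam; [exact: wf_nu | | by rewrite /= lcount_eshift (closed_lcount _
  (tm_in_out ws ps _))].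
by apply: tm_in_out_at_body => //; [exact: tm_in_wk | ctm_var].
Qed.

Lemma peq_out_at c H d k u : wf_ty (cty c) d -> tm_in c k (cT d) -> tm_in c u N ->
  pv c H (PEq d (App (out_at k) u) (App (TApp k N) (Tens (Bang (out_tm s)) u))).
Proof.
move=> wd hk hu; apply: prv_eqI; apply: (eeq_cast (eeq_beta (tm_in_app (tm_in_out_at wd hk) hu))).
by rewrite /= (tsub_nu ws) esub_inst_wk (out_esub ws ps).
Qed.

Lemma pack_eq_app_at c H d k : wf_ty (cty c) d -> tm_in c k (cT d) -> pv c H (pack_eq s d (app_at d k) k).
Proof.
move=> wd hk; apply: pack_eqI => //; first exact: tm_in_app_at.
set c2 := _ ▷ _; set H2 := wkH _ _.
have ok : ok_ren c c2 (wk 1 1 0) by rewrite /c2; okr.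
have k2 := tm_in_okr ok hk; rewrite (tren_contT ws) /= -/(eshift 1 1 k) in k2.
have wd2 : wf_ty (cty c2) (tren S d) := wf_okr ok wd.
have v : tm_in c2 (Var 0) (coT (TVar 0)) by ctm_var.
have w0 : wf_ty (cty c2) (TVar 0) by [].
have -> : eshift 1 1 (app_at d k) = app_at (tren S d) (eshift 1 1 k).
  by rewrite /app_at /eshift /= (tren_nu ws) !eren_eren.
have p2 := tm_in_packa ws w0 v.
apply: (peq_trans (tm_in_app (tm_in_app_at wd2 k2) p2) (peq_app_at H2 wd2 k2 p2)).
exact: peq_pack.
Qed.

(** On the pair of f and x the left side is [k] at [out] with state unfold f x. Since unfold f is a
    coalgebra map from f to [out], [nu_cont_nat] replaces this by [k] at f with state x. *)
Lemma pack_eq_out_at c H d k : wf_ty (cty c) d -> tm_in c k (cT d) -> pv c H (pack_eq s d (out_at k) k).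
Proof.
move=> wd hk; apply: pack_eqI => //; first exact: tm_in_out_at.
set c2 := _ ▷ _; set H2 := wkH _ _.
have ok : ok_ren c c2 (wk 1 1 0) by rewrite /c2; okr.
have k2 := tm_in_okr ok hk; rewrite (tren_contT ws) /= -/(eshift 1 1 k) in k2.
have wd2 : wf_ty (cty c2) (tren S d) := wf_okr ok wd.
have v : tm_in c2 (Var 0) (coT (TVar 0)) by ctm_var.
have w0 : wf_ty (cty c2) (TVar 0) by [].
have -> : eshift 1 1 (out_at k) = out_at (eshift 1 1 k).
  by rewrite /out_at /eshift /= (tren_nu ws) !eren_eren (eren_as_esub _ _ (out_tm s)) (out_esub ws ps).
move: (eshift 1 1 k) (tren S d) k2 wd2 => {wd hk ok} {}k {}d hk wd.
have ho := tm_in_out_at wd hk.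
have hpk : tm_in c2 (packa (TVar 0)) (TLol (coT (TVar 0)) N) := tm_in_tapp (tm_in_pack ws c2) w0
  (tapp_pack ws _).
have wc : wf_ty (cty c2) (coT (TVar 0)) by exact: wf_coalgT.
have htc := tm_in_tcomp wc hpk ho.
have htk := tm_in_tapp hk w0 (tapp_cont ws (TVar 0) d).
(* Both sides are brought into the form of one map applied to the variable of tensor type, so that
   the variable can be replaced by a pair of the form !f, x. *)
apply: (peq_trans (tm_in_app ho (tm_in_app hpk v)) (peq_sym (tm_in_app htc v) (peq_tcomp H2 wc hpk ho v))).
apply: (peq_appl htc v).
have wm : wf_ty (cty c2) (mor (TVar 0)) by rewrite /= wf_tapp_s.
apply: tens_bang_ind => //.
set c5 := _ ▷ _ ▷ _ ▷ _; set H5 := wkH _ _.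
have -> : eshift 0 3 (tcomp (coT (TVar 0)) (out_at k) (packa (TVar 0))) = tcomp (coT (TVar 0))
  (out_at (eshift 0 3 k)) (packa (TVar 0)).
  rewrite {1}/eshift eren_tcomp tren0 -!/(eshift 0 3 _).
  rewrite -[eshift 0 3 (packa (TVar 0))]/(TApp (eshift 0 3 (pack_tm s)) (TVar 0)) (closed_eshift 0 3
    (tm_in_pack ws _)).
  by congr tcomp; rewrite /out_at /eshift /= (tren_nu ws) !eren_eren (eren_as_esub _ _ (out_tm s))
    (out_esub ws ps).
rewrite -[eshift 0 3 (TApp k (TVar 0))]/(TApp (eshift 0 3 k) (TVar 0)).
have k5 : tm_in c5 (eshift 0 3 k) (cT d) by exact: tm_in_wk3.
have w5 : wf_ty (cty c5) (TVar 0) by [].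
have wd5 : wf_ty (cty c5) d by [].
have f5 : tm_in c5 (Var 0) (mor (TVar 0)) by ctm_var.
have x5 : tm_in c5 (Var 1) (TVar 0) by ctm_var.
have z5 := tm_in_tens (tm_in_bang f5) x5.
have ho5 := tm_in_out_at wd5 k5.
have hpk5 : tm_in c5 (packa (TVar 0)) (TLol (coT (TVar 0)) N) := tm_in_tapp (tm_in_pack ws c5) w5
  (tapp_pack ws _).
have wc5 : wf_ty (cty c5) (coT (TVar 0)) by exact: wf_coalgT.
have htc5 := tm_in_tcomp wc5 hpk5 ho5.
have p5 := tm_in_app hpk5 z5.
apply: (peq_trans (tm_in_app htc5 z5) (peq_tcomp H5 wc5 hpk5 ho5 z5)).
apply: (peq_trans (tm_in_app ho5 p5) (peq_out_at H5 wd5 k5 p5)).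
have wn := wf_nu ws (cty c5). have hout := tm_in_out ws ps c5.
have hu := tm_in_unfoldf ws w5 f5.
have Nt := nu_cont_nat ws ps w5 wn wd5 hu f5 hout k5 x5 (unfold_coalg ws ps H5 w5 f5).
have hux := tm_in_app hu x5.
have tkz := tm_in_cont_app ws w5 k5 z5.
have htn := tm_in_tapp k5 wn (tapp_cont ws _ _).
have tb := tm_in_bang hout.
have tux := tm_in_app htn (tm_in_tens tb hux).
apply: (@peq_trans _ _ _ (App (TApp (eshift 0 3 k) N) (Tens (Bang (out_tm s))
  (App (unfoldf (TVar 0) (Var 0)) (Var 1))))).
- exact: tm_in_app htn (tm_in_tens tb p5).
- apply: (peq_appr htn (tm_in_tens tb p5)).
  apply: (peq_tens tb tb p5 (peq_refl H5 tb)).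
  exact: (peq_sym hux (peq_unfold ws H5 w5 f5 x5)).
- exact: (peq_sym tkz Nt).
Qed.

Lemma tm_in_packc c : tm_in c (pack_tm s) (cT N).
Proof. by rewrite /contT (tren_nu ws); exact: tm_in_pack. Qed.

(** Run both sides on a continuation [k]. By definition of [app_at] the left side is [app_at] of u
    (nu s) pack, and [nu_pack_nat] with this map for [K] equates it with u run on [k]. *)
Lemma nu_pack c H u : tm_in c u N -> pv c H (PEq N (App (TApp u N) (pack_tm s)) u).
Proof.
move=> hu; have wn := wf_nu ws (cty c).
have hp := tm_in_nu_app ws wn hu (tm_in_packc c).
apply: (nu_ext ws) => //.
set c2 := _ ▷ _; set H2 := wkH _ _.
have ok : ok_ren c c2 (wk 1 1 0) by rewrite /c2; okr.
have u2 := tm_in_okr ok hu; rewrite (tren_nu ws) /= -/(eshift 1 1 u) in u2.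
have -> : eshift 1 1 (App (TApp u N) (pack_tm s)) = App (TApp (eshift 1 1 u) N) (pack_tm s).
  by rewrite -[LHS]/(App (TApp (eshift 1 1 u) (tren _ N)) (eshift 1 1 (pack_tm s))) (tren_nu ws)
    (closed_eshift 1 1 (tm_in_pack ws _)).
have k : tm_in c2 (Var 0) (cT (TVar 0)) by ctm_var.
have w0 : wf_ty (cty c2) (TVar 0) by [].
have hK := tm_in_app_at w0 k.
have P := nu_pack_nat ws w0 hK k u2 (pack_eq_app_at H2 w0 k).
have wn2 := wf_nu ws (cty c2).
have hp2 := tm_in_nu_app ws wn2 u2 (tm_in_packc c2).
apply: (peq_trans (tm_in_nu_app ws w0 hp2 k) _ P).
exact: (peq_sym (tm_in_app hK hp2) (peq_app_at H2 w0 k hp2)).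
Qed.

(** Run on a continuation [k], the left side is [k] at [out] with state u, that is [out_at k]
    applied to u. With u written as u (nu s) pack by [nu_pack], [nu_pack_nat] for [out_at k] gives u
    run on [k]. *)
Lemma nu_unfold_out c H u : tm_in c u N -> pv c H (PEq N (App U u) u).
Proof.
move=> hu; have wn := wf_nu ws (cty c).
have ho := tm_in_out ws ps c.
have hU := tm_in_unfoldf ws wn ho.
apply: (nu_ext ws) => //; first exact: tm_in_app hU hu.
set c2 := _ ▷ _; set H2 := wkH _ _.
have ok : ok_ren c c2 (wk 1 1 0) by rewrite /c2; okr.
have u2 := tm_in_okr ok hu; rewrite (tren_nu ws) /= -/(eshift 1 1 u) in u2.
have -> : eshift 1 1 (App U u) = App U (eshift 1 1 u).
  rewrite -[LHS]/(App (App (TApp (eshift 1 1 (unfold_tm s)) (tren _ N)) (Bang (eshift 1 1 (out_tm s))))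
    (eshift 1 1 u)).
  by rewrite (tren_nu ws) (closed_eshift 1 1 (tm_in_unfold ws _)) (closed_eshift 1 1 (tm_in_out ws ps _)).
have k : tm_in c2 (Var 0) (cT (TVar 0)) by ctm_var.
have w0 : wf_ty (cty c2) (TVar 0) by [].
have hK := tm_in_out_at w0 k.
have P := nu_pack_nat ws w0 hK k u2 (pack_eq_out_at H2 w0 k).
have wn2 := wf_nu ws (cty c2).
have hp2 := tm_in_nu_app ws wn2 u2 (tm_in_packc c2).
have ho2 := tm_in_out ws ps c2.
have hU2 := tm_in_unfoldf ws wn2 ho2.
have z2 := tm_in_tens (tm_in_bang ho2) u2.
have pz := tm_in_packa ws wn2 z2.
have tU := tm_in_app hU2 u2.
have tUt : tm_in c2 (TApp (App U (eshift 1 1 u)) (TVar 0)) (TLol (cT (TVar 0)) (TVar 0)).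
  by apply: tm_in_tapp w0 (tapp_nu ws _); rewrite -nu_contT.
apply: (@peq_trans _ _ _ (App (TApp (App (packa N) (Tens (Bang (out_tm s)) (eshift 1 1 u))) (TVar 0))
  (Var 0))).
- exact: tm_in_app tUt k.
- apply: (peq_appl tUt k); apply: (peq_tapp _ w0 (tapp_nu ws _)); rewrite -nu_contT //.
  exact: (peq_unfold ws H2 wn2 ho2 u2).
apply: (peq_trans (tm_in_nu_app ws w0 pz k) (peq_pack ws H2 wn2 w0 z2 k)).
have tk := tm_in_cont_app ws wn2 k z2.
apply: (peq_trans tk (peq_sym (tm_in_app hK u2) (peq_out_at H2 w0 k u2))).
apply: (peq_trans (tm_in_app hK u2) _ P).
apply: (peq_appr hK u2).
exact: (peq_sym hp2 (nu_pack H2 u2)).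
Qed.

(** For v of type [nu s], [nu_unfold_out] writes both h v and v as packings with the coalgebra
    [out], of states h v and v. As [h] is a coalgebra endomorphism of [out], [pack_nat] identifies
    the two packings. *)
Lemma nu_endo c H h : tm_in c h (TLol N N) ->
  pv c H (PEq (TLol N (tapp s N)) (tcomp N (out_tm s) h) (tcomp N (fmap s N N h) (out_tm s))) ->
  pv c H (PEq (TLol N N) h (idtm N)).
Proof.
move=> hh E; have wn := wf_nu ws (cty c).
have ho := tm_in_out ws ps c. have fh := tm_in_fmap ws ps wn wn hh.
apply: (pv_cut _ E); first by apply: wf_eq; [exact: tm_in_tcomp wn hh ho | exact: tm_in_tcomp wn ho fh].
apply: peq_funext => //; first exact: tm_in_id.
rewrite eshift_idtm; set c1 := c ▷ _; set H1 := wkH _ _.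
have h1 := tm_in_wk N hh. have v : tm_in c1 (Var 0) N by ctm_var.
have E1 : pv c1 H1 (PEq (TLol N (tapp s N)) (tcomp N (out_tm s) (eshift 0 1 h))
  (tcomp N (fmap s N N (eshift 0 1 h)) (out_tm s))).
  apply: pv_eq; first exact: pv_hyp0.
  rewrite /= !eren_tcomp !eren_fmap // !tren0 -![eren _ _ (out_tm s)]/(eshift 0 1 (out_tm s)).
  by rewrite !(closed_eshift 0 1 (tm_in_out ws ps _)).
have wn1 : wf_ty (cty c1) N := wn.
have ho1 := tm_in_out ws ps c1.
have hU := tm_in_unfoldf ws wn1 ho1.
have hv := tm_in_app h1 v.
have P := pack_nat ws ps wn1 wn1 h1 ho1 ho1 v E1.
have tz := tm_in_packa ws wn1 (tm_in_tens (tm_in_bang ho1) v).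
have tz' := tm_in_packa ws wn1 (tm_in_tens (tm_in_bang ho1) hv).
have ti := tm_in_app (@tm_in_id c1 _ wn1) v.
apply: (peq_trans hv (peq_sym (tm_in_app hU hv) (nu_unfold_out H1 hv))).
apply: (peq_trans (tm_in_app hU hv) (peq_unfold ws H1 wn1 ho1 hv)).
apply: (peq_trans tz' (peq_sym tz P)).
apply: (peq_trans tz (peq_sym (tm_in_app hU v) (peq_unfold ws H1 wn1 ho1 v))).
apply: (peq_trans (tm_in_app hU v) (nu_unfold_out H1 v)).
exact: (peq_sym ti (@peq_id c1 H1 _ _ wn1 v)).
Qed.
End Nu.

(** * Equational reasoning with morphisms in an arbitrary context *)

Section Category.
Variables (c : ctx) (H : seq prop).
Local Notation wf := (wf_ty (cty c)).

(** Bundles the equation with the typings that the rules for [PEq] ask for, so that chains of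
    equations carry them along. Context and hypotheses are arbitrary because such chains are also
    needed below the variable introduced by [Y_nat]. *)
Definition meq (a b : ty) (f g : tm) : Prop :=
  [/\ tm_in c f (TLol a b), tm_in c g (TLol a b) & pv c H (PEq (TLol a b) f g)].

Lemma meq_sym a b f g : meq a b f g -> meq a b g f.
Proof. by case=> hf hg E; split=> //; exact: peq_sym hf E. Qed.

Lemma meq_trans a b f g h : meq a b f g -> meq a b g h -> meq a b f h.
Proof. by case=> hf hg E [_ hh E']; split=> //; exact: peq_trans hf E E'. Qed.

Lemma meq_tcompl a b d f f' g : wf a -> wf b -> meq a b f f' -> tm_in c g (TLol b d) ->
  meq a d (tcomp a g f) (tcomp a g f').
Proof.
move=> wa wb [hf hf' E] hg; split; [exact: tm_in_tcomp hf hg | exact: tm_in_tcomp hf' hg |].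
have ht : tm_in (c ▷ TLol a b) (tcomp a (eshift 0 1 g) (Var 0)) (TLol a d).
  by apply: (@tm_in_tcomp _ _ b) => //; [ctm_var | exact: tm_in_wk].
by have := peq_subst ht hf E; rewrite !esub_tcomp !esub_inst_wk !tsub_id.
Qed.

Lemma meq_tcompr a b d f g g' : wf a -> wf b -> tm_in c f (TLol a b) -> meq b d g g' ->
  meq a d (tcomp a g f) (tcomp a g' f).
Proof.
move=> wa wb hf [hg hg' E]; split; [exact: tm_in_tcomp hf hg | exact: tm_in_tcomp hf hg' |].
have ht : tm_in (c ▷ TLol b d) (tcomp a (Var 0) (eshift 0 1 f)) (TLol a d).
  by apply: (@tm_in_tcomp _ _ b) => //; [exact: tm_in_wk | ctm_var].
by have := peq_subst ht hg E; rewrite !esub_tcomp !esub_inst_wk !tsub_id.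
Qed.

Lemma meq_assoc a b d e f g h : wf a -> wf b -> tm_in c f (TLol a b) -> tm_in c g (TLol b d) ->
  tm_in c h (TLol d e) -> meq a e (tcomp a h (tcomp a g f)) (tcomp a (tcomp b h g) f).
Proof.
move=> wa wb hf hg hh.
have fg := tm_in_tcomp wa hf hg; have gh := tm_in_tcomp wb hg hh.
split; [exact: tm_in_tcomp fg hh | exact: tm_in_tcomp hf gh |].
apply: (peq_tcomp_ext wa fg hh hf gh).
rewrite {2 3}/eshift !eren_tcomp !tren0 -!/(eshift 0 1 _).
have f1 := tm_in_wk a hf; have g1 := tm_in_wk a hg; have h1 := tm_in_wk a hh.
have v : tm_in (c ▷ a) (Var 0) a by ctm_var.
have fv := tm_in_app f1 v.
have fg1 := tm_in_tcomp (c := c ▷ a) wa f1 g1; have gh1 := tm_in_tcomp (c := c ▷ a) wb g1 h1.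
apply: (peq_trans (tm_in_app h1 (tm_in_app fg1 v)) (peq_appr h1 (tm_in_app fg1 v) (@peq_tcomp (c ▷ a) _
  _ _ _ _ _ _ wa f1 g1 v))).
exact: (peq_sym (tm_in_app gh1 fv) (@peq_tcomp (c ▷ a) _ _ _ _ _ _ _ wb g1 h1 fv)).
Qed.

Lemma meq_idl a b f : wf a -> wf b -> tm_in c f (TLol a b) -> meq a b (tcomp a (idtm b) f) f.
Proof.
move=> wa wb hf; apply: meq_sym; split=> //; first exact: tm_in_tcomp hf (tm_in_id wb).
exact: peq_tcomp_idl.
Qed.

Lemma meq_idr a b f : wf a -> wf b -> tm_in c f (TLol a b) -> meq a b (tcomp a f (idtm a)) f.
Proof.
move=> wa wb hf; have hi := tm_in_id wa; have hc := tm_in_tcomp wa hi hf; split=> //.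
apply: peq_funext => //; rewrite {1}/eshift eren_tcomp tren0 -!/(eshift 0 1 _) eshift_idtm.
have f1 := tm_in_wk a hf; have v : tm_in (c ▷ a) (Var 0) a by ctm_var.
have i1 := @tm_in_id (c ▷ a) a wa.
apply: (peq_trans (tm_in_app (tm_in_tcomp (c := c ▷ a) wa i1 f1) v) (@peq_tcomp (c ▷ a) _ _ _ _ _ _ _ wa
  i1 f1 v)).
exact: (peq_appr f1 (tm_in_app i1 v) (@peq_id (c ▷ a) _ _ _ wa v)).
Qed.

Section Fmap.
Variables (s : ty) (ws : wf_ty 1 s) (ps : occurs_only true 0 s).
Local Notation S_ a := (tapp s a).

Lemma meq_fmap a b f g : wf a -> wf b -> meq a b f g -> meq (S_ a) (S_ b) (fmap s a b f) (fmap s a b g).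
Proof.
by move=> wa wb [hf hg E]; split; [exact: tm_in_fmap | exact: tm_in_fmap | exact: peq_fmap].
Qed.

Lemma meq_fmap_id a : wf a -> meq (S_ a) (S_ a) (fmap s a a (idtm a)) (idtm (S_ a)).
Proof.
move=> wa; split; last exact: peq_fmap_id.
  by apply: tm_in_fmap => //; exact: tm_in_id.
by apply: tm_in_id; exact: wf_tapp_s.
Qed.

Lemma meq_fmap_comp a b e h q : wf a -> wf b -> wf e -> tm_in c h (TLol a b) -> tm_in c q (TLol b e) ->
  meq (S_ a) (S_ e) (fmap s a e (tcomp a q h)) (tcomp (S_ a) (fmap s b e q) (fmap s a b h)).
Proof.
move=> wa wb we hh hq; have wsa := wf_tapp_s ws wa.
have hp := tm_in_tcomp wa hh hq.
have fh := tm_in_fmap ws ps wa wb hh; have fq := tm_in_fmap ws ps wb we hq.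
have fp := tm_in_fmap ws ps wa we hp; have fc := tm_in_tcomp wsa fh fq.
split=> //; apply: (peq_funext wsa fp fc).
rewrite eshift_fmap // {1 2}/eshift !eren_tcomp !tren0 -!/(eshift 0 1 _) !eshift_fmap //.
set c1 := c ▷ _.
have wa1 : wf_ty (cty c1) a := wa. have wb1 : wf_ty (cty c1) b := wb. have we1 : wf_ty (cty c1) e := we.
have wsa1 : wf_ty (cty c1) (S_ a) := wsa.
have h1 : tm_in c1 (eshift 0 1 h) (TLol a b) := tm_in_wk _ hh.
have q1 : tm_in c1 (eshift 0 1 q) (TLol b e) := tm_in_wk _ hq.
have v : tm_in c1 (Var 0) (S_ a) by ctm_var.
have p1 := tm_in_tcomp wa1 h1 q1.
have fh1 := tm_in_fmap ws ps wa1 wb1 h1; have fq1 := tm_in_fmap ws ps wb1 we1 q1.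
have fp1 := tm_in_fmap ws ps wa1 we1 p1; have fc1 := tm_in_tcomp wsa1 fh1 fq1.
apply: (peq_trans (tm_in_app fp1 v) (peq_fmap_comp ws ps wa1 wb1 we1 h1 q1 p1 v (peq_refl _ p1))).
exact: (peq_sym (tm_in_app fc1 v) (peq_tcomp _ wsa1 fh1 fq1 v)).
Qed.
End Fmap.
End Category.

(** * Fixed points and hylomorphisms *)

Definition Y_body : ty := TArr (TArr (TVar 0) (TVar 0)) (TVar 0).
Local Notation Yf a F := (App (TApp YC a) (Bang F)).

Lemma tm_in_Ya c a : wf_ty (cty c) a -> tm_in c (TApp YC a) (TArr (TArr a a) a).
Proof. by move=> wa; apply: (@tm_in_tapp _ Y_body) => //; exact: tm_in_Y. Qed.

Lemma tm_in_Yf c a F : wf_ty (cty c) a -> tm_in c F (TArr a a) -> tm_in c (Yf a F) a.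
Proof. by move=> wa hF; apply: tm_in_app (tm_in_Ya wa) (tm_in_bang hF). Qed.

(* Parametricity of [Y] at the graph of [h]. *)
Lemma Y_nat c H a b h F G : wf_ty (cty c) a -> wf_ty (cty c) b -> tm_in c h (TLol a b) ->
  tm_in c F (TArr a a) -> tm_in c G (TArr b b) ->
  pv (c ▷ a) (wkH (BTm a) H) (PEq b (App (eshift 0 1 h) (App (eshift 0 1 F) (Bang (Var 0))))
     (App (eshift 0 1 G) (Bang (App (eshift 0 1 h) (Var 0))))) ->
  pv c H (PEq b (App h (Yf a F)) (Yf b G)).
Proof.
move=> wa wb hh hF hG P.
set rs := grels a b h [::].
have hrs : srels c rs [:: a] [:: b] := grels_srels (L := [::]) wa wb hh isT.
have hY := tm_in_Y c.
have R0 := @iesI c H Y_ty [::] YC YC isT isT hY hY (peq_refl H hY).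
have R1 := @rel_piE c H Y_body [::] [::] [::] _ _ (graph a b h) a b isT (srels_nil c) hY hY wa wb
  (srel_graph wa wb hh) R0.
have R2 : pv c H (PRel (RTy (TBang (TArr (TVar 0) (TVar 0))) rs) (Bang F) (Bang G)).
  pose q := PAll (BTm a) (PEq b (App (eshift 0 1 h) (App (eshift 0 1 F) (Bang (Var 0))))
     (App (eshift 0 1 G) (Bang (App (eshift 0 1 h) (Var 0))))).
  have wq : wfp c q.
    have v : tm_in (c ▷ a) (Var 0) a by ctm_var.
    have h1 := tm_in_wk a hh. have F1 := tm_in_wk a hF. have G1 := tm_in_wk a hG.
    apply: wf_all => //; apply: wf_eq.
      exact: tm_in_app h1 (tm_in_app F1 (tm_in_bang v)).
    exact: tm_in_app G1 (tm_in_bang (tm_in_app h1 v)).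
  apply: (pv_cut wq); first by apply: prv_allI.
  set H1 := q :: H.
  apply: (@rel_bangI c (TArr (TVar 0) (TVar 0)) rs [:: a] [:: b] isT hrs H1 F G hF hG).
  apply: (@rel_lolI c H1 (TBang (TVar 0)) (TVar 0) rs [:: a] [:: b] F G isT isT hrs hF hG).
  rewrite grels_ren; change (tapps (TBang (TVar 0)) [:: a]) with (TBang a); change
    (tapps (TBang (TVar 0)) [:: b]) with (TBang b).
  set c2 := c ▷ _ ▷ _; set H2 := (PRel _ _ _ :: _).
  have h2 : tm_in c2 (eshift 0 2 h) (TLol a b) by apply: tm_in_wk2.
  have F2 : tm_in c2 (eshift 0 2 F) (TArr a a) by apply: tm_in_wk2.
  have G2 : tm_in c2 (eshift 0 2 G) (TArr b b) by apply: tm_in_wk2.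
  have wa2 : wf_ty (cty c2) a by []. have wb2 : wf_ty (cty c2) b by [].
  have v1 : tm_in c2 (Var 1) (TBang a) by ctm_var.
  have v0 : tm_in c2 (Var 0) (TBang b) by ctm_var.
  have hrs2 : srels c2 (grels a b (eshift 0 2 h) [::]) [:: a] [:: b] := grels_srels (L := [::]) wa2 wb2
    h2 isT.
  apply: (@rel_varI c2 H2 0 (grels a b (eshift 0 2 h) [::]) [:: a] [:: b] (App (eshift 0 2 F) (Var 1))
    (App (eshift 0 2 G) (Var 0)) isT hrs2 (tm_in_app F2 v1) (tm_in_app G2 v0)).
  (* The arguments of [F] and [G] are related elements of [!] types. The target relation is the
     graph of [h], which is admissible, so it suffices to treat the arguments !x and !y with h x =
     y. *)
  apply: (@rel_bangE c2 (TVar 0) (grels a b (eshift 0 2 h) [::]) [:: a] [:: b] isT hrs2 H2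
    (graph a b (eshift 0 2 h)) a b (Var 1) (Var 0) _ _ wa2 wb2 (srel_graph wa2 wb2 h2) v1 v0 F2 G2
      (pv_hyp0 _ _ _)).
  rewrite grels_ren rren_graph /= !tren0; change (tapps (TVar 0) [:: a]) with a; change
    (tapps (TVar 0) [:: b]) with b.
  rewrite -!/(eshift 0 2 _).
  have e t : eshift 0 2 (eshift 0 2 t) = eshift 0 4 t by rewrite /eshift eren_eren.
  rewrite !e.
  set c4 := Ctx _ _ _; set H4 := (PRel _ _ _ :: _).
  rewrite -/(c2 ▷ a ▷ b) in c4 *.
  have h4 : tm_in c4 (eshift 0 4 h) (TLol a b) by exact: (tm_in_wk4 (TBang a) (TBang b) a b hh).
  have F4 : tm_in c4 (eshift 0 4 F) (TArr a a) by exact: (tm_in_wk4 (TBang a) (TBang b) a b hF).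
  have G4 : tm_in c4 (eshift 0 4 G) (TArr b b) by exact: (tm_in_wk4 (TBang a) (TBang b) a b hG).
  have u1 : tm_in c4 (Var 1) a by ctm_var.
  have u0 : tm_in c4 (Var 0) b by ctm_var.
  have wa4 : wf_ty (cty c4) a by []. have wb4 : wf_ty (cty c4) b by [].
  have t1 := tm_in_app h4 (tm_in_app F4 (tm_in_bang u1)).
  have t0 := tm_in_app G4 (tm_in_bang u0).
  apply: (rel_graphI wa4 wb4 h4 (tm_in_app F4 (tm_in_bang u1)) t0).
  have E0 := @grel0E c4 a b (eshift 0 4 h) [::] H4 wa4 wb4 h4 isT _ _ u1 u0 (pv_hyp0 _ _ _).
  have Q : pv c4 H4 (PEq b (App (eshift 0 4 h) (App (eshift 0 4 F) (Bang (Var 1)))) (App (eshift 0 4 G)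
    (Bang (App (eshift 0 4 h) (Var 1))))).
    have Q : pv c4 H4 (PAll (BTm a) (PEq b (App (eshift 0 5 h) (App (eshift 0 5 F) (Bang (Var 0))))
      (App (eshift 0 5 G) (Bang (App (eshift 0 5 h) (Var 0)))))).
      (* Hypothesis number 2 is the weakened [q], below the relatedness of the unbanged arguments
         and that of the original ones. *)
      by apply: pv_eq; [apply: (@prv_hyp _ _ _ 2); exact: erefl|]; rewrite /q; sub_eq.
    have {}Q := prv_allE Q (io_tm _ u1).
    by apply: (pv_eq Q); sub_eq.
  apply: (peq_trans t1 Q).
  have hv := tm_in_app h4 u1.
  apply: (peq_appr G4 (tm_in_bang hv)); exact: (peq_bang hv E0).
have R3 := @rel_lolE c H (TBang (TArr (TVar 0) (TVar 0))) (TVar 0) rs [:: a] [:: b] isT isT hrs _ _ _ _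
  (tm_in_Ya wa) (tm_in_Ya wb) (tm_in_bang hF) (tm_in_bang hG) R1 R2.
exact: (@grel0E c a b h [::] H wa wb hh isT _ _ (tm_in_Yf wa hF) (tm_in_Yf wb hG) R3).
Qed.

Section Hylo.
Variables (s : ty) (ws : wf_ty 1 s) (ps : occurs_only true 0 s).
Local Notation S_ a := (tapp s a).

(** The abstraction is intuitionistic because the functorial action may use its argument several
    times or not at all; this is also the form that [Y] expects. *)
Definition hylo_step (a b : ty) (f g : tm) : tm :=
  ILam (TLol a b) (tcomp a (eshift 0 1 g) (tcomp a (fmap s a b (Var 0)) (eshift 0 1 f))).
Definition hylo (a b : ty) (f g : tm) : tm := Yf (TLol a b) (hylo_step a b f g).

Lemma eshift_hylo_step m a b f g : eshift 0 m (hylo_step a b f g) = hylo_step a b (eshift 0 m f)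
  (eshift 0 m g).
Proof.
rewrite /eshift (eren_as_esub _ _ (hylo_step _ _ _ _)) /hylo_step esub_ILam !esub_tcomp esub_fmap //.
have -> : upe (Var \o addn m) = Var \o upr (addn m) by rewrite upe_var.
have et x : tsub (TVar \o addn 0) x = x by rewrite -tren_as_tsub tren0.
rewrite [tsub _ (TLol a b)]/= !et -!eren_as_esub.
have e t : eren (addn 0) (upr (addn m)) (eshift 0 1 t) = eshift 0 1 (eren (addn 0) (addn m) t).
  by rewrite /eshift !eren_eren.
by rewrite !e.
Qed.

Section Typing.
Variables (c : ctx) (a b : ty) (f g : tm).
Hypotheses (wa : wf_ty (cty c) a) (wb : wf_ty (cty c) b).
Hypotheses (hf : tm_in c f (TLol a (S_ a))) (hg : tm_in c g (TLol (S_ b) b)).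

Let wab : wf_ty (cty c) (TLol a b). Proof. by rewrite /= wa. Qed.

Lemma tm_in_sandwich k : tm_in c k (TLol a b) -> tm_in c (tcomp a g (tcomp a (fmap s a b k) f)) (TLol a b).
Proof.
move=> hk; have fk := tm_in_fmap ws ps wa wb hk.
exact: tm_in_tcomp wa (tm_in_tcomp wa hf fk) hg.
Qed.

Lemma tm_in_hylo_body : tm_in (c ▷ TLol a b) (tcomp a (eshift 0 1 g) (tcomp a (fmap s a b (Var 0))
  (eshift 0 1 f))) (TLol a b).
Proof.
have wa1 : wf_ty (cty (c ▷ TLol a b)) a by []. have wb1 : wf_ty (cty (c ▷ TLol a b)) b by [].
have v : tm_in (c ▷ TLol a b) (Var 0) (TLol a b) by ctm_var.
have fv := tm_in_fmap ws ps wa1 wb1 v.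
exact: tm_in_tcomp wa1 (tm_in_tcomp wa1 (tm_in_wk _ hf) fv) (tm_in_wk _ hg).
Qed.

Lemma tm_in_hylo_step : tm_in c (hylo_step a b f g) (TArr (TLol a b) (TLol a b)).
Proof. by apply: tm_in_ILam => //; exact: tm_in_hylo_body. Qed.

Lemma tm_in_hylo : tm_in c (hylo a b f g) (TLol a b).
Proof. by apply: tm_in_Yf => //; exact: tm_in_hylo_step. Qed.

Lemma meq_hylo_step H k : tm_in c k (TLol a b) ->
  meq c H a b (App (hylo_step a b f g) (Bang k)) (tcomp a g (tcomp a (fmap s a b k) f)).
Proof.
move=> hk; split; [exact: tm_in_app tm_in_hylo_step (tm_in_bang hk) | exact: tm_in_sandwich |].
have := peq_ibeta H wab tm_in_hylo_body hk.
by rewrite !esub_tcomp esub_fmap // !esub_inst_wk !tsub_id.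
Qed.

Lemma meq_hylo H : meq c H a b (hylo a b f g) (tcomp a g (tcomp a (fmap s a b (hylo a b f g)) f)).
Proof.
have hs := tm_in_hylo_step; have hh := tm_in_hylo.
have t := tm_in_app hs (tm_in_bang hh).
apply: meq_trans (meq_hylo_step H hh); split=> //; exact: (peq_sym t (peq_Y H wab hs)).
Qed.
End Typing.

(** Precomposition with [k] is a linear map from [TLol a' b] to [TLol a b], so [Y_nat] applies to
    its graph. It remains to check that it carries one step of the first recursion to one step of
    the second. *)
Lemma hylo_pre c H a a' b f f' g k : wf_ty (cty c) a -> wf_ty (cty c) a' -> wf_ty (cty c) b ->
  tm_in c f (TLol a (S_ a)) -> tm_in c f' (TLol a' (S_ a')) -> tm_in c g (TLol (S_ b) b) ->
  tm_in c k (TLol a a') ->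
  meq c H a (S_ a') (tcomp a f' k) (tcomp a (fmap s a a' k) f) ->
  meq c H a b (tcomp a (hylo a' b f' g) k) (hylo a b f g).
Proof.
move=> wa wa' wb hf hf' hg hk [t1 t2 E].
have wab : wf_ty (cty c) (TLol a b) by rewrite /= wa.
have wab' : wf_ty (cty c) (TLol a' b) by rewrite /= wa'.
pose h t := Lam (TLol a' b) (tcomp a (Var 0) (eshift 0 1 t)).
have hh c' t : wf_ty (cty c') a -> wf_ty (cty c') (TLol a' b) -> tm_in c' t (TLol a a') ->
    tm_in c' (h t) (TLol (TLol a' b) (TLol a b)) /\
    forall H' x, tm_in c' x (TLol a' b) -> meq c' H' a b (App (h t) x) (tcomp a x t).
  move=> w w' ht.
  have hb : tm_in (c' ▷ TLol a' b) (tcomp a (Var 0) (eshift 0 1 t)) (TLol a b).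
    by apply: (@tm_in_tcomp (c' ▷ TLol a' b) a a' b) => //; [exact: tm_in_wk | ctm_var].
  have lb : lcount 0 (tcomp a (Var 0) (eshift 0 1 t)) == 1 by rewrite lcount_tcomp lcount_eshift.
  have ht' := tm_in_lam w' hb lb.
  split=> // H' x hx; split; [exact: tm_in_app ht' hx | exact: tm_in_tcomp w ht hx |].
  by have := peq_beta H' w' hb lb hx; rewrite esub_tcomp esub_inst_wk tsub_id.
have [hk0 Ek0] := hh _ _ wa wab' hk.
have sf := tm_in_hylo_step wa wb hf hg; have sf' := tm_in_hylo_step wa' wb hf' hg.
have hy := tm_in_hylo wa wb hf hg; have hy' := tm_in_hylo wa' wb hf' hg.
apply: (meq_trans (meq_sym (Ek0 H _ hy'))).
split=> //; first exact: tm_in_app hk0 hy'.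
apply: (pv_cut (wf_eq _ t1 t2) E); apply: (Y_nat wab' wab hk0 sf' sf).
set c1 := c ▷ _; set H1 := wkH _ _; rewrite !eshift_hylo_step.
have -> : eshift 0 1 (h k) = h (eshift 0 1 k).
  rewrite -[LHS]/(Lam (tren _ (TLol a' b)) (eren (addn 0) (upr (addn 1)) (tcomp a (Var 0)
    (eshift 0 1 k)))) eren_tcomp !tren0.
  by congr (Lam _ (tcomp _ _ _)); rewrite /eshift !eren_eren.
have k1 := tm_in_wk (TLol a' b) hk; have f1 := tm_in_wk (TLol a' b) hf.
have f1' := tm_in_wk (TLol a' b) hf'; have g1 := tm_in_wk (TLol a' b) hg.
have x : tm_in c1 (Var 0) (TLol a' b) by ctm_var.
have wa1 : wf_ty (cty c1) a := wa. have wa1' : wf_ty (cty c1) a' := wa'. have wb1 : wf_ty (cty c1) b := wb.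
have wsa' := wf_tapp_s ws wa1'; have wsa := wf_tapp_s ws wa1; have wsb := wf_tapp_s ws wb1.
have fk := tm_in_fmap ws ps wa1 wa1' k1; have fx := tm_in_fmap ws ps wa1' wb1 x.
have xk := tm_in_tcomp wa1 k1 x; have fxk := tm_in_fmap ws ps wa1 wb1 xk.
have E1 : meq c1 H1 a (S_ a') (tcomp a (eshift 0 1 f') (eshift 0 1 k))
  (tcomp a (fmap s a a' (eshift 0 1 k)) (eshift 0 1 f)).
  split; [exact: tm_in_tcomp wa1 k1 f1' | exact: tm_in_tcomp wa1 f1 fk |].
  by apply: pv_eq; [exact: pv_hyp0 | rewrite /= !eren_tcomp !eren_fmap // !tren0].
have [hk1 Ek] := hh _ _ wa1 (wab' : wf_ty (cty c1) _) k1.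
have X' := meq_hylo_step wa1' wb1 f1' g1 H1 x; have hx := Ek H1 _ x.
have [tx' _ _] := X'; have [thx _ _] := hx.
have X := meq_hylo_step wa1 wb1 f1 g1 H1 thx.
have ff := tm_in_tcomp wa1' f1' fx.
suff [] : meq c1 H1 a b (App (h (eshift 0 1 k)) (App (hylo_step a' b (eshift 0 1 f') (eshift 0 1 g))
  (Bang (Var 0))))
  (App (hylo_step a b (eshift 0 1 f) (eshift 0 1 g)) (Bang (App (h (eshift 0 1 k)) (Var 0)))) by [].
(* With x the variable, the sides become (g o s(x) o f') o k and g o s(x o k) o f. After removing g,
   s(x o k) is split as s(x) o s(k), and [E1] replaces s(k) o f by f' o k. *)
apply: (meq_trans (meq_trans (Ek H1 _ tx') (meq_tcompr wa1 wa1' k1 X')) (meq_sym (meq_trans X _))).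
apply: (meq_trans _ (meq_assoc H1 wa1 wa1' k1 ff g1)); apply: meq_tcompl (g1) => //.
apply: (meq_trans (meq_tcompr wa1 wsa f1 (meq_fmap ws ps wa1 wb1 hx))).
apply: (meq_trans (meq_tcompr wa1 wsa f1 (meq_fmap_comp H1 ws ps wa1 wa1' wb1 k1 x))).
apply: (meq_trans (meq_sym (meq_assoc H1 wa1 wsa f1 fk fx))).
exact: (meq_trans (meq_tcompl wa1 wsa' (meq_sym E1) fx) (meq_assoc H1 wa1 wa1' k1 f1' fx)).
Qed.

(** The same with postcomposition: it is a linear map from [TLol a b] to [TLol a b'], and one step
    commutes with it because [k] is an algebra map. *)
Lemma hylo_post c H a b b' f g g' k : wf_ty (cty c) a -> wf_ty (cty c) b -> wf_ty (cty c) b' ->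
  tm_in c f (TLol a (S_ a)) -> tm_in c g (TLol (S_ b) b) -> tm_in c g' (TLol (S_ b') b') ->
  tm_in c k (TLol b b') ->
  meq c H (S_ b) b' (tcomp (S_ b) k g) (tcomp (S_ b) g' (fmap s b b' k)) ->
  meq c H a b' (tcomp a k (hylo a b f g)) (hylo a b' f g').
Proof.
move=> wa wb wb' hf hg hg' hk [t1 t2 E].
have wab : wf_ty (cty c) (TLol a b) by rewrite /= wa.
have wab' : wf_ty (cty c) (TLol a b') by rewrite /= wa.
pose h t := Lam (TLol a b) (tcomp a (eshift 0 1 t) (Var 0)).
have hh c' t : wf_ty (cty c') a -> wf_ty (cty c') (TLol a b) -> tm_in c' t (TLol b b') ->
    tm_in c' (h t) (TLol (TLol a b) (TLol a b')) /\
    forall H' x, tm_in c' x (TLol a b) -> meq c' H' a b' (App (h t) x) (tcomp a t x).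
  move=> w w' ht.
  have hb : tm_in (c' ▷ TLol a b) (tcomp a (eshift 0 1 t) (Var 0)) (TLol a b').
    by apply: (@tm_in_tcomp (c' ▷ TLol a b) a b b') => //; [ctm_var | exact: tm_in_wk].
  have lb : lcount 0 (tcomp a (eshift 0 1 t) (Var 0)) == 1 by rewrite lcount_tcomp lcount_eshift.
  have ht' := tm_in_lam w' hb lb.
  split=> // H' x hx; split; [exact: tm_in_app ht' hx | exact: tm_in_tcomp w hx ht |].
  by have := peq_beta H' w' hb lb hx; rewrite esub_tcomp esub_inst_wk tsub_id.
have [hk0 Ek0] := hh _ _ wa wab hk.
have sf := tm_in_hylo_step wa wb hf hg; have sf' := tm_in_hylo_step wa wb' hf hg'.
have hy := tm_in_hylo wa wb hf hg; have hy' := tm_in_hylo wa wb' hf hg'.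
apply: (meq_trans (meq_sym (Ek0 H _ hy))).
split=> //; first exact: tm_in_app hk0 hy.
apply: (pv_cut (wf_eq _ t1 t2) E); apply: (Y_nat wab wab' hk0 sf sf').
set c1 := c ▷ _; set H1 := wkH _ _; rewrite !eshift_hylo_step.
have -> : eshift 0 1 (h k) = h (eshift 0 1 k).
  rewrite -[LHS]/(Lam (tren _ (TLol a b)) (eren (addn 0) (upr (addn 1)) (tcomp a (eshift 0 1 k)
    (Var 0)))) eren_tcomp !tren0.
  by congr (Lam _ (tcomp _ _ _)); rewrite /eshift !eren_eren.
have k1 := tm_in_wk (TLol a b) hk; have f1 := tm_in_wk (TLol a b) hf.
have g1' := tm_in_wk (TLol a b) hg'; have g1 := tm_in_wk (TLol a b) hg.
have x : tm_in c1 (Var 0) (TLol a b) by ctm_var.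
have wa1 : wf_ty (cty c1) a := wa. have wb1' : wf_ty (cty c1) b' := wb'. have wb1 : wf_ty (cty c1) b := wb.
have wsa := wf_tapp_s ws wa1; have wsb := wf_tapp_s ws wb1.
have fk := tm_in_fmap ws ps wb1 wb1' k1; have fx := tm_in_fmap ws ps wa1 wb1 x.
have E1 : meq c1 H1 (S_ b) b' (tcomp (S_ b) (eshift 0 1 k) (eshift 0 1 g)) (tcomp (S_ b) (eshift 0 1 g')
  (fmap s b b' (eshift 0 1 k))).
  split; [exact: tm_in_tcomp wsb g1 k1 | exact: tm_in_tcomp wsb fk g1' |].
  by apply: pv_eq; [exact: pv_hyp0 | rewrite /= !eren_tcomp !eren_fmap // !tren0].
have [hk1 Ek] := hh _ _ wa1 (wab : wf_ty (cty c1) _) k1.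
have X := meq_hylo_step wa1 wb1 f1 g1 H1 x; have hx := Ek H1 _ x.
have [tx _ _] := X; have [thx _ _] := hx.
have X' := meq_hylo_step wa1 wb1' f1 g1' H1 thx.
have ff := tm_in_tcomp wa1 f1 fx.
suff [] : meq c1 H1 a b' (App (h (eshift 0 1 k)) (App (hylo_step a b (eshift 0 1 f) (eshift 0 1 g))
  (Bang (Var 0))))
  (App (hylo_step a b' (eshift 0 1 f) (eshift 0 1 g')) (Bang (App (h (eshift 0 1 k)) (Var 0)))) by [].
apply: (meq_trans (meq_trans (Ek H1 _ tx) (meq_tcompl wa1 wb1 X k1)) (meq_sym (meq_trans X' _))).
apply: (meq_trans _ (meq_sym (meq_assoc H1 wa1 wsb ff g1 k1))).
apply: (meq_trans _ (meq_tcompr wa1 wsb ff (meq_sym E1))).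
apply: (meq_trans _ (meq_assoc H1 wa1 wsb ff fk g1')); apply: meq_tcompl (g1') => //; first exact: wf_tapp_s.
apply: (meq_trans (meq_tcompr wa1 wsa f1 (meq_fmap ws ps wa1 wb1' hx))).
apply: (meq_trans (meq_tcompr wa1 wsa f1 (meq_fmap_comp H1 ws ps wa1 wb1 wb1' x k1))).
exact: (meq_sym (meq_assoc H1 wa1 wsa f1 fx fk)).
Qed.
End Hylo.

(** * The inverses of [in] and [out] *)

Section FixedPoints.
Variables (c : ctx) (H : seq prop) (s : ty) (ws : wf_ty 1 s) (ps : occurs_only true 0 s).
Local Notation wf := (wf_ty (cty c)).
Local Notation meq := (meq c H).
Local Notation S_ a := (tapp s a).
Local Notation M := (mu s).
Local Notation N := (nu s).
Definition in_inv : tm := App (TApp (fold_tm s) (S_ M)) (Bang (fmap s (S_ M) M (in_tm s))).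
Definition out_inv : tm := App (TApp (unfold_tm s) (S_ N)) (Bang (fmap s N (S_ N) (out_tm s))).

Let wM : wf M := wf_mu ws _.
Let wN : wf N := wf_nu ws _.
Let wSM : wf (S_ M) := wf_tapp_s ws wM.
Let wSN : wf (S_ N) := wf_tapp_s ws wN.
Let hin : tm_in c (in_tm s) (TLol (S_ M) M) := tm_in_in ws ps c.
Let hout : tm_in c (out_tm s) (TLol N (S_ N)) := tm_in_out ws ps c.
Let fin := tm_in_fmap ws ps wSM wM hin.
Let fout := tm_in_fmap ws ps wN wSN hout.

Lemma tm_in_in_inv : tm_in c in_inv (TLol M (S_ M)).
Proof. exact: (tm_in_foldg ws wSM fin). Qed.

Lemma tm_in_out_inv : tm_in c out_inv (TLol (S_ N) N).
Proof. exact: (tm_in_unfoldf ws wSN fout). Qed.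

Let hii := tm_in_in_inv.
Let hoi := tm_in_out_inv.
Let fii := tm_in_fmap ws ps wM wSM hii.
Let foi := tm_in_fmap ws ps wSN wN hoi.

(** The fold equation gives s(in) o s(in_inv), which functoriality combines. The formula serves
    twice: it makes in o in_inv an algebra endomorphism of [in], and once that is known to be the
    identity, it shows that in_inv o in is s(id). *)
Lemma meq_in_inv_alg : meq (S_ M) (S_ M) (tcomp (S_ M) in_inv (in_tm s))
  (fmap s M M (tcomp M (in_tm s) in_inv)).
Proof.
apply: (meq_trans _ (meq_sym (meq_fmap_comp H ws ps wM wSM wM hii hin))).
split; [exact: tm_in_tcomp hin hii | exact: tm_in_tcomp fii fin | exact: fold_alg].
Qed.

Lemma meq_out_inv_coalg : meq (S_ N) (S_ N) (tcomp (S_ N) (out_tm s) out_inv)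
  (fmap s N N (tcomp N out_inv (out_tm s))).
Proof.
apply: (meq_trans _ (meq_sym (meq_fmap_comp H ws ps wN wSN wN hout hoi))).
split; [exact: tm_in_tcomp hoi hout | exact: tm_in_tcomp fout foi | exact: unfold_coalg].
Qed.

Lemma in_in_inv : meq M M (tcomp M (in_tm s) in_inv) (idtm M).
Proof.
have hh := tm_in_tcomp wM hii hin.
split=> //; first exact: tm_in_id.
apply: mu_endo => //.
have [_ _ //] : meq (S_ M) M (tcomp (S_ M) (tcomp M (in_tm s) in_inv) (in_tm s))
                 (tcomp (S_ M) (in_tm s) (fmap s M M (tcomp M (in_tm s) in_inv))).
apply: (meq_trans (meq_sym (meq_assoc H wSM wM hin hii hin)) _).
exact: (meq_tcompl wSM wSM meq_in_inv_alg hin).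
Qed.

Lemma out_inv_out : meq N N (tcomp N out_inv (out_tm s)) (idtm N).
Proof.
have hh := tm_in_tcomp wN hout hoi.
split=> //; first exact: tm_in_id.
apply: nu_endo => //.
have [_ _ //] : meq N (S_ N) (tcomp N (out_tm s) (tcomp N out_inv (out_tm s)))
                 (tcomp N (fmap s N N (tcomp N out_inv (out_tm s))) (out_tm s)).
apply: (meq_trans (meq_assoc H wN wSN hout hoi hout) _).
exact: (meq_tcompr wN wSN hout meq_out_inv_coalg).
Qed.

Lemma in_inv_in : meq (S_ M) (S_ M) (tcomp (S_ M) in_inv (in_tm s)) (idtm (S_ M)).
Proof.
apply: (meq_trans meq_in_inv_alg _).
exact: (meq_trans (meq_fmap ws ps wM wM in_in_inv) (meq_fmap_id H ws ps wM)).
Qed.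

Lemma out_out_inv : meq (S_ N) (S_ N) (tcomp (S_ N) (out_tm s) out_inv) (idtm (S_ N)).
Proof.
apply: (meq_trans meq_out_inv_coalg _).
exact: (meq_trans (meq_fmap ws ps wN wN out_inv_out) (meq_fmap_id H ws ps wN)).
Qed.

(** The fixed point equation is hylo = g o s(hylo) o f, and [g'] cancels the leading [g]. Only this
    one-sided cancellation enters. *)
Lemma hylo_coalg_map a b f g g' : wf a -> wf b -> tm_in c f (TLol a (S_ a)) ->
  tm_in c g (TLol (S_ b) b) -> tm_in c g' (TLol b (S_ b)) ->
  meq (S_ b) (S_ b) (tcomp (S_ b) g' g) (idtm (S_ b)) ->
  meq a (S_ b) (tcomp a g' (hylo s a b f g)) (tcomp a (fmap s a b (hylo s a b f g)) f).
Proof.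
move=> wa wb hf hg hg' E; have hh := tm_in_hylo ws ps wa wb hf hg.
have wsa := wf_tapp_s ws wa; have wsb := wf_tapp_s ws wb.
have fh := tm_in_fmap ws ps wa wb hh; have t := tm_in_tcomp wa hf fh.
apply: (meq_trans (meq_tcompl wa wb (meq_hylo ws ps wa wb hf hg H) hg') _).
apply: (meq_trans (meq_assoc H wa wsb t hg hg') _).
exact: (meq_trans (meq_tcompr wa wsb t E) (meq_idl H wa wsb t)).
Qed.

(** Dually, [f'] is cancelled against the trailing [f] of the fixed point equation. *)
Lemma hylo_alg_map a b f f' g : wf a -> wf b -> tm_in c f (TLol a (S_ a)) ->
  tm_in c f' (TLol (S_ a) a) -> tm_in c g (TLol (S_ b) b) ->
  meq (S_ a) (S_ a) (tcomp (S_ a) f f') (idtm (S_ a)) ->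
  meq (S_ a) b (tcomp (S_ a) (hylo s a b f g) f') (tcomp (S_ a) g (fmap s a b (hylo s a b f g))).
Proof.
move=> wa wb hf hf' hg E; have hh := tm_in_hylo ws ps wa wb hf hg.
have wsa := wf_tapp_s ws wa; have wsb := wf_tapp_s ws wb.
have fh := tm_in_fmap ws ps wa wb hh; have t := tm_in_tcomp wa hf fh.
apply: (meq_trans (meq_tcompr wsa wa hf' (meq_hylo ws ps wa wb hf hg H)) _).
apply: (meq_trans (meq_sym (meq_assoc H wsa wa hf' t hg)) _).
apply: (meq_tcompl wsa wsb _ hg).
apply: (meq_trans (meq_sym (meq_assoc H wsa wa hf' hf fh)) _).
exact: (meq_trans (meq_tcompl wsa wsa E fh) (meq_idr H wsa wsb fh)).
Qed.

Lemma mu_hylo_unique a f h : wf a -> tm_in c f (TLol a (S_ a)) ->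
  meq a (S_ M) (tcomp a in_inv h) (tcomp a (fmap s a M h) f) -> tm_in c h (TLol a M) ->
  meq a M h (hylo s a M f (in_tm s)).
Proof.
move=> wa hf E hh.
have hU := tm_in_hylo ws ps wM wM hii hin.
have [_ _ A] := hylo_alg_map wM wM hii hin hin in_inv_in.
have U1 : meq M M (hylo s M M in_inv (in_tm s)) (idtm M).
  by split; [| exact: tm_in_id | exact: mu_endo A].
apply: (meq_trans (meq_sym (meq_idl H wa wM hh)) _).
apply: (meq_trans (meq_tcompr wa wM hh (meq_sym U1)) _).
exact: (hylo_pre ws ps wa wM wM hf hii hin hh E).
Qed.

Lemma nu_hylo_unique b g h : wf b -> tm_in c g (TLol (S_ b) b) ->
  meq (S_ N) b (tcomp (S_ N) h out_inv) (tcomp (S_ N) g (fmap s N b h)) -> tm_in c h (TLol N b) ->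
  meq N b h (hylo s N b (out_tm s) g).
Proof.
move=> wb hg E hh.
have hU := tm_in_hylo ws ps wN wN hout hoi.
have [_ _ A] := hylo_coalg_map wN wN hout hoi hout out_out_inv.
have U1 : meq N N (hylo s N N (out_tm s) out_inv) (idtm N).
  by split; [| exact: tm_in_id | exact: nu_endo A].
apply: (meq_trans (meq_sym (meq_idr H wN wb hh)) _).
apply: (meq_trans (meq_tcompl wN wN (meq_sym U1) hh) _).
exact: (hylo_post ws ps wN wN wb hout hoi hg hh E).
Qed.
End FixedPoints.

Theorem theorem2p39 (s : ty) (wf_s : wf_ty 1 s) (ind_s : ind_constructed s)
    (pos_s : occurs_only true 0 s) :
  exists in_inv out_inv : tm,
    [/\ hom 0 in_inv (mu s) (tapp s (mu s)),
        hom 0 out_inv (tapp s (nu s)) (nu s),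
        inverse_in 0 (in_tm s) in_inv (tapp s (mu s)) (mu s),
        inverse_in 0 (out_tm s) out_inv (nu s) (tapp s (nu s)) &
        forall n : nat,
          final_coalgebra s n (mu s) in_inv /\ initial_algebra s n (nu s) out_inv].
Proof.
have hi c := tm_in_in_inv c wf_s pos_s. have ho c := tm_in_out_inv c wf_s pos_s.
exists (in_inv s), (out_inv s); split; [exact: hi (Ctx 0 [::] [::]) | exact: ho (Ctx 0 [::] [::]) | | |].
- have [_ _ E] := in_inv_in (Ctx 0 [::] [::]) [::] wf_s pos_s.
  by have [_ _ E'] := in_in_inv (Ctx 0 [::] [::]) [::] wf_s pos_s.
- have [_ _ E] := out_inv_out (Ctx 0 [::] [::]) [::] wf_s pos_s.
  by have [_ _ E'] := out_out_inv (Ctx 0 [::] [::]) [::] wf_s pos_s.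
(* The witnesses are closed, so the same two terms serve for every number [n] of type variables;
   algebras and coalgebras to be compared with may depend on these variables. *)
move=> n; pose c := Ctx n [::] [::].
have wm : wf_ty (cty c) (mu s) := wf_mu wf_s n. have wn : wf_ty (cty c) (nu s) := wf_nu wf_s n.
split; split=> //.
- exact: (hi c).
- move=> a f wa hf; exists (hylo s a (mu s) f (in_tm s)).
  have [_ _ E] := @hylo_coalg_map c [::] _ wf_s pos_s a _ f _ _ wa wm hf (tm_in_in wf_s pos_s c) (hi c)
    (in_inv_in c [::] wf_s pos_s).
  have hh := @tm_in_hylo _ wf_s pos_s c a _ f _ wa wm hf (tm_in_in wf_s pos_s c).
  split=> // h [hh' E'].
  suff [] : meq c [::] a (mu s) h (hylo s a (mu s) f (in_tm s)) by [].
  apply: (@mu_hylo_unique c [::] s wf_s pos_s a f h wa hf _ hh'); split=> //.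
    exact: (@tm_in_tcomp c _ _ _ _ _ wa hh' (hi c)).
  exact: (@tm_in_tcomp c _ _ _ _ _ wa hf (@tm_in_fmap _ wf_s pos_s c _ _ wa wm _ hh')).
- exact: (ho c).
move=> b g wb hg; exists (hylo s (nu s) b (out_tm s) g).
have wsn := wf_tapp_s wf_s wn.
have [_ _ E] := @hylo_alg_map c [::] _ wf_s pos_s _ b _ _ g wn wb (tm_in_out wf_s pos_s c) (ho c) hg
  (out_out_inv c [::] wf_s pos_s).
have hh := @tm_in_hylo _ wf_s pos_s c _ b _ g wn wb (tm_in_out wf_s pos_s c) hg.
split=> // h [hh' E'].
suff [] : meq c [::] (nu s) b h (hylo s (nu s) b (out_tm s) g) by [].
apply: (@nu_hylo_unique c [::] s wf_s pos_s b g h wb hg _ hh'); split=> //.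
  exact: (@tm_in_tcomp c _ _ _ _ _ wsn (ho c) hh').
exact: (@tm_in_tcomp c _ _ _ _ _ wsn (@tm_in_fmap _ wf_s pos_s c _ _ wn wb _ hh') hg).
Qed.
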